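(* Let $a,b,c,d,e,f,g\in\mathbb C^\ast$ with $\Re(2+3a-b-c-d-e-f-g)>0$, such that all series and Gamma factors below are well defined. Then $${}_7H_7\left(\begin{matrix}1+\frac a2,b,c,d,e,f,g\\ \frac a2,1+a-b,1+a-c,1+a-d,1+a-e,1+a-f,1+a-g\end{matrix};1\right)=\frac{\Gamma(1-b,1-c,1-d,1+a-e,1+a-f,1+a-g)}{\Gamma(1+a,1-a)}\,\bigl(T_1+T_2+T_3\bigr),$$ where $$T_1=\frac{\Gamma(1+2a-b-c-d,\,1+a-e-f-g)}{\Gamma(1+a-b-c,1+a-b-d,1+a-c-d,1+a-e-f,1+a-e-g,1+a-f-g)}\;{}_4H_4\left(\begin{matrix}e,f,g,1+2a-b-c-d\\ 1+a-b,1+a-c,1+a-d,-a+e+f+g\end{matrix};1\right),$$ $$T_2=\frac{\Gamma(1-e,1-f,1-g,-1-2a+b+c+d,2+2a-b-c-d,2+3a-b-c-d-e-f-g)}{\Gamma(b-a,c-a,d-a,1+a-e-f,1+a-e-g,1+a-f-g,2+2a-b-c-d-e,2+2a-b-c-d-f,2+2a-b-c-d-g)}$$ $$\times\;{}_4F_3\left(\begin{matrix}1+a-b-c,1+a-b-d,1+a-c-d,2+3a-b-c-d-e-f-g\\ 2+2a-b-c-d-e,2+2a-b-c-d-f,2+2a-b-c-d-g\end{matrix};1\right),$$ $$T_3=\frac{\Gamma(1+a-b,1+a-c,1+a-d,-1-a+e+f+g,2+a-e-f-g,2+3a-b-c-d-e-f-g)}{\Gamma(e,f,g,1+a-b-c,1+a-b-d,1+a-c-d,2+2a-b-e-f-g,2+2a-c-e-f-g,2+2a-d-e-f-g)}$$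 $$\times\;{}_4F_3\left(\begin{matrix}1+a-e-f,1+a-e-g,1+a-f-g,2+3a-b-c-d-e-f-g\\ 2+2a-b-e-f-g,2+2a-c-e-f-g,2+2a-d-e-f-g\end{matrix};1\right).$$
   Context: $\mathbb C^\ast=\mathbb C\setminus\{0\}$. $\Gamma(x_1,\dots,x_m)=\Gamma(x_1)\cdots\Gamma(x_m)$, with $1/\Gamma$ entire. For $k\in\mathbb Z$, $(\alpha)_k=\Gamma(\alpha+k)/\Gamma(\alpha)$ (shifted factorial, extended to negative $k$ by $(\alpha)_{-n}=1/((\alpha-1)(\alpha-2)\cdots(\alpha-n))$). ${}_4F_3$ is the generalized hypergeometric series $\sum_{k\ge0}\frac{(a_1)_k\cdots(a_4)_k}{k!\,(b_1)_k(b_2)_k(b_3)_k}z^k$, and the bilateral hypergeometric series is $${}_rH_r\left(\begin{matrix}a_1,\dots,a_r\\ b_1,\dots,b_r\end{matrix};z\right)=\sum_{k=-\infty}^\infty\frac{(a_1)_k\cdots(a_r)_k}{(b_1)_k\cdots(b_r)_k}z^k .$$ ''Well defined'' means that no Gamma factor in a numerator is evaluated at a pole and no term of any of the series has a vanishing denominator. *)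

(* Defs.v *)
From Stdlib Require Import Reals ZArith List.
From Coquelicot Require Import Coquelicot.
Import ListNotations.
Local Open Scope C_scope.

(** Limits and series of complex sequences are taken componentwise.  Like
    [Lim_seq] and [Series], the two total operators below are meaningful only
    in case of convergence: see [CLim_seq_correct] and [CSeries_correct]. *)

Definition CLim_seq (u : nat -> C) : C :=
  (real (Lim_seq (fun n => Re (u n))), real (Lim_seq (fun n => Im (u n)))).

Definition CSeries (u : nat -> C) : C :=
  (Series (fun n => Re (u n)), Series (fun n => Im (u n))).

Definition ex_Cseries (u : nat -> C) : Prop :=
  @ex_series C_AbsRing C_NormedModule u.

Lemma CLim_seq_correct (u : nat -> C) (l : C) :
  filterlim u eventually (locally l) -> CLim_seq u = l.
Proof.
intros H; destruct l as [x y]; unfold CLim_seq.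
assert (Hx : is_lim_seq (fun n => Re (u n)) x).
{ intros P [eps He]; apply (H (fun z => P (Re z))); exists eps; intros z [Hz _]; now apply He. }
assert (Hy : is_lim_seq (fun n => Im (u n)) y).
{ intros P [eps He]; apply (H (fun z => P (Im z))); exists eps; intros z [_ Hz]; now apply He. }
now rewrite (is_lim_seq_unique _ _ Hx), (is_lim_seq_unique _ _ Hy).
Qed.

Lemma CSeries_correct (u : nat -> C) (l : C) :
  @is_series C_AbsRing C_NormedModule u l -> CSeries u = l.
Proof.
intros H.
rewrite <- (CLim_seq_correct (sum_n u) l H).
unfold CSeries, Series, CLim_seq.
assert (E : forall n, sum_n u n =
  (sum_n (fun k => Re (u k)) n, sum_n (fun k => Im (u k)) n)).
{ induction n as [|n IH].
  - now rewrite !sum_O; destruct (u 0%nat).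
  - now rewrite !sum_Sn, IH; destruct (u (S n)). }
now f_equal; f_equal; apply Lim_seq_ext; intros n; rewrite E.
Qed.

Definition Cexp (z : C) : C := (exp (Re z) * cos (Im z), exp (Re z) * sin (Im z))%R.

Definition Cprod (l : list C) : C := fold_right Cmult 1 l.

(** [rising x n] is x (x+1) ... (x+n-1); [falling x n] is (x-1) (x-2) ... (x-n). *)
Definition rising (x : C) (n : nat) : C :=
  Cprod (map (fun j => x + INR j) (seq 0 n)).

Definition falling (x : C) (n : nat) : C :=
  Cprod (map (fun j => x - INR j) (seq 1 n)).

(** Gauss' product
    1/Gamma(z) = lim z (z+1) ... (z+n) / (n! n^z),  with n^z = exp (z ln n),
    valid for every complex z; it vanishes exactly at 0, -1, -2, ... *)
Definition rGamma (z : C) : C :=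
  CLim_seq (fun n => rising z (S n) / (INR (fact n) * Cexp (z * ln (INR n)))).

Definition Gamma (z : C) : C := / rGamma z.

Definition Gamma_pole (z : C) : Prop := exists n : nat, z = - INR n.

(** Reciprocals of Gamma values are read as values of the entire function
    1/Gamma, so that poles are harmless in [den]. *)
Definition Gamma_quot (num den : list C) : C :=
  Cprod (map Gamma num) * Cprod (map rGamma den).

Definition zpoch (x : C) (k : Z) : C :=
  match k with
  | Z0 => 1
  | Zpos p => rising x (Pos.to_nat p)
  | Zneg p => / falling x (Pos.to_nat p)
  end.

Definition Cpowz (z : C) (k : Z) : C :=
  match k with
  | Z0 => 1
  | Zpos p => z ^ Pos.to_nat p
  | Zneg p => / z ^ Pos.to_nat p
  end.

Definition hyperF_term (a b : list C) (z : C) (k : nat) : C :=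
  Cprod (map (fun x => rising x k) a)
    / (INR (fact k) * Cprod (map (fun x => rising x k) b)) * z ^ k.

Definition hyperF (a b : list C) (z : C) : C := CSeries (hyperF_term a b z).

Definition hyperF_cvg (a b : list C) (z : C) : Prop :=
  ex_Cseries (hyperF_term a b z).

Definition hyperF_well_defined (b : list C) : Prop :=
  forall k : nat, List.Forall (fun x => rising x k <> 0) b.

(** For k = -n < 0 this is
    prod_i (b_i-1)...(b_i-n) / prod_i (a_i-1)...(a_i-n) * z^(-n).
    If some b_i is in {1, ..., n} the term is 0, which is also what the code
    gives, since [/ 0 = 0]. *)
Definition hyperH_term (a b : list C) (z : C) (k : Z) : C :=
  Cprod (map (fun x => zpoch x k) a) / Cprod (map (fun x => zpoch x k) b)
    * Cpowz z k.

Definition hyperH (a b : list C) (z : C) : C :=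
  CSeries (fun n => hyperH_term a b z (Z.of_nat n))
  + CSeries (fun n => hyperH_term a b z (- Z.of_nat (S n))%Z).

Definition hyperH_cvg (a b : list C) (z : C) : Prop :=
  ex_Cseries (fun n => hyperH_term a b z (Z.of_nat n))
  /\ ex_Cseries (fun n => hyperH_term a b z (- Z.of_nat (S n))%Z).

(** The denominators are the (b_i)_k for k >= 0 and, for k = -n < 0, the
    (a_i-1)...(a_i-n). *)
Definition hyperH_well_defined (a b : list C) : Prop :=
  forall n : nat, List.Forall (fun x => rising x n <> 0) b
               /\ List.Forall (fun x => falling x n <> 0) a.

(* Main.v *)
Require Import Defs.
From Stdlib Require Import Reals ZArith List Permutation Lia Lra.
From Stdlib Require Import ClassicalEpsilon FunctionalExtensionality.
From Coquelicot Require Import Coquelicot.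
Import ListNotations.
Local Open Scope C_scope.

(** Let phi_b(k) = 1/(Gamma(1-b-k) Gamma(1+a-b+k)). Up to a constant and a sign
    this is (b)_k/(1+a-b)_k, so that the 7H7 is a multiple of
      Lam = sum over k of (a+2k) P(k) Q(k),
      P = phi_b phi_c phi_d,   Q = phi_e phi_f phi_g.
    Put u = 1+2a-b-c-d, v = e+f+g-a, w = 2+3a-b-c-d-e-f-g and
    sg z = 1/(Gamma(z) Gamma(1-z)). Multiplied by suitable Gamma factors, the
    theorem reads sg u sg v Lam = sg a (T1 + T2 + T3), where both sides are regular
    for all parameters with Re w > 0 ([defect_zero]). Well-definedness makes these
    factors nonzero, and division by them gives the theorem.

    Two classical theorems carry the proof. The nonterminating Saalschuetz
    theorem ([saal_zero]), applied for each k, gives sg v Q = S1 + S2, where S2 is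
    a series of single functions phi_x and S1 is a series of kernels psi_n(k)
    ([phi3_expand]). The reflection k -> -k, a -> -a, x -> x - a gives
    sg u P = R1 + R2 in the same way. Dougall's bilateral sum ([err5_zero])
    evaluates the sum of (a+2k) phi_b phi_c phi_d phi_x. Now
      sg u sg v P Q = R1 S1 + sg u P S2 + sg v R2 Q - R2 S2.
    Summed against a+2k, the terms P S2 and R2 Q give T3 and T2 by Dougall; R2 S2
    gives 0, because sums with two factors phi telescope ([vw2_zero]); and R1 S1
    gives T1, because the kernels of S1 and of R1 are biorthogonal up to boundary
    terms which cancel between k >= 0 and k < 0 ([half_sum], [cross_swap]). This
    is legitimate if both P and Q decay ([defect_zero_base]).

    In general one of them may grow. But Lam, T1, T2 and T3 satisfy the same
    contiguous relation between (b+1,e), (b,e+1) and (b,e), except for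
    inhomogeneous terms that cancel in the sum ([defect_contig]), and this
    relation reduces every case with Re w > 0 to the one above.

    The two classical theorems are proved alike. The difference of the two sides
    satisfies a first-order recurrence under integer shifts of the parameters,
    since contiguous relations have closed-form antidifferences; and after many
    shifts it is negligible compared with the coefficient in the recurrence.
    The estimates rest on the Gaussian decay of n!^2/((n-k)! (n+k)!)
    ([bq_gauss]). For Dougall's sum the limit series diverges; there two
    instances, one of them a finite sum, are compared with each other
    ([err5_zero_strip]). Only absolutely convergent families are summed, so sums
    are taken over the net of finite sets ([csum]). *)

(** * Unordered summation *)

Definition rsum {I : Type} (f : I -> R) (l : list I) : R :=
  fold_right (fun i s => f i + s)%R 0%R l.

Definition fsum {I : Type} (f : I -> C) (l : list I) : C :=
  fold_right (fun i s => f i + s) 0 l.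

(** Used on nonnegative families, where it is absolute convergence with an
    explicit bound for the sum. *)
Definition rbnd {I : Type} (f : I -> R) (M : R) : Prop :=
  forall l, NoDup l -> (rsum f l <= M)%R.

Definition rsummable {I : Type} (f : I -> R) : Prop := exists M, rbnd f M.

Definition summable {I : Type} (f : I -> C) : Prop :=
  rsummable (fun i => Cmod (f i)).

(** Convergence along the net of finite subsets: sums over [nat], over [Z] and
    over products are treated alike, and reindexing costs nothing. *)
Definition has_sum {I : Type} (f : I -> C) (s : C) : Prop :=
  forall eps : R, (0 < eps)%R -> exists l0, forall l,
    NoDup l -> incl l0 l -> (Cmod (fsum f l - s) < eps)%R.

(** A total function, meaningful for summable families: see [csum_spec]. *)
Definition csum {I : Type} (f : I -> C) : C :=
  epsilon (inhabits (RtoC 0)) (has_sum f).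

Definition cdec {I : Type} (x y : I) : {x = y} + {x <> y} :=
  excluded_middle_informative (x = y).

Lemma incl_complement {I : Type} (l l' : list I) :
  NoDup l -> incl l l' -> exists r, Permutation l' (l ++ r).
Proof.
revert l'; induction l as [|x l IH]; intros l' Hn Hi.
- exists l'; apply Permutation_refl.
- assert (Hx : In x l') by (apply Hi; now left).
  destruct (in_split _ _ Hx) as [l1 [l2 ->]].
  inversion Hn as [|? ? Hnx Hnl]; subst.
  destruct (IH (l1 ++ l2) Hnl) as [r Hr].
  { intros y Hy. assert (H : In y (l1 ++ x :: l2)) by (apply Hi; now right).
    apply in_app_or in H; apply in_or_app.
    destruct H as [H|[H|H]]; [now left| |now right]. subst; contradiction. }
  exists r. simpl.
  apply Permutation_trans with (x :: l1 ++ l2).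
  { apply Permutation_sym, Permutation_middle. }
  now constructor.
Qed.

Lemma rsum_app {I : Type} (f : I -> R) l l' :
  rsum f (l ++ l') = (rsum f l + rsum f l')%R.
Proof. unfold rsum; induction l; simpl; [ring|]. rewrite IHl; ring. Qed.

Lemma fsum_app {I : Type} (f : I -> C) l l' :
  fsum f (l ++ l') = fsum f l + fsum f l'.
Proof. unfold fsum; induction l; simpl; [ring|]. rewrite IHl; ring. Qed.

Lemma rsum_perm {I : Type} (f : I -> R) l l' :
  Permutation l l' -> rsum f l = rsum f l'.
Proof. induction 1; simpl; [easy| | |]; try congruence. ring. Qed.

Lemma fsum_perm {I : Type} (f : I -> C) l l' :
  Permutation l l' -> fsum f l = fsum f l'.
Proof. induction 1; simpl; [easy| | |]; try congruence. ring. Qed.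

Lemma rsum_ge0 {I : Type} (f : I -> R) l :
  (forall i, In i l -> 0 <= f i)%R -> (0 <= rsum f l)%R.
Proof.
induction l as [|x l IH]; simpl; intros H; [lra|].
generalize (H x (or_introl eq_refl)) (IH (fun i h => H i (or_intror h))); lra.
Qed.

Lemma rsum_le {I : Type} (f g : I -> R) l :
  (forall i, In i l -> f i <= g i)%R -> (rsum f l <= rsum g l)%R.
Proof.
induction l as [|x l IH]; simpl; intros H; [lra|].
generalize (H x (or_introl eq_refl)) (IH (fun i h => H i (or_intror h))); lra.
Qed.

Lemma rsum_incl {I : Type} (f : I -> R) l l' :
  (forall i, 0 <= f i)%R -> NoDup l -> incl l l' -> (rsum f l <= rsum f l')%R.
Proof.
intros H Hn Hi; destruct (incl_complement l l' Hn Hi) as [r Hr].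
rewrite (rsum_perm f _ _ Hr), rsum_app.
generalize (rsum_ge0 f r (fun i _ => H i)); lra.
Qed.

Lemma rsum_plus {I : Type} (f g : I -> R) l :
  rsum (fun i => f i + g i)%R l = (rsum f l + rsum g l)%R.
Proof. induction l; simpl; [ring|]. rewrite IHl; ring. Qed.

Lemma rsum_scal {I : Type} (c : R) (f : I -> R) l :
  rsum (fun i => c * f i)%R l = (c * rsum f l)%R.
Proof. induction l; simpl; [ring|]. rewrite IHl; ring. Qed.

Lemma fsum_plus {I : Type} (f g : I -> C) l :
  fsum (fun i => f i + g i) l = fsum f l + fsum g l.
Proof. induction l; simpl; [ring|]. rewrite IHl; ring. Qed.

Lemma fsum_scal {I : Type} (c : C) (f : I -> C) l :
  fsum (fun i => c * f i) l = c * fsum f l.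
Proof. induction l; simpl; [ring|]. rewrite IHl; ring. Qed.

Lemma fsum_ext {I : Type} (f g : I -> C) l :
  (forall i, In i l -> f i = g i) -> fsum f l = fsum g l.
Proof.
induction l as [|x l IH]; simpl; intros H; [easy|].
rewrite (H x) by now left. rewrite IH; [easy|]. intros; apply H; now right.
Qed.

Lemma fsum_zero {I : Type} (f : I -> C) l :
  (forall i, In i l -> f i = 0) -> fsum f l = 0.
Proof.
induction l as [|x l IH]; simpl; intros H; [easy|].
rewrite (H x) by now left. rewrite IH; [ring|]. intros; apply H; now right.
Qed.

Lemma Cmod_fsum {I : Type} (f : I -> C) l :
  (Cmod (fsum f l) <= rsum (fun i => Cmod (f i)) l)%R.
Proof.
induction l as [|x l IH]; simpl; [rewrite Cmod_0; lra|].
eapply Rle_trans; [apply Cmod_triangle|]. lra.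
Qed.

Lemma fsum_map {I J : Type} (h : I -> J) (f : J -> C) l :
  fsum f (map h l) = fsum (fun i => f (h i)) l.
Proof. induction l; simpl; congruence. Qed.

Lemma rsum_map {I J : Type} (h : I -> J) (f : J -> R) l :
  rsum f (map h l) = rsum (fun i => f (h i)) l.
Proof. induction l; simpl; congruence. Qed.

Lemma rsummable_le {I : Type} (f g : I -> R) :
  (forall i, f i <= g i)%R -> rsummable g -> rsummable f.
Proof.
intros H [M HM]; exists M; intros l Hl.
eapply Rle_trans; [apply rsum_le; intros; apply H|now apply HM].
Qed.

Lemma rsummable_plus {I : Type} (f g : I -> R) :
  rsummable f -> rsummable g -> rsummable (fun i => f i + g i)%R.
Proof.
intros [M HM] [N HN]; exists (M + N)%R; intros l Hl.
rewrite rsum_plus; generalize (HM l Hl) (HN l Hl); lra.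
Qed.

Lemma rbnd_scal {I : Type} (c : R) (f : I -> R) M :
  (0 <= c)%R -> rbnd f M -> rbnd (fun i => c * f i)%R (c * M).
Proof.
intros Hc HM l Hl.
rewrite rsum_scal; apply Rmult_le_compat_l; [easy|now apply HM].
Qed.

Lemma rsummable_scal {I : Type} (c : R) (f : I -> R) :
  (0 <= c)%R -> rsummable f -> rsummable (fun i => c * f i)%R.
Proof. intros Hc [M HM]; exists (c * M)%R; now apply rbnd_scal. Qed.

Lemma rbnd_le {I : Type} (f g : I -> R) M :
  (forall i, f i <= g i)%R -> rbnd g M -> rbnd f M.
Proof.
intros H HM l Hl.
eapply Rle_trans; [apply rsum_le; intros; apply H|now apply HM].
Qed.

Lemma rbnd_weaken {I : Type} (f : I -> R) M N :
  (M <= N)%R -> rbnd f M -> rbnd f N.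
Proof. intros H HM l Hl; generalize (HM l Hl); lra. Qed.

Lemma rbnd_ge0 {I : Type} (f : I -> R) M : rbnd f M -> (0 <= M)%R.
Proof. intros H; apply (H nil); constructor. Qed.

Lemma rbnd_term {I : Type} (f : I -> R) M i : rbnd f M -> (f i <= M)%R.
Proof.
intros H. generalize (H [i] (NoDup_cons i (@in_nil _ i) (NoDup_nil _))). simpl; lra.
Qed.

(** The supremum of the finite sums serves as the sum. *)
Lemma nonneg_sum {I : Type} (f : I -> R) :
  (forall i, 0 <= f i)%R -> rsummable f ->
  exists s, forall eps, (0 < eps)%R -> exists l0, forall l,
    NoDup l -> incl l0 l -> (Rabs (rsum f l - s) < eps)%R.
Proof.
intros Hf [M HM].
set (E := fun x => exists l, NoDup l /\ x = rsum f l).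
destruct (completeness E) as [s [Hs1 Hs2]].
{ exists M; intros x [l [Hl ->]]; now apply HM. }
{ exists 0%R, nil; split; [constructor|easy]. }
exists s; intros eps He.
destruct (classic (exists l, NoDup l /\ (s - eps < rsum f l)%R)) as [[l0 [H1 H2]]|H].
- exists l0; intros l Hl Hi.
  assert (A : (rsum f l <= s)%R) by (apply Hs1; now exists l).
  generalize (rsum_incl f l0 l Hf H1 Hi); intros B.
  apply Rabs_def1; lra.
- exfalso. assert (A : (s <= s - eps)%R); [|lra].
  apply Hs2; intros x [l [Hl ->]].
  apply Rnot_lt_le; intros Hlt; apply H; now exists l.
Qed.

Lemma real_sum {I : Type} (f : I -> R) :
  rsummable (fun i => Rabs (f i)) ->
  exists s, forall eps, (0 < eps)%R -> exists l0, forall l,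
    NoDup l -> incl l0 l -> (Rabs (rsum f l - s) < eps)%R.
Proof.
intros Hf.
destruct (nonneg_sum (fun i => Rabs (f i))) as [s Hs]; [intros; apply Rabs_pos|easy|].
destruct (nonneg_sum (fun i => Rabs (f i) + f i)%R) as [t Ht].
{ intros i; generalize (Rle_abs (- f i)); rewrite Rabs_Ropp; lra. }
{ apply rsummable_le with (fun i => Rabs (f i) + Rabs (f i))%R; [|now apply rsummable_plus].
  intros i; generalize (Rle_abs (f i)); lra. }
exists (t - s)%R; intros eps He.
destruct (Hs (eps / 2)%R ltac:(lra)) as [l0 H0].
destruct (Ht (eps / 2)%R ltac:(lra)) as [l1 H1].
exists (l0 ++ l1); intros l Hl Hi.
specialize (H0 l Hl (fun x h => Hi x (in_or_app _ _ _ (or_introl h)))).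
specialize (H1 l Hl (fun x h => Hi x (in_or_app _ _ _ (or_intror h)))).
rewrite rsum_plus in H1.
apply Rabs_def2 in H0; apply Rabs_def2 in H1; apply Rabs_def1; lra.
Qed.

Lemma fsum_Re_Im {I : Type} (f : I -> C) l :
  fsum f l = (rsum (fun i => Re (f i)) l, rsum (fun i => Im (f i)) l).
Proof. induction l; simpl; [easy|]. rewrite IHl; now destruct (f a). Qed.

Lemma Rabs_Re_le (z : C) : (Rabs (Re z) <= Cmod z)%R.
Proof. eapply Rle_trans; [apply Rmax_l|apply Rmax_Cmod]. Qed.

Lemma Rabs_Im_le (z : C) : (Rabs (Im z) <= Cmod z)%R.
Proof. eapply Rle_trans; [apply Rmax_r|apply Rmax_Cmod]. Qed.

Lemma Cmod_le_Re_Im (z : C) : (Cmod z <= Rabs (Re z) + Rabs (Im z))%R.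
Proof.
unfold Cmod; change (fst z) with (Re z); change (snd z) with (Im z).
rewrite <- (sqrt_Rsqr (Rabs (Re z) + Rabs (Im z))).
2: generalize (Rabs_pos (Re z)) (Rabs_pos (Im z)); lra.
apply sqrt_le_1_alt; unfold Rsqr.
rewrite <- (pow2_abs (Re z)), <- (pow2_abs (Im z)).
generalize (Rabs_pos (Re z)) (Rabs_pos (Im z)); intros; nra.
Qed.

Lemma summable_has_sum {I : Type} (f : I -> C) :
  summable f -> exists s, has_sum f s.
Proof.
intros Hf.
destruct (real_sum (fun i => Re (f i))) as [s Hs].
{ eapply rsummable_le; [|exact Hf]; intros; apply Rabs_Re_le. }
destruct (real_sum (fun i => Im (f i))) as [t Ht].
{ eapply rsummable_le; [|exact Hf]; intros; apply Rabs_Im_le. }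
exists (s, t); intros eps He.
destruct (Hs (eps / 2)%R ltac:(lra)) as [l0 H0].
destruct (Ht (eps / 2)%R ltac:(lra)) as [l1 H1].
exists (l0 ++ l1); intros l Hl Hi.
specialize (H0 l Hl (fun x h => Hi x (in_or_app _ _ _ (or_introl h)))).
specialize (H1 l Hl (fun x h => Hi x (in_or_app _ _ _ (or_intror h)))).
rewrite fsum_Re_Im.
eapply Rle_lt_trans; [apply Cmod_le_Re_Im|]. simpl.
unfold Rminus in *; lra.
Qed.

Lemma Cmod_lt_all (z : C) :
  (forall eps, (0 < eps)%R -> (Cmod z < eps)%R) -> z = 0.
Proof.
intros H; apply Cmod_eq_0.
destruct (Cmod_ge_0 z) as [Hp|]; [|easy].
specialize (H _ Hp); lra.
Qed.

Lemma Cminus_eq (x y : C) : x - y = 0 -> x = y.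
Proof. intros H. replace x with ((x - y) + y) by ring. rewrite H; ring. Qed.

Lemma has_sum_unique {I : Type} (f : I -> C) s t :
  has_sum f s -> has_sum f t -> s = t.
Proof.
intros Hs Ht; apply Cminus_eq, Cmod_lt_all; intros eps He.
destruct (Hs (eps / 2)%R ltac:(lra)) as [l0 H0].
destruct (Ht (eps / 2)%R ltac:(lra)) as [l1 H1].
set (l := nodup cdec (l0 ++ l1)).
assert (Hl : NoDup l) by apply NoDup_nodup.
specialize (H0 l Hl (fun x h => proj2 (nodup_In cdec _ x) (in_or_app _ _ _ (or_introl h)))).
specialize (H1 l Hl (fun x h => proj2 (nodup_In cdec _ x) (in_or_app _ _ _ (or_intror h)))).
replace (s - t) with ((fsum f l - t) + - (fsum f l - s)) by ring.
eapply Rle_lt_trans; [apply Cmod_triangle|]. rewrite Cmod_opp; lra.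
Qed.

Lemma csum_spec {I : Type} (f : I -> C) : summable f -> has_sum f (csum f).
Proof. intros H; unfold csum; apply epsilon_spec, summable_has_sum, H. Qed.

Lemma csum_eq {I : Type} (f : I -> C) s : has_sum f s -> csum f = s.
Proof.
intros H; apply has_sum_unique with f; [|easy].
unfold csum; apply epsilon_spec; now exists s.
Qed.

Lemma csum_ext {I : Type} (f g : I -> C) : (forall i, f i = g i) -> csum f = csum g.
Proof. intros H; f_equal; now apply functional_extensionality. Qed.

Lemma summable_ext {I : Type} (f g : I -> C) :
  (forall i, f i = g i) -> summable f -> summable g.
Proof. intros H; now replace g with f by now apply functional_extensionality. Qed.

Lemma summable_le {I : Type} (f : I -> C) (g : I -> R) :
  (forall i, Cmod (f i) <= g i)%R -> rsummable g -> summable f.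
Proof. apply rsummable_le. Qed.

Lemma summable_plus {I : Type} (f g : I -> C) :
  summable f -> summable g -> summable (fun i => f i + g i).
Proof.
intros Hf Hg; eapply summable_le; [|exact (rsummable_plus _ _ Hf Hg)].
intros; apply Cmod_triangle.
Qed.

Lemma summable_scal {I : Type} (c : C) (f : I -> C) :
  summable f -> summable (fun i => c * f i).
Proof.
intros Hf; eapply summable_le; [|exact (rsummable_scal _ _ (Cmod_ge_0 c) Hf)].
intros; rewrite Cmod_mult; lra.
Qed.

Lemma csum_plus {I : Type} (f g : I -> C) :
  summable f -> summable g -> csum (fun i => f i + g i) = csum f + csum g.
Proof.
intros Hf Hg; apply csum_eq; intros eps He.
destruct (csum_spec f Hf (eps / 2)%R ltac:(lra)) as [l0 H0].
destruct (csum_spec g Hg (eps / 2)%R ltac:(lra)) as [l1 H1].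
exists (l0 ++ l1); intros l Hl Hi.
specialize (H0 l Hl (fun x h => Hi x (in_or_app _ _ _ (or_introl h)))).
specialize (H1 l Hl (fun x h => Hi x (in_or_app _ _ _ (or_intror h)))).
rewrite fsum_plus.
replace (fsum f l + fsum g l - (csum f + csum g))
  with ((fsum f l - csum f) + (fsum g l - csum g)) by ring.
eapply Rle_lt_trans; [apply Cmod_triangle|]. lra.
Qed.

Lemma csum_scal {I : Type} (c : C) (f : I -> C) :
  summable f -> csum (fun i => c * f i) = c * csum f.
Proof.
intros Hf; apply csum_eq; intros eps He.
assert (Hp : (0 < Cmod c + 1)%R) by (generalize (Cmod_ge_0 c); lra).
destruct (csum_spec f Hf (eps / (Cmod c + 1))%R) as [l0 H0].
{ now apply Rdiv_lt_0_compat. }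
exists l0; intros l Hl Hi. specialize (H0 l Hl Hi).
rewrite fsum_scal. replace (c * fsum f l - c * csum f) with (c * (fsum f l - csum f)) by ring.
rewrite Cmod_mult.
apply Rle_lt_trans with (Cmod c * (eps / (Cmod c + 1)))%R.
{ apply Rmult_le_compat_l; [apply Cmod_ge_0|lra]. }
apply Rlt_le_trans with ((Cmod c + 1) * (eps / (Cmod c + 1)))%R.
- apply Rmult_lt_compat_r; [now apply Rdiv_lt_0_compat|lra].
- right; field; lra.
Qed.

Lemma summable_opp {I : Type} (f : I -> C) : summable f -> summable (fun i => - f i).
Proof. intros H; eapply summable_le; [|exact H]. intros i; rewrite Cmod_opp; lra. Qed.

Lemma summable_minus {I : Type} (f g : I -> C) :
  summable f -> summable g -> summable (fun i => f i - g i).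
Proof. intros Hf Hg; apply summable_plus; [easy|now apply summable_opp]. Qed.

Lemma csum_opp {I : Type} (f : I -> C) : summable f -> csum (fun i => - f i) = - csum f.
Proof.
intros H. replace (- csum f) with ((-(1)) * csum f) by ring.
rewrite <- csum_scal by easy. apply csum_ext; intros; ring.
Qed.

Lemma csum_minus {I : Type} (f g : I -> C) :
  summable f -> summable g -> csum (fun i => f i - g i) = csum f - csum g.
Proof.
intros Hf Hg; unfold Cminus.
rewrite csum_plus; [now rewrite csum_opp|easy|now apply summable_opp].
Qed.

Lemma csum_bound {I : Type} (f : I -> C) M :
  rbnd (fun i => Cmod (f i)) M -> (Cmod (csum f) <= M)%R.
Proof.
intros HM.
assert (Hf : summable f) by now exists M.
apply le_epsilon; intros eps He.
destruct (csum_spec f Hf eps He) as [l0 H0].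
set (l := nodup cdec l0).
assert (Hl : NoDup l) by apply NoDup_nodup.
specialize (H0 l Hl (fun x h => proj2 (nodup_In cdec _ x) h)).
generalize (Cmod_fsum f l) (HM l Hl); intros A B.
replace (csum f) with (fsum f l + - (fsum f l - csum f)) by ring.
eapply Rle_trans; [apply Cmod_triangle|]. rewrite Cmod_opp; lra.
Qed.

Fixpoint preimages {I J : Type} (p : J -> option I) (l : list J) : list I :=
  match l with
  | nil => nil
  | j :: l => match p j with Some i => i :: preimages p l | None => preimages p l end
  end.

(** Reindexing along an injection [h]. Its partial inverse [p] makes the range
    decidable and pulls finite sets back. *)
Section Reindex.

Context {I J : Type} (h : I -> J) (p : J -> option I).
Context (ph : forall i, p (h i) = Some i)
  (hp : forall j i, p j = Some i -> h i = j).

Lemma in_preimages l i : In i (preimages p l) <-> In (h i) l.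
Proof.
induction l as [|j l IH]; simpl; [easy|].
destruct (p j) as [i'|] eqn:E; simpl; rewrite IH.
- rewrite <- (hp _ _ E). split; intros [H|H]; auto; [left; congruence|].
  left. apply (f_equal p) in H; rewrite !ph in H; congruence.
- split; [now right|]. intros [H|H]; [|easy]. rewrite H, ph in E; congruence.
Qed.

Lemma preimages_NoDup l : NoDup l -> NoDup (preimages p l).
Proof.
induction 1 as [|j l Hj Hl IH]; simpl; [constructor|].
destruct (p j) as [i|] eqn:E; [|easy].
constructor; [|easy]. rewrite in_preimages. now rewrite (hp _ _ E).
Qed.

Lemma fsum_preimages (f : J -> C) l :
  (forall j, p j = None -> f j = 0) ->
  fsum f l = fsum (fun i => f (h i)) (preimages p l).
Proof.
intros H0; induction l as [|j l IH]; simpl; [easy|].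
destruct (p j) as [i|] eqn:E; simpl; rewrite IH.
- now rewrite (hp _ _ E).
- rewrite H0; [ring|easy].
Qed.

Lemma rsum_preimages (f : J -> R) l :
  (forall j, p j = None -> f j = 0%R) ->
  rsum f l = rsum (fun i => f (h i)) (preimages p l).
Proof.
intros H0; induction l as [|j l IH]; simpl; [easy|].
destruct (p j) as [i|] eqn:E; simpl; rewrite IH.
- now rewrite (hp _ _ E).
- rewrite H0; [ring|easy].
Qed.

Lemma rbnd_reindex (f : J -> R) M :
  (forall j, p j = None -> f j = 0%R) -> rbnd (fun i => f (h i)) M -> rbnd f M.
Proof.
intros H0 H l Hl. rewrite rsum_preimages by easy.
apply H. now apply preimages_NoDup.
Qed.

Lemma NoDup_map_h l : NoDup l -> NoDup (map h l).
Proof.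
apply FinFun.Injective_map_NoDup. intros x y H.
apply (f_equal p) in H; rewrite !ph in H; congruence.
Qed.

Lemma rbnd_restrict (f : J -> R) M : rbnd f M -> rbnd (fun i => f (h i)) M.
Proof.
intros H l Hl. rewrite <- rsum_map. apply H, NoDup_map_h, Hl.
Qed.

Lemma summable_reindex (f : J -> C) :
  (forall j, p j = None -> f j = 0) -> summable (fun i => f (h i)) -> summable f.
Proof.
intros H0 [M HM]; exists M; apply rbnd_reindex; [|easy].
intros j Hj; rewrite H0 by easy; apply Cmod_0.
Qed.

Lemma summable_restrict (f : J -> C) : summable f -> summable (fun i => f (h i)).
Proof. intros [M HM]; exists M; now apply (rbnd_restrict (fun j => Cmod (f j))). Qed.

Lemma csum_reindex (f : J -> C) :
  (forall j, p j = None -> f j = 0) -> summable f ->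
  csum f = csum (fun i => f (h i)).
Proof.
intros H0 Hf; apply csum_eq; intros eps He.
destruct (csum_spec _ (summable_restrict f Hf) eps He) as [l0 Hl0].
exists (map h l0); intros l Hl Hi.
rewrite fsum_preimages by easy. apply Hl0.
- now apply preimages_NoDup.
- intros i Hin. apply in_preimages, Hi, in_map, Hin.
Qed.

End Reindex.

Lemma csum_bij {I J : Type} (h : I -> J) (k : J -> I) (f : J -> C) :
  (forall i, k (h i) = i) -> (forall j, h (k j) = j) -> summable f ->
  csum f = csum (fun i => f (h i)).
Proof.
intros H1 H2 Hf.
apply (csum_reindex h (fun j => Some (k j))); [congruence| |easy|easy].
intros j i E; injection E; intros <-; easy.
Qed.

Lemma summable_bij {I J : Type} (h : I -> J) (k : J -> I) (f : J -> C) :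
  (forall i, k (h i) = i) -> (forall j, h (k j) = j) -> summable f ->
  summable (fun i => f (h i)).
Proof.
intros H1 H2. apply (summable_restrict h (fun j => Some (k j))).
congruence.
Qed.

Lemma csum_finite {I : Type} (f : I -> C) l :
  NoDup l -> (forall i, ~ In i l -> f i = 0) -> summable f /\ csum f = fsum f l.
Proof.
intros Hl H0.
assert (A : forall l', NoDup l' -> incl l l' -> fsum f l' = fsum f l).
{ intros l' Hl' Hi; destruct (incl_complement l l' Hl Hi) as [r Hr].
  rewrite (fsum_perm f _ _ Hr), fsum_app, (fsum_zero f r); [ring|].
  intros i Hr'. apply H0; intros Hin.
  apply (Permutation_NoDup Hr) in Hl'.
  apply NoDup_app_remove_l with (l := nil) in Hl'. simpl in Hl'.
  clear - Hl' Hin Hr'. induction l as [|x l IH]; [easy|].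
  inversion Hl'; subst. destruct Hin as [->|Hin]; [|auto].
  apply H1, in_or_app; now right. }
split.
- exists (rsum (fun i => Cmod (f i)) l); intros l' Hl'.
  assert (B : rsum (fun i => Cmod (f i)) l' =
              rsum (fun i => Cmod (f i)) (filter (fun i => if in_dec cdec i l then true else false) l')).
  { clear Hl'. induction l' as [|x l' IH]; simpl; [easy|].
    destruct (in_dec cdec x l); simpl; rewrite IH; [easy|].
    rewrite H0 by easy. rewrite Cmod_0; ring. }
  rewrite B. apply rsum_incl; [intros; apply Cmod_ge_0|now apply NoDup_filter|].
  intros x Hx. apply filter_In in Hx. now destruct (in_dec cdec x l).
- apply csum_eq; intros eps He; exists l; intros l' Hl' Hi.
  rewrite A by easy. replace (fsum f l - fsum f l) with (RtoC 0) by ring.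
  now rewrite Cmod_0.
Qed.

Lemma csum_zero {I : Type} (f : I -> C) : (forall i, f i = 0) -> csum f = 0.
Proof. intros H. now destruct (csum_finite f nil (NoDup_nil _)) as [_ ->]. Qed.

(** * Interchange of summations *)

Lemma NoDup_pairs {I J : Type} (L : list I) (r : I -> list J) :
  NoDup L -> (forall i, NoDup (r i)) ->
  NoDup (flat_map (fun i => map (pair i) (r i)) L).
Proof.
intros HL Hr; induction HL as [|i L Hi HL IH]; simpl; [constructor|].
apply NoDup_app; [|easy|].
- apply FinFun.Injective_map_NoDup; [|easy]. intros x y H; congruence.
- intros [i' j] H1 H2. apply in_map_iff in H1 as [j' [E _]].
  apply in_flat_map in H2 as [i'' [H2 H3]]. apply in_map_iff in H3 as [j'' [E' _]].
  congruence.
Qed.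

Lemma fsum_pairs {I J : Type} (f : I * J -> C) (L : list I) (r : I -> list J) :
  fsum f (flat_map (fun i => map (pair i) (r i)) L)
  = fsum (fun i => fsum (fun j => f (i, j)) (r i)) L.
Proof.
induction L as [|i L IH]; simpl; [easy|].
now rewrite fsum_app, fsum_map, IH.
Qed.

Lemma rsum_pairs {I J : Type} (f : I * J -> R) (L : list I) (r : I -> list J) :
  rsum f (flat_map (fun i => map (pair i) (r i)) L)
  = rsum (fun i => rsum (fun j => f (i, j)) (r i)) L.
Proof.
induction L as [|i L IH]; simpl; [easy|].
now rewrite rsum_app, rsum_map, IH.
Qed.

Lemma rsummable_pair {I J : Type} (u : I * J -> R) (g : I -> R) :
  (forall x, 0 <= u x)%R -> (forall i, rbnd (fun j => u (i, j)) (g i)) ->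
  rsummable g -> rsummable u.
Proof.
intros H0 Hu [M HM]; exists M; intros l Hl.
set (L := nodup cdec (map fst l)). set (K := nodup cdec (map snd l)).
apply Rle_trans with (rsum u (flat_map (fun i => map (pair i) K) L)).
{ apply rsum_incl; [easy|easy|]. intros [i j] Hin.
  apply in_flat_map; exists i; split.
  - apply nodup_In. now apply (in_map fst) in Hin.
  - apply in_map, nodup_In. now apply (in_map snd) in Hin. }
rewrite (rsum_pairs u L (fun _ => K)).
apply Rle_trans with (rsum g L).
- apply rsum_le; intros i _. apply Hu, NoDup_nodup.
- apply HM, NoDup_nodup.
Qed.

Lemma summable_row {I J : Type} (f : I * J -> C) i :
  summable f -> summable (fun j => f (i, j)).
Proof.
intros [M HM]; exists M; intros l Hl.
rewrite <- (rsum_map (pair i) (fun x => Cmod (f x))). apply HM.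
apply FinFun.Injective_map_NoDup; [|easy]. intros x y H; congruence.
Qed.

Lemma row_approx {J : Type} (f : J -> C) (l0 : list J) eps :
  summable f -> (0 < eps)%R ->
  exists l, NoDup l /\ incl l0 l /\ (Cmod (fsum f l - csum f) < eps)%R.
Proof.
intros Hf He; destruct (csum_spec f Hf eps He) as [l1 H1].
exists (nodup cdec (l0 ++ l1)).
assert (Hn : NoDup (nodup cdec (l0 ++ l1))) by apply NoDup_nodup.
split; [easy|split].
- intros x Hx; apply nodup_In, in_or_app; now left.
- apply H1; [easy|]. intros x Hx; apply nodup_In, in_or_app; now right.
Qed.

(** A finite set that is good for the whole family is enlarged, row by row, by
    finite sets that are good for the rows. *)
Lemma csum_pair {I J : Type} (f : I * J -> C) :
  summable f -> csum f = csum (fun i => csum (fun j => f (i, j))).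
Proof.
intros Hf; symmetry; apply csum_eq; intros eps He.
destruct (csum_spec f Hf (eps / 2)%R ltac:(lra)) as [l0 H0].
exists (map fst l0); intros L HL Hi.
set (N := (INR (length L) + 1)%R).
assert (HN : (0 < N)%R) by (unfold N; generalize (pos_INR (length L)); lra).
assert (Hr : exists r : I -> list J, forall i, NoDup (r i) /\ incl (map snd l0) (r i) /\
   (Cmod (fsum (fun j => f (i, j)) (r i) - csum (fun j => f (i, j))) < eps / 2 / N)%R).
{ assert (A : forall i, exists l, NoDup l /\ incl (map snd l0) l /\
     (Cmod (fsum (fun j => f (i, j)) l - csum (fun j => f (i, j))) < eps / 2 / N)%R).
  { intros i; apply row_approx; [now apply summable_row|].
    apply Rdiv_lt_0_compat; lra. }
  exists (fun i => proj1_sig (constructive_indefinite_description _ (A i))).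
  intros i; apply (proj2_sig (constructive_indefinite_description _ (A i))). }
destruct Hr as [r Hr].
specialize (H0 (flat_map (fun i => map (pair i) (r i)) L)).
assert (H1 := H0 (NoDup_pairs L r HL (fun i => proj1 (Hr i)))); clear H0.
assert (H2 : incl l0 (flat_map (fun i => map (pair i) (r i)) L)).
{ intros [i j] Hin. apply in_flat_map; exists i; split.
  - apply Hi. now apply (in_map fst) in Hin.
  - apply in_map. apply (proj1 (proj2 (Hr i))). now apply (in_map snd) in Hin. }
specialize (H1 H2). rewrite fsum_pairs in H1.
assert (A : (Cmod (fsum (fun i => csum (fun j => f (i, j))) L
   - fsum (fun i => fsum (fun j => f (i, j)) (r i)) L) <= INR (length L) * (eps / 2 / N))%R).
{ revert Hr. generalize (eps / 2 / N)%R. intros q Hr. clear -Hr. induction L as [|i L IH].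
  - cbn [fsum fold_right length INR]. replace (0 - 0) with (RtoC 0) by ring. rewrite Cmod_0; lra.
  - cbn [length fsum fold_right]. rewrite S_INR.
    change (fold_right (fun i0 s => csum (fun j => f (i0, j)) + s) 0 L)
      with (fsum (fun i0 => csum (fun j => f (i0, j))) L).
    change (fold_right (fun i0 s => fsum (fun j => f (i0, j)) (r i0) + s) 0 L)
      with (fsum (fun i0 => fsum (fun j => f (i0, j)) (r i0)) L).
    set (X := fsum (fun i0 => csum (fun j => f (i0, j))) L) in *.
    set (Y := fsum (fun i0 => fsum (fun j => f (i0, j)) (r i0)) L) in *.
    destruct (Hr i) as [_ [_ H]].
    match goal with |- (Cmod (?x + X - (?y + Y)) <= _)%R =>
      replace (x + X - (y + Y)) with (- (y - x) + (X - Y)) by ring end.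
    eapply Rle_trans; [apply Cmod_triangle|]. rewrite Cmod_opp. lra. }
assert (B : (INR (length L) * (eps / 2 / N) <= eps / 2)%R).
{ unfold N. apply Rmult_le_reg_r with N; [easy|]. unfold N.
  field_simplify; [|unfold N in HN; lra].
  generalize (pos_INR (length L)); nra. }
set (X := fsum (fun i => csum (fun j => f (i, j))) L) in *.
set (Y := fsum (fun i => fsum (fun j => f (i, j)) (r i)) L) in *.
replace (X - csum f) with ((X - Y) + (Y - csum f)) by ring.
eapply Rle_lt_trans; [apply Cmod_triangle|]. lra.
Qed.

Lemma summable_csum_rows {I J : Type} (u : I -> J -> C) (g : I -> R) :
  (forall i, rbnd (fun j => Cmod (u i j)) (g i)) -> rsummable g ->
  summable (fun i => csum (u i)).
Proof.
intros H; apply summable_le; intros i; apply csum_bound, H.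
Qed.

(** Fubini: both sides are the sum over the product, whose absolute convergence
    the bound on the rows provides. *)
Lemma csum_swap {I J : Type} (u : I -> J -> C) (g : I -> R) :
  (forall i, rbnd (fun j => Cmod (u i j)) (g i)) -> rsummable g ->
  csum (fun i => csum (fun j => u i j)) = csum (fun j => csum (fun i => u i j)).
Proof.
intros Hu Hg.
set (f := fun x : I * J => u (fst x) (snd x)).
assert (Hf : summable f).
{ apply (rsummable_pair (fun x => Cmod (f x)) g); [intros; apply Cmod_ge_0|exact Hu|easy]. }
set (sw := fun x : J * I => (snd x, fst x)).
set (sw' := fun x : I * J => (snd x, fst x)).
assert (E1 : forall x, sw' (sw x) = x) by now intros [].
assert (E2 : forall x, sw (sw' x) = x) by now intros [].
change (csum (fun i => csum (fun j => f (i, j))) = csum (fun j => csum (fun i => f (sw (j, i))))).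
rewrite <- (csum_pair f) by easy.
rewrite <- (csum_pair (fun x => f (sw x))).
- now apply csum_bij with sw'.
- now apply summable_bij with sw'.
Qed.

Lemma summable_swap {I J : Type} (u : I -> J -> C) (g : I -> R) :
  (forall i, rbnd (fun j => Cmod (u i j)) (g i)) -> rsummable g ->
  summable (fun j => csum (fun i => u i j)).
Proof.
intros Hu [M HM]; exists M; intros l Hl.
assert (Hcol : forall j, rbnd (fun i => Cmod (u i j)) M).
{ intros j L HL; apply Rle_trans with (rsum g L); [|now apply HM].
  apply rsum_le; intros i _; apply (rbnd_term (fun j => Cmod (u i j))), Hu. }
apply le_epsilon; intros eps He.
set (N := (INR (length l) + 1)%R).
assert (HN : (0 < N)%R) by (unfold N; generalize (pos_INR (length l)); lra).
assert (He' : (0 < eps / N)%R) by now apply Rdiv_lt_0_compat.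
assert (A : exists L, NoDup L /\ forall j, In j l ->
   (Cmod (fsum (fun i => u i j) L - csum (fun i => u i j)) < eps / N)%R).
{ revert He'. generalize (eps / N)%R. intros d Hd. clear N HN Hl.
  assert (Hex : exists L0, forall L, NoDup L -> incl L0 L -> forall j, In j l ->
     (Cmod (fsum (fun i => u i j) L - csum (fun i => u i j)) < d)%R).
  { induction l as [|j l IH]; [now exists nil|].
    destruct IH as [L0 H0].
    destruct (csum_spec (fun i => u i j) (ex_intro _ M (Hcol j)) d Hd) as [L1 H1].
    exists (L0 ++ L1); intros L HL Hi j' [<-|Hj'].
    - apply H1; [easy|]. intros x Hx; apply Hi, in_or_app; now right.
    - apply H0; [easy| |easy]. intros x Hx; apply Hi, in_or_app; now left. }
  destruct Hex as [L0 H0]. exists (nodup cdec L0).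
  assert (Hn : NoDup (nodup cdec L0)) by apply NoDup_nodup.
  split; [easy|]. apply H0; [easy|]. intros x Hx; now apply nodup_In. }
destruct A as [L [HL H]].
apply Rle_trans with (rsum (fun j => rsum (fun i => Cmod (u i j)) L + eps / N)%R l).
{ apply rsum_le; intros j Hj. specialize (H j Hj).
  generalize (Cmod_fsum (fun i => u i j) L); intros B.
  set (X := fsum (fun i => u i j) L) in *. set (Y := csum (fun i => u i j)) in *.
  replace Y with (X + - (X - Y)) by ring.
  eapply Rle_trans; [apply Cmod_triangle|]. rewrite Cmod_opp. lra. }
rewrite rsum_plus. apply Rplus_le_compat.
- apply Rle_trans with (rsum g L); [|now apply HM].
  apply Rle_trans with (rsum (fun i => rsum (fun j => Cmod (u i j)) l) L).
  + right. clear. induction l as [|j l IH]; simpl.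
    * induction L; simpl in *; lra.
    * rewrite IH, <- rsum_plus. now apply Rle_antisym; apply rsum_le; intros; simpl; lra.
  + apply rsum_le; intros i _; now apply Hu.
- apply Rle_trans with (INR (length l) * (eps / N))%R.
  + right. generalize (eps / N)%R; intros q. clear. induction l as [|j l IH]; [simpl; ring|].
    cbn [length rsum fold_right]. rewrite S_INR.
    change (fold_right (fun (i : J) s => q + s)%R 0%R l) with (rsum (fun _ : J => q) l).
    rewrite IH; ring.
  + apply Rmult_le_reg_r with N; [easy|].
    replace (INR (length l) * (eps / N) * N)%R with (INR (length l) * eps)%R by (field; lra).
    unfold N; generalize (pos_INR (length l)); nra.
Qed.

(** * Limits of complex sequences *)

Definition clim (u : nat -> C) (l : C) : Prop :=
  is_lim_seq (fun n => Cmod (u n - l)) 0.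

Lemma clim_eps u l :
  clim u l <-> forall eps, (0 < eps)%R -> exists N, forall n, (N <= n)%nat ->
    (Cmod (u n - l) < eps)%R.
Proof.
unfold clim; split.
- intros H eps He. apply is_lim_seq_spec in H. destruct (H (mkposreal eps He)) as [N HN].
  exists N; intros n Hn; specialize (HN n Hn); simpl in HN.
  rewrite Rminus_0_r, Rabs_pos_eq in HN by apply Cmod_ge_0. easy.
- intros H. apply is_lim_seq_spec. intros [eps He]. destruct (H eps He) as [N HN].
  exists N; intros n Hn; simpl. rewrite Rminus_0_r, Rabs_pos_eq by apply Cmod_ge_0. now apply HN.
Qed.

Lemma clim_squeeze u l (b : nat -> R) :
  (forall n, Cmod (u n - l) <= b n)%R -> is_lim_seq b 0 -> clim u l.
Proof.
intros H Hb. apply is_lim_seq_le_le with (fun _ => 0%R) b; [|apply is_lim_seq_const|easy].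
intros n; split; [apply Cmod_ge_0|apply H].
Qed.

Lemma lim0_scal (c : R) (u : nat -> R) :
  is_lim_seq u 0 -> is_lim_seq (fun n => c * u n)%R 0.
Proof.
intros H. replace (Finite 0) with (Rbar_mult c 0) by (simpl; f_equal; ring).
now apply is_lim_seq_scal_l.
Qed.

Lemma lim0_plus (u v : nat -> R) :
  is_lim_seq u 0 -> is_lim_seq v 0 -> is_lim_seq (fun n => u n + v n)%R 0.
Proof.
intros Hu Hv. replace (Finite 0) with (Rbar_plus 0 0) by (simpl; f_equal; ring).
now apply is_lim_seq_plus'.
Qed.

Lemma clim_const l : clim (fun _ => l) l.
Proof.
unfold clim. replace (l - l) with (RtoC 0) by ring. rewrite Cmod_0; apply is_lim_seq_const.
Qed.

Lemma clim_ext u v l : (forall n, u n = v n) -> clim u l -> clim v l.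
Proof. intros H; now replace v with u by now apply functional_extensionality. Qed.

Lemma clim_val u l l' : l = l' -> clim u l -> clim u l'.
Proof. now intros <-. Qed.

Lemma clim_shift u l p : clim u l -> clim (fun n => u (n + p)%nat) l.
Proof.
rewrite !clim_eps; intros H eps He. destruct (H eps He) as [N HN].
exists N; intros n Hn; apply HN; lia.
Qed.

Lemma clim_unshift u l p : clim (fun n => u (n + p)%nat) l -> clim u l.
Proof.
rewrite !clim_eps; intros H eps He. destruct (H eps He) as [N HN].
exists (N + p)%nat; intros n Hn. replace n with ((n - p) + p)%nat by lia. apply HN; lia.
Qed.

Lemma clim_plus u v l m : clim u l -> clim v m -> clim (fun n => u n + v n) (l + m).
Proof.
intros Hu Hv; apply clim_squeeze with (fun n => Cmod (u n - l) + Cmod (v n - m))%R.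
- intros n; replace (u n + v n - (l + m)) with ((u n - l) + (v n - m)) by ring. apply Cmod_triangle.
- now apply lim0_plus.
Qed.

Lemma clim_bounded u l : clim u l -> exists M, (0 < M)%R /\ forall n, (Cmod (u n) <= M)%R.
Proof.
intros H.
destruct (filterlim_bounded (fun n => Cmod (u n - l))) as [M HM].
{ exists 0%R; exact H. }
exists (Rabs M + Cmod l + 1)%R; split.
{ generalize (Rabs_pos M) (Cmod_ge_0 l); lra. }
intros n; specialize (HM n); unfold norm in HM; simpl in HM; unfold abs in HM; simpl in HM.
rewrite Rabs_pos_eq in HM by apply Cmod_ge_0.
replace (u n) with ((u n - l) + l) by ring.
eapply Rle_trans; [apply Cmod_triangle|]. generalize (Rle_abs M); lra.
Qed.

Lemma clim_scal c u l : clim u l -> clim (fun n => c * u n) (c * l).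
Proof.
intros Hu; apply clim_squeeze with (fun n => Cmod c * Cmod (u n - l))%R.
- intros n; replace (c * u n - c * l) with (c * (u n - l)) by ring. rewrite Cmod_mult; lra.
- now apply lim0_scal.
Qed.

Lemma clim_mult u v l m : clim u l -> clim v m -> clim (fun n => u n * v n) (l * m).
Proof.
intros Hu Hv. destruct (clim_bounded _ _ Hu) as [M [HM0 HM]].
apply clim_squeeze with (fun n => M * Cmod (v n - m) + Cmod m * Cmod (u n - l))%R.
- intros n; replace (u n * v n - l * m) with (u n * (v n - m) + m * (u n - l)) by ring.
  eapply Rle_trans; [apply Cmod_triangle|]. rewrite !Cmod_mult.
  apply Rplus_le_compat_r, Rmult_le_compat_r; [apply Cmod_ge_0|apply HM].
- now apply lim0_plus; apply lim0_scal.
Qed.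

Lemma clim_opp u l : clim u l -> clim (fun n => - u n) (- l).
Proof.
intros H. apply clim_ext with (fun n => (-(1)) * u n); [intros; ring|].
replace (- l) with ((-(1)) * l) by ring. now apply clim_scal.
Qed.

Lemma clim_minus u v l m : clim u l -> clim v m -> clim (fun n => u n - v n) (l - m).
Proof. intros Hu Hv; apply clim_plus; [easy|now apply clim_opp]. Qed.

Lemma clim_unique u l m : clim u l -> clim u m -> l = m.
Proof.
intros H1 H2. apply Cminus_eq, Cmod_lt_all; intros eps He.
rewrite clim_eps in H1, H2.
destruct (H1 (eps / 2)%R ltac:(lra)) as [N HN]. destruct (H2 (eps / 2)%R ltac:(lra)) as [M HM].
specialize (HN (N + M)%nat ltac:(lia)). specialize (HM (N + M)%nat ltac:(lia)).
replace (l - m) with ((u (N + M)%nat - m) + - (u (N + M)%nat - l)) by ring.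
eapply Rle_lt_trans; [apply Cmod_triangle|]. rewrite Cmod_opp; lra.
Qed.

Lemma clim_inv (u : nat -> C) (l : C) : l <> 0 -> clim u l -> clim (fun n => / u n) (/ l).
Proof.
intros Hl Hu.
assert (Hp : (0 < Cmod l)%R) by (apply Cmod_gt_0; exact Hl).
rewrite clim_eps in *; intros eps He.
destruct (Hu (Rmin (Cmod l / 2) (eps * (Cmod l * Cmod l) / 2))%R) as [N HN].
{ apply Rmin_glb_lt; [lra|]. apply Rdiv_lt_0_compat; [|lra]. apply Rmult_lt_0_compat; [easy|nra]. }
exists N; intros n Hn; specialize (HN n Hn).
assert (H1 := Rlt_le_trans _ _ _ HN (Rmin_l _ _)).
assert (H2 := Rlt_le_trans _ _ _ HN (Rmin_r _ _)).
assert (Hun : (Cmod l / 2 < Cmod (u n))%R).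
{ assert (A : (Cmod l <= Cmod (u n) + Cmod (u n - l))%R); [|lra].
  replace l with (u n + - (u n - l)) at 1 by ring.
  eapply Rle_trans; [apply Cmod_triangle|]. rewrite Cmod_opp; lra. }
assert (Hu0 : u n <> 0) by (intros E; rewrite E, Cmod_0 in Hun; lra).
replace (/ u n - / l) with (- (u n - l) / (u n * l)) by (field; split; easy).
rewrite Cmod_div by now apply Cmult_neq_0. rewrite Cmod_opp, Cmod_mult.
assert (Hq : (0 < Cmod (u n) * Cmod l)%R) by (apply Rmult_lt_0_compat; lra).
apply Rmult_lt_reg_r with (Cmod (u n) * Cmod l)%R; [easy|].
unfold Rdiv; rewrite Rmult_assoc, Rinv_l, Rmult_1_r by lra.
apply Rlt_le_trans with (1 := H2).
apply Rle_trans with (eps * (Cmod l / 2 * Cmod l))%R; [right; field|].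
apply Rmult_le_compat_l; [lra|]. apply Rmult_le_compat_r; lra.
Qed.

Lemma clim_CLim u l : clim u l -> CLim_seq u = l.
Proof.
intros H; apply CLim_seq_correct. rewrite clim_eps in H.
intros P [eps HP]. destruct (H eps (cond_pos eps)) as [N HN].
exists N; intros n Hn; apply HP. specialize (HN n Hn).
assert (A := Rabs_Re_le (u n - l)). assert (B := Rabs_Im_le (u n - l)).
split; [apply Rle_lt_trans with (1 := A)|apply Rle_lt_trans with (1 := B)]; easy.
Qed.

(** * Exhausting a family by finite ranges *)

Lemma has_sum_clim {I : Type} (f : I -> C) s (L : nat -> list I) :
  has_sum f s -> (forall n, NoDup (L n)) ->
  (forall i, exists N, forall n, (N <= n)%nat -> In i (L n)) ->
  clim (fun n => fsum f (L n)) s.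
Proof.
intros Hf HL Hx; rewrite clim_eps; intros eps He.
destruct (Hf eps He) as [l0 H0].
assert (A : exists N, forall n, (N <= n)%nat -> incl l0 (L n)).
{ clear H0. induction l0 as [|i l0 [N IH]].
  - exists 0%nat; intros n _ x [].
  - destruct (Hx i) as [M HM]; exists (N + M)%nat; intros n Hn x [<-|Hin].
    + apply HM; lia.
    + apply IH; [lia|easy]. }
destruct A as [N HN]; exists N; intros n Hn; apply H0; auto.
Qed.

Lemma csum_nat_clim (f : nat -> C) :
  summable f -> clim (fun n => fsum f (seq 0 n)) (csum f).
Proof.
intros Hf; apply has_sum_clim; [now apply csum_spec|intros; apply seq_NoDup|].
intros i; exists (S i); intros n Hn; apply in_seq; lia.
Qed.

Definition zrange (n : nat) : list Z := map (fun i => (Z.of_nat i - Z.of_nat n)%Z) (seq 0 (2 * n)).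

Lemma csum_Z_clim (f : Z -> C) :
  summable f -> clim (fun n => fsum f (zrange n)) (csum f).
Proof.
intros Hf; apply has_sum_clim; [now apply csum_spec| |].
- intros n; apply FinFun.Injective_map_NoDup; [intros x y; lia|apply seq_NoDup].
- intros i; exists (S (Z.abs_nat i)); intros n Hn. apply in_map_iff.
  exists (Z.to_nat (i + Z.of_nat n)); split; [lia|apply in_seq; lia].
Qed.

Lemma fsum_seq_S (f : nat -> C) n : fsum f (seq 0 (S n)) = fsum f (seq 0 n) + f n.
Proof. rewrite seq_S, fsum_app; simpl. ring. Qed.

Lemma rsum_seq_S (f : nat -> R) n : rsum f (seq 0 (S n)) = (rsum f (seq 0 n) + f n)%R.
Proof. rewrite seq_S, rsum_app; simpl. ring. Qed.

(** Gosper's method: all contiguous relations of one-sided series below are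
    instances, with the partial sums [G] as certificate. *)
Lemma csum_partial (f G : nat -> C) l :
  summable f -> f 0%nat = G 0%nat -> (forall n, G n + f (S n) = G (S n)) ->
  clim G l -> csum f = l.
Proof.
intros Hf H0 HS HG.
apply clim_unique with (fun n => fsum f (seq 0 (n + 1))); [now apply (clim_shift (fun n => fsum f (seq 0 n))), csum_nat_clim|].
apply clim_ext with G; [|easy]. intros n; rewrite Nat.add_1_r.
induction n as [|n IH]; [simpl; rewrite H0; ring|].
rewrite fsum_seq_S, <- IH; symmetry; apply HS.
Qed.

Lemma csum_telescope (f g : Z -> C) lp lm :
  summable f -> (forall k, f k = g (k + 1)%Z - g k) ->
  clim (fun n => g (Z.of_nat n)) lp -> clim (fun n => g (- Z.of_nat n)%Z) lm ->
  csum f = lp - lm.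
Proof.
intros Hf Hg Hp Hm.
apply clim_unique with (fun n => fsum f (zrange n)); [now apply csum_Z_clim|].
apply clim_ext with (fun n => g (Z.of_nat n) - g (- Z.of_nat n)%Z); [|now apply clim_minus].
intros n; unfold zrange; rewrite fsum_map.
assert (A : forall m, fsum (fun i => f (Z.of_nat i - Z.of_nat n)%Z) (seq 0 m)
   = g (Z.of_nat m - Z.of_nat n)%Z - g (- Z.of_nat n)%Z).
{ induction m as [|m IH].
  - cbn [seq fsum fold_right]. replace (Z.of_nat 0 - Z.of_nat n)%Z with (- Z.of_nat n)%Z by lia. ring.
  - rewrite fsum_seq_S, IH, Hg.
    replace (Z.of_nat m - Z.of_nat n + 1)%Z with (Z.of_nat (S m) - Z.of_nat n)%Z by lia. ring. }
rewrite A. f_equal. f_equal. lia.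
Qed.

Lemma rbnd_nat (f : nat -> R) M :
  (forall n, 0 <= f n)%R -> (forall n, rsum f (seq 0 n) <= M)%R -> rbnd f M.
Proof.
intros H0 H l Hl.
apply Rle_trans with (2 := H (S (list_max l))).
apply rsum_incl; [easy|easy|]. intros x Hx. apply in_seq.
assert (A := proj1 (list_max_le l (list_max l)) (Nat.le_refl _)).
rewrite Forall_forall in A. specialize (A x Hx). lia.
Qed.

(** * Powers of n+1 *)

Definition pw (n : nat) (x : R) : R := Rpower (INR n + 1) x.

Lemma INR1_pos n : (0 < INR n + 1)%R.
Proof. generalize (pos_INR n); lra. Qed.

Lemma pw_pos n x : (0 < pw n x)%R.
Proof. apply exp_pos. Qed.

Lemma pw_ge0 n x : (0 <= pw n x)%R.
Proof. apply Rlt_le, pw_pos. Qed.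

Lemma pw_plus n x y : (pw n x * pw n y = pw n (x + y))%R.
Proof. unfold pw; now rewrite Rpower_plus. Qed.

Lemma pw_0 n : pw n 0 = 1%R.
Proof. unfold pw; apply Rpower_O, INR1_pos. Qed.

Lemma pw_1 n : pw n 1 = (INR n + 1)%R.
Proof. unfold pw; apply Rpower_1, INR1_pos. Qed.

Lemma pw_opp n x : (pw n x * pw n (- x) = 1)%R.
Proof. rewrite pw_plus, Rplus_opp_r; apply pw_0. Qed.

Lemma ln_ge0 n : (0 <= ln (INR n + 1))%R.
Proof.
destruct (pos_INR n) as [H|H].
- rewrite <- ln_1; apply Rlt_le, ln_increasing; lra.
- rewrite <- H, Rplus_0_l, ln_1; lra.
Qed.

Lemma exp_le x y : (x <= y)%R -> (exp x <= exp y)%R.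
Proof. intros [H| ->]; [apply Rlt_le; now apply exp_increasing|lra]. Qed.

Lemma pw_le n x y : (x <= y)%R -> (pw n x <= pw n y)%R.
Proof.
intros H; apply exp_le, Rmult_le_compat_r; [apply ln_ge0|easy].
Qed.

Lemma ln_le' x y : (0 < x)%R -> (x <= y)%R -> (ln x <= ln y)%R.
Proof. intros H [H'| ->]; [apply Rlt_le; now apply ln_increasing|lra]. Qed.

Lemma pw_anti n m x : (n <= m)%nat -> (x <= 0)%R -> (pw m x <= pw n x)%R.
Proof.
intros H Hx; unfold pw, Rpower; apply exp_le.
assert (ln (INR n + 1) <= ln (INR m + 1))%R; [|nra].
apply ln_le'; [apply INR1_pos|]. apply le_INR in H; lra.
Qed.

Lemma pw_lim x : (x < 0)%R -> is_lim_seq (fun n => pw n x) 0.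
Proof.
intros Hx.
apply is_lim_seq_spec; intros [eps He]; simpl.
destruct (nfloor_ex (exp (ln eps / x))) as [N HN]; [apply Rlt_le, exp_pos|].
exists (S N); intros n Hn. rewrite Rminus_0_r, Rabs_pos_eq by apply pw_ge0.
unfold pw, Rpower. rewrite <- (exp_ln eps) by easy. apply exp_increasing.
assert (A : (ln eps / x < ln (INR n + 1))%R).
{ rewrite <- (ln_exp (ln eps / x)). apply ln_increasing; [apply exp_pos|].
  apply le_INR in Hn. rewrite S_INR in Hn. lra. }
replace (ln eps) with (x * (ln eps / x))%R by (field; lra). nra.
Qed.

Lemma inv_le_ln n : (/ (INR n + 2) <= ln (INR n + 2) - ln (INR n + 1))%R.
Proof.
assert (H := INR1_pos n).
assert (A := exp_ineq1_le (ln (INR n + 1) - ln (INR n + 2))).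
unfold Rminus in A at 2. rewrite exp_plus, exp_Ropp, !exp_ln in A by lra.
replace (/ (INR n + 2))%R with (1 - (INR n + 1) * / (INR n + 2))%R by (field; lra). lra.
Qed.

Lemma ln_le_inv n : (ln (INR n + 2) - ln (INR n + 1) <= / (INR n + 1))%R.
Proof.
assert (H := INR1_pos n).
assert (A := exp_ineq1_le (ln (INR n + 2) - ln (INR n + 1))).
unfold Rminus in A at 2. rewrite exp_plus, exp_Ropp, !exp_ln in A by lra.
replace (/ (INR n + 1))%R with ((INR n + 2) * / (INR n + 1) - 1)%R by (field; lra). lra.
Qed.

(** A telescoping majorant of n^(-1-x). *)
Lemma pw_step n x : (0 < x)%R -> (pw (S n) (- 1 - x) <= (pw n (- x) - pw (S n) (- x)) / x)%R.
Proof.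
intros Hx. assert (H := INR1_pos n).
assert (E : pw n (- x) = (pw (S n) (- x) * exp (x * (ln (INR n + 2) - ln (INR n + 1))))%R).
{ unfold pw, Rpower. rewrite <- exp_plus. f_equal. rewrite S_INR.
  replace (INR n + 1 + 1)%R with (INR n + 2)%R by ring. ring. }
assert (F : pw (S n) (- 1 - x) = (pw (S n) (- x) * / (INR n + 2))%R).
{ replace (-1 - x)%R with (- x + - (1))%R by ring. rewrite <- pw_plus. f_equal.
  unfold pw; rewrite Rpower_Ropp, Rpower_1 by apply INR1_pos. rewrite S_INR. f_equal; ring. }
rewrite E, F.
apply Rmult_le_reg_r with x; [easy|].
match goal with |- (_ <= ?t / x * x)%R => replace (t / x * x)%R with t by (field; lra) end.
assert (A := exp_ineq1_le (x * (ln (INR n + 2) - ln (INR n + 1)))).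
assert (B := inv_le_ln n). assert (P := pw_pos (S n) (- x)).
apply Rle_trans with (pw (S n) (- x) * (exp (x * (ln (INR n + 2) - ln (INR n + 1))) - 1))%R; [|lra].
rewrite Rmult_assoc. apply Rmult_le_compat_l; [lra|]. nra.
Qed.

Lemma rsummable_pw x : (x < -1)%R -> rsummable (fun n => pw n x).
Proof.
intros Hx. set (d := (- 1 - x)%R). assert (Hd : (0 < d)%R) by (unfold d; lra).
exists (1 + / d)%R. apply rbnd_nat; [intros; apply pw_ge0|].
assert (A : forall n, (rsum (fun n => pw n x) (seq 0 (S n)) <= 1 + / d - / d * pw n (- d))%R).
{ induction n as [|n IH].
  - simpl. unfold pw; simpl. unfold Rpower; rewrite Rplus_0_l, ln_1, !Rmult_0_r, exp_0; lra.
  - rewrite rsum_seq_S. generalize (pw_step n d Hd). replace (-1 - d)%R with x by (unfold d; ring).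
    unfold Rdiv; lra. }
intros [|n]; [|apply Rle_trans with (1 := A n)].
- simpl. generalize (Rinv_0_lt_compat d Hd); lra.
- generalize (Rinv_0_lt_compat d Hd) (pw_pos n (- d)); nra.
Qed.

Definition pz (k : Z) (x : R) : R := pw (Z.abs_nat k) x.

Lemma rsummable_Z (f : Z -> R) :
  rsummable (fun n => f (Z.of_nat n)) -> rsummable (fun n => f (- Z.of_nat n - 1)%Z) ->
  rsummable f.
Proof.
intros [M HM] [N HN].
apply rsummable_le with (fun k => (if (0 <=? k)%Z then f k else 0) + (if (k <? 0)%Z then f k else 0))%R.
{ intros k; destruct (Z.leb_spec 0 k), (Z.ltb_spec k 0); try lia; lra. }
apply rsummable_plus.
- exists M. apply (rbnd_reindex Z.of_nat (fun k => if (0 <=? k)%Z then Some (Z.to_nat k) else None)).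
  + intros i. destruct (Z.leb_spec 0 (Z.of_nat i)); [f_equal|]; lia.
  + intros j i. destruct (Z.leb_spec 0 j); [|easy]. intros E; injection E; lia.
  + intros j. now destruct (Z.leb_spec 0 j).
  + intros l Hl. eapply Rle_trans; [|exact (HM l Hl)]. apply rsum_le; intros i _.
    destruct (Z.leb_spec 0 (Z.of_nat i)); [lra|lia].
- exists N. apply (rbnd_reindex (fun n => (- Z.of_nat n - 1)%Z) (fun k => if (k <? 0)%Z then Some (Z.to_nat (- k - 1)) else None)).
  + intros i. destruct (Z.ltb_spec (- Z.of_nat i - 1) 0); [f_equal|]; lia.
  + intros j i. destruct (Z.ltb_spec j 0); [|easy]. intros E; injection E; lia.
  + intros j. now destruct (Z.ltb_spec j 0).
  + intros l Hl. eapply Rle_trans; [|exact (HN l Hl)]. apply rsum_le; intros i _.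
    destruct (Z.ltb_spec (- Z.of_nat i - 1) 0); [lra|lia].
Qed.

Lemma rsummable_pz x : (x < -1)%R -> rsummable (fun k => pz k x).
Proof.
intros Hx; apply rsummable_Z.
- eapply rsummable_le; [|exact (rsummable_pw x Hx)]. intros n; unfold pz.
  rewrite Zabs2Nat.id; lra.
- eapply rsummable_le; [|exact (rsummable_pw x Hx)]. intros n; unfold pz.
  replace (Z.abs_nat (- Z.of_nat n - 1)) with (S n) by lia.
  apply pw_anti; [lia|lra].
Qed.

(** * The complex exponential *)

Lemma Cexp_plus x y : Cexp (x + y) = Cexp x * Cexp y.
Proof.
destruct x as [a b], y as [c d]; unfold Cexp, Cmult; simpl.
rewrite exp_plus, cos_plus, sin_plus; f_equal; ring.
Qed.

Lemma Cexp_0 : Cexp 0 = 1.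
Proof. unfold Cexp; simpl. rewrite exp_0, cos_0, sin_0, Rmult_1_l, Rmult_0_r. easy. Qed.

Lemma Cmod_Cexp z : Cmod (Cexp z) = exp (Re z).
Proof.
assert (A : forall e s c, (s * s + c * c = 1 -> (e * c) ^ 2 + (e * s) ^ 2 = e ^ 2)%R).
{ intros e s c H. replace ((e * c) ^ 2 + (e * s) ^ 2)%R with (e ^ 2 * (s * s + c * c))%R by ring.
  rewrite H; ring. }
destruct z as [x y]; unfold Cexp, Cmod; cbn [fst snd Re Im].
rewrite (A _ _ _ (sin2_cos2 y)). apply sqrt_pow2, Rlt_le, exp_pos.
Qed.

Lemma Cexp_neq_0 z : Cexp z <> 0.
Proof. intros H. generalize (exp_pos (Re z)). rewrite <- Cmod_Cexp, H, Cmod_0; lra. Qed.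

Lemma abs_sin_le y : (Rabs (sin y) <= Rabs y)%R.
Proof.
destruct (MVT_abs sin cos 0 y) as [c [E _]].
{ intros; apply derivable_pt_lim_sin. }
rewrite sin_0, !Rminus_0_r in E. rewrite E.
assert (A : (Rabs (cos c) <= 1)%R) by (apply Rabs_le, COS_bound).
generalize (Rabs_pos y); nra.
Qed.

Lemma abs_cos_le y : (Rabs (cos y - 1) <= Rabs y * Rabs y)%R.
Proof.
destruct (MVT_abs cos (fun x => - sin x)%R 0 y) as [c [E [H1 H2]]].
{ intros; apply derivable_pt_lim_cos. }
rewrite cos_0, Rminus_0_r in E. rewrite E, Rabs_Ropp.
apply Rmult_le_compat_r; [apply Rabs_pos|].
eapply Rle_trans; [apply abs_sin_le|].
unfold Rmin, Rmax in *; destruct (Rle_dec 0 y); unfold Rabs; destruct (Rcase_abs c), (Rcase_abs y); lra.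
Qed.

Lemma abs_sin_le2 y : (Rabs (sin y - y) <= Rabs y * (Rabs y * Rabs y))%R.
Proof.
destruct (MVT_abs (fun x => sin x - x)%R (fun x => cos x - 1)%R 0 y) as [c [E [H1 H2]]].
{ intros; apply derivable_pt_lim_minus; [apply derivable_pt_lim_sin|apply derivable_pt_lim_id]. }
rewrite sin_0, !Rminus_0_r in E. rewrite E, Rmult_comm.
apply Rmult_le_compat_l; [apply Rabs_pos|].
eapply Rle_trans; [apply abs_cos_le|].
assert (Rabs c <= Rabs y)%R.
{ unfold Rmin, Rmax in *; destruct (Rle_dec 0 y); unfold Rabs; destruct (Rcase_abs c), (Rcase_abs y); lra. }
generalize (Rabs_pos c); nra.
Qed.

Lemma abs_exp_le x : (Rabs x <= 1)%R -> (Rabs (exp x - 1) <= 3 * Rabs x)%R.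
Proof.
intros Hx. destruct (MVT_abs exp exp 0 x) as [c [E [H1 H2]]].
{ intros; apply derivable_pt_lim_exp. }
rewrite exp_0, Rminus_0_r in E. rewrite E.
apply Rmult_le_compat_r; [apply Rabs_pos|].
rewrite Rabs_pos_eq by apply Rlt_le, exp_pos.
apply Rle_trans with (exp 1); [|apply exp_le_3]. apply exp_le.
apply Rabs_le_between in Hx.
unfold Rmin, Rmax in *; destruct (Rle_dec 0 x); lra.
Qed.

Lemma abs_exp_le2 x : (Rabs x <= 1)%R -> (Rabs (exp x - 1 - x) <= 3 * (Rabs x * Rabs x))%R.
Proof.
intros Hx. destruct (MVT_abs (fun x => exp x - 1 - x)%R (fun x => exp x - 1)%R 0 x) as [c [E [H1 H2]]].
{ intros t _. replace (exp t - 1)%R with (exp t - 0 - 1)%R by ring.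
  apply derivable_pt_lim_minus; [|apply derivable_pt_lim_id].
  apply (derivable_pt_lim_minus exp (fun _ => 1%R)); [apply derivable_pt_lim_exp|apply derivable_pt_lim_const]. }
rewrite exp_0 in E. replace (exp x - 1 - x - (1 - 1 - 0))%R with (exp x - 1 - x)%R in E by ring.
rewrite Rminus_0_r in E. rewrite E.
assert (A : (Rabs c <= Rabs x)%R).
{ unfold Rmin, Rmax in *; destruct (Rle_dec 0 x); unfold Rabs; destruct (Rcase_abs c), (Rcase_abs x); lra. }
assert (B := abs_exp_le c ltac:(lra)). generalize (Rabs_pos x) (Rabs_pos c); nra.
Qed.

(** The second order matters: it makes the factors of Gauss' product 1 + O(n^(-2)). *)
Lemma Cexp_estimate z : (Cmod z <= 1)%R -> (Cmod (Cexp z - 1 - z) <= 12 * (Cmod z * Cmod z))%R.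
Proof.
intros Hz.
assert (Hx := Rabs_Re_le z). assert (Hy := Rabs_Im_le z).
destruct z as [x y]; set (r := Cmod (x, y)) in *; simpl in Hx, Hy.
assert (Hr : (0 <= r)%R) by apply Cmod_ge_0.
eapply Rle_trans; [apply Cmod_le_Re_Im|]. unfold Cexp; simpl.
assert (E1 := abs_exp_le x ltac:(lra)). assert (E2 := abs_exp_le2 x ltac:(lra)).
assert (C1 := abs_cos_le y). assert (S1 := abs_sin_le2 y).
assert (E3 : (0 < exp x <= 3)%R).
{ split; [apply exp_pos|]. apply Rle_trans with (exp 1); [|apply exp_le_3].
  apply exp_le. apply Rabs_le_between in Hx; lra. }
assert (Px := Rabs_pos x). assert (Py := Rabs_pos y).
assert (A : (Rabs (exp x * cos y + - (1) + - x) <= 6 * (r * r))%R).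
{ replace (exp x * cos y + - (1) + - x)%R with ((exp x - 1 - x) + exp x * (cos y - 1))%R by ring.
  eapply Rle_trans; [apply Rabs_triang|]. rewrite Rabs_mult, (Rabs_pos_eq (exp x)) by lra.
  assert (Rabs x * Rabs x <= r * r)%R by nra. assert (Rabs y * Rabs y <= r * r)%R by nra.
  assert (exp x * Rabs (cos y - 1) <= 3 * (r * r))%R; [|lra].
  apply Rmult_le_compat; try lra. apply Rabs_pos. }
assert (B : (Rabs (exp x * sin y + - 0 + - y) <= 6 * (r * r))%R).
{ replace (exp x * sin y + - 0 + - y)%R with ((exp x - 1) * y + exp x * (sin y - y))%R by ring.
  eapply Rle_trans; [apply Rabs_triang|]. rewrite !Rabs_mult, (Rabs_pos_eq (exp x)) by lra.
  assert (Rabs y * (Rabs y * Rabs y) <= r * r)%R.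
  { assert (Rabs y * Rabs y <= r * r)%R by nra. nra. }
  assert (exp x * Rabs (sin y - y) <= 3 * (r * r))%R.
  { apply Rmult_le_compat; try lra. apply Rabs_pos. }
  assert (Rabs (exp x - 1) * Rabs y <= 3 * r * r)%R.
  { apply Rmult_le_compat; try lra. apply Rabs_pos. }
  lra. }
lra.
Qed.

Lemma Cexp_lim_0 (u : nat -> C) : clim u 0 -> clim (fun n => Cexp (u n)) 1.
Proof.
intros Hu; rewrite clim_eps in *; intros eps He.
destruct (Hu (Rmin 1 (eps / 14))%R) as [N HN]; [apply Rmin_glb_lt; lra|].
exists N; intros n Hn; specialize (HN n Hn).
assert (H1 := Rlt_le_trans _ _ _ HN (Rmin_l _ _)).
assert (H2 := Rlt_le_trans _ _ _ HN (Rmin_r _ _)).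
replace (u n - 0) with (u n) in * by ring.
assert (A := Cexp_estimate (u n) ltac:(lra)).
replace (Cexp (u n) - 1) with ((Cexp (u n) - 1 - u n) + u n) by ring.
eapply Rle_lt_trans; [apply Cmod_triangle|]. generalize (Cmod_ge_0 (u n)); nra.
Qed.

Definition cpw (n : nat) (z : C) : C := Cexp (z * RtoC (ln (INR n + 1))).

Lemma cpw_plus n x y : cpw n (x + y) = cpw n x * cpw n y.
Proof. unfold cpw; rewrite <- Cexp_plus; f_equal; ring. Qed.

Lemma cpw_neq_0 n z : cpw n z <> 0.
Proof. apply Cexp_neq_0. Qed.

Lemma cpw_0 n : cpw n 0 = 1.
Proof. unfold cpw; rewrite Cmult_0_l; apply Cexp_0. Qed.

Lemma Cmod_cpw n z : Cmod (cpw n z) = pw n (Re z).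
Proof. unfold cpw; rewrite Cmod_Cexp. unfold pw, Rpower; f_equal. destruct z; simpl; ring. Qed.

Lemma cpw_1 n : cpw n 1 = RtoC (INR n + 1).
Proof.
unfold cpw, Cexp. rewrite Cmult_1_l; simpl.
rewrite cos_0, sin_0, exp_ln by apply INR1_pos. unfold RtoC; f_equal; ring.
Qed.

Lemma Cmod_split x y : (Cmod x <= Cmod y + Cmod (x - y))%R.
Proof. replace x with (y + (x - y)) at 1 by ring. apply Cmod_triangle. Qed.

Lemma Cmod_minus_sym x y : Cmod (x - y) = Cmod (y - x).
Proof. rewrite <- Cmod_opp. f_equal; ring. Qed.

(** * Shifted factorials *)

Lemma Cprod_app l l' : Cprod (l ++ l') = Cprod l * Cprod l'.
Proof. unfold Cprod; induction l; simpl; [ring|]. rewrite IHl; ring. Qed.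

Lemma RtoC_S n : RtoC (INR (S n)) = RtoC (INR n) + 1.
Proof. now rewrite S_INR, RtoC_plus. Qed.

Lemma rising_0 x : rising x 0 = 1.
Proof. easy. Qed.

Lemma rising_S x n : rising x (S n) = rising x n * (x + INR n).
Proof. unfold rising; rewrite seq_S, map_app, Cprod_app; simpl. ring. Qed.

Lemma rising_S_l x n : rising x (S n) = x * rising (x + 1) n.
Proof.
induction n as [|n IH]; [rewrite rising_S, !rising_0; simpl; ring|].
rewrite rising_S, IH, (rising_S (x + 1)), RtoC_S. ring.
Qed.

Lemma rising_plus x n m : rising x (n + m) = rising x n * rising (x + INR n) m.
Proof.
induction m as [|m IH]; [rewrite Nat.add_0_r, rising_0; ring|].
rewrite Nat.add_succ_r, !rising_S, IH, plus_INR, RtoC_plus. ring.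
Qed.

Lemma falling_0 x : falling x 0 = 1.
Proof. easy. Qed.

Lemma falling_S x n : falling x (S n) = falling x n * (x - INR (S n)).
Proof.
unfold falling. rewrite (seq_S n 1), map_app, Cprod_app. cbn [map Cprod fold_right].
replace (1 + n)%nat with (S n) by lia. ring.
Qed.

Lemma Cmod_falling x n : Cmod (falling x n) = Cmod (rising (1 - x) n).
Proof.
induction n as [|n IH]; [easy|].
rewrite falling_S, rising_S, !Cmod_mult, IH, RtoC_S. f_equal.
rewrite <- Cmod_opp. f_equal. ring.
Qed.

(** * Convergence of Gauss' product *)

Lemma infinite_product_bounded (b q : nat -> C) K :
  (forall n, b (S n) = b n * q n) -> (0 <= K)%R ->
  (forall n, Cmod (q n - 1) <= K * pw n (-2))%R ->
  exists l, clim b l.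
Proof.
intros Hb HK Hq.
destruct (rsummable_pw (-2) ltac:(lra)) as [M HM].
assert (HM' : forall n, (rsum (fun n => pw n (-2)) (seq 0 n) <= M)%R)
  by (intros n; apply HM, seq_NoDup).
assert (Hbd : forall n, (Cmod (b n) <= Cmod (b 0%nat) * exp (K * M))%R).
{ intros n.
  apply Rle_trans with (Cmod (b 0%nat) * exp (K * rsum (fun n => pw n (-2)) (seq 0 n)))%R.
  - induction n as [|n IH].
    + simpl. rewrite Rmult_0_r, exp_0; lra.
    + rewrite rsum_seq_S, Hb, Cmod_mult, Rmult_plus_distr_l, exp_plus, <- Rmult_assoc.
      apply Rmult_le_compat; [apply Cmod_ge_0|apply Cmod_ge_0|easy|].
      apply Rle_trans with (1 + K * pw n (-2))%R; [|apply exp_ineq1_le].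
      replace (q n) with (1 + (q n - 1)) by ring.
      eapply Rle_trans; [apply Cmod_triangle|]. rewrite Cmod_1. generalize (Hq n); lra.
  - apply Rmult_le_compat_l; [apply Cmod_ge_0|]. apply exp_le.
    apply Rmult_le_compat_l; auto. }
set (d := fun n => b (S n) - b n).
assert (Hd : summable d).
{ apply summable_le with (fun n => (Cmod (b 0%nat) * exp (K * M) * K) * pw n (-2))%R.
  - intros n; unfold d. rewrite Hb. replace (b n * q n - b n) with (b n * (q n - 1)) by ring.
    rewrite Cmod_mult, Rmult_assoc. apply Rmult_le_compat; auto using Cmod_ge_0.
  - apply rsummable_scal; [|apply rsummable_pw; lra].
    apply Rmult_le_pos; [|easy]. apply Rmult_le_pos; [apply Cmod_ge_0|apply Rlt_le, exp_pos]. }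
exists (b 0%nat + csum d).
apply clim_ext with (fun n => b 0%nat + fsum d (seq 0 n)).
- intros n; induction n as [|n IH]; [simpl; ring|].
  rewrite fsum_seq_S, Cplus_assoc, IH. unfold d; ring.
- apply clim_plus; [apply clim_const|now apply csum_nat_clim].
Qed.

Lemma pw_anti_add N n x : (x <= 0)%R -> (pw (n + N) x <= pw n x)%R.
Proof. intros; apply pw_anti; [lia|easy]. Qed.

(** The reciprocals of the terms form a convergent product as well, which is why
    the limit can vanish only together with some term. *)
Lemma infinite_product (a r : nat -> C) K N :
  (forall n, a (S n) = a n * r n) ->
  (forall n, (N <= n)%nat -> Cmod (r n - 1) <= K * pw n (-2))%R ->
  exists l, clim a l /\ ((forall n, a n <> 0) -> l <> 0).
Proof.
intros Ha Hr.
assert (HK : (0 <= K)%R).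
{ generalize (Hr N (le_n _)) (Cmod_ge_0 (r N - 1)) (pw_pos N (-2)); nra. }
destruct (infinite_product_bounded (fun n => a (n + N)%nat) (fun n => r (n + N)%nat) K) as [l Hl].
{ intros n; apply Ha. }
{ easy. }
{ intros n; apply Rle_trans with (1 := Hr (n + N)%nat ltac:(lia)).
  apply Rmult_le_compat_l; [easy|]. apply pw_anti_add; lra. }
exists l; split; [now apply clim_unshift with N|].
intros Hne.
assert (Hsmall : exists N', (N <= N')%nat /\ forall n, (N' <= n)%nat -> (K * pw n (-2) <= 1 / 2)%R).
{ assert (L := lim0_scal K _ (pw_lim (-2) ltac:(lra))).
  apply is_lim_seq_spec in L. destruct (L (mkposreal (1/2) ltac:(lra))) as [N' H'].
  exists (N + N')%nat; split; [lia|]. intros n Hn. specialize (H' n ltac:(lia)). simpl in H'.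
  rewrite Rminus_0_r in H'. generalize (Rle_abs (K * pw n (-2))); lra. }
destruct Hsmall as [N' [HN' Hs]].
destruct (infinite_product_bounded (fun n => / a (n + N')%nat) (fun n => / r (n + N')%nat) (2 * K)) as [l' Hl'].
{ intros n; simpl. rewrite Ha.
  assert (r (n + N')%nat <> 0).
  { intros E. apply (Hne (S (n + N'))%nat). rewrite Ha, E; ring. }
  field; split; [easy|apply Hne]. }
{ lra. }
{ intros n. set (m := (n + N')%nat).
  assert (A := Hr m ltac:(unfold m; lia)). assert (B := Hs m ltac:(unfold m; lia)).
  assert (C1 : (1 / 2 <= Cmod (r m))%R).
  { assert (D := Cmod_split 1 (r m)). rewrite Cmod_1, Cmod_minus_sym in D. lra. }
  assert (Hrm : r m <> 0) by (intros E; rewrite E, Cmod_0 in C1; lra).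
  replace (/ r m - 1) with (- (r m - 1) / r m) by (field; easy).
  rewrite Cmod_div, Cmod_opp by easy.
  apply Rle_trans with (2 * Cmod (r m - 1))%R.
  - apply Rmult_le_reg_r with (Cmod (r m)); [lra|].
    replace (Cmod (r m - 1) / Cmod (r m) * Cmod (r m))%R with (Cmod (r m - 1)) by (field; lra).
    generalize (Cmod_ge_0 (r m - 1)); nra.
  - rewrite Rmult_assoc. apply Rmult_le_compat_l; [lra|]. apply Rle_trans with (1 := A).
    apply Rmult_le_compat_l; [easy|]. apply pw_anti_add; lra. }
intros E; subst l.
assert (U := clim_unshift _ _ _ Hl).
assert (V := clim_shift _ _ N' U).
assert (W := clim_mult _ _ _ _ V Hl'). simpl in W.
assert (X : RtoC 1 = 0 * l').
{ apply clim_unique with (fun _ : nat => RtoC 1); [apply clim_const|].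
  apply clim_ext with (2 := W). intros n; simpl. field; apply Hne. }
rewrite Cmult_0_l in X. apply (f_equal Re) in X. simpl in X; lra.
Qed.

(** Gauss' product with (n+1)^z in place of n^z: the limit is the same, and n = 0
    is no exception. *)
Definition gseq (z : C) (n : nat) : C := rising z (S n) / (INR (fact n) * cpw n z).

Definition grat (z : C) (n : nat) : C :=
  (1 + z / (INR n + 1)%R) * Cexp (- (z * RtoC (ln (INR n + 2) - ln (INR n + 1)))).

Lemma INR_fact_C n : RtoC (INR (fact n)) <> 0.
Proof. intros H; apply RtoC_inj in H. now apply INR_fact_neq_0 in H. Qed.

Lemma INR1_C n : RtoC (INR n + 1) <> 0.
Proof. intros H; apply RtoC_inj in H. generalize (INR1_pos n); lra. Qed.

Lemma gseq_S z n : gseq z (S n) = gseq z n * grat z n.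
Proof.
unfold gseq, grat.
assert (E : cpw (S n) z * Cexp (- (z * RtoC (ln (INR n + 2) - ln (INR n + 1)))) = cpw n z).
{ unfold cpw. rewrite <- Cexp_plus. f_equal. rewrite S_INR.
  replace (INR n + 1 + 1)%R with (INR n + 2)%R by ring.
  unfold Rminus; rewrite RtoC_plus, RtoC_opp; ring. }
rewrite <- E, (rising_S z (S n)), fact_simpl, mult_INR, S_INR, RtoC_mult.
field. repeat split; auto using INR_fact_C, INR1_C, cpw_neq_0, Cexp_neq_0.
Qed.

(** 1 + z/(n+1) and exp(z (ln(n+2) - ln(n+1))) agree to first order. *)
Lemma grat_estimate z : exists K N, forall n, (N <= n)%nat ->
  (Cmod (grat z n - 1) <= K * pw n (-2))%R.
Proof.
destruct (nfloor_ex (Cmod z)) as [N HN]; [apply Cmod_ge_0|].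
set (r := Cmod z) in *.
exists (24 * (r * r) + r + r * r)%R, N; intros n Hn.
assert (Hm := INR1_pos n). set (m := (INR n + 1)%R) in *.
assert (Hrm : (r <= m)%R) by (apply le_INR in Hn; unfold m; lra).
assert (Hr : (0 <= r)%R) by apply Cmod_ge_0.
assert (E2 : pw n (-2) = (/ m * / m)%R).
{ replace (-2)%R with (- (1) + - (1))%R by ring. rewrite <- pw_plus.
  unfold pw; rewrite Rpower_Ropp, Rpower_1; [easy|apply INR1_pos]. }
rewrite E2.
assert (D1 := inv_le_ln n). assert (D2 := ln_le_inv n).
set (d := (ln (INR n + 2) - ln (INR n + 1))%R) in *. fold m in D2.
assert (Hi : (0 < / m)%R) by now apply Rinv_0_lt_compat.
assert (Hi2 : (0 < / (INR n + 2))%R) by (apply Rinv_0_lt_compat; unfold m in Hm; lra).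
assert (Hdm : (/ m - d <= / m * / m)%R).
{ assert (Hd1 : (/ (INR n + 2) <= d)%R) by exact D1.
  apply Rle_trans with (/ m - / (INR n + 2))%R; [lra|].
  replace (INR n + 2)%R with (m + 1)%R by (unfold m; ring).
  apply Rmult_le_reg_r with (m * (m + 1))%R; [nra|].
  replace ((/ m - / (m + 1)) * (m * (m + 1)))%R with 1%R by (field; lra).
  replace (/ m * / m * (m * (m + 1)))%R with (1 + / m)%R by (field; lra). lra. }
set (w := - (z * RtoC d)).
assert (Hw : Cmod w = (r * d)%R).
{ unfold w; rewrite Cmod_opp, Cmod_mult, Cmod_R, Rabs_pos_eq; [easy|lra]. }
assert (Hrd : (r * d <= r * / m)%R) by (apply Rmult_le_compat_l; lra).
assert (Hrm1 : (r * / m <= 1)%R).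
{ apply Rmult_le_reg_r with m; [easy|]. rewrite Rmult_assoc, Rinv_l by lra. lra. }
assert (He := Cexp_estimate w ltac:(lra)). rewrite Hw in He.
unfold grat. fold d. fold w. fold m.
replace ((1 + z / m) * Cexp w - 1)
  with ((1 + z / m) * (Cexp w - 1 - w) + (z * RtoC (/ m - d) + z / m * w)).
2:{ unfold w, Rminus. rewrite RtoC_plus, RtoC_opp, RtoC_inv by lra. field.
    intros H; apply RtoC_inj in H; lra. }
assert (Hzm : Cmod (z / m) = (r * / m)%R).
{ rewrite Cmod_div, Cmod_R, Rabs_pos_eq; [easy|lra|]. intros H; apply RtoC_inj in H; lra. }
eapply Rle_trans; [apply Cmod_triangle|]. rewrite Cmod_mult.
assert (A1 : (Cmod (1 + z / m) <= 2)%R).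
{ eapply Rle_trans; [apply Cmod_triangle|]. rewrite Cmod_1, Hzm; lra. }
assert (A2 : (Cmod (z * RtoC (/ m - d) + z / m * w) <= r * (/ m * / m) + r * r * (/ m * / m))%R).
{ eapply Rle_trans; [apply Cmod_triangle|]. rewrite !Cmod_mult, Hw, Hzm, Cmod_R, Rabs_pos_eq by lra.
  fold r. apply Rplus_le_compat; [now apply Rmult_le_compat_l|].
  replace (r * r * (/ m * / m))%R with (r * / m * (r * / m))%R by ring.
  apply Rmult_le_compat_l; [|easy]. apply Rmult_le_pos; lra. }
assert (A3 : (Cmod (1 + z / m) * Cmod (Cexp w - 1 - w) <= 2 * (12 * (r * / m * (r * / m))))%R).
{ apply Rmult_le_compat; auto using Cmod_ge_0.
  apply Rle_trans with (1 := He). apply Rmult_le_compat_l; [lra|].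
  assert (0 <= r * d)%R by (apply Rmult_le_pos; lra). apply Rmult_le_compat; lra. }
replace ((24 * (r * r) + r + r * r) * (/ m * / m))%R with
  (2 * (12 * (r * / m * (r * / m))) + (r * (/ m * / m) + r * r * (/ m * / m)))%R by ring.
lra.
Qed.

Lemma clim_RtoC (u : nat -> R) : is_lim_seq u 0 -> clim (fun n => RtoC (u n)) 0.
Proof.
intros H. unfold clim. apply is_lim_seq_ext with (fun n => Rabs (u n)).
- intros n; now rewrite <- Cmod_R, Cminus_0_r || (replace (RtoC (u n) - 0) with (RtoC (u n)) by ring; now rewrite Cmod_R).
- replace (Finite 0) with (Rbar_abs 0) by (simpl; now rewrite Rabs_R0). now apply is_lim_seq_abs.
Qed.

Lemma clim_dln : clim (fun n => RtoC (ln (INR n + 2) - ln (INR n + 1))) 0.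
Proof.
apply clim_RtoC. apply is_lim_seq_le_le with (fun _ => 0%R) (fun n => pw n (- (1))).
- intros n; assert (A := inv_le_ln n). assert (B := ln_le_inv n). assert (H := INR1_pos n).
  assert (0 < / (INR n + 2))%R by (apply Rinv_0_lt_compat; lra).
  unfold pw; rewrite Rpower_Ropp, Rpower_1 by easy. lra.
- apply is_lim_seq_const.
- apply pw_lim; lra.
Qed.

Lemma gseq_lim z : clim (gseq z) (rGamma z) /\ ((forall n : nat, z + INR n <> 0) -> rGamma z <> 0).
Proof.
destruct (grat_estimate z) as [K [N H]].
destruct (infinite_product (gseq z) (grat z) K N (gseq_S z) H) as [l [Hl Hn]].
assert (E : rGamma z = l).
{ apply clim_CLim. apply (clim_unshift _ _ 1).
  apply clim_ext with (fun n => gseq z (n + 1) * Cexp (z * RtoC (ln (INR n + 2) - ln (INR n + 1)))).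
  - intros n. unfold gseq, cpw. rewrite Nat.add_1_r, !S_INR.
    replace (INR n + 1 + 1)%R with (INR n + 2)%R by ring.
    unfold Rminus; rewrite RtoC_plus, RtoC_opp, Cmult_plus_distr_l, Cexp_plus.
    assert (X : Cexp (z * RtoC (ln (INR n + 1))) * Cexp (z * - RtoC (ln (INR n + 1))) = 1).
    { rewrite <- Cexp_plus. replace (z * RtoC (ln (INR n + 1)) + z * - RtoC (ln (INR n + 1))) with (RtoC 0) by ring. apply Cexp_0. }
    assert (Y : Cexp (z * - RtoC (ln (INR n + 1))) = / Cexp (z * RtoC (ln (INR n + 1)))).
    { rewrite <- (Cmult_1_l (/ _)), <- X. field. apply Cexp_neq_0. }
    rewrite Y. field. repeat split; auto using INR_fact_C, Cexp_neq_0.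
  - apply clim_val with (l * 1); [ring|]. apply clim_mult; [now apply (clim_shift (gseq z))|].
    apply Cexp_lim_0. apply clim_val with (z * 0); [ring|]. apply clim_scal, clim_dln. }
rewrite E; split; [easy|].
intros Hz; apply Hn; intros n. unfold gseq.
assert (R : forall k, rising z k <> 0).
{ induction k; [rewrite rising_0; exact C1_nz|]. rewrite rising_S; now apply Cmult_neq_0. }
intros X. apply (R (S n)).
replace (rising z (S n)) with (rising z (S n) / (INR (fact n) * cpw n z) * (INR (fact n) * cpw n z)).
- rewrite X; ring.
- field; split; [apply cpw_neq_0|apply INR_fact_C].
Qed.

Notation rG := rGamma.

Lemma clim_inv_INR1 : clim (fun n => RtoC (/ (INR n + 1))) 0.
Proof.
apply clim_RtoC. apply is_lim_seq_ext with (fun n => pw n (- (1))); [|apply pw_lim; lra].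
intros n; unfold pw; now rewrite Rpower_Ropp, Rpower_1 by apply INR1_pos.
Qed.

Lemma clim_ratio z : clim (fun n => (z + INR n) / (INR n + 1)%R) 1.
Proof.
apply clim_ext with (fun n => 1 + (z - 1) * RtoC (/ (INR n + 1))).
- intros n. rewrite RtoC_inv by (generalize (INR1_pos n); lra).
  assert (H := INR1_C n). rewrite RtoC_plus in *. field. easy.
- apply clim_val with (1 + (z - 1) * 0); [ring|].
  apply clim_plus; [apply clim_const|]. apply clim_scal, clim_inv_INR1.
Qed.

(** Gauss' products for z and z + 1 have a simple quotient, with limit z. *)
Lemma rGamma_rec z : rG z = z * rG (z + 1).
Proof.
apply clim_unique with (fun n => gseq z n * ((z + 1 + INR n) / (INR n + 1)%R)).
- apply clim_val with (rG z * 1); [ring|]. apply clim_mult; [apply gseq_lim|apply clim_ratio].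
- apply clim_ext with (fun n => z * gseq (z + 1) n); [|apply clim_scal, gseq_lim].
  intros n. unfold gseq. rewrite cpw_plus, cpw_1, <- (Cmult_1_r (z * _)).
  replace (z * (rising (z + 1) (S n) / (INR (fact n) * (cpw n z * (INR n + 1)%R)))) with
    (z * rising (z + 1) (S n) / (INR (fact n) * (cpw n z * (INR n + 1)%R))).
  + rewrite <- rising_S_l, (rising_S z (S n)), RtoC_S. field. repeat split; auto using INR_fact_C, INR1_C, cpw_neq_0.
  + field. repeat split; auto using INR_fact_C, INR1_C, cpw_neq_0.
Qed.

Lemma rGamma_1 : rG 1 = 1.
Proof.
apply clim_unique with (gseq 1); [apply gseq_lim|].
apply clim_ext with (fun _ => RtoC 1); [|apply clim_const].
intros n. unfold gseq. rewrite cpw_1.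
assert (E : forall k, rising 1 k = INR (fact k)).
{ induction k as [|k IH]; [simpl; easy|]. rewrite rising_S, IH, fact_simpl, mult_INR, S_INR, RtoC_mult, RtoC_plus. ring. }
rewrite E, fact_simpl, mult_INR, S_INR, RtoC_mult. field. split; auto using INR_fact_C, INR1_C.
Qed.

Lemma rGamma_0 : rG 0 = 0.
Proof. rewrite rGamma_rec; ring. Qed.

Lemma rGamma_neg n : rG (- INR n) = 0.
Proof.
induction n as [|n IH]; [simpl; replace (- 0) with (RtoC 0) by ring; apply rGamma_0|].
rewrite rGamma_rec, RtoC_S. replace (- (INR n + 1) + 1) with (- INR n) by ring.
rewrite IH; ring.
Qed.

Lemma rGamma_neq_0 z : ~ Gamma_pole z -> rG z <> 0.
Proof.
intros H; apply gseq_lim. intros n E; apply H; exists n.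
apply Cminus_eq. rewrite <- E; ring.
Qed.

Lemma rGamma_Re_pos z : (0 < Re z)%R -> rG z <> 0.
Proof.
intros H; apply rGamma_neq_0; intros [n E]. rewrite E in H; simpl in H.
generalize (pos_INR n); lra.
Qed.

Lemma rGamma_rising z n : rG z = rising z n * rG (z + INR n).
Proof.
induction n as [|n IH]; [rewrite rising_0; simpl; replace (z + 0) with z by ring; ring|].
rewrite rising_S, RtoC_S, Cplus_assoc, IH, (rGamma_rec (z + INR n)). ring.
Qed.

Lemma rGamma_falling z n : rG (z - INR n) = falling z n * rG z.
Proof.
induction n as [|n IH].
- rewrite falling_0; simpl; replace (z - 0) with z by ring; ring.
- rewrite falling_S, rGamma_rec, RtoC_S. replace (z - (INR n + 1) + 1) with (z - INR n) by ring.
  rewrite IH; ring.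
Qed.

(** 1/Gamma(z+n) divided by its order of magnitude (n+1)^(1-z)/n!. *)
Definition nrm (z : C) (n : nat) : C := rG (z + INR n) * INR (fact n) * cpw n (z - 1).

Lemma nrm_pred z n : nrm z n = nrm (z + 1) n * ((z + INR n) / (INR n + 1)%R).
Proof.
unfold nrm. rewrite (rGamma_rec (z + INR n)).
replace (z + INR n + 1) with (z + 1 + INR n) by ring.
replace (z + 1 - 1) with ((z - 1) + 1) by ring. rewrite cpw_plus, cpw_1. field. apply INR1_C.
Qed.

(** This is Gauss' product when 1/Gamma(z-1) is not zero, hence for large Re z;
    [nrm_pred] carries it down to every z. *)
Lemma nrm_lim z : clim (nrm z) 1.
Proof.
assert (A : forall z, rG z <> 0 -> clim (nrm (z + 1)) 1).
{ clear z; intros z Hz.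
  apply clim_ext with (fun n => rG z * / gseq z n).
  - intros n. unfold nrm. replace (z + 1 + INR n) with (z + INR (S n)) by (rewrite RtoC_S; ring).
    replace (z + 1 - 1) with z by ring.
    assert (H := rGamma_rising z (S n)).
    assert (Hr : rising z (S n) <> 0) by (intros E; rewrite E, Cmult_0_l in H; easy).
    rewrite H at 1. unfold gseq. field. repeat split; auto using INR_fact_C, cpw_neq_0.
  - apply clim_val with (rG z * / rG z); [field; easy|].
    apply clim_scal, clim_inv; [easy|]. apply gseq_lim. }
assert (B : forall N z, (0 < Re z + INR N - 1)%R -> clim (nrm z) 1).
{ clear z; induction N as [|N IH]; intros z Hz.
  - replace z with ((z - 1) + 1) by ring. apply A, rGamma_Re_pos.
    destruct z; simpl in *; lra.
  - apply clim_ext with (fun n => nrm (z + 1) n * ((z + INR n) / (INR n + 1)%R)).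
    + intros n; now rewrite <- nrm_pred.
    + apply clim_val with (1 * 1); [ring|]. apply clim_mult; [|apply clim_ratio].
      apply IH. rewrite S_INR in Hz. destruct z; simpl in *; lra. }
destruct (nfloor_ex (Rabs (Re z) + 1)) as [N HN]; [generalize (Rabs_pos (Re z)); lra|].
apply (B (S N)). rewrite S_INR. generalize (Rle_abs (- Re z)); rewrite Rabs_Ropp; lra.
Qed.

Lemma nrm_rG z n : rG (z + INR n) = nrm z n * cpw n (1 - z) / INR (fact n).
Proof.
unfold nrm. assert (E : cpw n (z - 1) * cpw n (1 - z) = 1).
{ rewrite <- cpw_plus. replace (z - 1 + (1 - z)) with (RtoC 0) by ring. apply cpw_0. }
replace (rG (z + INR n) * INR (fact n) * cpw n (z - 1) * cpw n (1 - z) / INR (fact n))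
  with (rG (z + INR n) * (cpw n (z - 1) * cpw n (1 - z))) by (field; apply INR_fact_C).
rewrite E; ring.
Qed.

(** * Bounds for Gamma quotients *)

Lemma pw_cmp n m c x : (1 <= c)%R -> (INR n + 1 <= c * (INR m + 1))%R ->
  (INR m + 1 <= c * (INR n + 1))%R -> (pw n x <= Rpower c (Rabs x) * pw m x)%R.
Proof.
intros Hc H1 H2. assert (Hn := INR1_pos n). assert (Hm := INR1_pos m).
unfold pw, Rpower. rewrite <- exp_plus. apply exp_le.
assert (A : (ln (INR n + 1) <= ln c + ln (INR m + 1))%R).
{ rewrite <- ln_mult by lra. now apply ln_le'. }
assert (B : (ln (INR m + 1) <= ln c + ln (INR n + 1))%R).
{ rewrite <- ln_mult by lra. now apply ln_le'. }
unfold Rabs; destruct (Rcase_abs x); nra.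
Qed.

Lemma INR_fact_pos n : (0 < INR (fact n))%R.
Proof. apply INR_fact_lt_0. Qed.

Lemma rG_bound_p z : exists K, (0 < K)%R /\ forall n : nat,
  (Cmod (rG (z + INR n)) <= K * pw n (1 - Re z) / INR (fact n))%R.
Proof.
destruct (clim_bounded _ _ (nrm_lim z)) as [K [HK H]].
exists K; split; [easy|]; intros n.
rewrite nrm_rG, Cmod_div, Cmod_mult, Cmod_cpw, Cmod_R, Rabs_pos_eq by
  (auto using INR_fact_C; apply Rlt_le, INR_fact_pos).
unfold Rdiv; apply Rmult_le_compat_r; [apply Rlt_le, Rinv_0_lt_compat, INR_fact_pos|].
replace (Re (1 - z)) with (1 - Re z)%R by (destruct z; simpl; ring).
apply Rmult_le_compat_r; [apply pw_ge0|apply H].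
Qed.

Lemma rising_bound z : exists K, (0 < K)%R /\ forall n : nat,
  (Cmod (rising z n) <= K * pw n (Re z - 1) * INR (fact n))%R.
Proof.
destruct (clim_bounded _ _ (proj1 (gseq_lim z))) as [K [HK H]].
assert (HP : (0 < Rpower 2 (Rabs (Re z)))%R) by apply exp_pos.
exists (K * Rpower 2 (Rabs (Re z)) * 2 + 1)%R; split; [nra|].
intros [|n].
- rewrite rising_0, Cmod_1. unfold pw, Rpower; simpl. rewrite Rplus_0_l, ln_1, Rmult_0_r, exp_0.
  fold (Rpower 2 (Rabs (Re z))). nra.
- assert (E : rising z (S n) = gseq z n * (INR (fact n) * cpw n z)).
  { unfold gseq; field; split; [apply cpw_neq_0|apply INR_fact_C]. }
  rewrite E, !Cmod_mult, Cmod_cpw, Cmod_R, Rabs_pos_eq by apply Rlt_le, INR_fact_pos.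
  assert (A := pw_cmp n (S n) 2 (Re z) ltac:(lra)). rewrite S_INR in A.
  specialize (A ltac:(generalize (pos_INR n); lra) ltac:(generalize (pos_INR n); lra)).
  rewrite fact_simpl, mult_INR, S_INR.
  replace (pw (S n) (Re z)) with (pw (S n) (Re z - 1) * (INR n + 2))%R in A.
  2:{ replace (INR n + 2)%R with (pw (S n) 1) by (rewrite pw_1, S_INR; ring).
      rewrite pw_plus; f_equal; ring. }
  assert (B := pw_pos (S n) (Re z - 1)). assert (F := INR_fact_pos n). assert (I := pos_INR n).
  set (P := Rpower 2 (Rabs (Re z))) in *. set (q := pw (S n) (Re z - 1)) in *.
  set (f := INR (fact n)) in *. set (x := INR n) in *.
  apply Rle_trans with (K * (f * (P * (q * (x + 2)))))%R.
  { apply Rmult_le_compat; auto using Cmod_ge_0.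
    - apply Rmult_le_pos; [lra|apply pw_ge0].
    - apply Rmult_le_compat_l; lra. }
  apply Rle_trans with (K * P * q * f * (2 * (x + 1)))%R.
  { replace (K * (f * (P * (q * (x + 2)))))%R with (K * P * q * f * (x + 2))%R by ring.
    apply Rmult_le_compat_l; [|lra]. repeat apply Rmult_le_pos; lra. }
  assert (0 <= q * ((x + 1) * f))%R by (repeat apply Rmult_le_pos; lra). nra.
Qed.

Lemma rising_lower z : rG z <> 0 -> exists K, (0 < K)%R /\ forall n : nat,
  (pw n (Re z - 1) * INR (fact n) <= K * Cmod (rising z n))%R.
Proof.
intros Hz. destruct (rG_bound_p z) as [K [HK H]].
exists (K / Cmod (rG z))%R.
assert (Hp : (0 < Cmod (rG z))%R) by (apply Cmod_gt_0; exact Hz).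
split; [now apply Rdiv_lt_0_compat|]. intros n; specialize (H n).
assert (E := rGamma_rising z n). apply (f_equal Cmod) in E. rewrite Cmod_mult in E.
assert (F := INR_fact_pos n). assert (P := pw_pos n (Re z - 1)).
assert (Q := pw_opp n (Re z - 1)). replace (- (Re z - 1))%R with (1 - Re z)%R in Q by ring.
assert (R0 := Cmod_ge_0 (rising z n)).
apply Rmult_le_reg_r with (Cmod (rG z)); [easy|].
replace (K / Cmod (rG z) * Cmod (rising z n) * Cmod (rG z))%R with (K * Cmod (rising z n))%R by (field; lra).
rewrite E.
apply Rle_trans with (pw n (Re z - 1) * INR (fact n) * (Cmod (rising z n) * (K * pw n (1 - Re z) / INR (fact n))))%R.
- apply Rmult_le_compat_l; [apply Rmult_le_pos; lra|]. now apply Rmult_le_compat_l.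
- right. transitivity (K * Cmod (rising z n) * (pw n (Re z - 1) * pw n (1 - Re z)))%R; [field; lra|].
  rewrite Q; ring.
Qed.

(** 1/Gamma(z-n) grows like n!: it is a shifted factorial times 1/Gamma(z). *)
Lemma falling_bound z : exists K, (0 < K)%R /\ forall n : nat,
  (Cmod (falling z n) <= K * pw n (- Re z) * INR (fact n))%R.
Proof.
destruct (rising_bound (1 - z)) as [K [HK H]]. exists K; split; [easy|].
intros n; rewrite Cmod_falling.
replace (- Re z)%R with (Re (1 - z) - 1)%R by (destruct z; simpl; ring). apply H.
Qed.

Lemma rG_bound_m z : exists K, (0 < K)%R /\ forall n : nat,
  (Cmod (rG (z - INR n)) <= K * pw n (- Re z) * INR (fact n))%R.
Proof.
destruct (falling_bound z) as [K [HK H]].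
exists (K * (Cmod (rG z) + 1))%R. assert (G := Cmod_ge_0 (rG z)).
split; [apply Rmult_lt_0_compat; lra|]. intros n.
rewrite rGamma_falling, Cmod_mult.
assert (A := pw_pos n (- Re z)). assert (F := INR_fact_pos n).
apply Rle_trans with (K * pw n (- Re z) * INR (fact n) * (Cmod (rG z) + 1))%R; [|right; ring].
apply Rmult_le_compat; try lra; [apply Cmod_ge_0|apply H].
Qed.

(** * The product 1/(Gamma(z) Gamma(1-z)) *)

(** This is sin(pi z)/pi. *)
Definition sg (z : C) : C := rG z * rG (1 - z).

Lemma sg_S z : sg (z + 1) = - sg z.
Proof.
unfold sg. rewrite (rGamma_rec z). replace (1 - (z + 1)) with (- z) by ring.
rewrite (rGamma_rec (- z)). replace (- z + 1) with (1 - z) by ring. ring.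
Qed.

Lemma sg_compl z : sg (1 - z) = sg z.
Proof. unfold sg. replace (1 - (1 - z)) with z by ring. ring. Qed.

Lemma sg_opp z : sg (- z) = - sg z.
Proof. rewrite <- sg_S, <- sg_compl. f_equal; ring. Qed.

Lemma sg_pred z : sg (z - 1) = - sg z.
Proof. replace z with (z - 1 + 1) at 2 by ring. rewrite sg_S; ring. Qed.

Definition Cz (k : Z) : C := RtoC (IZR k).

Lemma Cz_plus k l : Cz (k + l) = Cz k + Cz l.
Proof. unfold Cz; now rewrite plus_IZR, RtoC_plus. Qed.

Lemma Cz_opp k : Cz (- k) = - Cz k.
Proof. unfold Cz; now rewrite opp_IZR, RtoC_opp. Qed.

Lemma Cz_minus k l : Cz (k - l) = Cz k - Cz l.
Proof. unfold Z.sub; rewrite Cz_plus, Cz_opp; easy. Qed.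

Lemma Cz_nat n : Cz (Z.of_nat n) = RtoC (INR n).
Proof. unfold Cz; now rewrite <- INR_IZR_INZ. Qed.

Lemma Cz_0 : Cz 0 = 0. Proof. easy. Qed.
Lemma Cz_1 : Cz 1 = 1. Proof. easy. Qed.

Definition sgn (k : Z) : C := if Z.even k then 1 else -(1).

Lemma sgn_plus k l : sgn (k + l) = sgn k * sgn l.
Proof. unfold sgn; rewrite Z.even_add. destruct (Z.even k), (Z.even l); simpl; ring. Qed.

Lemma sgn_opp k : sgn (- k) = sgn k.
Proof. unfold sgn; now rewrite Z.even_opp. Qed.

Lemma sgn_sq k : sgn k * sgn k = 1.
Proof. unfold sgn; destruct (Z.even k); ring. Qed.

Lemma Cmod_sgn k : Cmod (sgn k) = 1%R.
Proof. unfold sgn; destruct (Z.even k); [|rewrite Cmod_opp]; apply Cmod_1. Qed.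

Lemma Z_ind_pm (P : Z -> Prop) :
  P 0%Z -> (forall k, P k <-> P (k + 1)%Z) -> forall k, P k.
Proof.
intros H0 HS k. induction k using Z.peano_ind; [easy| |].
- unfold Z.succ. apply (proj1 (HS k)), IHk.
- apply (proj2 (HS (Z.pred k))). now replace (Z.pred k + 1)%Z with k by lia.
Qed.

Lemma sg_Z z k : sg (z + Cz k) = sgn k * sg z.
Proof.
revert k; apply Z_ind_pm.
- rewrite Cz_0, Cplus_0_r. unfold sgn; simpl; ring.
- intros k; rewrite Cz_plus, Cz_1, Cplus_assoc, sg_S, sgn_plus.
  replace (sgn 1) with (-(1)) by easy.
  split; intros H; [rewrite H; ring|].
  replace (sg (z + Cz k)) with (- - sg (z + Cz k)) by ring. rewrite H; ring.
Qed.

(** Landau's O(n^x (n!)^p). Keeping the power of n! apart makes the orders of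
    Gamma quotients add up. *)
Definition asy (f : nat -> C) (x : R) (p : Z) : Prop :=
  exists K, (0 < K)%R /\ forall n, (Cmod (f n) <= K * pw n x * powerRZ (INR (fact n)) p)%R.

Lemma powerRZ_m1 x : powerRZ x (-1) = (/ x)%R.
Proof. simpl. now rewrite Rmult_1_r. Qed.

Lemma asy_mult f g x y p q :
  asy f x p -> asy g y q -> asy (fun n => f n * g n) (x + y) (p + q).
Proof.
intros [K [HK Hf]] [L [HL Hg]]; exists (K * L)%R; split; [nra|]; intros n.
rewrite Cmod_mult, <- pw_plus, powerRZ_add by apply INR_fact_neq_0.
replace (K * L * (pw n x * pw n y) * (powerRZ (INR (fact n)) p * powerRZ (INR (fact n)) q))%R
  with ((K * pw n x * powerRZ (INR (fact n)) p) * (L * pw n y * powerRZ (INR (fact n)) q))%R by ring.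
apply Rmult_le_compat; auto using Cmod_ge_0.
Qed.

Lemma asy_const c : asy (fun _ => c) 0 0.
Proof.
exists (Cmod c + 1)%R; split; [generalize (Cmod_ge_0 c); lra|].
intros n; rewrite pw_0; simpl. lra.
Qed.

Lemma asy_rising z : asy (rising z) (Re z - 1) 1.
Proof.
destruct (rising_bound z) as [K [HK H]]; exists K; split; [easy|]; intros n.
rewrite powerRZ_1; apply H.
Qed.

Lemma asy_invfact : asy (fun n => / INR (fact n)) 0 (-1).
Proof.
exists 1%R; split; [lra|]; intros n.
rewrite Cmod_inv by apply INR_fact_C. rewrite Cmod_R, Rabs_pos_eq by apply Rlt_le, INR_fact_pos.
rewrite pw_0, powerRZ_m1. lra.
Qed.

Lemma asy_rG z : asy (fun n => rG (z + INR n)) (1 - Re z) (-1).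
Proof.
destruct (rG_bound_p z) as [K [HK H]]; exists K; split; [easy|]; intros n.
rewrite powerRZ_m1; apply H.
Qed.

Lemma asy_rG_m z : asy (fun n => rG (z - INR n)) (- Re z) 1.
Proof.
destruct (rG_bound_m z) as [K [HK H]]; exists K; split; [easy|]; intros n.
rewrite powerRZ_1; apply H.
Qed.

Lemma asy_lin z : asy (fun n => z + INR n) 1 0.
Proof.
exists (Cmod z + 1)%R; split; [generalize (Cmod_ge_0 z); lra|].
intros n; rewrite pw_1; simpl.
eapply Rle_trans; [apply Cmod_triangle|]. rewrite Cmod_R, Rabs_pos_eq by apply pos_INR.
generalize (Cmod_ge_0 z) (pos_INR n); nra.
Qed.

Lemma asy_eq f g x y p q : (forall n, f n = g n) -> x = y -> p = q -> asy f x p -> asy g y q.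
Proof. intros H <- <-; now replace g with f by now apply functional_extensionality. Qed.

Lemma asy_use f g x y p q : asy f x p -> (forall n, f n = g n) -> x = y -> p = q -> asy g y q.
Proof. intros A B D F; exact (asy_eq f g x y p q B D F A). Qed.

Lemma asy_bound f x : asy f x 0 -> exists K, (0 < K)%R /\ forall n, (Cmod (f n) <= K * pw n x)%R.
Proof.
intros [K [HK H]]; exists K; split; [easy|]; intros n. generalize (H n); simpl; lra.
Qed.

Lemma asy_summable f x : asy f x 0 -> (x < -1)%R -> summable f.
Proof.
intros H Hx; destruct (asy_bound f x H) as [K [HK H']].
apply summable_le with (fun n => K * pw n x)%R; [easy|].
apply rsummable_scal; [lra|now apply rsummable_pw].
Qed.

Lemma asy_lim0 f x : asy f x 0 -> (x < 0)%R -> clim f 0.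
Proof.
intros H Hx; destruct (asy_bound f x H) as [K [HK H']].
apply clim_squeeze with (fun n => K * pw n x)%R.
- intros n; now rewrite Cminus_0_r || replace (f n - 0) with (f n) by ring.
- apply lim0_scal; now apply pw_lim.
Qed.

Ltac asy_tac := repeat lazymatch goal with
  | |- asy (fun n => @?f n * @?g n) _ _ => apply (asy_mult f g)
  | |- asy (fun n => rising ?z n) _ _ => apply asy_rising
  | |- asy (rising _) _ _ => apply asy_rising
  | |- asy (fun n => / RtoC (INR (fact n))) _ _ => apply asy_invfact
  | |- asy (fun n => rGamma (?z + RtoC (INR n))) _ _ => apply asy_rG
  | |- asy (fun n => rGamma (?z - RtoC (INR n))) _ _ => apply asy_rG_m
  | |- asy (fun n => ?z + RtoC (INR n)) _ _ => apply asy_lin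
  | |- asy (fun _ => ?c) _ _ => apply asy_const
  end.

Lemma cpw_one n (x : C) : x = 0 -> cpw n x = 1.
Proof. intros ->; apply cpw_0. Qed.

(** The shifted factorial (z)_n divided by its order of magnitude. *)
Definition rnrm (z : C) (n : nat) : C := rising z n / (INR (fact n) * cpw n (z - 1)).

Lemma rnrm_rising z n : rising z n = rnrm z n * INR (fact n) * cpw n (z - 1).
Proof. unfold rnrm; field; split; [apply cpw_neq_0|apply INR_fact_C]. Qed.

Lemma rnrm_lim z : clim (rnrm z) (rG z).
Proof.
apply (clim_unshift _ _ 1).
apply clim_ext with (fun n => gseq z n * Cexp (- ((z - 1) * RtoC (ln (INR n + 2) - ln (INR n + 1))))).
- intros n; rewrite Nat.add_1_r. unfold rnrm, gseq.
  assert (E : cpw (S n) (z - 1) * Cexp (- ((z - 1) * RtoC (ln (INR n + 2) - ln (INR n + 1)))) = cpw n (z - 1)).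
  { unfold cpw. rewrite <- Cexp_plus. f_equal. rewrite S_INR.
    replace (INR n + 1 + 1)%R with (INR n + 2)%R by ring.
    unfold Rminus; rewrite RtoC_plus, RtoC_opp; ring. }
  replace (cpw n z) with (cpw n (z - 1) * cpw n 1) by (rewrite <- cpw_plus; f_equal; ring).
  rewrite <- E, cpw_1, fact_simpl, mult_INR, S_INR, RtoC_mult. field.
  repeat split; auto using INR_fact_C, INR1_C, cpw_neq_0, Cexp_neq_0.
- apply clim_val with (rG z * 1); [ring|]. apply clim_mult; [apply gseq_lim|].
  apply Cexp_lim_0. apply clim_ext with (fun n => (-(z-1)) * RtoC (ln (INR n + 2) - ln (INR n + 1))); [intros; ring|].
  apply clim_val with (-(z-1) * 0); [ring|]. apply clim_scal, clim_dln.
Qed.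

Ltac clim_tac := repeat lazymatch goal with
  | |- clim (fun n => @?f n * @?g n) _ => apply (clim_mult f g)
  | |- clim (fun n => rnrm ?z n) _ => apply rnrm_lim
  | |- clim (fun n => nrm ?z n) _ => apply nrm_lim
  | |- clim (fun n => (?z + RtoC (INR n)) / RtoC (INR n + 1)) _ => apply clim_ratio
  | |- clim (fun _ => ?c) _ => apply clim_const
  end.

(** * The balanced series *)

(** The summand of a 3F2 at 1, with the reciprocals of Gamma(D) and Gamma(v)
    built in: it is entire in all parameters. The series is balanced if
    D + v = e + f + g + 1, and then the summand is O(m^(-2)) in any case. *)
Definition bal_term (e f g D v : C) (m : nat) : C :=
  rising e m * rising f m * rising g m * / INR (fact m) * rG (D + INR m) * rG (v + INR m).

Definition bal (e f g D v : C) : C := csum (bal_term e f g D v).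

Lemma asy_bal_term e f g D v : D + v = e + f + g + 1 -> asy (bal_term e f g D v) (-2) 0.
Proof.
intros H. unfold bal_term. eapply asy_eq; [intros n; reflexivity| | |asy_tac]; [|lia].
apply (f_equal Re) in H. destruct e, f, g, D, v; simpl in *; lra.
Qed.

Lemma summable_bal_term e f g D v : D + v = e + f + g + 1 -> summable (bal_term e f g D v).
Proof. intros H; apply asy_summable with (-2)%R; [now apply asy_bal_term|lra]. Qed.

Lemma bal_sym e f g D v : bal e f g D v = bal e f g v D.
Proof. apply csum_ext; intros; unfold bal_term; ring. Qed.

Lemma bal_perm1 e f g D v : bal e f g D v = bal f e g D v.
Proof. apply csum_ext; intros; unfold bal_term; ring. Qed.

Lemma bal_perm2 e f g D v : bal e f g D v = bal e g f D v.
Proof. apply csum_ext; intros; unfold bal_term; ring. Qed.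

Ltac cpw_collect E :=
  match type of E with ?X = _ =>
    match goal with |- ?l = ?r => transitivity (l * X); [rewrite E; ring|field] end
  end.

Ltac rgS z := rewrite (rGamma_rec z).

Lemma bal_contig1 e f g D v : D + v = e + f + g + 1 ->
  (v - f) * (v - g) * bal (e + 1) f g D (v + 1) + (D - 1 - e) * bal e f g D v
  = rG (e + 1) * rG f * rG g.
Proof.
intros H.
assert (S1 : summable (bal_term (e + 1) f g D (v + 1))) by (apply summable_bal_term; rewrite Cplus_assoc, H; ring).
assert (S2 := summable_bal_term e f g D v H).
unfold bal. rewrite <- !csum_scal, <- csum_plus by (easy || now apply summable_scal).
apply csum_partial with (fun n => rising (e + 1) n * rising f (S n) * rising g (S n) * / INR (fact n)
   * rG (D + INR n) * rG (v + INR n + 1)).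
- apply summable_plus; now apply summable_scal.
- unfold bal_term. rewrite !rising_S, !rising_0. simpl INR. simpl fact. rewrite !Cplus_0_r.
  rgS v. replace D with (e + f + g + 1 - v) by (rewrite <- H; ring).
  generalize (rG (e + f + g + 1 - v)) (rG (v + 1)); intros. field; try exact C1_nz.
- intros n. unfold bal_term.
  rewrite !fact_simpl, !mult_INR, !RtoC_mult, !RtoC_S.
  rewrite (rising_S_l e), !(rising_S _ (S n)), (rising_S (e + 1)), !RtoC_S.
  rgS (D + INR n). rgS (v + INR n + 1).
  replace (D + (INR n + 1)) with (D + INR n + 1) by ring.
  replace (v + 1 + (INR n + 1)) with (v + INR n + 1 + 1) by ring.
  rgS (v + (INR n + 1)).
  replace (v + (INR n + 1) + 1) with (v + INR n + 1 + 1) by ring.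
  assert (HD : D = e + f + g + 1 - v) by (rewrite <- H; ring).
  generalize (rG (D + INR n + 1)) (rG (v + INR n + 1 + 1)) (rising (e + 1) n) (rising f (S n)) (rising g (S n)).
  intros. rewrite HD. field. split; [apply INR_fact_C|]. rewrite <- RtoC_S.
  rewrite RtoC_S, <- RtoC_plus. apply INR1_C.
- apply clim_ext with (fun n => rnrm (e + 1) n * rnrm f n * rnrm g n * nrm D n * nrm (v + 1) n
     * ((f + INR n) / (INR n + 1)%R) * ((g + INR n) / (INR n + 1)%R)).
  + intros n. rewrite !rising_S, !rnrm_rising.
    replace (v + INR n + 1) with (v + 1 + INR n) by ring. rewrite !nrm_rG.
    assert (E : cpw n (e + 1 - 1) * cpw n (f - 1) * cpw n (g - 1) * cpw n (1 - D) * cpw n (1 - (v + 1))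
       * ((INR n + 1)%R * (INR n + 1)%R) = 1).
    { rewrite <- cpw_1, <- !cpw_plus. apply cpw_one.
      replace D with (e + f + g + 1 - v) by (rewrite <- H; ring). ring. }
    cpw_collect E. split; [apply INR_fact_C|apply INR1_C].
  + apply clim_val with (rG (e + 1) * rG f * rG g * 1 * 1 * 1 * 1); [ring|].
    clim_tac.
Qed.

Lemma bal_contig3 e f g D v : D + v = e + f + g + 1 ->
  (g - v) * (D - g) * bal (e + 1) (f + 1) g (D + 1) (v + 1) + bal e f g D v
  = rG (e + 1) * rG (f + 1) * rG g.
Proof.
intros H.
assert (S1 : summable (bal_term (e + 1) (f + 1) g (D + 1) (v + 1))).
{ apply summable_bal_term. replace (D + 1 + (v + 1)) with (D + v + 1 + 1) by ring. rewrite H; ring. }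
assert (S2 := summable_bal_term e f g D v H).
unfold bal. rewrite <- !csum_scal, <- csum_plus by (easy || now apply summable_scal).
apply csum_partial with (fun n => rising (e + 1) n * rising (f + 1) n * rising g (S n) * / INR (fact n)
   * (e + f + 1 + INR n) * rG (D + INR n + 1) * rG (v + INR n + 1)).
- apply summable_plus; [now apply summable_scal|easy].
- unfold bal_term. rewrite !rising_S, !rising_0. simpl INR. simpl fact. rewrite !Cplus_0_r.
  rgS v. rgS D. assert (HD : D = e + f + g + 1 - v) by (rewrite <- H; ring).
  generalize (rG (D + 1)) (rG (v + 1)); intros. rewrite HD. field; try exact C1_nz.
- intros n. unfold bal_term.
  rewrite !fact_simpl, !mult_INR, !RtoC_mult, !RtoC_S.
  rewrite (rising_S_l e), (rising_S_l f), !(rising_S _ (S n)), (rising_S (e + 1)), (rising_S (f + 1)), !RtoC_S.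
  replace (D + (INR n + 1)) with (D + INR n + 1) by ring.
  replace (v + (INR n + 1)) with (v + INR n + 1) by ring.
  rgS (D + INR n + 1). rgS (v + INR n + 1).
  replace (D + 1 + (INR n + 1)) with (D + INR n + 1 + 1) by ring.
  replace (v + 1 + (INR n + 1)) with (v + INR n + 1 + 1) by ring.
  assert (HD : D = e + f + g + 1 - v) by (rewrite <- H; ring).
  generalize (rG (D + INR n + 1 + 1)) (rG (v + INR n + 1 + 1)) (rising (e + 1) n) (rising (f + 1) n) (rising g (S n)).
  intros. rewrite HD. field. split; [apply INR_fact_C|]. rewrite <- RtoC_plus. apply INR1_C.
- apply clim_ext with (fun n => rnrm (e + 1) n * rnrm (f + 1) n * rnrm g n * nrm (D + 1) n * nrm (v + 1) n
     * ((e + f + 1 + INR n) / (INR n + 1)%R) * ((g + INR n) / (INR n + 1)%R)).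
  + intros n. rewrite !rising_S, !rnrm_rising.
    replace (v + INR n + 1) with (v + 1 + INR n) by ring.
    replace (D + INR n + 1) with (D + 1 + INR n) by ring. rewrite !nrm_rG.
    assert (E : cpw n (e + 1 - 1) * cpw n (f + 1 - 1) * cpw n (g - 1) * cpw n (1 - (D + 1)) * cpw n (1 - (v + 1))
       * ((INR n + 1)%R * (INR n + 1)%R) = 1).
    { rewrite <- cpw_1, <- !cpw_plus. apply cpw_one.
      replace D with (e + f + g + 1 - v) by (rewrite <- H; ring). ring. }
    cpw_collect E. split; [apply INR_fact_C|apply INR1_C].
  + apply clim_val with (rG (e + 1) * rG (f + 1) * rG g * 1 * 1 * 1 * 1); [ring|].
    clim_tac.
Qed.

(** * Central binomial quotients *)

(** The quotient of the binomial coefficients (2n choose n-k) and (2n choose n):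
    a bell curve in k of width sqrt n. *)
Definition bq (n k : nat) : R :=
  (INR (fact n) * INR (fact n) / (INR (fact (n - k)) * INR (fact (n + k))))%R.

Lemma bq_pos n k : (0 < bq n k)%R.
Proof.
unfold bq; apply Rdiv_lt_0_compat; apply Rmult_lt_0_compat; apply INR_fact_pos.
Qed.

Lemma fact_S_R n : INR (fact (S n)) = ((INR n + 1) * INR (fact n))%R.
Proof. now rewrite fact_simpl, mult_INR, S_INR. Qed.

Lemma bq_S n k : (S k <= n)%nat ->
  (bq n (S k) * (INR n + INR k + 1) = bq n k * (INR n - INR k))%R.
Proof.
intros H. unfold bq.
replace (n - k)%nat with (S (n - S k)) by lia. replace (n + S k)%nat with (S (n + k)) by lia.
rewrite !fact_S_R, minus_INR, plus_INR, S_INR by lia.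
assert (A := INR_fact_pos (n - S k)). assert (B := INR_fact_pos (n + k)).
assert (Hn := pos_INR n). assert (Hk := pos_INR k). apply le_INR in H. rewrite S_INR in H.
field. repeat split; lra.
Qed.

(** The Gaussian decay in k, in a form that survives an induction on k. *)
Lemma bq_gauss n k : (k <= n)%nat ->
  (bq n k * (INR n + 1 + INR k * INR k) <= INR n + 1)%R.
Proof.
induction k as [|k IH]; intros H.
- unfold bq. rewrite Nat.sub_0_r, Nat.add_0_r. simpl.
  assert (A := INR_fact_pos n). right; field; lra.
- specialize (IH ltac:(lia)). assert (E := bq_S n k H).
  assert (P := bq_pos n k). assert (P' := bq_pos n (S k)).
  assert (Hk := pos_INR k). apply le_INR in H. rewrite S_INR in *.
  set (x := INR n) in *. set (y := INR k) in *.
  apply Rmult_le_reg_r with (x + y + 1)%R; [lra|].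
  replace (bq n (S k) * (x + 1 + (y + 1) * (y + 1)) * (x + y + 1))%R
    with (bq n k * ((x - y) * (x + 1 + (y + 1) * (y + 1))))%R.
  2:{ rewrite <- Rmult_assoc, <- E; ring. }
  apply Rle_trans with (bq n k * ((x + 1 + y * y) * (x + y + 1)))%R.
  + apply Rmult_le_compat_l; [lra|]. nra.
  + rewrite <- Rmult_assoc. apply Rmult_le_compat_r; [lra|easy].
Qed.

(** An interpolation between the bounds 1 and n/k^2 of [bq_gauss]: part of the
    decay in k is given up for less growth in n. *)
Lemma bq_le n k d : (k <= n)%nat -> (0 <= d <= 1)%R ->
  (bq n k <= 2 * pw n (1 - d) * pw k (- 2 + 2 * d))%R.
Proof.
intros H [Hd0 Hd1]. assert (G := bq_gauss n k H). assert (P := bq_pos n k).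
assert (Hn := pos_INR n). assert (Hk := pos_INR k).
set (X := (INR n + 1 + INR k * INR k)%R) in *.
assert (HX : (1 <= X)%R) by (unfold X; nra).
assert (A1 : (pw n d <= Rpower X d)%R).
{ unfold pw. apply Rle_Rpower_l; [easy|]. unfold X; nra. }
assert (A2 : (pw k (2 - 2 * d) <= 2 * Rpower X (1 - d))%R).
{ apply Rle_trans with (Rpower (2 * X) (1 - d)).
  - replace (pw k (2 - 2 * d)) with (Rpower ((INR k + 1) * (INR k + 1)) (1 - d)).
    + apply Rle_Rpower_l; [lra|]. split; [nra|].
      generalize (Rle_0_sqr (INR k - 1)); unfold X, Rsqr; lra.
    + unfold pw, Rpower. rewrite ln_mult by lra. f_equal; ring.
  - rewrite <- Rpower_mult_distr by lra. apply Rmult_le_compat_r; [apply Rlt_le, exp_pos|].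
    rewrite <- (Rpower_1 2) at 2 by lra. apply Rle_Rpower; lra. }
assert (A3 : (pw n d * pw k (2 - 2 * d) <= 2 * X)%R).
{ apply Rle_trans with (Rpower X d * (2 * Rpower X (1 - d)))%R.
  - apply Rmult_le_compat; auto using pw_ge0.
  - right. replace (Rpower X d * (2 * Rpower X (1 - d)))%R with (2 * (Rpower X d * Rpower X (1 - d)))%R by ring.
    rewrite <- Rpower_plus. replace (d + (1 - d))%R with 1%R by ring. rewrite Rpower_1; lra. }
assert (B1 := pw_pos n d). assert (B2 := pw_pos k (2 - 2 * d)).
assert (B3 := pw_pos n (1 - d)). assert (B4 := pw_pos k (-2 + 2 * d)).
assert (E1 : (pw n d * pw n (1 - d) = INR n + 1)%R).
{ rewrite pw_plus. replace (d + (1 - d))%R with 1%R by ring. apply pw_1. }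
assert (E2 : (pw k (2 - 2 * d) * pw k (-2 + 2 * d) = 1)%R).
{ rewrite pw_plus. replace (2 - 2 * d + (-2 + 2 * d))%R with 0%R by ring. apply pw_0. }
apply Rmult_le_reg_r with (pw n d * pw k (2 - 2 * d))%R; [now apply Rmult_lt_0_compat|].
apply Rle_trans with (2 * (INR n + 1))%R.
- apply Rle_trans with (bq n k * (2 * X))%R; [apply Rmult_le_compat_l; lra|lra].
- right. replace (2 * pw n (1 - d) * pw k (-2 + 2 * d) * (pw n d * pw k (2 - 2 * d)))%R
    with (2 * (pw n d * pw n (1 - d)) * (pw k (2 - 2 * d) * pw k (-2 + 2 * d)))%R by ring.
  rewrite E1, E2; ring.
Qed.

Lemma fact_pow_le m p : (INR (fact m) * (INR m + 1) ^ p <= INR (fact (m + p)))%R.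
Proof.
induction p as [|p IH]; [rewrite Nat.add_0_r; simpl; lra|].
rewrite Nat.add_succ_r, fact_S_R, plus_INR. simpl.
assert (A := INR1_pos m). assert (B := pos_INR p). assert (F := INR_fact_pos (m + p)).
apply Rle_trans with ((INR m + 1) * INR (fact (m + p)))%R; [|apply Rmult_le_compat_r; lra].
apply Rle_trans with ((INR m + 1) * (INR (fact m) * (INR m + 1) ^ p))%R; [right; ring|].
apply Rmult_le_compat_l; lra.
Qed.

Lemma fact_pow_ge m p : (INR (fact (m + p)) <= INR (fact p) * INR (fact m) * (INR m + 1) ^ p)%R.
Proof.
induction p as [|p IH]; [rewrite Nat.add_0_r; simpl; lra|].
rewrite Nat.add_succ_r, !fact_S_R, plus_INR. simpl.
assert (A := pos_INR m). assert (B := pos_INR p). assert (F := INR_fact_pos (m + p)).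
apply Rle_trans with (((INR p + 1) * (INR m + 1)) * INR (fact (m + p)))%R.
- apply Rmult_le_compat_r; [lra|]. nra.
- replace ((INR p + 1) * INR (fact p) * INR (fact m) * ((INR m + 1) * (INR m + 1) ^ p))%R
    with (((INR p + 1) * (INR m + 1)) * (INR (fact p) * INR (fact m) * (INR m + 1) ^ p))%R by ring.
  apply Rmult_le_compat_l; [nra|easy].
Qed.

(** Near the edge k = m a power of (m+1)/(m-k+1) is as large as m^p, but there
    the quotient is tiny: passing from m to m+p absorbs the power. *)
Lemma bq_edge p d : (0 <= d <= 1)%R -> exists K, (0 < K)%R /\ forall m k, (k <= m)%nat ->
  (((INR m + 1) / (INR (m - k) + 1)) ^ p * bq m k <= K * pw m (1 - d) * pw k (- 2 + 2 * d))%R.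
Proof.
intros Hd.
exists (INR (fact p) * 2 ^ p * 2 * Rpower (INR p + 1) (Rabs (1 - d)))%R; split.
{ repeat apply Rmult_lt_0_compat; try lra; [apply INR_fact_pos|apply pow_lt; lra|apply exp_pos]. }
intros m k H.
assert (Hm := pos_INR m). assert (Hk := pos_INR k). assert (Hp := pos_INR p).
assert (Q := INR1_pos (m - k)).
assert (F1 := INR_fact_pos m). assert (F2 := INR_fact_pos (m - k)). assert (F3 := INR_fact_pos (m + k)).
assert (F4 := INR_fact_pos (m + p)). assert (F5 := INR_fact_pos (m + p - k)). assert (F6 := INR_fact_pos (m + p + k)).
assert (Fp := INR_fact_pos p).
assert (A : (((INR m + 1) / (INR (m - k) + 1)) ^ p * bq m k <= INR (fact p) * 2 ^ p * bq (m + p) k)%R).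
{ assert (A1 := fact_pow_le m p). assert (A2 := fact_pow_ge (m - k) p).
  replace (m - k + p)%nat with (m + p - k)%nat in A2 by lia.
  assert (A3 : (INR (fact m) * INR (fact (m + p + k)) <= 2 ^ p * INR (fact (m + p)) * INR (fact (m + k)))%R).
  { clear -H. induction p as [|p IH]; [rewrite !Nat.add_0_r; simpl; lra|].
    replace (m + S p + k)%nat with (S (m + p + k)) by lia. rewrite Nat.add_succ_r, !fact_S_R, !plus_INR.
    apply le_INR in H. assert (Hm := pos_INR m). assert (Hk := pos_INR k). assert (Hp := pos_INR p). simpl.
    set (T := (2 ^ p * INR (fact (m + p)) * INR (fact (m + k)))%R) in *.
    assert (0 < T)%R by (unfold T; repeat apply Rmult_lt_0_compat; try apply INR_fact_pos; apply pow_lt; lra).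
    apply Rle_trans with ((INR m + INR p + INR k + 1) * T)%R.
    - replace (INR (fact m) * ((INR m + INR p + INR k + 1) * INR (fact (m + p + k))))%R
        with ((INR m + INR p + INR k + 1) * (INR (fact m) * INR (fact (m + p + k))))%R by ring.
      apply Rmult_le_compat_l; lra.
    - replace (2 * 2 ^ p * ((INR m + INR p + 1) * INR (fact (m + p))) * INR (fact (m + k)))%R
        with ((2 * (INR m + INR p + 1)) * T)%R by (unfold T; ring).
      apply Rmult_le_compat_r; lra. }
  unfold bq. unfold Rdiv at 1. rewrite Rpow_mult_distr, pow_inv.
  set (a := ((INR m + 1) ^ p)%R) in *. set (b := ((INR (m - k) + 1) ^ p)%R) in *.
  assert (Ha : (0 < a)%R) by (apply pow_lt; lra). assert (Hb : (0 < b)%R) by (apply pow_lt; lra).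
  set (f1 := INR (fact m)) in *. set (f2 := INR (fact (m - k))) in *. set (f3 := INR (fact (m + k))) in *.
  set (f4 := INR (fact (m + p))) in *. set (f5 := INR (fact (m + p - k))) in *. set (f6 := INR (fact (m + p + k))) in *.
  set (fp := INR (fact p)) in *. set (t := (2 ^ p)%R) in *.
  assert (Ht : (0 < t)%R) by (apply pow_lt; lra).
  apply Rmult_le_reg_r with (b * f2 * f3 * f5 * f6)%R; [repeat apply Rmult_lt_0_compat; easy|].
  replace (a * / b * (f1 * f1 / (f2 * f3)) * (b * f2 * f3 * f5 * f6))%R
    with ((f1 * a) * (f5 * (f1 * f6)))%R by (field; lra).
  replace (fp * t * (f4 * f4 / (f5 * f6)) * (b * f2 * f3 * f5 * f6))%R
    with (f4 * ((fp * f2 * b) * (t * f4 * f3)))%R by (field; lra).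
  apply Rmult_le_compat; [apply Rmult_le_pos; lra|repeat apply Rmult_le_pos; lra|easy|].
  apply Rmult_le_compat; [lra|apply Rmult_le_pos; lra|easy|easy]. }
assert (B := bq_le (m + p) k d ltac:(lia) Hd).
assert (Cc := pw_cmp (m + p) m (INR p + 1) (1 - d) ltac:(lra)).
rewrite plus_INR in Cc. specialize (Cc ltac:(nra) ltac:(nra)).
assert (P := pw_pos k (-2 + 2 * d)). assert (T : (0 < 2 ^ p)%R) by (apply pow_lt; lra).
apply Rle_trans with (1 := A).
apply Rle_trans with (INR (fact p) * 2 ^ p * (2 * pw (m + p) (1 - d) * pw k (-2 + 2 * d)))%R.
{ apply Rmult_le_compat_l; [apply Rmult_le_pos; lra|easy]. }
replace (INR (fact p) * 2 ^ p * (2 * pw (m + p) (1 - d) * pw k (-2 + 2 * d)))%R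
  with (INR (fact p) * 2 ^ p * 2 * pw k (-2 + 2 * d) * pw (m + p) (1 - d))%R by ring.
replace (INR (fact p) * 2 ^ p * 2 * Rpower (INR p + 1) (Rabs (1 - d)) * pw m (1 - d) * pw k (-2 + 2 * d))%R
  with (INR (fact p) * 2 ^ p * 2 * pw k (-2 + 2 * d) * (Rpower (INR p + 1) (Rabs (1 - d)) * pw m (1 - d)))%R by ring.
apply Rmult_le_compat_l; [repeat apply Rmult_le_pos; lra|easy].
Qed.

Lemma pw_exp q e : (0 < e)%R -> exists K, (0 < K)%R /\ forall m, (pw m q <= K * exp (e * INR m))%R.
Proof.
intros He. set (r := (Rabs q + 1)%R). assert (Hr : (0 < r)%R) by (unfold r; generalize (Rabs_pos q); lra).
exists (exp (e + r * ln (r / e))); split; [apply exp_pos|]; intros m.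
rewrite <- exp_plus. apply Rle_trans with (pw m r).
{ apply pw_le. unfold r; generalize (Rle_abs q); lra. }
unfold pw, Rpower. apply exp_le.
assert (Hm := INR1_pos m).
assert (Hc : (0 < r / e)%R) by now apply Rdiv_lt_0_compat.
assert (A : (ln ((INR m + 1) / (r / e)) <= (INR m + 1) / (r / e) - 1)%R).
{ assert (B := exp_ineq1_le (ln ((INR m + 1) / (r / e)))).
  rewrite exp_ln in B by (now apply Rdiv_lt_0_compat). lra. }
unfold Rdiv at 1 in A. rewrite ln_mult, ln_Rinv in A by (try apply Rinv_0_lt_compat; easy).
assert (E : (r * ((INR m + 1) / (r / e)) = e * (INR m + 1))%R) by (field; lra).
assert (r * (ln (INR m + 1) - ln (r / e)) <= r * ((INR m + 1) / (r / e)))%R.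
{ apply Rmult_le_compat_l; lra. }
lra.
Qed.

Lemma rsummable_pw_half x : rsummable (fun m => pw m x * (/ 2) ^ m)%R.
Proof.
destruct (pw_exp (x + 2) (ln 2)) as [K [HK H]]; [generalize ln_lt_2; lra|].
apply rsummable_le with (fun m => K * pw m (-2))%R.
- intros m. specialize (H m).
  replace (exp (ln 2 * INR m)) with (2 ^ m)%R in H.
  2:{ rewrite <- Rpower_pow by lra. unfold Rpower. f_equal; ring. }
  assert (P := pw_pos m (-2)). assert (T : (0 < 2 ^ m)%R) by (apply pow_lt; lra).
  rewrite pow_inv.
  replace (pw m x) with (pw m (x + 2) * pw m (-2))%R by (rewrite pw_plus; f_equal; ring).
  apply Rmult_le_reg_r with (2 ^ m)%R; [easy|].
  replace (pw m (x + 2) * pw m (-2) * / 2 ^ m * 2 ^ m)%R with (pw m (x + 2) * pw m (-2))%R by (field; lra).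
  replace (K * pw m (-2) * 2 ^ m)%R with (K * 2 ^ m * pw m (-2))%R by ring.
  apply Rmult_le_compat_r; lra.
- apply rsummable_scal; [lra|]. apply rsummable_pw; lra.
Qed.

Lemma binom_ge_pow k m : (m <= k)%nat ->
  (2 ^ m * (INR (fact m) * INR (fact k)) <= INR (fact (k + m)))%R.
Proof.
induction m as [|m IH]; intros H; [rewrite Nat.add_0_r; simpl; lra|].
specialize (IH ltac:(lia)). rewrite Nat.add_succ_r, !fact_S_R, plus_INR. simpl.
apply le_INR in H; rewrite S_INR in H. assert (A := pos_INR m). assert (F := INR_fact_pos (k + m)).
apply Rle_trans with ((2 * (INR m + 1)) * INR (fact (k + m)))%R; [|apply Rmult_le_compat_r; lra].
replace (2 * 2 ^ m * ((INR m + 1) * INR (fact m) * INR (fact k)))%R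
  with ((2 * (INR m + 1)) * (2 ^ m * (INR (fact m) * INR (fact k))))%R by ring.
apply Rmult_le_compat_l; lra.
Qed.

Lemma binom_ge_k k m : (1 <= m)%nat -> (m < k)%nat ->
  (INR k * (INR (fact m) * INR (fact (k - m))) <= INR (fact k))%R.
Proof.
intros H1 H2. remember (k - m)%nat as j. assert (k = m + j)%nat by lia. subst k.
assert (Hj : (1 <= j)%nat) by lia. clear Heqj H2.
induction H1 as [|m Hm IH].
- change (1 + j)%nat with (S j). rewrite (fact_S_R j), S_INR. simpl (INR (fact 1)). lra.
- change (S m + j)%nat with (S (m + j)). rewrite !fact_S_R, S_INR.
  apply le_INR in Hm, Hj. simpl in Hm, Hj. rewrite plus_INR in *.
  assert (F := INR_fact_pos m). assert (G := INR_fact_pos j). assert (T := INR_fact_pos (m + j)).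
  set (x := INR m) in *. set (y := INR j) in *. set (f := INR (fact m)) in *. set (h := INR (fact j)) in *.
  assert (P : (0 < f * h)%R) by (apply Rmult_lt_0_compat; lra).
  apply Rle_trans with ((x + y + 1) * ((x + y) * (f * h)))%R; [|apply Rmult_le_compat_l; lra].
  replace ((x + y + 1) * ((x + 1) * f * h))%R with ((x + y + 1) * ((x + 1) * (f * h)))%R by ring.
  apply Rmult_le_compat_l; [lra|]. apply Rmult_le_compat_r; lra.
Qed.

Lemma pw_ratio j m x p : (j <= m)%nat -> (x <= INR p)%R ->
  (pw j (- x) * pw m x <= ((INR m + 1) / (INR j + 1)) ^ p)%R.
Proof.
intros H Hx. assert (Hj := INR1_pos j). assert (Hm := INR1_pos m).
assert (Hr : (1 <= (INR m + 1) / (INR j + 1))%R).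
{ apply Rmult_le_reg_r with (INR j + 1)%R; [easy|].
  replace ((INR m + 1) / (INR j + 1) * (INR j + 1))%R with (INR m + 1)%R by (field; lra).
  apply le_INR in H; lra. }
rewrite <- Rpower_pow by lra.
apply Rle_trans with (Rpower ((INR m + 1) / (INR j + 1)) x); [|now apply Rle_Rpower].
right. unfold pw, Rpower, Rdiv. rewrite ln_mult, ln_Rinv, <- exp_plus by (try apply Rinv_0_lt_compat; easy).
f_equal; ring.
Qed.

Lemma pw_sub j m x : (pw j x <= pw (m + j) x * pw m (Rabs x))%R.
Proof.
assert (Hj := INR1_pos j). assert (Hm := INR1_pos m). assert (Hk := INR1_pos (m + j)).
unfold pw, Rpower. rewrite <- exp_plus. apply exp_le.
assert (A : (ln (INR j + 1) <= ln (INR (m + j) + 1))%R).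
{ apply ln_le'; [easy|]. rewrite plus_INR. generalize (pos_INR m); lra. }
assert (B : (ln (INR (m + j) + 1) <= ln (INR m + 1) + ln (INR j + 1))%R).
{ rewrite <- ln_mult by lra. apply ln_le'; [easy|]. rewrite plus_INR.
  generalize (pos_INR m) (pos_INR j); nra. }
assert (P := ln_ge0 m).
unfold Rabs; destruct (Rcase_abs x); nra.
Qed.

Lemma pw_double n k x : (k <= n)%nat -> (pw (n + k) x <= Rpower 2 (Rabs x) * pw n x)%R.
Proof.
intros H; apply pw_cmp; [lra| |]; rewrite plus_INR; apply le_INR in H;
generalize (pos_INR k) (pos_INR n); lra.
Qed.

Lemma rbnd_nat_S (f : nat -> R) a b :
  (forall n, 0 <= f n)%R -> (f 0%nat <= a)%R -> rbnd (fun m => f (S m)) b -> rbnd f (a + b).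
Proof.
intros H0 Ha Hb. apply rbnd_nat; [easy|].
assert (A : forall n, rsum f (seq 0 (S n)) = (f 0%nat + rsum (fun m => f (S m)) (seq 0 n))%R).
{ induction n as [|n IH]; [simpl; ring|]. rewrite rsum_seq_S, IH, rsum_seq_S; ring. }
intros [|n].
- simpl. generalize (H0 0%nat) (rbnd_ge0 _ _ Hb); lra.
- rewrite A. generalize (Hb _ (seq_NoDup n 0)); lra.
Qed.

(** * Uniform bounds for the rows of a double series *)

(** The series to be bounded has the summand s(m)/(Gamma(y-k+m) Gamma(y'+k+m)),
    with s(m) of order m^(th-3) m!^2. For m >= k the factorials make up [bq m k];
    for m < k, where 1/Gamma(y-k+m) is large, they make up the reciprocal of
    the product of (k choose m) and (k+m choose m). *)
Section Rows.

Context (s : nat -> C) (y y' : C) (K0 th d : R) (HK0 : (0 < K0)%R)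
  (Hs : forall m, (Cmod (s m) <= K0 * pw m (th - 3) * (INR (fact m) * INR (fact m)))%R)
  (Hth : th = (Re y + Re y' - 1)%R) (Hd : (0 < d <= 1)%R).

Definition row (k m : nat) : C := s m * rG (y - INR k + INR m) * rG (y' + INR k + INR m).

Lemma row_far : exists K, (0 < K)%R /\ forall k m, (k <= m)%nat ->
  (Cmod (row k m) <= K * pw m (- 1 - d) * pw k (- 2 + 2 * d))%R.
Proof.
destruct (rG_bound_p y) as [Ky [HKy Hy]]. destruct (rG_bound_p y') as [Ky' [HKy' Hy']].
destruct (nfloor_ex (Rabs (Re y - 1))) as [p0 Hp0]; [apply Rabs_pos|].
set (p := S p0). assert (Hp : (Re y - 1 <= INR p)%R).
{ unfold p; rewrite S_INR. generalize (Rle_abs (Re y - 1)); lra. }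
destruct (bq_edge p d ltac:(lra)) as [Ke [HKe He]].
set (c := Rpower 2 (Rabs (1 - Re y'))). assert (Hc : (0 < c)%R) by apply exp_pos.
exists (K0 * Ky * Ky' * c * Ke)%R; split; [repeat apply Rmult_lt_0_compat; easy|].
intros k m H. unfold row.
replace (y - INR k + INR m) with (y + INR (m - k)) by (rewrite minus_INR, RtoC_minus by easy; ring).
replace (y' + INR k + INR m) with (y' + INR (m + k)) by (rewrite plus_INR, RtoC_plus; ring).
rewrite !Cmod_mult.
specialize (Hs m); specialize (Hy (m - k)%nat); specialize (Hy' (m + k)%nat); specialize (He m k H).
assert (D := pw_double m k (1 - Re y') H). fold c in D.
assert (R := pw_ratio (m - k) m (Re y - 1) p ltac:(lia) Hp).
replace (- (Re y - 1))%R with (1 - Re y)%R in R by ring.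
assert (F1 := INR_fact_pos m). assert (F2 := INR_fact_pos (m - k)). assert (F3 := INR_fact_pos (m + k)).
assert (P1 := pw_pos m (th - 3)). assert (P2 := pw_pos (m - k) (1 - Re y)).
assert (P3 := pw_pos (m + k) (1 - Re y')). assert (P4 := pw_pos m (1 - Re y')).
assert (P5 := pw_pos m (-2)). assert (P6 := pw_pos m (Re y - 1)).
assert (E : (pw m (th - 3) * pw m (1 - Re y') = pw m (-2) * pw m (Re y - 1))%R).
{ rewrite !pw_plus. f_equal. rewrite Hth; ring. }
assert (B := bq_pos m k).
apply Rle_trans with ((K0 * pw m (th - 3) * (INR (fact m) * INR (fact m)))
  * (Ky * pw (m - k) (1 - Re y) / INR (fact (m - k)))
  * (Ky' * (c * pw m (1 - Re y')) / INR (fact (m + k))))%R.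
{ apply Rmult_le_compat; [apply Rmult_le_pos; apply Cmod_ge_0|apply Cmod_ge_0| |].
  - apply Rmult_le_compat; auto using Cmod_ge_0.
  - apply Rle_trans with (1 := Hy'). unfold Rdiv. apply Rmult_le_compat_r.
    + apply Rlt_le, Rinv_0_lt_compat; easy.
    + apply Rmult_le_compat_l; lra. }
replace ((K0 * pw m (th - 3) * (INR (fact m) * INR (fact m)))
  * (Ky * pw (m - k) (1 - Re y) / INR (fact (m - k)))
  * (Ky' * (c * pw m (1 - Re y')) / INR (fact (m + k))))%R
with (K0 * Ky * Ky' * c * (bq m k * pw (m - k) (1 - Re y) * (pw m (th - 3) * pw m (1 - Re y'))))%R
  by (unfold bq; field; lra).
rewrite E.
replace (K0 * Ky * Ky' * c * Ke * pw m (-1 - d) * pw k (-2 + 2 * d))%R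
  with (K0 * Ky * Ky' * c * (Ke * pw m (-1 - d) * pw k (-2 + 2 * d)))%R by ring.
apply Rmult_le_compat_l; [repeat apply Rmult_le_pos; lra|].
replace (bq m k * pw (m - k) (1 - Re y) * (pw m (-2) * pw m (Re y - 1)))%R
  with (pw m (-2) * bq m k * (pw (m - k) (1 - Re y) * pw m (Re y - 1)))%R by ring.
apply Rle_trans with (pw m (-2) * bq m k * ((INR m + 1) / (INR (m - k) + 1)) ^ p)%R.
{ apply Rmult_le_compat_l; [apply Rmult_le_pos; lra|easy]. }
apply Rle_trans with (pw m (-2) * (Ke * pw m (1 - d) * pw k (-2 + 2 * d)))%R.
{ rewrite Rmult_assoc. apply Rmult_le_compat_l; [lra|]. rewrite Rmult_comm; easy. }
right. replace (-1 - d)%R with (-2 + (1 - d))%R by ring. rewrite <- (pw_plus m (-2)); ring.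
Qed.

Lemma row_near : exists K q, (0 < K)%R /\ forall k m, (1 <= m)%nat -> (m < k)%nat ->
  (Cmod (row k m) <= K * (pw m q * (/ 2) ^ m) * pw k (- th - 1))%R.
Proof.
destruct (rG_bound_m y) as [Ky [HKy Hy]]. destruct (rG_bound_p y') as [Ky' [HKy' Hy']].
set (c := Rpower 2 (Rabs (1 - Re y'))). assert (Hc : (0 < c)%R) by apply exp_pos.
exists (K0 * Ky * Ky' * c * 2)%R, (th - 3 + Rabs (- Re y))%R.
split; [repeat apply Rmult_lt_0_compat; lra|].
intros k m H1 H2. unfold row.
replace (y - INR k + INR m) with (y - INR (k - m)) by (rewrite minus_INR, RtoC_minus by lia; ring).
replace (y' + INR k + INR m) with (y' + INR (k + m)) by (rewrite plus_INR, RtoC_plus; ring).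
rewrite !Cmod_mult.
specialize (Hs m); specialize (Hy (k - m)%nat); specialize (Hy' (k + m)%nat).
assert (D := pw_double k m (1 - Re y') ltac:(lia)). fold c in D.
assert (R := pw_sub (k - m) m (- Re y)). replace (m + (k - m))%nat with k in R by lia.
assert (N1 := binom_ge_k k m H1 H2). assert (N2 := binom_ge_pow k m ltac:(lia)).
assert (F1 := INR_fact_pos m). assert (F2 := INR_fact_pos (k - m)). assert (F3 := INR_fact_pos (k + m)).
assert (F4 := INR_fact_pos k).
assert (P1 := pw_pos m (th - 3)). assert (P2 := pw_pos (k - m) (- Re y)).
assert (P3 := pw_pos k (- Re y)). assert (P4 := pw_pos k (1 - Re y')).
assert (P5 := pw_pos m (Rabs (- Re y))). assert (P6 := pw_pos (k + m) (1 - Re y')).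
assert (Hk : (1 <= INR k)%R) by (change 1%R with (INR 1); apply le_INR; lia).
assert (T : (0 < 2 ^ m)%R) by (apply pow_lt; lra).
assert (Fq : (INR (fact m) * INR (fact m) * INR (fact (k - m)) / INR (fact (k + m))
              <= (/ 2) ^ m * (2 * pw k (- (1))))%R).
{ unfold pw at 1. rewrite Rpower_Ropp, Rpower_1 by lra. rewrite pow_inv.
  apply Rmult_le_reg_r with (INR (fact (k + m)) * (INR k * 2 ^ m))%R.
  { repeat apply Rmult_lt_0_compat; lra. }
  apply Rle_trans with (INR (fact (k + m)) * 1)%R.
  - replace (INR (fact m) * INR (fact m) * INR (fact (k - m)) / INR (fact (k + m)) *
      (INR (fact (k + m)) * (INR k * 2 ^ m)))%R
    with (2 ^ m * (INR (fact m) * (INR k * (INR (fact m) * INR (fact (k - m))))))%R by (field; lra).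
    rewrite Rmult_1_r. apply Rle_trans with (2 := N2).
    apply Rmult_le_compat_l; [lra|]. apply Rmult_le_compat_l; lra.
  - replace (/ 2 ^ m * (2 * / (INR k + 1)) * (INR (fact (k + m)) * (INR k * 2 ^ m)))%R
      with (INR (fact (k + m)) * (2 * INR k / (INR k + 1)))%R by (field; lra).
    apply Rmult_le_compat_l; [lra|].
    apply Rmult_le_reg_r with (INR k + 1)%R; [lra|].
    replace (2 * INR k / (INR k + 1) * (INR k + 1))%R with (2 * INR k)%R by (field; lra). lra. }
apply Rle_trans with ((K0 * pw m (th - 3) * (INR (fact m) * INR (fact m)))
  * (Ky * (pw k (- Re y) * pw m (Rabs (- Re y))) * INR (fact (k - m)))
  * (Ky' * (c * pw k (1 - Re y')) / INR (fact (k + m))))%R.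
{ apply Rmult_le_compat; [apply Rmult_le_pos; apply Cmod_ge_0|apply Cmod_ge_0| |].
  - apply Rmult_le_compat; auto using Cmod_ge_0.
    apply Rle_trans with (1 := Hy). apply Rmult_le_compat_r; [lra|].
    apply Rmult_le_compat_l; lra.
  - apply Rle_trans with (1 := Hy'). unfold Rdiv. apply Rmult_le_compat_r.
    + apply Rlt_le, Rinv_0_lt_compat; easy.
    + apply Rmult_le_compat_l; lra. }
replace ((K0 * pw m (th - 3) * (INR (fact m) * INR (fact m)))
  * (Ky * (pw k (- Re y) * pw m (Rabs (- Re y))) * INR (fact (k - m)))
  * (Ky' * (c * pw k (1 - Re y')) / INR (fact (k + m))))%R
with (K0 * Ky * Ky' * c * (pw m (th - 3) * pw m (Rabs (- Re y))) * (pw k (- Re y) * pw k (1 - Re y'))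
  * (INR (fact m) * INR (fact m) * INR (fact (k - m)) / INR (fact (k + m))))%R by (field; lra).
rewrite !pw_plus.
replace (- Re y + (1 - Re y'))%R with (- th)%R by (rewrite Hth; ring).
replace (K0 * Ky * Ky' * c * 2 * (pw m (th - 3 + Rabs (- Re y)) * (/ 2) ^ m) * pw k (- th - 1))%R
with (K0 * Ky * Ky' * c * pw m (th - 3 + Rabs (- Re y)) * pw k (- th) * ((/ 2) ^ m * (2 * pw k (- (1)))))%R.
2:{ replace (- th - 1)%R with (- th + - (1))%R by ring. rewrite <- (pw_plus k (- th)); ring. }
apply Rmult_le_compat_l; [|easy].
repeat apply Rmult_le_pos; try lra; apply pw_ge0.
Qed.

(** The first term of a row is of the larger order k^(-th) and has a limit of
    its own, so it is kept apart. *)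
Lemma row_tail : exists K, (0 < K)%R /\ forall k,
  rbnd (fun m => Cmod (row k (S m))) (K * (pw k (- th - 1) + pw k (- 2 + 2 * d))).
Proof.
destruct row_far as [A [HA Hfar]]. destruct row_near as [B [q [HB Hnear]]].
destruct (rsummable_pw_half q) as [M1 HM1]. destruct (rsummable_pw (- 1 - d) ltac:(lra)) as [M2 HM2].
assert (G1 := rbnd_ge0 _ _ HM1). assert (G2 := rbnd_ge0 _ _ HM2).
exists (B * M1 + A * M2 + 1)%R; split.
{ assert (0 <= B * M1)%R by (apply Rmult_le_pos; lra). assert (0 <= A * M2)%R by (apply Rmult_le_pos; lra). lra. }
intros k.
set (P := pw k (- th - 1)). set (Q := pw k (- 2 + 2 * d)).
assert (HP : (0 < P)%R) by apply pw_pos. assert (HQ : (0 < Q)%R) by apply pw_pos.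
set (pr := fun j : nat => match j with O => None | S i => Some i end).
assert (R1 := rbnd_restrict S pr (fun i => eq_refl) _ _ HM1).
assert (R2 := rbnd_restrict S pr (fun i => eq_refl) _ _ HM2).
intros l Hl.
apply Rle_trans with (rsum (fun m => (B * P) * (pw (S m) q * (/ 2) ^ S m) + (A * Q) * pw (S m) (- 1 - d))%R l).
{ apply rsum_le; intros m _.
  assert (X1 : (0 <= B * P * (pw (S m) q * (/ 2) ^ S m))%R).
  { apply Rmult_le_pos; [apply Rmult_le_pos; lra|]. apply Rmult_le_pos; [apply pw_ge0|apply pow_le; lra]. }
  assert (X2 : (0 <= A * Q * pw (S m) (- 1 - d))%R).
  { apply Rmult_le_pos; [apply Rmult_le_pos; lra|apply pw_ge0]. }
  destruct (Nat.le_gt_cases k (S m)) as [Hk|Hk].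
  - generalize (Hfar k (S m) Hk). fold Q.
    replace (A * pw (S m) (-1 - d) * Q)%R with (A * Q * pw (S m) (-1 - d))%R by ring. lra.
  - generalize (Hnear k (S m) ltac:(lia) Hk). fold P.
    replace (B * (pw (S m) q * (/ 2) ^ S m) * P)%R with (B * P * (pw (S m) q * (/ 2) ^ S m))%R by ring. lra. }
rewrite rsum_plus, !rsum_scal.
specialize (R1 l Hl). specialize (R2 l Hl).
assert (Y1 := Rmult_le_compat_l (B * P) _ _ ltac:(apply Rmult_le_pos; lra) R1).
assert (Y2 := Rmult_le_compat_l (A * Q) _ _ ltac:(apply Rmult_le_pos; lra) R2).
assert (0 <= B * M1 * Q)%R by (repeat apply Rmult_le_pos; lra).
assert (0 <= A * M2 * P)%R by (repeat apply Rmult_le_pos; lra).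
lra.
Qed.

Lemma row_first : exists K, (0 < K)%R /\ forall k, (Cmod (row k 0) <= K * pw k (- th))%R.
Proof.
assert (A : asy (fun k => s 0%nat * rG (y - INR k) * rG (y' + INR k)) (- th) 0).
{ eapply asy_eq; [intros; reflexivity| | |asy_tac]; [rewrite Hth; ring|lia]. }
destruct (asy_bound _ _ A) as [K [HK H]]; exists K; split; [easy|]; intros k.
unfold row; simpl. rewrite !Cplus_0_r. apply H.
Qed.

Lemma row_bound : exists K, (0 < K)%R /\ forall k,
  rbnd (fun m => Cmod (row k m)) (K * (pw k (- th) + pw k (- 2 + 2 * d))).
Proof.
destruct row_tail as [A [HA Ht]]. destruct row_first as [B [HB Hf]].
exists (A + B)%R; split; [lra|]; intros k.
apply rbnd_weaken with (B * pw k (- th) + A * (pw k (- th - 1) + pw k (- 2 + 2 * d)))%R.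
- assert (P := pw_pos k (- th)). assert (Q := pw_pos k (-2 + 2 * d)).
  assert (pw k (- th - 1) <= pw k (- th))%R by (apply pw_le; lra).
  assert (A * pw k (- th - 1) <= A * pw k (- th))%R by (apply Rmult_le_compat_l; lra).
  assert (0 <= B * pw k (-2 + 2 * d))%R by (apply Rmult_le_pos; lra). lra.
- apply (rbnd_nat_S (fun m => Cmod (row k m))); [intros; apply Cmod_ge_0|apply Hf|apply Ht].
Qed.

End Rows.

(** * The nonterminating Saalschuetz theorem *)

Lemma lincomb1 (k a b x y : C) : a = b -> x - y = k * (a - b) -> x = y.
Proof. intros -> H. apply Cminus_eq. rewrite H; ring. Qed.

Lemma lincomb2 (k a b k' a' b' x y : C) :
  a = b -> a' = b' -> x - y = k * (a - b) + k' * (a' - b') -> x = y.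
Proof. intros -> -> H. apply Cminus_eq. rewrite H; ring. Qed.

(** The difference of the two sides of the nonterminating Saalschuetz theorem,
    multiplied by reciprocals of Gamma factors so as to be entire. *)
Definition saal (e f g D v : C) : C :=
  rG (1 + e - v) * rG (1 + f - v) * rG (1 + g - v) * bal e f g D v
  - rG e * rG f * rG g * bal (1 + e - v) (1 + f - v) (1 + g - v) (D + 1 - v) (2 - v)
  - sg v * (rG (D - e) * rG (D - f) * rG (D - g)).

(** A contiguous relation of the first series, with the matching one of the
    second, is a first-order recurrence for the difference: the inhomogeneous
    terms cancel. Likewise for [saal_shift_eD] and [saal_shift_egDv]. *)
Lemma saal_shift_gv e f g D v : D + v = e + f + g + 1 ->
  saal e f (g + 1) D (v + 1) = - (D - 1 - g) * saal e f g D v.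
Proof.
intros H. assert (HD : D = e + f + g + 1 - v) by (rewrite <- H; ring).
assert (C1 := bal_contig1 g e f D v ltac:(rewrite H; ring)).
rewrite (bal_perm1 (g + 1)), (bal_perm2 e), (bal_perm1 g), (bal_perm2 e g) in C1.
assert (C3 := bal_contig3 (e - v) (f - v) (1 + g - v) (D - v) (1 - v) ltac:(rewrite HD; ring)).
replace (e - v + 1) with (1 + e - v) in C3 by ring.
replace (f - v + 1) with (1 + f - v) in C3 by ring.
replace (D - v + 1) with (D + 1 - v) in C3 by ring.
replace (1 - v + 1) with (2 - v) in C3 by (replace (RtoC 2) with (1 + 1) by (rewrite <- RtoC_plus; easy); ring).
unfold saal.
replace (1 + e - (v + 1)) with (e - v) by ring.
replace (1 + f - (v + 1)) with (f - v) by ring.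
replace (1 + (g + 1) - (v + 1)) with (1 + g - v) by ring.
replace (D + 1 - (v + 1)) with (D - v) by ring.
replace (2 - (v + 1)) with (1 - v) by (replace (RtoC 2) with (1 + 1) by (rewrite <- RtoC_plus; easy); ring).
replace (D - (g + 1)) with (D - g - 1) by ring.
rewrite sg_S, (rGamma_rec (e - v)), (rGamma_rec (f - v)), (rGamma_rec (D - g - 1)), (rGamma_rec g).
replace (e - v + 1) with (1 + e - v) by ring.
replace (f - v + 1) with (1 + f - v) by ring.
replace (D - g - 1 + 1) with (D - g) by ring.
revert C1 C3.
generalize (bal e f (g + 1) D (v + 1)) (bal e f g D v) (bal (1 + e - v) (1 + f - v) (1 + g - v) (D + 1 - v) (2 - v))
  (bal (e - v) (f - v) (1 + g - v) (D - v) (1 - v)) (rG (1 + e - v)) (rG (1 + f - v)) (rG (1 + g - v))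
  (rG e) (rG f) (rG (g + 1)) (rG (D - e)) (rG (D - f)) (rG (D - g)) (sg v).
intros X1 X2 X3 X4 r1 r2 r3 r4 r5 r6 r7 r8 r9 s C1 C3.
apply (lincomb2 (r1 * r2 * r3) _ _ (- r4 * r5 * r6) _ _ _ _ C1 C3). rewrite HD; ring.
Qed.

Lemma RtoC_2 : RtoC 2 = 1 + 1.
Proof. rewrite <- RtoC_plus; easy. Qed.

Lemma saal_shift_eD e f g D v : D + v = e + f + g + 1 ->
  (D - f) * (D - g) * saal (e + 1) f g (D + 1) v = saal e f g D v.
Proof.
intros H. assert (HD : D = e + f + g + 1 - v) by (rewrite <- H; ring).
assert (C1 := bal_contig1 e f g v D ltac:(rewrite <- H; ring)).
rewrite !(bal_sym _ _ _ v) in C1.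
assert (C2 := bal_contig1 (1 + e - v) (1 + f - v) (1 + g - v) (2 - v) (D + 1 - v) ltac:(rewrite HD, RtoC_2; ring)).
rewrite !(bal_sym _ _ _ (2 - v)) in C2.
replace (1 + e - v + 1) with (1 + (e + 1) - v) in C2 by ring.
replace (D + 1 - v + 1) with (D + 1 + 1 - v) in C2 by ring.
unfold saal.
replace (D + 1 - (e + 1)) with (D - e) by ring.
replace (D + 1 - f) with (D - f + 1) by ring.
replace (D + 1 - g) with (D - g + 1) by ring.
rewrite (rGamma_rec (D - f)), (rGamma_rec (D - g)), (rGamma_rec e), (rGamma_rec (1 + e - v)).
replace (1 + e - v + 1) with (1 + (e + 1) - v) by ring.
revert C1 C2.
generalize (bal (e + 1) f g (D + 1) v) (bal e f g D v) (bal (1 + e - v) (1 + f - v) (1 + g - v) (D + 1 - v) (2 - v))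
  (bal (1 + (e + 1) - v) (1 + f - v) (1 + g - v) (D + 1 + 1 - v) (2 - v)) (rG (1 + (e + 1) - v)) (rG (1 + f - v)) (rG (1 + g - v))
  (rG (e + 1)) (rG f) (rG g) (rG (D - e)) (rG (D - f + 1)) (rG (D - g + 1)) (sg v).
intros X1 X2 X3 X4 r1 r2 r3 r4 r5 r6 r7 r8 r9 s C1 C2.
apply (lincomb2 (r1 * r2 * r3) _ _ (- r4 * r5 * r6) _ _ _ _ C1 C2). rewrite HD, RtoC_2; ring.
Qed.

Lemma saal_shift_egDv e f g D v : D + v = e + f + g + 1 ->
  (D - f) * saal (e + 1) f (g + 1) (D + 1) (v + 1) = - saal e f g D v.
Proof.
intros H. assert (HD : D = e + f + g + 1 - v) by (rewrite <- H; ring).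
assert (C3 := bal_contig3 e g f D v ltac:(rewrite H; ring)).
rewrite (bal_perm2 (e + 1)), (bal_perm2 e) in C3.
assert (C1 := bal_contig1 (f - v) (1 + e - v) (1 + g - v) (D + 1 - v) (1 - v) ltac:(rewrite HD; ring)).
rewrite (bal_perm1 (f - v + 1)), (bal_perm1 (f - v)) in C1.
replace (f - v + 1) with (1 + f - v) in C1 by ring.
replace (1 - v + 1) with (2 - v) in C1 by (rewrite RtoC_2; ring).
unfold saal.
replace (1 + (e + 1) - (v + 1)) with (1 + e - v) by ring.
replace (1 + f - (v + 1)) with (f - v) by ring.
replace (1 + (g + 1) - (v + 1)) with (1 + g - v) by ring.
replace (D + 1 + 1 - (v + 1)) with (D + 1 - v) by ring.
replace (2 - (v + 1)) with (1 - v) by (rewrite RtoC_2; ring).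
replace (D + 1 - (e + 1)) with (D - e) by ring.
replace (D + 1 - (g + 1)) with (D - g) by ring.
replace (D + 1 - f) with (D - f + 1) by ring.
rewrite sg_S, (rGamma_rec (f - v)), (rGamma_rec (D - f)), (rGamma_rec e), (rGamma_rec g).
replace (f - v + 1) with (1 + f - v) by ring.
revert C1 C3.
generalize (bal (e + 1) f (g + 1) (D + 1) (v + 1)) (bal e f g D v) (bal (1 + e - v) (1 + f - v) (1 + g - v) (D + 1 - v) (2 - v))
  (bal (1 + e - v) (f - v) (1 + g - v) (D + 1 - v) (1 - v)) (rG (1 + e - v)) (rG (1 + f - v)) (rG (1 + g - v))
  (rG (e + 1)) (rG f) (rG (g + 1)) (rG (D - e)) (rG (D - f + 1)) (rG (D - g)) (sg v).
intros X1 X2 X3 X4 r1 r2 r3 r4 r5 r6 r7 r8 r9 s C1 C3.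
apply (lincomb2 (- r4 * r5 * r6) _ _ (r1 * r2 * r3) _ _ _ _ C1 C3). rewrite HD, ?RtoC_2; ring.
Qed.

Lemma saal_perm1 e f g D v : saal e f g D v = saal f e g D v.
Proof. unfold saal. rewrite (bal_perm1 e), (bal_perm1 (1 + e - v)). ring. Qed.

Lemma saal_perm2 e f g D v : saal e f g D v = saal e g f D v.
Proof. unfold saal. rewrite (bal_perm2 e f), (bal_perm2 (1 + e - v) (1 + f - v)). ring. Qed.

(** The three recurrences combine to a shift in which no parameter of the second
    series moves except for its denominators. *)
Lemma saal_step e f g D v : D + v = e + f + g + 1 ->
  (D - e) * (D - f) * (D - g) * saal (e + 1) (f + 1) (g + 1) (D + 1 + 1) (v + 1)
  = - saal e f g D v.
Proof.
intros H. rewrite <- (saal_shift_egDv e f g D v H).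
rewrite (saal_perm1 (e + 1) f).
rewrite <- (saal_shift_eD f (e + 1) (g + 1) (D + 1) (v + 1)).
- rewrite (saal_perm1 (f + 1)). ring.
- replace (D + 1 + (v + 1)) with (D + v + 1 + 1) by ring. rewrite H; ring.
Qed.

(** An involution of the parameters exchanges the two series. *)
Lemma saal_flip e f g D v :
  saal (1 + e - v) (1 + f - v) (1 + g - v) (D + 1 - v) (2 - v) = - saal e f g D v.
Proof.
unfold saal.
replace (1 + (1 + e - v) - (2 - v)) with e by (rewrite RtoC_2; ring).
replace (1 + (1 + f - v) - (2 - v)) with f by (rewrite RtoC_2; ring).
replace (1 + (1 + g - v) - (2 - v)) with g by (rewrite RtoC_2; ring).
replace (D + 1 - v + 1 - (2 - v)) with D by (rewrite RtoC_2; ring).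
replace (2 - (2 - v)) with v by ring.
replace (D + 1 - v - (1 + e - v)) with (D - e) by ring.
replace (D + 1 - v - (1 + f - v)) with (D - f) by ring.
replace (D + 1 - v - (1 + g - v)) with (D - g) by ring.
replace (2 - v) with (- v + 1 + 1) by (rewrite RtoC_2; ring). rewrite !sg_S, sg_opp. ring.
Qed.

Lemma saal_iter e f g D v k : D + v = e + f + g + 1 ->
  saal e f g D v = sgn (Z.of_nat k) * (rising (D - e) k * rising (D - f) k * rising (D - g) k)
    * saal (e + INR k) (f + INR k) (g + INR k) (D + INR k + INR k) (v + INR k).
Proof.
intros H; induction k as [|k IH].
- simpl. rewrite !rising_0, !Cplus_0_r. unfold sgn; simpl. ring.
- rewrite IH, Nat2Z.inj_succ. unfold Z.succ. rewrite sgn_plus, !rising_S, !RtoC_S, !Cplus_assoc.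
  assert (S := saal_step (e + INR k) (f + INR k) (g + INR k) (D + INR k + INR k) (v + INR k)).
  replace (D + INR k + 1 + INR k + 1) with (D + INR k + INR k + 1 + 1) by ring.
  replace (D + INR k + INR k - (e + INR k)) with (D - e + INR k) in S by ring.
  replace (D + INR k + INR k - (f + INR k)) with (D - f + INR k) in S by ring.
  replace (D + INR k + INR k - (g + INR k)) with (D - g + INR k) in S by ring.
  replace (saal (e + INR k) (f + INR k) (g + INR k) (D + INR k + INR k) (v + INR k)) with
    (- - saal (e + INR k) (f + INR k) (g + INR k) (D + INR k + INR k) (v + INR k)) by ring.
  rewrite <- S.
  + replace (sgn 1) with (-(1)) by easy. ring.
  + replace (D + INR k + INR k + (v + INR k)) with (D + v + (INR k + INR k + INR k)) by ring. rewrite H; ring.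
Qed.

(** In the shifted series the factorials combine to [bq (k+m) k], and [bq_le]
    turns its Gaussian decay into the power k^(-2+2d). *)
Lemma saal_lim1 e f g D v d : D + v = e + f + g + 1 ->
  (0 < Re e)%R -> (0 < Re f)%R -> (0 < Re g)%R -> (0 < d <= 1)%R ->
  exists K, (0 < K)%R /\ forall k,
    (Cmod (bal (e + INR k) (f + INR k) (g + INR k) (D + INR k + INR k) (v + INR k))
      * (INR (fact k) * INR (fact k) * INR (fact k))
     <= K * pw k (3 - Re e - Re f - Re g) * pw k (- 2 + 2 * d))%R.
Proof.
intros H He Hf Hg Hd.
destruct (rising_lower e (rGamma_Re_pos e He)) as [Le [HLe He']].
destruct (rising_lower f (rGamma_Re_pos f Hf)) as [Lf [HLf Hf']].
destruct (rising_lower g (rGamma_Re_pos g Hg)) as [Lg [HLg Hg']].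
destruct (rising_bound e) as [Ke [HKe Hbe]]. destruct (rising_bound f) as [Kf [HKf Hbf]].
destruct (rising_bound g) as [Kg [HKg Hbg]].
destruct (rG_bound_p D) as [KD [HKD HbD]]. destruct (rG_bound_p v) as [Kv [HKv Hbv]].
set (c := Rpower 2 (Rabs (1 - Re D))). assert (Hc : (0 < c)%R) by apply exp_pos.
set (A := (Le * Lf * Lg * (Ke * Kf * Kg) * KD * Kv * c * 2)%R).
assert (HA : (0 < A)%R) by (unfold A; repeat apply Rmult_lt_0_compat; lra).
destruct (rsummable_pw (- 1 - d) ltac:(lra)) as [M HM]. assert (HM0 := rbnd_ge0 _ _ HM).
exists (A * M + 1)%R; split; [nra|]. intros k.
set (F := (INR (fact k) * INR (fact k) * INR (fact k))%R).
assert (HF : (0 < F)%R) by (unfold F; repeat apply Rmult_lt_0_compat; apply INR_fact_pos).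
set (P := pw k (3 - Re e - Re f - Re g)). assert (HP : (0 < P)%R) by apply pw_pos.
set (Q := pw k (- 2 + 2 * d)). assert (HQ : (0 < Q)%R) by apply pw_pos.
assert (X : rbnd (fun m => Cmod (bal_term (e + INR k) (f + INR k) (g + INR k) (D + INR k + INR k) (v + INR k) m))
   (/ F * (A * P * Q) * M)).
{ apply rbnd_le with (fun m => (/ F * (A * P * Q)) * pw m (- 1 - d))%R.
  2:{ apply rbnd_scal; [|exact HM]. apply Rmult_le_pos; [apply Rlt_le, Rinv_0_lt_compat, HF|].
      repeat apply Rmult_le_pos; lra. }
  intros m. set (n := (k + m)%nat).
  assert (Hri : forall z L, (0 < L)%R -> (forall j, pw j (Re z - 1) * INR (fact j) <= L * Cmod (rising z j))%R ->
     forall K, (0 < K)%R -> (forall j, Cmod (rising z j) <= K * pw j (Re z - 1) * INR (fact j))%R ->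
     (Cmod (rising (z + INR k) m) <= L * K * (pw n (Re z - 1) * INR (fact n)) * (pw k (1 - Re z) * / INR (fact k)))%R).
  { intros z L HL H1 K HK H2. assert (E := rising_plus z k m). fold n in E.
    assert (p1 := pw_pos k (Re z - 1)). assert (F1 := INR_fact_pos k).
    assert (p2 := pw_opp k (Re z - 1)). replace (- (Re z - 1))%R with (1 - Re z)%R in p2 by ring.
    assert (p3 := pw_pos k (1 - Re z)).
    apply (f_equal Cmod) in E. rewrite Cmod_mult in E.
    specialize (H1 k). specialize (H2 n). rewrite E in H2.
    assert (R1 := Cmod_ge_0 (rising (z + INR k) m)).
    apply Rmult_le_reg_r with (pw k (Re z - 1) * INR (fact k))%R; [nra|].
    replace (L * K * (pw n (Re z - 1) * INR (fact n)) * (pw k (1 - Re z) * / INR (fact k)) * (pw k (Re z - 1) * INR (fact k)))%R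
      with (L * (K * pw n (Re z - 1) * INR (fact n)) * (pw k (Re z - 1) * pw k (1 - Re z)))%R by (field; lra).
    rewrite p2, Rmult_1_r.
    apply Rle_trans with (L * (Cmod (rising z k) * Cmod (rising (z + INR k) m)))%R; [|apply Rmult_le_compat_l; lra].
    apply Rle_trans with (Cmod (rising (z + INR k) m) * (L * Cmod (rising z k)))%R; [|right; ring].
    apply Rmult_le_compat_l; easy. }
  assert (Y1 := Hri e Le HLe He' Ke HKe Hbe). assert (Y2 := Hri f Lf HLf Hf' Kf HKf Hbf).
  assert (Y3 := Hri g Lg HLg Hg' Kg HKg Hbg). clear Hri.
  assert (Y4 := HbD (n + k)%nat). assert (Y5 := Hbv n).
  replace (D + INR (n + k)) with (D + INR k + INR k + INR m) in Y4 by (unfold n; rewrite !plus_INR, !RtoC_plus; ring).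
  replace (v + INR n) with (v + INR k + INR m) in Y5 by (unfold n; rewrite !plus_INR, !RtoC_plus; ring).
  assert (Y6 := pw_double n k (1 - Re D) ltac:(unfold n; lia)). fold c in Y6.
  assert (Y7 := bq_le n k d ltac:(unfold n; lia) ltac:(lra)). fold Q in Y7.
  unfold bal_term. rewrite !Cmod_mult, Cmod_inv, Cmod_R, Rabs_pos_eq by (try apply INR_fact_C; apply Rlt_le, INR_fact_pos).
  assert (f1 := INR_fact_pos n). assert (f2 := INR_fact_pos m). assert (f3 := INR_fact_pos (n + k)).
  assert (f4 := INR_fact_pos k).
  assert (q1 := pw_pos n (Re e - 1)). assert (q2 := pw_pos n (Re f - 1)). assert (q3 := pw_pos n (Re g - 1)).
  assert (q4 := pw_pos n (1 - Re D)). assert (q5 := pw_pos n (1 - Re v)). assert (q6 := pw_pos (n + k) (1 - Re D)).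
  assert (t1 := pw_pos k (1 - Re e)). assert (t2 := pw_pos k (1 - Re f)). assert (t3 := pw_pos k (1 - Re g)).
  apply Rle_trans with (
   (Le * Ke * (pw n (Re e - 1) * INR (fact n)) * (pw k (1 - Re e) * / INR (fact k)))
   * (Lf * Kf * (pw n (Re f - 1) * INR (fact n)) * (pw k (1 - Re f) * / INR (fact k)))
   * (Lg * Kg * (pw n (Re g - 1) * INR (fact n)) * (pw k (1 - Re g) * / INR (fact k)))
   * / INR (fact m) * (KD * (c * pw n (1 - Re D)) / INR (fact (n + k)))
   * (Kv * pw n (1 - Re v) / INR (fact n)))%R.
  { assert (I : (0 <= / INR (fact m))%R) by (apply Rlt_le, Rinv_0_lt_compat; easy).
    repeat (apply Rmult_le_compat; [repeat apply Rmult_le_pos; auto using Cmod_ge_0|auto using Cmod_ge_0| |]); try easy; try lra.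
    apply Rle_trans with (1 := Y4). unfold Rdiv. apply Rmult_le_compat_r; [apply Rlt_le, Rinv_0_lt_compat; easy|].
    apply Rmult_le_compat_l; lra. }
  replace (
   (Le * Ke * (pw n (Re e - 1) * INR (fact n)) * (pw k (1 - Re e) * / INR (fact k)))
   * (Lf * Kf * (pw n (Re f - 1) * INR (fact n)) * (pw k (1 - Re f) * / INR (fact k)))
   * (Lg * Kg * (pw n (Re g - 1) * INR (fact n)) * (pw k (1 - Re g) * / INR (fact k)))
   * / INR (fact m) * (KD * (c * pw n (1 - Re D)) / INR (fact (n + k)))
   * (Kv * pw n (1 - Re v) / INR (fact n)))%R with
   (/ F * (Le * Lf * Lg * (Ke * Kf * Kg) * KD * Kv * c) * bq n k
     * (pw k (1 - Re e) * pw k (1 - Re f) * pw k (1 - Re g))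
     * (pw n (Re e - 1) * pw n (Re f - 1) * pw n (Re g - 1) * pw n (1 - Re D) * pw n (1 - Re v)))%R.
  2:{ unfold bq, F. replace (n - k)%nat with m by (unfold n; lia). field. lra. }
  rewrite !pw_plus.
  replace (1 - Re e + (1 - Re f) + (1 - Re g))%R with (3 - Re e - Re f - Re g)%R by ring. fold P.
  replace (Re e - 1 + (Re f - 1) + (Re g - 1) + (1 - Re D) + (1 - Re v))%R with (-2)%R.
  2:{ apply (f_equal Re) in H. destruct e, f, g, D, v; simpl in *; lra. }
  replace (pw m (-1 - d)) with (pw m (-1 - d) * 1)%R by ring.
  assert (Z1 : (pw n (-1 - d) <= pw m (-1 - d))%R) by (apply pw_anti; [unfold n; lia|lra]).
  apply Rle_trans with (/ F * (Le * Lf * Lg * (Ke * Kf * Kg) * KD * Kv * c) * (2 * pw n (1 - d) * Q) * P * pw n (-2))%R.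
  { repeat (apply Rmult_le_compat_r; [auto using pw_ge0; lra|]).
    apply Rmult_le_compat_l; [|easy]. apply Rmult_le_pos; [apply Rlt_le, Rinv_0_lt_compat, HF|].
    repeat apply Rmult_le_pos; lra. }
  replace (/ F * (Le * Lf * Lg * (Ke * Kf * Kg) * KD * Kv * c) * (2 * pw n (1 - d) * Q) * P * pw n (-2))%R
    with (/ F * (A * P * Q) * (pw n (-2) * pw n (1 - d)))%R by (unfold A; ring).
  rewrite pw_plus. replace (-2 + (1 - d))%R with (-1 - d)%R by ring. rewrite Rmult_1_r.
  apply Rmult_le_compat_l; [|easy]. apply Rmult_le_pos; [apply Rlt_le, Rinv_0_lt_compat, HF|].
  repeat apply Rmult_le_pos; lra. }
apply csum_bound in X. fold (bal (e + INR k) (f + INR k) (g + INR k) (D + INR k + INR k) (v + INR k)) in X.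
apply Rle_trans with (/ F * (A * P * Q) * M * F)%R; [apply Rmult_le_compat_r; [lra|exact X]|].
replace (/ F * (A * P * Q) * M * F)%R with (A * M * P * Q)%R by (field; lra).
assert (0 < P * Q)%R by (apply Rmult_lt_0_compat; lra).
rewrite !Rmult_assoc. rewrite <- (Rmult_assoc A M (P * Q)). apply Rmult_le_compat_r; lra.
Qed.

Lemma csum_nat_S (f : nat -> C) : summable f -> csum f = f 0%nat + csum (fun m => f (S m)).
Proof.
intros Hf.
assert (Hs : summable (fun m => f (S m))).
{ apply (summable_restrict S (fun j => match j with O => None | S i => Some i end)); easy. }
apply clim_unique with (fun n => fsum f (seq 0 (n + 1))).
- now apply (clim_shift (fun n => fsum f (seq 0 n))), csum_nat_clim.
- apply clim_ext with (fun n => f 0%nat + fsum (fun m => f (S m)) (seq 0 n)).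
  + intros n; rewrite Nat.add_1_r. induction n as [|n IH]; [simpl; ring|].
    rewrite fsum_seq_S, Cplus_assoc, IH. now rewrite <- (fsum_seq_S f (S n)).
  + apply clim_plus; [apply clim_const|now apply csum_nat_clim].
Qed.

Lemma falling_rising z n : falling z n = sgn (Z.of_nat n) * rising (1 - z) n.
Proof.
induction n as [|n IH]; [rewrite falling_0, rising_0; unfold sgn; simpl; ring|].
rewrite falling_S, rising_S, IH, Nat2Z.inj_succ, RtoC_S. unfold Z.succ; rewrite sgn_plus.
replace (sgn 1) with (-(1)) by easy. ring.
Qed.

Lemma asy_balcoef e f g :
  exists K, (0 < K)%R /\ forall m,
  (Cmod (rising e m * rising f m * rising g m * / INR (fact m))
    <= K * pw m (Re e + Re f + Re g - 3) * (INR (fact m) * INR (fact m)))%R.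
Proof.
assert (A : asy (fun m => rising e m * rising f m * rising g m * / INR (fact m)) (Re e + Re f + Re g - 3) 2).
{ eapply asy_eq; [intros; reflexivity| | |asy_tac]; [ring|lia]. }
destruct A as [K [HK H]]; exists K; split; [easy|]; intros m.
apply Rle_trans with (1 := H m). right. simpl. ring.
Qed.

Lemma pw_lim_scal K x (f : nat -> C) : (x < 0)%R ->
  (forall n, Cmod (f n) <= K * pw n x)%R -> clim f 0.
Proof.
intros Hx H. apply clim_squeeze with (fun n => K * pw n x)%R.
- intros n. replace (f n - 0) with (f n) by ring. apply H.
- apply lim0_scal; now apply pw_lim.
Qed.

(** By [saal_iter] the difference does not depend on k when it is computed from
    the parameters shifted k times; so it equals the limit for k to infinity. *)
Lemma saal_zero_pos e f g D v : D + v = e + f + g + 1 ->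
  (0 < Re e)%R -> (0 < Re f)%R -> (0 < Re g)%R ->
  (3 * Re D - 2 * (Re e + Re f + Re g) < 2)%R -> saal e f g D v = 0.
Proof.
intros H He Hf Hg Hth.
set (th := (3 * Re D - 2 * (Re e + Re f + Re g))%R) in *.
set (d := Rmin 1 ((2 - th) / 4)).
assert (Hd : (0 < d <= 1)%R).
{ split; [apply Rmin_glb_lt; lra|apply Rmin_l]. }
assert (Hd2 : (th - 2 + 2 * d < 0)%R) by (generalize (Rmin_r 1 ((2 - th) / 4)); fold d; lra).
assert (HRe : (Re D + Re v = Re e + Re f + Re g + 1)%R).
{ apply (f_equal Re) in H. destruct e, f, g, D, v; simpl in *; lra. }
set (e' := 1 + e - v). set (f' := 1 + f - v). set (g' := 1 + g - v). set (D' := D + 1 - v).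
set (y := 2 - v).
set (s := fun m => rising e' m * rising f' m * rising g' m * / INR (fact m)).
set (pr := fun k : nat => rising (D - e) k * rising (D - f) k * rising (D - g) k).
set (gm := fun k : nat => rG (e + INR k) * rG (f + INR k) * rG (g + INR k)).
set (P := rG (D - e) * rG (D - f) * rG (D - g)).
destruct (asy_balcoef e' f' g') as [Ks [HKs Hs]].
assert (Hrow := row_tail s y D' Ks th d HKs).
destruct Hrow as [Kt [HKt Htail]].
{ intros m. replace (th - 3)%R with (Re e' + Re f' + Re g' - 3)%R; [apply Hs|].
  unfold e', f', g', th. destruct e, f, g, v; simpl in *; lra. }
{ unfold y, D', th. destruct D, v; simpl in *; lra. }
{ easy. }
assert (Hpg : exists K, (0 < K)%R /\ forall k, (Cmod (pr k * gm k) <= K * pw k th)%R).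
{ apply asy_bound. unfold pr, gm. eapply asy_eq; [intros; reflexivity| | |asy_tac]; [|lia].
  unfold th. destruct e, f, g, D; simpl; lra. }
destruct Hpg as [Kp [HKp Hpg]].
destruct (saal_lim1 e f g D v d H He Hf Hg Hd) as [Kb [HKb Hb]].
assert (Hpr : exists K, (0 < K)%R /\ forall k, (Cmod (pr k) <= K * pw k (3 * Re D - (Re e + Re f + Re g) - 3)
    * (INR (fact k) * INR (fact k) * INR (fact k)))%R).
{ assert (A : asy pr (3 * Re D - (Re e + Re f + Re g) - 3) 3).
  { unfold pr. eapply asy_eq; [intros; reflexivity| | |asy_tac]; [|lia].
    destruct e, f, g, D; simpl; lra. }
  destruct A as [K [HK HA]]; exists K; split; [easy|]; intros k.
  apply Rle_trans with (1 := HA k). right; simpl; ring. }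
destruct Hpr as [Kr [HKr Hpr]].
set (bk := fun k : nat => bal (e + INR k) (f + INR k) (g + INR k) (D + INR k + INR k) (v + INR k)).
assert (Hrs : forall k, summable (row s y D' k)).
{ intros k. apply summable_ext with (bal_term e' f' g' (D' + INR k) (y - INR k)).
  - intros m. unfold bal_term, row, s. ring.
  - apply summable_bal_term. unfold e', f', g', D', y. rewrite RtoC_2.
    replace (D + 1 - v + INR k + (1 + 1 - v - INR k)) with (D + v + (1 + 1 + 1 - v - v - v)) by ring.
    rewrite H; ring. }
apply clim_unique with (fun _ : nat => saal e f g D v); [apply clim_const|].
apply clim_ext with (fun k => sgn (Z.of_nat k) * pr k * (rG e' * rG f' * rG g') * bk k
   - (sgn (Z.of_nat k) * pr k * gm k * row s y D' k 0
      + sgn (Z.of_nat k) * pr k * gm k * csum (fun m => row s y D' k (S m)) + sg v * P)).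
{ intros k. rewrite (saal_iter e f g D v k H). fold (pr k). unfold saal. fold (bk k).
  replace (1 + (e + INR k) - (v + INR k)) with e' by (unfold e'; ring).
  replace (1 + (f + INR k) - (v + INR k)) with f' by (unfold f'; ring).
  replace (1 + (g + INR k) - (v + INR k)) with g' by (unfold g'; ring).
  replace (D + INR k + INR k + 1 - (v + INR k)) with (D' + INR k) by (unfold D'; ring).
  replace (2 - (v + INR k)) with (y - INR k) by (unfold y; ring).
  replace (D + INR k + INR k - (e + INR k)) with (D - e + INR k) by ring.
  replace (D + INR k + INR k - (f + INR k)) with (D - f + INR k) by ring.
  replace (D + INR k + INR k - (g + INR k)) with (D - g + INR k) by ring.
  fold (gm k).
  replace (bal e' f' g' (D' + INR k) (y - INR k)) with (csum (row s y D' k)).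
  2:{ apply csum_ext; intros m. unfold bal_term, row, s. ring. }
  rewrite (csum_nat_S (row s y D' k)) by easy.
  assert (E : pr k * (rG (D - e + INR k) * rG (D - f + INR k) * rG (D - g + INR k)) = P).
  { unfold P, pr. rewrite (rGamma_rising (D - e) k), (rGamma_rising (D - f) k), (rGamma_rising (D - g) k). ring. }
  replace (sg (v + INR k)) with (sgn (Z.of_nat k) * sg v) by (rewrite <- Cz_nat; now rewrite sg_Z).
  apply (lincomb2 (sg v * (pr k * (rG (D - e + INR k) * rG (D - f + INR k) * rG (D - g + INR k))))
    _ _ (sg v) _ _ _ _ (sgn_sq (Z.of_nat k)) E).
  fold (pr k). ring. }
apply clim_val with (0 - (- (sg v * P) + 0 + sg v * P)); [ring|].
apply clim_minus; [|apply clim_plus; [apply clim_plus|apply clim_const]].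
(* The first series is O(k^(th-2+2d)) together with its prefactor. *)
- apply pw_lim_scal with (Kr * Cmod (rG e' * rG f' * rG g') * Kb)%R (th - 2 + 2 * d)%R; [easy|].
  intros k. rewrite !Cmod_mult, Cmod_sgn, Rmult_1_l, <- !Cmod_mult.
  rewrite (Cmod_mult (pr k * _)), (Cmod_mult (pr k)).
  set (G := Cmod (rG e' * rG f' * rG g')). assert (HG : (0 <= G)%R) by apply Cmod_ge_0.
  specialize (Hpr k). specialize (Hb k). fold (bk k) in Hb.
  set (F := (INR (fact k) * INR (fact k) * INR (fact k))%R) in *.
  assert (p1 := pw_pos k (3 * Re D - (Re e + Re f + Re g) - 3)).
  apply Rle_trans with (Kr * pw k (3 * Re D - (Re e + Re f + Re g) - 3) * F * G * Cmod (bk k))%R.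
  { apply Rmult_le_compat_r; [apply Cmod_ge_0|]. now apply Rmult_le_compat_r. }
  replace (Kr * pw k (3 * Re D - (Re e + Re f + Re g) - 3) * F * G * Cmod (bk k))%R
    with (Kr * G * pw k (3 * Re D - (Re e + Re f + Re g) - 3) * (Cmod (bk k) * F))%R by ring.
  replace (Kr * G * Kb * pw k (th - 2 + 2 * d))%R with
    (Kr * G * pw k (3 * Re D - (Re e + Re f + Re g) - 3) * (Kb * pw k (3 - Re e - Re f - Re g) * pw k (-2 + 2 * d)))%R.
  + apply Rmult_le_compat_l; [repeat apply Rmult_le_pos; lra|easy].
  + replace (th - 2 + 2 * d)%R with ((3 * Re D - (Re e + Re f + Re g) - 3) + ((3 - Re e - Re f - Re g) + (-2 + 2 * d)))%R by (unfold th; ring).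
    rewrite <- !(pw_plus k). ring.
(* In the second series only the leading term has a limit, and this limit
   cancels the product of Gamma factors. *)
- apply clim_ext with (fun k => rG (2 - v) * (rnrm (D - e) k * rnrm (D - f) k * rnrm (D - g) k * rnrm (v - 1) k
     * nrm e k * nrm f k * nrm g k * nrm D' k)).
  + intros k. unfold row, pr, gm, s, y. simpl (INR 0). simpl (INR (fact 0)). rewrite !rising_0, !Cplus_0_r.
    rewrite (rGamma_falling (2 - v)), falling_rising. replace (1 - (2 - v)) with (v - 1) by (rewrite RtoC_2; ring).
    rewrite !rnrm_rising, !nrm_rG.
    assert (E : cpw k (D - e - 1) * cpw k (D - f - 1) * cpw k (D - g - 1) * cpw k (v - 1 - 1) *
      cpw k (1 - e) * cpw k (1 - f) * cpw k (1 - g) * cpw k (1 - D') = 1).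
    { rewrite <- !cpw_plus. apply cpw_one. unfold D'.
      replace D with (e + f + g + 1 - v) by (rewrite <- H; ring). ring. }
    assert (Q := sgn_sq (Z.of_nat k)).
    match goal with |- ?l = ?r => transitivity (l * (sgn (Z.of_nat k) * sgn (Z.of_nat k))); [rewrite Q; ring|] end.
    cpw_collect E. apply INR_fact_C.
  + apply clim_val with (rG (2 - v) * (rG (D - e) * rG (D - f) * rG (D - g) * rG (v - 1) * 1 * 1 * 1 * 1)).
    { replace (sg v) with (- sg (v - 1)) by (rewrite sg_pred; ring). unfold sg, P.
      replace (1 - (v - 1)) with (2 - v) by (rewrite RtoC_2; ring). ring. }
    apply clim_scal. clim_tac.
(* The remaining terms are O(k^(-1)) + O(k^(th-2+2d)). *)
- apply pw_lim_scal with (Kp * Kt * 2)%R (Rmax (-1) (th - 2 + 2 * d)); [apply Rmax_lub_lt; lra|].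
  intros k. rewrite Cmod_mult.
  replace (sgn (Z.of_nat k) * pr k * gm k) with (sgn (Z.of_nat k) * (pr k * gm k)) by ring.
  rewrite Cmod_mult, Cmod_sgn, Rmult_1_l.
  assert (X := csum_bound _ _ (Htail k)). specialize (Hpg k).
  apply Rle_trans with ((Kp * pw k th) * (Kt * (pw k (- th - 1) + pw k (-2 + 2 * d))))%R.
  { apply Rmult_le_compat; auto using Cmod_ge_0. }
  replace ((Kp * pw k th) * (Kt * (pw k (- th - 1) + pw k (-2 + 2 * d))))%R
    with (Kp * Kt * (pw k th * pw k (- th - 1) + pw k th * pw k (-2 + 2 * d)))%R by ring.
  rewrite !pw_plus. rewrite (Rmult_assoc (Kp * Kt)). apply Rmult_le_compat_l; [apply Rmult_le_pos; lra|].
  assert (Y1 : (pw k (th + (- th - 1)) <= pw k (Rmax (-1) (th - 2 + 2 * d)))%R).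
  { apply pw_le. eapply Rle_trans; [|apply Rmax_l]. lra. }
  assert (Y2 : (pw k (th + (-2 + 2 * d)) <= pw k (Rmax (-1) (th - 2 + 2 * d)))%R).
  { apply pw_le. eapply Rle_trans; [|apply Rmax_r]. lra. }
  lra.
Qed.

Lemma saal_zero_small e f g D v : D + v = e + f + g + 1 ->
  (3 * Re D - 2 * (Re e + Re f + Re g) < 2)%R -> saal e f g D v = 0.
Proof.
intros H Hth.
destruct (nfloor_ex (Rabs (Re e) + Rabs (Re f) + Rabs (Re g))) as [k Hk].
{ generalize (Rabs_pos (Re e)) (Rabs_pos (Re f)) (Rabs_pos (Re g)); lra. }
assert (Ae := Rle_abs (- Re e)). assert (Af := Rle_abs (- Re f)). assert (Ag := Rle_abs (- Re g)).
rewrite Rabs_Ropp in Ae, Af, Ag.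
assert (Pe := Rabs_pos (Re e)). assert (Pf := Rabs_pos (Re f)). assert (Pg := Rabs_pos (Re g)).
rewrite (saal_iter e f g D v (S k) H).
assert (Hk' : (Rabs (Re e) + Rabs (Re f) + Rabs (Re g) < INR (S k))%R) by (rewrite S_INR; lra).
rewrite (saal_zero_pos (e + INR (S k))); [ring| | | | |].
- replace (D + INR (S k) + INR (S k) + (v + INR (S k))) with (D + v + (INR (S k) + INR (S k) + INR (S k))) by ring.
  rewrite H; ring.
- destruct e; cbn [Re fst Cplus RtoC snd] in *; lra.
- destruct f; cbn [Re fst Cplus RtoC snd] in *; lra.
- destruct g; cbn [Re fst Cplus RtoC snd] in *; lra.
- destruct e, f, g, D; cbn [Re fst Cplus RtoC snd] in *; lra.
Qed.

(** Every instance reduces to one where the limit applies, either directly or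
    after exchanging the roles of the two series. *)
Lemma saal_zero e f g D v : D + v = e + f + g + 1 -> saal e f g D v = 0.
Proof.
assert (A : forall N e f g D v, D + v = e + f + g + 1 ->
   (3 * Re D - 2 * (Re e + Re f + Re g) < 2 + 2 * INR N)%R -> saal e f g D v = 0).
2:{ intros H. destruct (nfloor_ex (Rabs (3 * Re D - 2 * (Re e + Re f + Re g)))) as [N HN]; [apply Rabs_pos|].
    apply (A N); [easy|]. generalize (Rle_abs (3 * Re D - 2 * (Re e + Re f + Re g))) (pos_INR N); lra. }
clear. induction N as [|N IH]; intros e f g D v H Hth.
{ apply saal_zero_small; [easy|]. simpl in Hth; lra. }
rewrite S_INR in Hth.
assert (B : forall e f g D v, D + v = e + f + g + 1 ->
   (3 * Re D - 2 * (Re e + Re f + Re g) < 2 + 2 * (INR N + 1))%R -> D - 1 - g <> 0 -> saal e f g D v = 0).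
{ clear - IH. intros e f g D v H Hth Hg.
  assert (E := saal_shift_gv e f g D v H).
  rewrite IH in E.
  - replace (saal e f g D v) with (- (D - 1 - g) * saal e f g D v * (/ (- (D - 1 - g)))).
    + rewrite <- E; ring.
    + field. replace (- D + 1 + g) with (- (D - 1 - g)) by ring. intros X. apply Hg. 
      replace (D - 1 - g) with (- - (D - 1 - g)) by ring. rewrite X; ring.
  - rewrite Cplus_assoc, H; ring.
  - destruct e, f, g, D; cbn [Re fst Cplus RtoC snd] in *; lra. }
destruct (classic (D - 1 - g = 0)) as [Eg|Hg]; [|now apply B].
destruct (classic (D - 1 - f = 0)) as [Ef|Hf].
2:{ rewrite saal_perm2. apply B; [rewrite H; ring| |easy]. lra. }
destruct (classic (D - 1 - e = 0)) as [Ee|He].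
2:{ rewrite saal_perm1, saal_perm2. apply B; [rewrite H; ring| |easy]. lra. }
(* Now e = f = g = D - 1, where the decay condition holds either as it stands or
   after exchanging the two series. *)
assert (Re e = Re D - 1)%R by (apply (f_equal Re) in Ee; destruct e, D; simpl in *; lra).
assert (Re f = Re D - 1)%R by (apply (f_equal Re) in Ef; destruct f, D; simpl in *; lra).
assert (Re g = Re D - 1)%R by (apply (f_equal Re) in Eg; destruct g, D; simpl in *; lra).
assert (HRe : (Re D + Re v = Re e + Re f + Re g + 1)%R).
{ apply (f_equal Re) in H. destruct e, f, g, D, v; simpl in *; lra. }
destruct (Rlt_le_dec (3 * Re D - 2 * (Re e + Re f + Re g)) 2) as [L|L].
{ now apply saal_zero_small. }
replace (saal e f g D v) with (- - saal e f g D v) by ring.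
rewrite <- saal_flip, saal_zero_small; [ring| |].
- rewrite RtoC_2. replace D with (e + f + g + 1 - v) by (rewrite <- H; ring). ring.
- destruct e, f, g, D, v; cbn [Re fst Cplus RtoC snd Cminus Copp] in *; lra.
Qed.

(** * Well-poised bilateral sums *)

(** Landau's O on the integers, at both ends. *)
Definition zO (f : Z -> C) (x : R) : Prop :=
  exists K, (0 < K)%R /\ forall k, (Cmod (f k) <= K * pz k x)%R.

Lemma zO_halves f x :
  asy (fun n => f (Z.of_nat n)) x 0 -> asy (fun n => f (- Z.of_nat n)%Z) x 0 -> zO f x.
Proof.
intros H1 H2. destruct (asy_bound _ _ H1) as [K [HK HK']]. destruct (asy_bound _ _ H2) as [L [HL HL']].
exists (K + L)%R; split; [lra|]. intros k. unfold pz.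
assert (P := pw_pos (Z.abs_nat k) x).
destruct (Z.le_ge_cases 0 k).
- specialize (HK' (Z.abs_nat k)). replace (Z.of_nat (Z.abs_nat k)) with k in HK' by lia. nra.
- specialize (HL' (Z.abs_nat k)). replace (- Z.of_nat (Z.abs_nat k))%Z with k in HL' by lia. nra.
Qed.

Lemma zO_nat f x : zO f x -> asy (fun n => f (Z.of_nat n)) x 0 /\ asy (fun n => f (- Z.of_nat n)%Z) x 0.
Proof.
intros [K [HK H]]; split; exists K; (split; [easy|]); intros n; simpl; rewrite Rmult_1_r.
- generalize (H (Z.of_nat n)); unfold pz; now rewrite Zabs2Nat.id.
- generalize (H (- Z.of_nat n)%Z); unfold pz. now replace (Z.abs_nat (- Z.of_nat n)) with n by lia.
Qed.

Lemma zO_mult f g x y : zO f x -> zO g y -> zO (fun k => f k * g k) (x + y).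
Proof.
intros [K [HK Hf]] [L [HL Hg]]; exists (K * L)%R; split; [nra|]; intros k.
unfold pz in *; rewrite Cmod_mult, <- pw_plus.
replace (K * L * (pw (Z.abs_nat k) x * pw (Z.abs_nat k) y))%R
  with ((K * pw (Z.abs_nat k) x) * (L * pw (Z.abs_nat k) y))%R by ring.
apply Rmult_le_compat; auto using Cmod_ge_0.
Qed.

Lemma zO_const c : zO (fun _ => c) 0.
Proof.
exists (Cmod c + 1)%R; split; [generalize (Cmod_ge_0 c); lra|].
intros k; unfold pz; rewrite pw_0. lra.
Qed.

Lemma zO_weaken f x y : (x <= y)%R -> zO f x -> zO f y.
Proof.
intros H [K [HK Hf]]; exists K; split; [easy|]; intros k.
apply Rle_trans with (1 := Hf k). apply Rmult_le_compat_l; [lra|now apply pw_le].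
Qed.

Lemma zO_eq f g x y : (forall k, f k = g k) -> x = y -> zO f x -> zO g y.
Proof. intros H <-; now replace g with f by now apply functional_extensionality. Qed.

Lemma zO_summable f x : zO f x -> (x < -1)%R -> summable f.
Proof.
intros [K [HK H]] Hx. apply summable_le with (fun k => K * pz k x)%R; [easy|].
apply rsummable_scal; [lra|now apply rsummable_pz].
Qed.

Lemma Cz_mnat n : Cz (- Z.of_nat n) = - RtoC (INR n).
Proof. now rewrite Cz_opp, Cz_nat. Qed.

(** Up to the sign (-1)^k and a constant this is (b)_k/(1+a-b)_k, the contribution
    of b to a well-poised bilateral series. It is entire in a and b. *)
Definition phi (a b : C) (k : Z) : C := rG (1 - b - Cz k) * rG (1 + a - b + Cz k).

Lemma zO_phi a b : zO (phi a b) (2 * Re b - Re a - 1).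
Proof.
apply zO_halves; unfold phi.
- eapply (asy_use (fun n => rG (1 - b - INR n) * rG (1 + a - b + INR n))); [asy_tac| |destruct a, b; simpl; ring|lia].
  intros n; now rewrite Cz_nat.
- eapply (asy_use (fun n => rG (1 - b + INR n) * rG (1 + a - b - INR n))); [asy_tac| |destruct a, b; simpl; ring|lia].
  intros n; rewrite Cz_mnat. f_equal; f_equal; ring.
Qed.

(** The very-well-poised factor a + 2k. *)
Definition vw (a : C) (k : Z) : C := a + Cz k + Cz k.

Lemma zO_vw a : zO (vw a) 1.
Proof.
apply zO_halves; unfold vw.
- exists (2 * (Cmod a + 1))%R; split; [generalize (Cmod_ge_0 a); lra|]; intros n.
  rewrite Cz_nat, pw_1; simpl. assert (A := pos_INR n). assert (B := Cmod_ge_0 a).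
  eapply Rle_trans; [apply Cmod_triangle|].
  eapply Rle_trans; [apply Rplus_le_compat_r, Cmod_triangle|].
  rewrite Cmod_R, Rabs_pos_eq by easy. nra.
- exists (2 * (Cmod a + 1))%R; split; [generalize (Cmod_ge_0 a); lra|]; intros n.
  rewrite Cz_mnat, pw_1; simpl. assert (A := pos_INR n). assert (B := Cmod_ge_0 a).
  eapply Rle_trans; [apply Cmod_triangle|].
  eapply Rle_trans; [apply Rplus_le_compat_r, Cmod_triangle|].
  rewrite Cmod_opp, Cmod_R, Rabs_pos_eq by easy. nra.
Qed.

Lemma phi_reflect a b k : phi (- a) (b - a) (- k) = phi a b k.
Proof.
unfold phi. rewrite Cz_opp.
replace (1 - (b - a) - - Cz k) with (1 + a - b + Cz k) by ring.
replace (1 + - a - (b - a) + - Cz k) with (1 - b - Cz k) by ring. ring.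
Qed.

Lemma phi_S a b k : phi a (b + 1) k = - ((b + Cz k) * (a - b + Cz k)) * phi a b k.
Proof.
unfold phi. rewrite (rGamma_rec (1 - (b + 1) - Cz k)), (rGamma_rec (1 + a - (b + 1) + Cz k)).
replace (1 - (b + 1) - Cz k + 1) with (1 - b - Cz k) by ring.
replace (1 + a - (b + 1) + Cz k + 1) with (1 + a - b + Cz k) by ring. ring.
Qed.

(** A product of such functions is an antidifference: its values at k and k+1
    are polynomial multiples of the product of the [phi a b k]. *)
Definition gphi (a b : C) (k : Z) : C := rG (1 - b - Cz k) * rG (a - b + Cz k).

Lemma gphi_0 a b k : gphi a b k = (a - b + Cz k) * phi a b k.
Proof.
unfold gphi, phi. rewrite (rGamma_rec (a - b + Cz k)).
replace (a - b + Cz k + 1) with (1 + a - b + Cz k) by ring. ring.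
Qed.

Lemma gphi_1 a b k : gphi a b (k + 1) = - (b + Cz k) * phi a b k.
Proof.
unfold gphi, phi. rewrite Cz_plus, Cz_1, (rGamma_rec (1 - b - (Cz k + 1))).
replace (1 - b - (Cz k + 1) + 1) with (1 - b - Cz k) by ring.
replace (a - b + (Cz k + 1)) with (1 + a - b + Cz k) by ring. ring.
Qed.

Lemma zO_gphi a b : zO (gphi a b) (2 * Re b - Re a).
Proof.
apply zO_halves; unfold gphi.
- eapply (asy_use (fun n => rG (1 - b - INR n) * rG (a - b + INR n))); [asy_tac| |destruct a, b; simpl; ring|lia].
  intros n; now rewrite Cz_nat.
- eapply (asy_use (fun n => rG (1 - b + INR n) * rG (a - b - INR n))); [asy_tac| |destruct a, b; simpl; ring|lia].
  intros n; rewrite Cz_mnat. f_equal; f_equal; ring.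
Qed.

Ltac zO_tac := repeat lazymatch goal with
  | |- zO (fun k => @?f k * @?g k) _ => apply (zO_mult f g)
  | |- zO (fun k => phi ?a ?b k) _ => apply zO_phi
  | |- zO (fun k => gphi ?a ?b k) _ => apply zO_gphi
  | |- zO (fun k => vw ?a k) _ => apply zO_vw
  | |- zO (fun _ => ?c) _ => apply zO_const
  end.

Lemma csum_telescope0 (f g : Z -> C) x :
  summable f -> (forall k, f k = g (k + 1)%Z - g k) -> zO g x -> (x < 0)%R -> csum f = 0.
Proof.
intros Hf Hg Hx Hx0. destruct (zO_nat _ _ Hx) as [H1 H2].
replace (RtoC 0) with (RtoC 0 - 0) by ring.
apply csum_telescope with g; [easy|easy| |]; now apply asy_lim0 with x.
Qed.

Lemma vw2_summable a b c : (Re b + Re c < Re a)%R ->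
  summable (fun k => vw a k * (phi a b k * phi a c k)).
Proof.
intros H. eapply zO_summable; [zO_tac|]. lra.
Qed.

(** The product of two [gphi] is an antidifference of b+c-a times the summand,
    and it vanishes at both ends. *)
Lemma vw2_zero a b c : (Re b + Re c < Re a)%R ->
  csum (fun k => vw a k * (phi a b k * phi a c k)) = 0.
Proof.
intros H.
assert (Hs := vw2_summable a b c H).
assert (E : (b + c - a) * csum (fun k => vw a k * (phi a b k * phi a c k)) = 0).
{ rewrite <- csum_scal by easy.
  apply csum_telescope0 with (fun k => gphi a b k * gphi a c k) ((2 * Re b - Re a) + (2 * Re c - Re a))%R.
  - now apply summable_scal.
  - intros k. rewrite !gphi_1, !gphi_0. unfold vw. ring.
  - zO_tac.
  - lra. }
assert (Hn : b + c - a <> 0).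
{ intros X. apply (f_equal Re) in X. destruct a, b, c; simpl in *; lra. }
replace (csum (fun k => vw a k * (phi a b k * phi a c k))) with
  (/ (b + c - a) * ((b + c - a) * csum (fun k => vw a k * (phi a b k * phi a c k)))) by (field; easy).
rewrite E; ring.
Qed.

(** * Dougall's bilateral 5H5 sum *)

Definition lam5t (a b c d e : C) (k : Z) : C :=
  vw a k * (phi a b k * phi a c k * phi a d k * phi a e k).

Definition lam5 (a b c d e : C) : C := csum (lam5t a b c d e).

Definition cv5 (a b c d e : C) : Prop := (0 < Re (1 + a + a - b - c - d - e))%R.

(** The Gamma quotient in Dougall's theorem, up to the factor [sg a]. *)
Definition y5 (a b c d e : C) : C :=
  / rG (1 + a + a - b - c - d - e)
  * (rG (1 + a - b - c) * rG (1 + a - b - d) * rG (1 + a - b - e)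
     * rG (1 + a - c - d) * rG (1 + a - c - e) * rG (1 + a - d - e)).

Definition err5 (a b c d e : C) : C := lam5 a b c d e - sg a * y5 a b c d e.

Lemma zO_lam5t a b c d e :
  zO (lam5t a b c d e) (2 * (Re b + Re c + Re d + Re e) - 4 * Re a - 3).
Proof.
unfold lam5t. eapply zO_eq; [intros k; reflexivity| |zO_tac]. ring.
Qed.

Lemma cv5_Re a b c d e : cv5 a b c d e <-> (0 < 1 + 2 * Re a - (Re b + Re c + Re d + Re e))%R.
Proof. unfold cv5. destruct a, b, c, d, e; simpl. split; lra. Qed.

Lemma lam5_summable a b c d e : cv5 a b c d e -> summable (lam5t a b c d e).
Proof. rewrite cv5_Re; intros H; eapply zO_summable; [apply zO_lam5t|lra]. Qed.

(** The product of the four [gphi] is the antidifference. *)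
Lemma lam5_rec a b c d e : cv5 a b c d (e + 1) ->
  (a + a - b - c - d - e) * lam5 a b c d (e + 1)
  = (a - b - e) * (a - c - e) * (a - d - e) * lam5 a b c d e.
Proof.
intros H. assert (H0 : cv5 a b c d e).
{ rewrite cv5_Re in *. destruct e; simpl in *; lra. }
assert (S1 := lam5_summable _ _ _ _ _ H). assert (S2 := lam5_summable _ _ _ _ _ H0).
apply Cminus_eq. unfold lam5.
rewrite <- !csum_scal, <- csum_minus by (easy || now apply summable_scal).
apply csum_telescope0 with (fun k => gphi a b k * gphi a c k * gphi a d k * gphi a e k)
  ((2 * Re b - Re a) + (2 * Re c - Re a) + (2 * Re d - Re a) + (2 * Re e - Re a))%R.
- apply summable_minus; now apply summable_scal.
- intros k. rewrite !gphi_1, !gphi_0. unfold lam5t, vw. rewrite phi_S. ring.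
- zO_tac.
- rewrite cv5_Re in H. destruct e; simpl in *; lra.
Qed.

Lemma err5_rec a b c d e : cv5 a b c d (e + 1) ->
  (a + a - b - c - d - e) * err5 a b c d (e + 1)
  = (a - b - e) * (a - c - e) * (a - d - e) * err5 a b c d e.
Proof.
intros H. assert (R := lam5_rec a b c d e H).
assert (Hn : a + a - b - c - d - e <> 0).
{ intros X. apply (f_equal Re) in X. unfold cv5 in H. destruct a, b, c, d, e; simpl in *; lra. }
assert (Hg : rG (1 + a + a - b - c - d - e) <> 0).
{ apply rGamma_Re_pos. unfold cv5 in H. destruct a, b, c, d, e; simpl in *; lra. }
unfold err5.
assert (Y : (a + a - b - c - d - e) * y5 a b c d (e + 1)
  = (a - b - e) * (a - c - e) * (a - d - e) * y5 a b c d e).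
{ unfold y5.
  replace (1 + a + a - b - c - d - (e + 1)) with (a + a - b - c - d - e) by ring.
  replace (1 + a - b - (e + 1)) with (a - b - e) by ring.
  replace (1 + a - c - (e + 1)) with (a - c - e) by ring.
  replace (1 + a - d - (e + 1)) with (a - d - e) by ring.
  rewrite (rGamma_rec (a + a - b - c - d - e)), (rGamma_rec (a - b - e)), (rGamma_rec (a - c - e)), (rGamma_rec (a - d - e)).
  replace (a + a - b - c - d - e + 1) with (1 + a + a - b - c - d - e) by ring.
  replace (a - b - e + 1) with (1 + a - b - e) by ring.
  replace (a - c - e + 1) with (1 + a - c - e) by ring.
  replace (a - d - e + 1) with (1 + a - d - e) by ring.
  field. split; easy. }
apply (lincomb2 1 _ _ (- sg a) _ _ _ _ R Y). ring.
Qed.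

Lemma err5_swap_de a b c d e : err5 a b c d e = err5 a b c e d.
Proof.
unfold err5, lam5. f_equal; [apply csum_ext; intros; unfold lam5t; ring|].
f_equal. unfold y5. replace (1 + a + a - b - c - e - d) with (1 + a + a - b - c - d - e) by ring.
replace (1 + a - e - d) with (1 + a - d - e) by ring. ring.
Qed.

Lemma err5_swap_bc a b c d e : err5 a b c d e = err5 a c b d e.
Proof.
unfold err5, lam5. f_equal; [apply csum_ext; intros; unfold lam5t; ring|].
f_equal. unfold y5. replace (1 + a + a - c - b - d - e) with (1 + a + a - b - c - d - e) by ring.
replace (1 + a - c - b) with (1 + a - b - c) by ring. ring.
Qed.

Lemma err5_swap_be a b c d e : err5 a b c d e = err5 a e c d b.
Proof.
unfold err5, lam5. f_equal; [apply csum_ext; intros; unfold lam5t; ring|].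
f_equal. unfold y5. replace (1 + a + a - e - c - d - b) with (1 + a + a - b - c - d - e) by ring.
replace (1 + a - e - c) with (1 + a - c - e) by ring.
replace (1 + a - e - d) with (1 + a - d - e) by ring.
replace (1 + a - e - b) with (1 + a - b - e) by ring.
replace (1 + a - c - b) with (1 + a - b - c) by ring.
replace (1 + a - d - b) with (1 + a - b - d) by ring. ring.
Qed.

Lemma err5_lower a b c d e : cv5 a b c d (e + 1) ->
  a - b - e <> 0 -> a - c - e <> 0 -> a - d - e <> 0 ->
  err5 a b c d (e + 1) = 0 -> err5 a b c d e = 0.
Proof.
intros H H1 H2 H3 E. assert (R := err5_rec a b c d e H). rewrite E in R.
replace (err5 a b c d e) with
  ((a - b - e) * (a - c - e) * (a - d - e) * err5 a b c d e * / ((a - b - e) * (a - c - e) * (a - d - e))).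
- rewrite <- R; ring.
- field. auto.
Qed.

Lemma err5_raise a b c d e : cv5 a b c d (e + 1) -> err5 a b c d e = 0 -> err5 a b c d (e + 1) = 0.
Proof.
intros H E. assert (R := err5_rec a b c d e H). rewrite E in R.
assert (Hn : a + a - b - c - d - e <> 0).
{ intros X. apply (f_equal Re) in X. unfold cv5 in H. destruct a, b, c, d, e; simpl in *; lra. }
replace (err5 a b c d (e + 1)) with
  ((a + a - b - c - d - e) * err5 a b c d (e + 1) * / (a + a - b - c - d - e)) by (field; easy).
rewrite R; ring.
Qed.

Lemma err5_raise_n a b c d e n : cv5 a b c d e -> err5 a b c d (e - INR n) = 0 -> err5 a b c d e = 0.
Proof.
revert e; induction n as [|n IH]; intros e H E.
- replace (e - INR 0) with e in E by (simpl; ring). easy.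
- replace e with (e - 1 + 1) by ring. apply err5_raise; [now replace (e - 1 + 1) with e by ring|].
  apply IH.
  + rewrite cv5_Re in *. destruct e; simpl in *; lra.
  + rewrite RtoC_S in E. now replace (e - 1 - INR n) with (e - (INR n + 1)) by ring.
Qed.

Lemma rG_Zneg k : (k <= 0)%Z -> rG (Cz k) = 0.
Proof.
intros H. replace k with (- Z.of_nat (Z.to_nat (- k)))%Z by lia. rewrite Cz_mnat. apply rGamma_neg.
Qed.

Lemma rG_1_pm k : (k <> 0)%Z -> rG (1 + Cz k) * rG (1 - Cz k) = 0.
Proof.
intros H. destruct (Z.lt_total k 0) as [L|[L|L]]; [|easy|].
- rewrite <- Cz_1, <- Cz_plus, rG_Zneg by lia. ring.
- rewrite <- Cz_1, <- Cz_minus, (rG_Zneg (1 - k)) by lia. ring.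
Qed.

(** With parameters a and 0 only the term k = 0 survives. *)
Lemma err5_base a b c : (0 < Re (1 + a - b - c))%R -> err5 a b c a 0 = 0.
Proof.
intros H. unfold err5.
assert (E : lam5 a b c a 0 = a * (phi a b 0 * phi a c 0 * phi a a 0 * phi a 0 0)).
{ unfold lam5. destruct (csum_finite (lam5t a b c a 0) [0%Z]) as [_ ->].
  - constructor; [easy|constructor].
  - intros k Hk. assert (k <> 0)%Z by (intros ->; apply Hk; now left).
    unfold lam5t. replace (phi a b k * phi a c k * phi a a k * phi a 0 k)
      with (phi a b k * phi a c k * (phi a a k * phi a 0 k)) by ring.
    replace (phi a a k * phi a 0 k) with (RtoC 0); [ring|].
    unfold phi. replace (1 + a - a + Cz k) with (1 + Cz k) by ring.
    replace (1 - 0 - Cz k) with (1 - Cz k) by ring.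
    transitivity (rG (1 - a - Cz k) * rG (1 + a - 0 + Cz k) * (rG (1 + Cz k) * rG (1 - Cz k))); [|ring].
    rewrite rG_1_pm by easy. ring.
  - unfold lam5t, vw. simpl. rewrite Cz_0. ring. }
rewrite E. unfold y5, sg, phi. rewrite Cz_0.
replace (1 + a + a - b - c - a - 0) with (1 + a - b - c) by ring.
replace (1 - a - 0) with (1 - a) by ring.
replace (1 - 0 - 0) with (RtoC 1) by ring.
replace (1 + a - a + 0) with (RtoC 1) by ring.
replace (1 + a - a - 0) with (RtoC 1) by ring.
replace (1 + a - b - a) with (1 - b) by ring.
replace (1 + a - c - a) with (1 - c) by ring.
replace (1 + a - b - 0) with (1 + a - b) by ring.
replace (1 + a - c - 0) with (1 + a - c) by ring.
replace (1 + a - b + 0) with (1 + a - b) by ring.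
replace (1 + a - c + 0) with (1 + a - c) by ring.
replace (1 - b - 0) with (1 - b) by ring.
replace (1 - c - 0) with (1 - c) by ring.
replace (1 + a - 0 + 0) with (1 + a) by ring.
rewrite rGamma_1, (rGamma_rec a). replace (a + 1) with (1 + a) by ring.
field. now apply rGamma_Re_pos.
Qed.

Lemma Re_neq_0 (z : C) : (0 < Re z)%R -> z <> 0.
Proof. intros H E; rewrite E in H; simpl in H; lra. Qed.

Lemma Re_plus x y : Re (x + y) = (Re x + Re y)%R. Proof. easy. Qed.
Lemma Re_minus x y : Re (x - y) = (Re x - Re y)%R. Proof. easy. Qed.
Lemma Re_opp x : Re (- x) = (- Re x)%R. Proof. easy. Qed.
Lemma Re_R (x : R) : Re (RtoC x) = x. Proof. easy. Qed.
Hint Rewrite Re_plus Re_minus Re_opp Re_R : re.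

(** Finite instances: lower the two parameters a and 0 while b and c are so
    negative that no factor vanishes, then raise b and c again. *)
Lemma err5_fin a b c n : cv5 a b c (a - INR n) (- INR n) -> err5 a b c (a - INR n) (- INR n) = 0.
Proof.
intros H.
destruct (nfloor_ex (Rabs (Re a) + Rabs (Re b) + Rabs (Re c) + 1)) as [m Hm].
{ generalize (Rabs_pos (Re a)) (Rabs_pos (Re b)) (Rabs_pos (Re c)); lra. }
assert (Aa := Rle_abs (Re a)). assert (Ba := Rle_abs (Re b)). assert (Ca := Rle_abs (Re c)).
assert (Aa' := Rle_abs (- Re a)). rewrite Rabs_Ropp in Aa'.
assert (Ab := Rabs_pos (Re b)). assert (Ac := Rabs_pos (Re c)). assert (Aaa := Rabs_pos (Re a)).
set (p := S m). assert (Hp : (Rabs (Re a) + Rabs (Re b) + Rabs (Re c) + 1 < INR p)%R) by (unfold p; rewrite S_INR; lra).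
set (b' := b - INR p). set (c' := c - INR p).
assert (Rb : Re b' = (Re b - INR p)%R) by (unfold b'; now autorewrite with re).
assert (Rc : Re c' = (Re c - INR p)%R) by (unfold c'; now autorewrite with re).
assert (A1 : forall j, err5 a b' c' (a - INR j) 0 = 0).
{ induction j as [|j IH].
  - replace (a - INR 0) with a by (simpl; ring). apply err5_base. autorewrite with re; lra.
  - rewrite err5_swap_de. rewrite err5_swap_de in IH. rewrite RtoC_S.
    assert (Hj := pos_INR j).
    replace (a - INR j) with (a - (INR j + 1) + 1) in IH by ring.
    apply err5_lower; [| | | |exact IH].
    + rewrite cv5_Re; autorewrite with re; lra.
    + apply Re_neq_0; autorewrite with re; lra.
    + apply Re_neq_0; autorewrite with re; lra.
    + apply Re_neq_0; autorewrite with re; lra. }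
assert (A2 : forall j, err5 a b' c' (a - INR n) (- INR j) = 0).
{ induction j as [|j IH].
  - replace (- INR 0) with (RtoC 0) by (simpl; ring). apply A1.
  - rewrite RtoC_S. assert (Hj := pos_INR j). assert (Hn := pos_INR n).
    replace (- INR j) with (- (INR j + 1) + 1) in IH by ring.
    apply err5_lower; [| | | |exact IH].
    + rewrite cv5_Re; autorewrite with re; lra.
    + apply Re_neq_0; autorewrite with re; lra.
    + apply Re_neq_0; autorewrite with re; lra.
    + apply Re_neq_0; autorewrite with re; lra. }
rewrite cv5_Re in H. autorewrite with re in H.
rewrite err5_swap_be. apply err5_raise_n with p.
{ rewrite cv5_Re; autorewrite with re; lra. }
fold b'. rewrite err5_swap_be, err5_swap_bc, err5_swap_be. apply err5_raise_n with p.
{ rewrite cv5_Re; autorewrite with re; lra. }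
fold c'. rewrite err5_swap_be, err5_swap_bc. apply A2.
Qed.

(** ** Gaussian cut-offs *)

Lemma exp_m1_le u : (0 <= u)%R -> (exp u - 1 <= u * exp u)%R.
Proof.
intros H. assert (A := exp_ineq1_le (- u)). rewrite exp_Ropp in A.
assert (P := exp_pos u).
assert (exp u * (1 + - u) <= exp u * / exp u)%R by (apply Rmult_le_compat_l; lra).
rewrite Rinv_r in H0 by lra. lra.
Qed.

(** The recursion of [phi a (d - n) j / phi a (d - n) 0] in j, with h = a - d. For
    d = h = 0 its solution is [bq n], with which the general solution is compared. *)
Definition cutseq (d h : C) (n : nat) (c : nat -> C) : Prop :=
  c 0%nat = 1 /\ forall j, c (S j) * (INR n + 1 + h + INR j) = c j * (INR n - d - INR j).

(** Up to j = n/2 each step differs from the corresponding step of [bq n] by a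
    factor 1 + O(1/n) only. *)
Lemma cut_body d h (C0 := (Cmod d + Cmod h + 1)%R) n c j :
  (8 * C0 <= INR n)%R -> cutseq d h n c -> (2 * j <= n)%nat ->
  (Cmod (c j - bq n j) <= (exp (INR j * (8 * C0 / INR n)) - 1) * bq n j)%R.
Proof.
intros Hn [Hc0 HcS].
assert (Hd := Cmod_ge_0 d). assert (Hh := Cmod_ge_0 h).
assert (HC0 : (1 <= C0)%R) by (unfold C0; lra).
set (q := (8 * C0 / INR n)%R). assert (Hq : (0 < q)%R) by (apply Rdiv_lt_0_compat; lra).
induction j as [|j IH]; intros Hj.
- rewrite Hc0. simpl. rewrite Rmult_0_l, exp_0. unfold bq. rewrite Nat.sub_0_r, Nat.add_0_r.
  assert (F := INR_fact_pos n). replace (INR (fact n) * INR (fact n) / (INR (fact n) * INR (fact n)))%R with 1%R by (field; lra).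
  replace (1 - 1) with (RtoC 0) by ring. rewrite Cmod_0; lra.
- specialize (IH ltac:(lia)). specialize (HcS j). assert (B := bq_S n j ltac:(lia)).
  apply le_INR in Hj. rewrite mult_INR, (S_INR j) in Hj. simpl (INR 2) in Hj.
  assert (Hj0 := pos_INR j). set (x := INR n) in *. set (y := INR j) in *.
  assert (Hxy : (x / 2 <= x - y)%R) by lra.
  assert (Hb := bq_pos n j). assert (Hb' := bq_pos n (S j)).
  set (t := ((x - y) / (x + y + 1))%R).
  assert (Ht : (0 < t)%R) by (apply Rdiv_lt_0_compat; lra).
  assert (Eb : bq n (S j) = (bq n j * t)%R).
  { unfold t. apply Rmult_eq_reg_r with (x + y + 1)%R; [|lra]. rewrite B. field; lra. }
  assert (Hden : (x / 2 <= Cmod (x + 1 + h + y))%R).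
  { assert (S := Cmod_split (RtoC (x + 1 + y)) (- h)). rewrite Cmod_opp in S.
    replace (RtoC (x + 1 + y) - - h) with (x + 1 + h + y) in S by (rewrite !RtoC_plus; ring).
    rewrite Cmod_R, Rabs_pos_eq in S by lra. unfold C0 in *; lra. }
  assert (Hden0 : x + 1 + h + y <> 0) by (intros E; rewrite E, Cmod_0 in Hden; lra).
  set (r := (x - d - y) * (x + 1 + y) / ((x - y) * (x + 1 + h + y))).
  assert (Hxy0 : x - y <> 0).
  { rewrite <- RtoC_minus. intros E; apply RtoC_inj in E; lra. }
  assert (Hxy1 : x + 1 + y <> 0).
  { rewrite <- !RtoC_plus. intros E; apply RtoC_inj in E; lra. }
  assert (Hr : (Cmod (r - 1) <= q)%R).
  { unfold r. replace ((x - d - y) * (x + 1 + y) / ((x - y) * (x + 1 + h + y)) - 1)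
      with ((- d * (x + 1 + y) + - h * (x - y)) / ((x - y) * (x + 1 + h + y))) by (field; split; easy).
    rewrite Cmod_div by now apply Cmult_neq_0.
    assert (N1 : (Cmod (- d * (x + 1 + y) + - h * (x - y)) <= C0 * (2 * x))%R).
    { eapply Rle_trans; [apply Cmod_triangle|].
      rewrite !Cmod_mult, !Cmod_opp, <- !RtoC_plus, <- RtoC_minus, !Cmod_R, !Rabs_pos_eq by lra.
      apply Rle_trans with (Cmod d * (2 * x) + Cmod h * (2 * x))%R.
      - apply Rplus_le_compat; apply Rmult_le_compat_l; lra.
      - unfold C0; nra. }
    assert (N2 : (x / 2 * (x / 2) <= Cmod ((x - y) * (x + 1 + h + y)))%R).
    { rewrite Cmod_mult, <- RtoC_minus, Cmod_R, Rabs_pos_eq by lra.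
      apply Rmult_le_compat; lra. }
    assert (Hx2 : (0 < x / 2 * (x / 2))%R) by (apply Rmult_lt_0_compat; lra).
    apply Rmult_le_reg_r with (Cmod ((x - y) * (x + 1 + h + y))); [lra|].
    match goal with |- (?u / ?w * ?w <= _)%R => replace (u / w * w)%R with u by (field; lra) end.
    apply Rle_trans with (1 := N1). apply Rle_trans with (q * (x / 2 * (x / 2)))%R.
    - right. unfold q. field. lra.
    - apply Rmult_le_compat_l; lra. }
  assert (Ec : c (S j) = RtoC t * (c j * r)).
  { replace (c (S j)) with (c (S j) * (x + 1 + h + y) * / (x + 1 + h + y)) by (field; easy).
    rewrite HcS. unfold r, t. rewrite RtoC_div, RtoC_minus, !RtoC_plus by lra. field.
    repeat split; try easy. replace (x + y + 1) with (x + 1 + y) by ring. easy. }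
  rewrite Ec, Eb. rewrite S_INR. fold y.
  replace ((y + 1) * q)%R with (y * q + q)%R by ring. rewrite exp_plus.
  replace (RtoC t * (c j * r) - RtoC (bq n j * t)) with (RtoC t * ((c j - bq n j) * r + bq n j * (r - 1)))
    by (rewrite RtoC_mult; ring).
  rewrite Cmod_mult, Cmod_R, Rabs_pos_eq by lra.
  assert (R1 : (Cmod r <= 1 + q)%R).
  { assert (S := Cmod_split r 1). rewrite Cmod_1 in S. lra. }
  set (E := exp (y * q)) in *.
  assert (HE : (1 <= E)%R).
  { unfold E. rewrite <- exp_0. apply exp_le. apply Rmult_le_pos; lra. }
  assert (Q1 : (1 + q <= exp q)%R) by apply exp_ineq1_le.
  replace ((E * exp q - 1) * (bq n j * t))%R with (t * ((E * exp q - 1) * bq n j))%R by ring.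
  apply Rmult_le_compat_l; [lra|].
  eapply Rle_trans; [apply Cmod_triangle|]. rewrite !Cmod_mult, Cmod_R, Rabs_pos_eq by lra.
  apply Rle_trans with ((E - 1) * bq n j * (1 + q) + bq n j * q)%R.
  + apply Rplus_le_compat.
    * apply Rmult_le_compat; auto using Cmod_ge_0.
    * apply Rmult_le_compat_l; lra.
  + replace ((E - 1) * bq n j * (1 + q) + bq n j * q)%R with ((E * (1 + q) - 1) * bq n j)%R by ring.
    apply Rmult_le_compat_r; [lra|]. nra.
Qed.

(** Beyond n/2 every step gains the factor ((j+1)/(j+2))^2, so that the
    solution is O(j^(-2)) from there on. *)
Lemma cut_step d h (C0 := (Cmod d + Cmod h + 1)%R) n c j :
  (8 * C0 <= INR n)%R -> cutseq d h n c -> (n <= 2 * j + 1)%nat ->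
  (Cmod (c (S j)) * ((INR j + 2) * (INR j + 2)) <= Cmod (c j) * ((INR j + 1) * (INR j + 1)))%R.
Proof.
intros Hn [_ HcS] Hj. specialize (HcS j).
assert (Hd := Cmod_ge_0 d). assert (Hh := Cmod_ge_0 h).
assert (HC0 : (1 <= C0)%R) by (unfold C0; lra).
apply le_INR in Hj. rewrite plus_INR, mult_INR in Hj. simpl in Hj.
assert (Hj0 := pos_INR j). set (x := INR n) in *. set (y := INR j) in *.
assert (Hden : (x + y + 1 - C0 <= Cmod (x + 1 + h + y))%R).
{ assert (S := Cmod_split (RtoC (x + 1 + y)) (- h)). rewrite Cmod_opp in S.
  replace (RtoC (x + 1 + y) - - h) with (x + 1 + h + y) in S by (rewrite !RtoC_plus; ring).
  rewrite Cmod_R, Rabs_pos_eq in S by lra. unfold C0 in *; lra. }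
assert (Hnum : (Cmod (x - d - y) <= Rabs (x - y) + C0)%R).
{ replace (x - d - y) with (RtoC (x - y) + - d) by (rewrite RtoC_minus; ring).
  eapply Rle_trans; [apply Cmod_triangle|]. rewrite Cmod_R, Cmod_opp. unfold C0; lra. }
apply (f_equal Cmod) in HcS. rewrite !Cmod_mult in HcS.
assert (P0 := Cmod_ge_0 (c j)). assert (P1 := Cmod_ge_0 (c (S j))).
set (D := Cmod (x + 1 + h + y)) in *. set (N := Cmod (x - d - y)) in *.
assert (HD : (0 < D)%R) by lra.
assert (K : (N * ((y + 2) * (y + 2)) <= D * ((y + 1) * (y + 1)))%R).
{ apply Rle_trans with ((Rabs (x - y) + C0) * ((y + 2) * (y + 2)))%R.
  { apply Rmult_le_compat_r; [nra|easy]. }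
  apply Rle_trans with ((x + y + 1 - C0) * ((y + 1) * (y + 1)))%R.
  2:{ apply Rmult_le_compat_r; [nra|lra]. }
  destruct (Rle_lt_dec y x) as [L|L].
  - rewrite Rabs_pos_eq by lra.
    apply Rle_trans with ((x / 2 + / 2 + C0) * (2 * ((y + 1) * (y + 1))))%R.
    + apply Rmult_le_compat; [lra|nra|lra|nra].
    + rewrite <- Rmult_assoc. apply Rmult_le_compat_r; [nra|]. lra.
  - rewrite Rabs_minus_sym, Rabs_pos_eq by lra.
    set (p := (x - C0)%R). assert (1 <= p)%R by (unfold p; lra).
    replace (y - x + C0)%R with (y - p)%R by (unfold p; ring).
    replace (x + y + 1 - C0)%R with (y + p + 1)%R by (unfold p; ring).
    assert (0 <= (p - 1) * ((y + 2) * (y + 2) + (y + 1) * (y + 1)))%R by (apply Rmult_le_pos; nra).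
    nra. }
apply Rmult_le_reg_r with D; [easy|].
replace (Cmod (c (S j)) * ((y + 2) * (y + 2)) * D)%R with (Cmod (c (S j)) * D * ((y + 2) * (y + 2)))%R by ring.
rewrite HcS. nra.
Qed.

Lemma cut_est d h : exists K N, (0 < K)%R /\ forall n c, (N <= n)%nat -> cutseq d h n c ->
  (forall j, (2 * j <= n)%nat -> Cmod (c j - bq n j) <= K * (pw j 1 * pw n (- (1))) * bq n j)%R
  /\ (forall j, (n <= 2 * j + 1)%nat -> Cmod (c j) <= K * pw n 1 * pw j (- (2)))%R.
Proof.
set (C0 := (Cmod d + Cmod h + 1)%R).
assert (HC0 : (1 <= C0)%R) by (unfold C0; generalize (Cmod_ge_0 d) (Cmod_ge_0 h); lra).
destruct (nfloor_ex (8 * C0)%R ltac:(lra)) as [N HN].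
set (E := exp (4 * C0)). assert (HE : (1 <= E)%R).
{ unfold E; rewrite <- exp_0; apply exp_le; lra. }
exists (16 * C0 * E + 2 * E)%R, (S N); split; [nra|]. intros n c Hn Hc.
apply le_INR in Hn. rewrite S_INR in Hn.
assert (Hn8 : (8 * C0 <= INR n)%R) by lra.
assert (Hq : forall j, (2 * j <= n)%nat -> (INR j * (8 * C0 / INR n) <= 4 * C0)%R).
{ intros j Hj. apply le_INR in Hj. rewrite mult_INR in Hj. simpl (INR 2) in Hj.
  apply Rmult_le_reg_r with (INR n); [lra|].
  replace (INR j * (8 * C0 / INR n) * INR n)%R with (8 * C0 * INR j)%R by (field; lra). nra. }
assert (Hq0 : forall j, (0 <= INR j * (8 * C0 / INR n))%R).
{ intros j. apply Rmult_le_pos; [apply pos_INR|]. apply Rlt_le, Rdiv_lt_0_compat; lra. }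
split.
- intros j Hj. apply Rle_trans with (1 := cut_body d h n c j Hn8 Hc Hj).
  apply Rmult_le_compat_r; [apply Rlt_le, bq_pos|]. fold C0.
  eapply Rle_trans; [apply exp_m1_le, Hq0|].
  rewrite pw_1. unfold pw; rewrite Rpower_Ropp, Rpower_1 by apply INR1_pos.
  apply Rle_trans with (INR j * (8 * C0 / INR n) * E)%R.
  { apply Rmult_le_compat_l; [apply Hq0|]. apply exp_le, Hq, Hj. }
  assert (Hj0 := pos_INR j).
  assert (A : (/ INR n <= 2 * / (INR n + 1))%R).
  { apply Rmult_le_reg_r with (INR n * (INR n + 1))%R; [nra|].
    replace (/ INR n * (INR n * (INR n + 1)))%R with (INR n + 1)%R by (field; lra).
    replace (2 * / (INR n + 1) * (INR n * (INR n + 1)))%R with (2 * INR n)%R by (field; lra). lra. }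
  assert (I : (0 < / (INR n + 1))%R) by (apply Rinv_0_lt_compat; lra).
  assert (B : (INR j * / INR n <= (INR j + 1) * (2 * / (INR n + 1)))%R).
  { apply Rmult_le_compat; try lra. apply Rlt_le, Rinv_0_lt_compat; lra. }
  replace (INR j * (8 * C0 / INR n) * E)%R with (8 * C0 * E * (INR j * / INR n))%R by (unfold Rdiv; ring).
  apply Rle_trans with (8 * C0 * E * ((INR j + 1) * (2 * / (INR n + 1))))%R.
  { apply Rmult_le_compat_l; [nra|easy]. }
  assert (0 <= E * ((INR j + 1) * / (INR n + 1)))%R by (repeat apply Rmult_le_pos; lra). nra.
- set (j0 := Nat.div2 n).
  assert (Hj0 : (2 * j0 <= n /\ n <= 2 * j0 + 1)%nat).
  { unfold j0. generalize (Nat.div2_odd n). destruct (Nat.odd n); simpl; lia. }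
  assert (V0 : (Cmod (c j0) * ((INR j0 + 1) * (INR j0 + 1)) <= 2 * E * (INR n + 1))%R).
  { assert (X1 := cut_body d h n c j0 Hn8 Hc (proj1 Hj0)). fold C0 in X1.
    assert (X2 := Cmod_split (c j0) (RtoC (bq n j0))). rewrite Cmod_R, Rabs_pos_eq in X2 by apply Rlt_le, bq_pos.
    assert (X3 := bq_gauss n j0 ltac:(lia)). assert (P := bq_pos n j0).
    assert (X4 : (exp (INR j0 * (8 * C0 / INR n)) <= E)%R) by (apply exp_le, Hq, Hj0).
    assert (X5 : (Cmod (c j0) <= E * bq n j0)%R) by nra.
    assert (X6 : ((INR j0 + 1) * (INR j0 + 1) <= 2 * (INR n + 1 + INR j0 * INR j0))%R).
    { generalize (Rle_0_sqr (INR j0 - 1)); unfold Rsqr; lra. }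
    apply Rle_trans with (E * bq n j0 * (2 * (INR n + 1 + INR j0 * INR j0)))%R.
    - apply Rmult_le_compat; [apply Cmod_ge_0| |easy|easy].
      apply Rmult_le_pos; generalize (pos_INR j0); lra.
    - replace (E * bq n j0 * (2 * (INR n + 1 + INR j0 * INR j0)))%R
        with (2 * E * (bq n j0 * (INR n + 1 + INR j0 * INR j0)))%R by ring.
      apply Rmult_le_compat_l; lra. }
  assert (V : forall i, (Cmod (c (j0 + i)%nat) * ((INR (j0 + i) + 1) * (INR (j0 + i) + 1)) <= 2 * E * (INR n + 1))%R).
  { induction i as [|i IH]; [rewrite Nat.add_0_r; easy|].
    apply Rle_trans with (2 := IH). rewrite Nat.add_succ_r, S_INR.
    replace (INR (j0 + i) + 1 + 1)%R with (INR (j0 + i) + 2)%R by ring.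
    apply cut_step with d h n; [exact Hn8|easy|lia]. }
  intros j Hj. replace j with (j0 + (j - j0))%nat by lia. set (i := (j - j0)%nat). specialize (V i).
  set (k := (j0 + i)%nat) in *. assert (Hk := INR1_pos k).
  replace (- (2))%R with (- (1) + - (1))%R by ring. rewrite <- pw_plus, pw_1.
  unfold pw; rewrite Rpower_Ropp, Rpower_1 by easy.
  apply Rmult_le_reg_r with ((INR k + 1) * (INR k + 1))%R; [nra|].
  replace ((16 * C0 * E + 2 * E) * (INR n + 1) * (/ (INR k + 1) * / (INR k + 1)) * ((INR k + 1) * (INR k + 1)))%R
    with ((16 * C0 * E + 2 * E) * (INR n + 1))%R by (field; lra).
  apply Rle_trans with (1 := V). apply Rmult_le_compat_r; [lra|]. nra.
Qed.

Definition cutref (n j : nat) : R := if (2 * j <=? n)%nat then (bq n j * bq n j)%R else 0%R.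

Lemma pw_le2 n j x : (INR n + 1 <= 2 * (INR j + 1))%R -> (0 <= x)%R ->
  (pw n x <= Rpower 2 x * pw j x)%R.
Proof.
intros H Hx. unfold pw. rewrite Rpower_mult_distr by (try lra; apply INR1_pos).
apply Rle_Rpower_l; [easy|]. generalize (INR1_pos n); lra.
Qed.

(** Both products of two solutions are close to the same reference, the square
    of the bell curve. *)
Lemma cut_pair d h d' h' t : (0 < t <= 1)%R -> exists K N, (0 < K)%R /\
  forall n c c', (N <= n)%nat -> cutseq d h n c -> cutseq d' h' n c' -> forall j,
  (Cmod (c j * c' j - cutref n j) <= K * pw n (1 - 2 * t) * pw j (- 3 + 4 * t))%R.
Proof.
intros Ht. destruct (cut_est d h) as [K [N [HK H]]]. destruct (cut_est d' h') as [K' [N' [HK' H']]].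
exists ((K * (1 + K') + K') * 4 + K * K' * Rpower 2 (1 + 2 * t))%R, (N + N')%nat.
assert (HR : (0 < Rpower 2 (1 + 2 * t))%R) by apply exp_pos.
assert (HKK : (0 < K * K')%R) by (apply Rmult_lt_0_compat; lra).
assert (HKR : (0 < K * K' * Rpower 2 (1 + 2 * t))%R) by (apply Rmult_lt_0_compat; lra).
split; [lra|]. intros n c c' Hn Hc Hc' j.
destruct (H n c ltac:(lia) Hc) as [H1 H2]. destruct (H' n c' ltac:(lia) Hc') as [H1' H2']. clear H H'.
unfold cutref. destruct (Nat.leb_spec (2 * j) n) as [L|L].
- specialize (H1 j L). specialize (H1' j L). clear H2 H2'.
  assert (B := bq_pos n j). assert (B2 := bq_le n j t ltac:(lia) ltac:(lra)).
  set (w := (pw j 1 * pw n (- (1)))%R) in *.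
  assert (Hw : (0 < w <= 1)%R).
  { split; [apply Rmult_lt_0_compat; apply pw_pos|]. unfold w.
    rewrite pw_1. unfold pw; rewrite Rpower_Ropp, Rpower_1 by apply INR1_pos.
    apply Rmult_le_reg_r with (INR n + 1)%R; [apply INR1_pos|].
    rewrite Rmult_assoc, Rinv_l by (generalize (INR1_pos n); lra).
    assert (L' : (j <= n)%nat) by lia. apply le_INR in L'. lra. }
  set (b := bq n j) in *.
  replace (c j * c' j - RtoC (b * b)) with ((c j - b) * c' j + b * (c' j - b)) by (rewrite RtoC_mult; ring).
  assert (X : (Cmod (c' j) <= (1 + K') * b)%R).
  { assert (S := Cmod_split (c' j) (RtoC b)). rewrite Cmod_R, Rabs_pos_eq in S by lra.
    assert (K' * w * b <= K' * b)%R by (apply Rmult_le_compat_r; nra). lra. }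
  apply Rle_trans with ((K * (1 + K') + K') * w * (b * b))%R.
  { eapply Rle_trans; [apply Cmod_triangle|]. rewrite !Cmod_mult, Cmod_R, Rabs_pos_eq by lra.
    apply Rle_trans with (K * w * b * ((1 + K') * b) + b * (K' * w * b))%R.
    - apply Rplus_le_compat; [apply Rmult_le_compat; auto using Cmod_ge_0|apply Rmult_le_compat_l; lra].
    - right; ring. }
  apply Rle_trans with ((K * (1 + K') + K') * w * ((2 * pw n (1 - t) * pw j (-2 + 2 * t)) * (2 * pw n (1 - t) * pw j (-2 + 2 * t))))%R.
  { apply Rmult_le_compat_l; [apply Rmult_le_pos; lra|]. apply Rmult_le_compat; lra. }
  replace ((K * (1 + K') + K') * w * ((2 * pw n (1 - t) * pw j (-2 + 2 * t)) * (2 * pw n (1 - t) * pw j (-2 + 2 * t))))%R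
    with ((K * (1 + K') + K') * 4 * (pw n (- (1)) * pw n (1 - t) * pw n (1 - t)) * (pw j 1 * pw j (-2 + 2 * t) * pw j (-2 + 2 * t)))%R by (unfold w; ring).
  rewrite !pw_plus.
  replace (- (1) + (1 - t) + (1 - t))%R with (1 - 2 * t)%R by ring.
  replace (1 + (-2 + 2 * t) + (-2 + 2 * t))%R with (-3 + 4 * t)%R by ring.
  assert (P := pw_pos n (1 - 2 * t)). assert (Q := pw_pos j (-3 + 4 * t)).
  apply Rmult_le_compat_r; [lra|]. apply Rmult_le_compat_r; lra.
- specialize (H2 j ltac:(lia)). specialize (H2' j ltac:(lia)). clear H1 H1'.
  replace (c j * c' j - 0) with (c j * c' j) by ring. rewrite Cmod_mult.
  apply Rle_trans with ((K * pw n 1 * pw j (- (2))) * (K' * pw n 1 * pw j (- (2))))%R.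
  { apply Rmult_le_compat; auto using Cmod_ge_0. }
  replace ((K * pw n 1 * pw j (- (2))) * (K' * pw n 1 * pw j (- (2))))%R
    with (K * K' * (pw n 1 * pw n 1) * (pw j (- (2)) * pw j (- (2))))%R by ring.
  rewrite !pw_plus.
  replace (1 + 1)%R with ((1 - 2 * t) + (1 + 2 * t))%R by ring. rewrite <- (pw_plus n).
  assert (A : (pw n (1 + 2 * t) <= Rpower 2 (1 + 2 * t) * pw j (1 + 2 * t))%R).
  { apply pw_le2; [|lra]. assert (L' : (n + 1 <= 2 * (j + 1))%nat) by lia.
    apply le_INR in L'. rewrite mult_INR, !plus_INR in L'. simpl in L'. lra. }
  assert (P := pw_pos n (1 - 2 * t)). assert (Q := pw_pos j (- (2) + - (2))). assert (Q' := pw_pos j (-3 + 4 * t)).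
  apply Rle_trans with (K * K' * (pw n (1 - 2 * t) * (Rpower 2 (1 + 2 * t) * pw j (1 + 2 * t))) * pw j (- (2) + - (2)))%R.
  { apply Rmult_le_compat_r; [lra|]. apply Rmult_le_compat_l; [lra|]. apply Rmult_le_compat_l; lra. }
  replace (K * K' * (pw n (1 - 2 * t) * (Rpower 2 (1 + 2 * t) * pw j (1 + 2 * t))) * pw j (- (2) + - (2)))%R
    with (K * K' * Rpower 2 (1 + 2 * t) * pw n (1 - 2 * t) * (pw j (1 + 2 * t) * pw j (- (2) + - (2))))%R by ring.
  rewrite pw_plus.
  assert (Y : (pw j (1 + 2 * t + (- (2) + - (2))) <= pw j (-3 + 4 * t))%R) by (apply pw_le; lra).
  apply Rle_trans with (K * K' * Rpower 2 (1 + 2 * t) * pw n (1 - 2 * t) * pw j (-3 + 4 * t))%R.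
  { apply Rmult_le_compat_l; [|easy]. repeat apply Rmult_le_pos; lra. }
  apply Rmult_le_compat_r; [lra|]. apply Rmult_le_compat_r; lra.
Qed.

(** [phi a (d - n)] normalized at 0. *)
Definition cut (a d : C) (n : nat) (k : Z) : C := phi a (d - INR n) k / phi a (d - INR n) 0.

Lemma phi_step a b k : (1 + a - b + Cz k) * phi a b (k + 1) = - (b + Cz k) * phi a b k.
Proof.
rewrite <- gphi_1, gphi_0, Cz_plus, Cz_1. ring.
Qed.

Lemma large_Re (z : C) : exists N, forall n, (N <= n)%nat -> (0 < Re z + INR n)%R.
Proof.
destruct (nfloor_ex (Rabs (Re z))) as [N HN]; [apply Rabs_pos|].
exists (S N); intros n Hn. apply le_INR in Hn. rewrite S_INR in Hn.
generalize (Rle_abs (- Re z)); rewrite Rabs_Ropp; lra.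
Qed.

Lemma phi_large_neq_0 a d : exists N, forall n, (N <= n)%nat -> phi a (d - INR n) 0 <> 0.
Proof.
destruct (large_Re (1 - d)) as [N1 H1]. destruct (large_Re (1 + a - d)) as [N2 H2].
exists (N1 + N2)%nat; intros n Hn. specialize (H1 n ltac:(lia)). specialize (H2 n ltac:(lia)).
unfold phi. rewrite Cz_0. apply Cmult_neq_0; apply rGamma_Re_pos; autorewrite with re in *; lra.
Qed.

Lemma cut_cutseq a d : exists N, forall n, (N <= n)%nat ->
  cutseq d (a - d) n (fun j => cut a d n (Z.of_nat j)).
Proof.
destruct (phi_large_neq_0 a d) as [N1 H1]. exists N1; intros n Hn. specialize (H1 n Hn).
split; unfold cut.
- simpl. field; easy.
- intros j. assert (P := phi_step a (d - INR n) (Z.of_nat j)).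
  rewrite Cz_nat in P. rewrite Nat2Z.inj_succ. unfold Z.succ.
  replace (INR n + 1 + (a - d) + INR j) with (1 + a - (d - INR n) + INR j) by ring.
  replace (INR n - d - INR j) with (- (d - INR n + INR j)) by ring.
  transitivity ((1 + a - (d - INR n) + INR j) * phi a (d - INR n) (Z.of_nat j + 1) / phi a (d - INR n) 0).
  { field; easy. }
  rewrite P. field; easy.
Qed.

Lemma cut_neg a d n k : cut a d n (- k) = cut (- a) (d - a) n k.
Proof.
unfold cut. rewrite <- (phi_reflect a (d - INR n) (- k)), <- (phi_reflect a (d - INR n) 0).
replace (d - INR n - a) with (d - a - INR n) by ring. now replace (- - k)%Z with k by lia.
Qed.

Lemma cut_diff a d e d' e' t : (0 < t <= 1)%R -> exists K N, (0 < K)%R /\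
  forall n, (N <= n)%nat -> forall k,
  (Cmod (cut a d n k * cut a e n k - cut a d' n k * cut a e' n k)
   <= K * pw n (1 - 2 * t) * pz k (- 3 + 4 * t))%R.
Proof.
intros Ht.
assert (A : forall a d e d' e', exists K N, (0 < K)%R /\ forall n, (N <= n)%nat -> forall j : nat,
  (Cmod (cut a d n (Z.of_nat j) * cut a e n (Z.of_nat j) - cut a d' n (Z.of_nat j) * cut a e' n (Z.of_nat j))
   <= K * pw n (1 - 2 * t) * pw j (- 3 + 4 * t))%R).
{ clear a d e d' e'. intros a d e d' e'.
  destruct (cut_pair d (a - d) e (a - e) t Ht) as [K1 [N1 [HK1 H1]]].
  destruct (cut_pair d' (a - d') e' (a - e') t Ht) as [K2 [N2 [HK2 H2]]].
  destruct (cut_cutseq a d) as [M1 G1]. destruct (cut_cutseq a e) as [M2 G2].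
  destruct (cut_cutseq a d') as [M3 G3]. destruct (cut_cutseq a e') as [M4 G4].
  exists (K1 + K2)%R, (N1 + N2 + M1 + M2 + M3 + M4)%nat; split; [lra|]. intros n Hn j.
  specialize (H1 n _ _ ltac:(lia) (G1 n ltac:(lia)) (G2 n ltac:(lia)) j).
  specialize (H2 n _ _ ltac:(lia) (G3 n ltac:(lia)) (G4 n ltac:(lia)) j).
  set (X := cut a d n (Z.of_nat j) * cut a e n (Z.of_nat j)) in *.
  set (Y := cut a d' n (Z.of_nat j) * cut a e' n (Z.of_nat j)) in *.
  replace (X - Y) with ((X - cutref n j) + - (Y - cutref n j)) by ring.
  eapply Rle_trans; [apply Cmod_triangle|]. rewrite Cmod_opp. lra. }
destruct (A a d e d' e') as [K1 [N1 [HK1 H1]]].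
destruct (A (- a) (d - a) (e - a) (d' - a) (e' - a)) as [K2 [N2 [HK2 H2]]].
exists (K1 + K2)%R, (N1 + N2)%nat; split; [lra|]. intros n Hn k. unfold pz.
assert (P : (0 < pw n (1 - 2 * t) * pw (Z.abs_nat k) (-3 + 4 * t))%R) by (apply Rmult_lt_0_compat; apply pw_pos).
assert (P1 : (0 < K1 * (pw n (1 - 2 * t) * pw (Z.abs_nat k) (-3 + 4 * t)))%R) by (apply Rmult_lt_0_compat; lra).
assert (P2 : (0 < K2 * (pw n (1 - 2 * t) * pw (Z.abs_nat k) (-3 + 4 * t)))%R) by (apply Rmult_lt_0_compat; lra).
destruct (Z.le_ge_cases 0 k).
- specialize (H1 n ltac:(lia) (Z.abs_nat k)). replace (Z.of_nat (Z.abs_nat k)) with k in H1 by lia. lra.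
- specialize (H2 n ltac:(lia) (Z.abs_nat k)). rewrite <- !cut_neg in H2.
  replace (- Z.of_nat (Z.abs_nat k))%Z with k in H2 by lia. lra.
Qed.

Lemma nrm_neq_0 z n : (0 < Re z + INR n)%R -> nrm z n <> 0.
Proof.
intros H. unfold nrm. repeat apply Cmult_neq_0; [|apply INR_fact_C|apply cpw_neq_0].
apply rGamma_Re_pos. autorewrite with re; lra.
Qed.

Lemma clim_double u l : clim u l -> clim (fun n => u (n + n)%nat) l.
Proof.
rewrite !clim_eps. intros H eps He. destruct (H eps He) as [N HN].
exists N; intros n Hn; apply HN; lia.
Qed.

(** The growth of the Gamma quotient depends on b+c-a only. *)
Lemma y5_growth a b c d e (s := b + c - a) : exists rho, clim rho 1 /\ exists N, forall n, (N <= n)%nat ->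
  y5 a b c (d - INR n) (e - INR n) = phi a (d - INR n) 0 * phi a (e - INR n) 0
   * (rG (1 + a - b - c) * (cpw n (s + s) * cpw (n + n) (- s)) * rho n).
Proof.
set (z0 := 1 + a + a - b - c - d - e).
exists (fun n => nrm (1 + a - b - d) n * nrm (1 + a - b - e) n * nrm (1 + a - c - d) n * nrm (1 + a - c - e) n
  * nrm (1 + a - d - e) (n + n) * / nrm z0 (n + n) * / nrm (1 - d) n * / nrm (1 + a - d) n
  * / nrm (1 - e) n * / nrm (1 + a - e) n).
assert (Hinv : forall z, clim (fun n => / nrm z n) 1).
{ intros z. apply clim_val with (/ 1); [field|]. apply clim_inv; [exact C1_nz|apply nrm_lim]. }
split.
- apply clim_val with (1 * 1 * 1 * 1 * 1 * 1 * 1 * 1 * 1 * 1); [ring|].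
  repeat lazymatch goal with
    | |- clim (fun n => @?f n * @?g n) _ => apply (clim_mult f g)
    | |- clim (fun n => nrm ?z n) _ => apply nrm_lim
    | |- clim (fun n => / nrm ?z n) _ => apply Hinv
    | |- clim (fun n => nrm ?z (n + n)%nat) _ => apply (clim_double (nrm z)), nrm_lim
    | |- clim (fun n => / nrm ?z (n + n)%nat) _ => apply (clim_double (fun m => / nrm z m)), Hinv
  end.
- destruct (large_Re z0) as [N0 H0]. destruct (large_Re (1 - d)) as [N1 H1].
  destruct (large_Re (1 + a - d)) as [N2 H2]. destruct (large_Re (1 - e)) as [N3 H3].
  destruct (large_Re (1 + a - e)) as [N4 H4].
  exists (N0 + N1 + N2 + N3 + N4)%nat; intros n Hn.
  specialize (H0 (n + n)%nat ltac:(lia)). specialize (H1 n ltac:(lia)). specialize (H2 n ltac:(lia)).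
  specialize (H3 n ltac:(lia)). specialize (H4 n ltac:(lia)).
  apply nrm_neq_0 in H0, H1, H2, H3, H4.
  unfold y5, phi. rewrite Cz_0.
  replace (1 + a + a - b - c - (d - INR n) - (e - INR n)) with (z0 + INR (n + n)) by (unfold z0; rewrite plus_INR, RtoC_plus; ring).
  replace (1 + a - b - (d - INR n)) with (1 + a - b - d + INR n) by ring.
  replace (1 + a - b - (e - INR n)) with (1 + a - b - e + INR n) by ring.
  replace (1 + a - c - (d - INR n)) with (1 + a - c - d + INR n) by ring.
  replace (1 + a - c - (e - INR n)) with (1 + a - c - e + INR n) by ring.
  replace (1 + a - (d - INR n) - (e - INR n)) with (1 + a - d - e + INR (n + n)) by (rewrite plus_INR, RtoC_plus; ring).
  replace (1 - (d - INR n) - 0) with (1 - d + INR n) by ring.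
  replace (1 - (e - INR n) - 0) with (1 - e + INR n) by ring.
  replace (1 + a - (d - INR n) + 0) with (1 + a - d + INR n) by ring.
  replace (1 + a - (e - INR n) + 0) with (1 + a - e + INR n) by ring.
  rewrite !nrm_rG.
  assert (E1 : cpw n (1 - (1 + a - b - d)) * cpw n (1 - (1 + a - b - e)) * cpw n (1 - (1 + a - c - d)) * cpw n (1 - (1 + a - c - e))
    = cpw n (1 - (1 - d)) * cpw n (1 - (1 + a - d)) * cpw n (1 - (1 - e)) * cpw n (1 - (1 + a - e)) * cpw n (s + s)).
  { rewrite <- !cpw_plus. f_equal. unfold s. ring. }
  assert (E2 : cpw (n + n) (1 - (1 + a - d - e)) = cpw (n + n) (1 - z0) * cpw (n + n) (- s)).
  { rewrite <- !cpw_plus. f_equal. unfold s, z0. ring. }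
  rewrite E2.
  match goal with |- ?l = ?r =>
    transitivity (/ (nrm z0 (n + n)) * rG (1 + a - b - c) * nrm (1 + a - b - d) n * nrm (1 + a - b - e) n
      * nrm (1 + a - c - d) n * nrm (1 + a - c - e) n * nrm (1 + a - d - e) (n + n) * cpw (n + n) (- s)
      * (cpw n (1 - (1 + a - b - d)) * cpw n (1 - (1 + a - b - e)) * cpw n (1 - (1 + a - c - d)) * cpw n (1 - (1 + a - c - e)))
      / (INR (fact n) * INR (fact n) * INR (fact n) * INR (fact n))) end.
  + field. repeat split; auto using cpw_neq_0, INR_fact_C.
  + rewrite E1. field. repeat split; auto using cpw_neq_0, INR_fact_C.
Qed.

Lemma err5_iter a b c d e n : cv5 a b c d e ->
  err5 a b c d e * rising (1 + a + a - b - c - d - e) n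
  = rising (1 + a - b - e) n * rising (1 + a - c - e) n * rising (1 + a - d - e) n
    * err5 a b c d (e - INR n).
Proof.
intros H. induction n as [|n IH].
- rewrite !rising_0. replace (e - INR 0) with e by (simpl; ring). ring.
- rewrite !rising_S, RtoC_S.
  assert (R := err5_rec a b c d (e - INR n - 1)).
  replace (e - INR n - 1 + 1) with (e - INR n) in R by ring.
  specialize (R ltac:(rewrite cv5_Re in *; autorewrite with re; generalize (pos_INR n); lra)).
  replace (e - (INR n + 1)) with (e - INR n - 1) by ring.
  replace (a + a - b - c - d - (e - INR n - 1)) with (1 + a + a - b - c - d - e + INR n) in R by ring.
  replace (a - b - (e - INR n - 1)) with (1 + a - b - e + INR n) in R by ring.
  replace (a - c - (e - INR n - 1)) with (1 + a - c - e + INR n) in R by ring.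
  replace (a - d - (e - INR n - 1)) with (1 + a - d - e + INR n) in R by ring.
  apply (lincomb2 (1 + a + a - b - c - d - e + INR n) _ _
     (rising (1 + a - b - e) n * rising (1 + a - c - e) n * rising (1 + a - d - e) n) _ _ _ _ IH R). ring.
Qed.

Lemma err5_iter2 a b c d e n : cv5 a b c d e ->
  err5 a b c d e * rising (1 + a + a - b - c - d - e) (n + n)
  = rising (1 + a - b - e) n * rising (1 + a - c - e) n * rising (1 + a - b - d) n * rising (1 + a - c - d) n
    * rising (1 + a - d - e) (n + n) * err5 a b c (d - INR n) (e - INR n).
Proof.
intros H. rewrite !rising_plus.
assert (E1 := err5_iter a b c d e n H).
assert (E2 := err5_iter a b c (e - INR n) d n).
specialize (E2 ltac:(rewrite cv5_Re in *; autorewrite with re; generalize (pos_INR n); lra)).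
rewrite !(err5_swap_de a b c (e - INR n)) in E2.
replace (1 + a + a - b - c - (e - INR n) - d) with (1 + a + a - b - c - d - e + INR n) in E2 by ring.
replace (1 + a - (e - INR n) - d) with (1 + a - d - e + INR n) in E2 by ring.
apply (lincomb2 (rising (1 + a + a - b - c - d - e + INR n) n) _ _
  (rising (1 + a - b - e) n * rising (1 + a - c - e) n * rising (1 + a - d - e) n) _ _ _ _ E1 E2). ring.
Qed.

Lemma lam5_cut a b c d e n : phi a (d - INR n) 0 <> 0 -> phi a (e - INR n) 0 <> 0 ->
  cv5 a b c (d - INR n) (e - INR n) ->
  summable (fun k => vw a k * (phi a b k * phi a c k) * (cut a d n k * cut a e n k)) /\
  lam5 a b c (d - INR n) (e - INR n) = phi a (d - INR n) 0 * phi a (e - INR n) 0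
   * csum (fun k => vw a k * (phi a b k * phi a c k) * (cut a d n k * cut a e n k)).
Proof.
intros H1 H2 Hc. assert (S := lam5_summable _ _ _ _ _ Hc).
assert (S' : summable (fun k => vw a k * (phi a b k * phi a c k) * (cut a d n k * cut a e n k))).
{ apply summable_ext with (fun k => / (phi a (d - INR n) 0 * phi a (e - INR n) 0) * lam5t a b c (d - INR n) (e - INR n) k).
  - intros k; unfold lam5t, cut. field. split; easy.
  - now apply summable_scal. }
split; [easy|]. rewrite <- csum_scal by easy. apply csum_ext; intros k.
unfold lam5t, cut. field. split; easy.
Qed.

Lemma rbnd_pz_csum (f : Z -> C) K x M : (0 <= K)%R -> rbnd (fun k => pz k x) M ->
  (forall k, Cmod (f k) <= K * pz k x)%R -> (Cmod (csum f) <= K * M)%R.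
Proof.
intros HK HM H. apply csum_bound. apply rbnd_le with (fun k => K * pz k x)%R; [easy|].
now apply rbnd_scal.
Qed.

(** Let d and e tend to minus infinity by integer steps. The normalized summand
    becomes (a+2k) phi_b(k) phi_c(k), of order k^(2s-1) with s = b+c-a, times a
    bell-shaped cut-off. Although the sum grows like n^s, replacing the cut-off
    for (d,e) by the one for (a,0) changes it by o(n^s) only, and with the latter
    the sum is finite and known from [err5_fin]. So the error is o(n^s), while
    the recurrence [err5_iter2] says that it is a constant times n^s. *)
Lemma err5_zero_strip a b c d e : cv5 a b c d e ->
  (0 <= Re b + Re c - Re a < 1)%R -> err5 a b c d e = 0.
Proof.
intros Hcv Hs. set (sr := (Re b + Re c - Re a)%R) in *. set (s := b + c - a).
assert (Hsr : Re s = sr) by (unfold s, sr; now autorewrite with re).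
(* With this t the difference of the cut-offs, times k^(2s-1), is
   O(n^(s-3/8) k^(-5/4)). *)
set (t := (11 / 16 - sr / 2)%R). assert (Ht : (0 < t <= 1)%R) by (unfold t; lra).
destruct (cut_diff a d e a 0 t Ht) as [Kc [Nc [HKc Hcut]]].
destruct (y5_growth a b c d e) as [rho [Hrho [Ny Hy]]].
destruct (y5_growth a b c a 0) as [rho' [Hrho' [Ny' Hy']]].
destruct (phi_large_neq_0 a d) as [N1 P1]. destruct (phi_large_neq_0 a e) as [N2 P2].
destruct (phi_large_neq_0 a a) as [N3 P3]. destruct (phi_large_neq_0 a 0) as [N4 P4].
assert (HF : zO (fun k => vw a k * (phi a b k * phi a c k)) (2 * sr - 1)).
{ eapply zO_eq; [intros; reflexivity| |zO_tac]. unfold sr; ring. }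
destruct HF as [KF [HKF HF]].
destruct (rsummable_pz (- 5 / 4) ltac:(lra)) as [M HM]. assert (HM0 := rbnd_ge0 _ _ HM).
set (X := Cmod (rG (1 + a - b - c))). set (Y := Cmod (sg a)).
assert (HX : (0 <= X)%R) by apply Cmod_ge_0. assert (HY : (0 <= Y)%R) by apply Cmod_ge_0.
set (eps := fun n => (KF * Kc * M * pw n (- 3 / 8) + Y * X * Cmod (rho n - rho' n))%R).
set (N := (Nc + Ny + Ny' + N1 + N2 + N3 + N4 + 1)%nat).
assert (Hn : forall n, (N <= n)%nat ->
  (Cmod (err5 a b c (d - INR n) (e - INR n)) <= Cmod (phi a (d - INR n) 0 * phi a (e - INR n) 0) * (pw n sr * eps n))%R).
{ intros n Hn. assert (Hn1 : (1 <= INR n)%R) by (change 1%R with (INR 1); apply le_INR; lia).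
  specialize (Hcut n ltac:(lia)). specialize (Hy n ltac:(lia)). specialize (Hy' n ltac:(lia)).
  specialize (P1 n ltac:(lia)). specialize (P2 n ltac:(lia)). specialize (P3 n ltac:(lia)). specialize (P4 n ltac:(lia)).
  assert (C1 : cv5 a b c (d - INR n) (e - INR n)).
  { rewrite cv5_Re in *; autorewrite with re; lra. }
  assert (C2 : cv5 a b c (a - INR n) (- INR n)).
  { rewrite cv5_Re in *; autorewrite with re. unfold sr in *; lra. }
  assert (Z := err5_fin a b c n C2).
  replace (- INR n) with (0 - INR n) in C2, Z by ring.
  destruct (lam5_cut a b c d e n P1 P2 C1) as [S1 L1].
  destruct (lam5_cut a b c a 0 n P3 P4 C2) as [S2 L2].
  set (f := fun k => vw a k * (phi a b k * phi a c k) * (cut a d n k * cut a e n k)) in *.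
  set (f' := fun k => vw a k * (phi a b k * phi a c k) * (cut a a n k * cut a 0 n k)) in *.
  fold s in Hy, Hy'. set (q := cpw n (s + s) * cpw (n + n) (- s)) in *.
  assert (Z' : csum f' = sg a * (rG (1 + a - b - c) * q * rho' n)).
  { unfold err5 in Z. rewrite L2, Hy' in Z.
    set (w := phi a (a - INR n) 0 * phi a (0 - INR n) 0) in *.
    assert (Hw : w <> 0) by (now apply Cmult_neq_0).
    apply Cminus_eq. replace (csum f' - sg a * (rG (1 + a - b - c) * q * rho' n))
      with ((w * csum f' - sg a * (w * (rG (1 + a - b - c) * q * rho' n))) * / w) by (field; easy).
    rewrite Z; ring. }
  assert (D : csum (fun k => f k - f' k) = csum f - csum f') by (now apply csum_minus).
  unfold err5. rewrite L1, Hy.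
  replace (phi a (d - INR n) 0 * phi a (e - INR n) 0 * csum f -
    sg a * (phi a (d - INR n) 0 * phi a (e - INR n) 0 * (rG (1 + a - b - c) * q * rho n)))
    with (phi a (d - INR n) 0 * phi a (e - INR n) 0 * (csum (fun k => f k - f' k) + - (sg a * rG (1 + a - b - c) * q * (rho n - rho' n)))).
  2:{ rewrite D, Z'; ring. }
  rewrite Cmod_mult. apply Rmult_le_compat_l; [apply Cmod_ge_0|].
  eapply Rle_trans; [apply Cmod_triangle|]. unfold eps. rewrite Rmult_plus_distr_l. apply Rplus_le_compat.
  - apply Rle_trans with ((KF * Kc * pw n (1 - 2 * t)) * M)%R.
    + apply rbnd_pz_csum with (- 5 / 4)%R; [repeat apply Rmult_le_pos; try lra; apply pw_ge0|easy|].
      intros k. unfold f, f'.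
      match goal with |- (Cmod (?x * ?u - ?x * ?v) <= _)%R => replace (x * u - x * v) with (x * (u - v)) by ring end.
      rewrite Cmod_mult.
      apply Rle_trans with ((KF * pz k (2 * sr - 1)) * (Kc * pw n (1 - 2 * t) * pz k (-3 + 4 * t)))%R.
      { apply Rmult_le_compat; auto using Cmod_ge_0. }
      right. replace (- 5 / 4)%R with ((2 * sr - 1) + (-3 + 4 * t))%R by (unfold t; field).
      unfold pz. rewrite <- (pw_plus (Z.abs_nat k) (2 * sr - 1)). ring.
    + right. replace (1 - 2 * t)%R with (sr + - 3 / 8)%R by (unfold t; field). rewrite <- (pw_plus n sr); ring.
  - rewrite Cmod_opp, !Cmod_mult. fold X Y.
    assert (Hq : (Cmod q <= pw n sr)%R).
    { unfold q. rewrite Cmod_mult, !Cmod_cpw. autorewrite with re. rewrite Hsr, <- pw_plus.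
      apply Rle_trans with (pw n sr * pw n sr * pw n (- sr))%R.
      - apply Rmult_le_compat_l; [apply Rmult_le_pos; apply pw_ge0|]. apply pw_anti; [lia|lra].
      - rewrite Rmult_assoc, pw_opp. lra. }
    apply Rle_trans with (Y * X * pw n sr * Cmod (rho n - rho' n))%R; [|right; ring].
    apply Rmult_le_compat_r; [apply Cmod_ge_0|]. apply Rmult_le_compat_l; [|easy]. now apply Rmult_le_pos. }
assert (Heps : is_lim_seq eps 0).
{ apply lim0_plus; apply lim0_scal; [apply pw_lim; lra|].
  assert (U := clim_minus _ _ _ _ Hrho Hrho'). unfold clim in U.
  apply is_lim_seq_ext with (2 := U). intros n. f_equal. ring. }
set (z0 := 1 + a + a - b - c - d - e).
assert (Hz0 : rG z0 <> 0) by (apply rGamma_Re_pos; exact Hcv).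
destruct (rising_lower z0 Hz0) as [L [HL HLo]].
destruct (rising_bound (1 + a - d - e)) as [U [HU HUp]].
assert (Hpr : asy (fun n => rising (1 + a - b - e) n * rising (1 + a - c - e) n * rising (1 + a - b - d) n * rising (1 + a - c - d) n
   * (rG (1 - d + INR n) * rG (1 + a - d + INR n) * (rG (1 - e + INR n) * rG (1 + a - e + INR n)))) (- 2 * sr) 0).
{ eapply asy_eq; [intros; reflexivity| | |asy_tac]; [|lia]. unfold sr. autorewrite with re. ring. }
destruct (asy_bound _ _ Hpr) as [V [HV HVp]].
set (c2 := Rpower 2 (Rabs sr)). assert (Hc2 : (0 < c2)%R) by apply exp_pos.
apply Cmod_lt_all. intros del Hdel.
assert (Hlim := lim0_scal (L * V * U * c2) _ Heps).
apply is_lim_seq_spec in Hlim. destruct (Hlim (mkposreal del Hdel)) as [N5 H5].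
set (n := (N + N5)%nat). specialize (H5 n ltac:(unfold n; lia)). simpl in H5. rewrite Rminus_0_r in H5.
apply Rle_lt_trans with (2 := Rle_lt_trans _ _ _ (Rle_abs _) H5).
specialize (Hn n ltac:(unfold n; lia)). specialize (HLo (n + n)%nat). specialize (HUp (n + n)%nat). specialize (HVp n).
assert (It := err5_iter2 a b c d e n Hcv). fold z0 in It.
apply (f_equal Cmod) in It. rewrite (Cmod_mult (err5 a b c d e)) in It.
assert (F := INR_fact_pos (n + n)).
set (T := (pw (n + n) (Re z0 - 1) * INR (fact (n + n)))%R) in *.
assert (HT : (0 < T)%R) by (unfold T; apply Rmult_lt_0_compat; [apply pw_pos|easy]).
assert (He0 : (0 <= eps n)%R).
{ unfold eps. apply Rplus_le_le_0_compat; repeat apply Rmult_le_pos; try lra; try apply pw_ge0; apply Cmod_ge_0. }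
apply Rmult_le_reg_r with T; [easy|].
apply Rle_trans with (Cmod (err5 a b c d e) * (L * Cmod (rising z0 (n + n))))%R.
{ apply Rmult_le_compat_l; [apply Cmod_ge_0|easy]. }
replace (Cmod (err5 a b c d e) * (L * Cmod (rising z0 (n + n))))%R with
  (L * (Cmod (err5 a b c d e) * Cmod (rising z0 (n + n))))%R by ring.
rewrite It. rewrite (Cmod_mult _ (err5 _ _ _ _ _)), (Cmod_mult _ (rising (1 + a - d - e) (n + n))).
set (G := rising (1 + a - b - e) n * rising (1 + a - c - e) n * rising (1 + a - b - d) n * rising (1 + a - c - d) n) in *.
rewrite (Cmod_mult G) in HVp.
replace (rG (1 - d + INR n) * rG (1 + a - d + INR n) * (rG (1 - e + INR n) * rG (1 + a - e + INR n)))
  with (phi a (d - INR n) 0 * phi a (e - INR n) 0) in HVp.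
2:{ unfold phi. rewrite Cz_0. f_equal; f_equal; f_equal; ring. }
set (W := Cmod (phi a (d - INR n) 0 * phi a (e - INR n) 0)) in *.
assert (HW : (0 <= W)%R) by apply Cmod_ge_0. assert (HG : (0 <= Cmod G)%R) by apply Cmod_ge_0.
assert (Pw := pw_pos n sr). assert (Pw2 := pw_pos (n + n) (Re (1 + a - d - e) - 1)).
apply Rle_trans with (L * (Cmod G * (U * pw (n + n) (Re (1 + a - d - e) - 1) * INR (fact (n + n))) * (W * (pw n sr * eps n))))%R.
{ apply Rmult_le_compat_l; [lra|]. apply Rmult_le_compat; [apply Rmult_le_pos; apply Cmod_ge_0|apply Cmod_ge_0| |easy].
  apply Rmult_le_compat_l; easy. }
replace (L * (Cmod G * (U * pw (n + n) (Re (1 + a - d - e) - 1) * INR (fact (n + n))) * (W * (pw n sr * eps n))))%R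
  with (L * U * pw (n + n) (Re (1 + a - d - e) - 1) * INR (fact (n + n)) * pw n sr * eps n * (Cmod G * W))%R by ring.
apply Rle_trans with (L * U * pw (n + n) (Re (1 + a - d - e) - 1) * INR (fact (n + n)) * pw n sr * eps n * (V * pw n (- 2 * sr)))%R.
{ apply Rmult_le_compat_l; [repeat apply Rmult_le_pos; lra|easy]. }
replace (Re (1 + a - d - e) - 1)%R with ((Re z0 - 1) + sr)%R by (unfold z0, sr; autorewrite with re; ring).
rewrite <- (pw_plus (n + n)).
assert (Q := pw_double n n sr ltac:(lia)). fold c2 in Q.
assert (Q2 : (pw n sr * pw n (- 2 * sr) * pw n sr = 1)%R).
{ rewrite !pw_plus. replace (sr + - 2 * sr + sr)%R with 0%R by ring. apply pw_0. }
apply Rle_trans with (L * U * V * T * eps n * (pw n sr * pw n (- 2 * sr) * (c2 * pw n sr)))%R.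
- replace (L * U * (pw (n + n) (Re z0 - 1) * pw (n + n) sr) * INR (fact (n + n)) * pw n sr * eps n * (V * pw n (- 2 * sr)))%R
    with (L * U * V * T * eps n * (pw n sr * pw n (- 2 * sr) * pw (n + n) sr))%R by (unfold T; ring).
  apply Rmult_le_compat_l; [repeat apply Rmult_le_pos; try lra; apply pw_ge0|]. apply Rmult_le_compat_l; [|easy].
  apply Rmult_le_pos; apply pw_ge0.
- right. replace (pw n sr * pw n (-2 * sr) * (c2 * pw n sr))%R with (c2 * (pw n sr * pw n (- 2 * sr) * pw n sr))%R by ring.
  rewrite Q2. ring.
Qed.

(** The recurrence brings Re (b+c-a) into the strip [0,1). *)
Lemma err5_zero a b c d e : cv5 a b c d e -> err5 a b c d e = 0.
Proof.
assert (A : forall M a b c d e, cv5 a b c d e -> (- INR M <= Re b + Re c - Re a < 1)%R -> err5 a b c d e = 0).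
{ clear. induction M as [|M IH]; intros a b c d e H Hs.
  - apply err5_zero_strip; [easy|]. simpl in Hs; lra.
  - destruct (Rle_lt_dec 0 (Re b + Re c - Re a)) as [L|L]; [apply err5_zero_strip; lra || easy|].
    (* The recurrence must not meet a vanishing factor: this is ensured by
       lowering d and e beforehand. *)
    destruct (nfloor_ex (Rabs (Re a) + Rabs (Re b) + Rabs (Re c) + Rabs (Re d) + Rabs (Re e) + 2)) as [m Hm].
    { generalize (Rabs_pos (Re a)) (Rabs_pos (Re b)) (Rabs_pos (Re c)) (Rabs_pos (Re d)) (Rabs_pos (Re e)); lra. }
    assert (X1 := Rle_abs (Re a)). assert (X2 := Rle_abs (- Re a)). rewrite Rabs_Ropp in X2.
    assert (X3 := Rle_abs (Re b)). assert (X4 := Rle_abs (Re c)). assert (X5 := Rle_abs (Re d)). assert (X6 := Rle_abs (Re e)).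
    assert (Y1 := Rabs_pos (Re a)). assert (Y2 := Rabs_pos (Re b)). assert (Y3 := Rabs_pos (Re c)).
    assert (Y4 := Rabs_pos (Re d)). assert (Y5 := Rabs_pos (Re e)).
    set (p := S m). assert (Hp : (Rabs (Re a) + Rabs (Re b) + Rabs (Re c) + Rabs (Re d) + Rabs (Re e) + 2 < INR p)%R)
      by (unfold p; rewrite S_INR; lra).
    rewrite cv5_Re in H.
    apply err5_raise_n with p; [now rewrite cv5_Re|].
    rewrite err5_swap_de. apply err5_raise_n with p; [rewrite cv5_Re in *; autorewrite with re; lra|].
    rewrite err5_swap_be.
    apply err5_lower.
    + rewrite cv5_Re; autorewrite with re; lra.
    + intros E. apply (f_equal Re) in E. autorewrite with re in E. lra.
    + intros E. apply (f_equal Re) in E. autorewrite with re in E. lra.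
    + intros E. apply (f_equal Re) in E. autorewrite with re in E. lra.
    + rewrite err5_swap_be. apply IH; [rewrite cv5_Re; autorewrite with re; lra|].
      rewrite S_INR in Hs. autorewrite with re; lra. }
intros H.
destruct (nfloor_ex (Rabs (Re b + Re c - Re a))) as [m Hm]; [apply Rabs_pos|].
rewrite err5_swap_be. apply err5_raise_n with (S m).
{ rewrite cv5_Re in *. lra. }
rewrite err5_swap_be.
assert (X1 := Rle_abs (Re b + Re c - Re a)). assert (X2 := Rle_abs (- (Re b + Re c - Re a))). rewrite Rabs_Ropp in X2.
apply (A (2 * S m)%nat).
- rewrite cv5_Re in *. autorewrite with re. generalize (pos_INR (S m)); lra.
- rewrite mult_INR, !S_INR. autorewrite with re. simpl (INR 0). rewrite ?S_INR. lra.
Qed.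

(** * Expansion of a product of three well-poised factors *)

Definition phi3 (a e f g : C) (k : Z) : C := phi a e k * phi a f k * phi a g k.

(** The series with parameters e+k, f+k, g+k and denominators 1+a+2k and v+k is
    balanced for every k. *)
Definition vv (a e f g : C) : C := e + f + g - a.

Definition m3 (a e f g : C) : C := rG (1 + a - f - g) * rG (1 + a - e - g) * rG (1 + a - e - f).

Definition qn (a e f g : C) (n : Z) : C :=
  rG (vv a e f g + Cz n) * (rG (1 - e - Cz n) * rG (1 - f - Cz n) * rG (1 - g - Cz n)).

(** With summation index n = k + m the dependence of the first Saalschuetz series
    on k is confined to this kernel, which vanishes for n < k. *)
Definition psi (a : C) (n k : Z) : C := rG (1 + Cz n - Cz k) * rG (1 + a + Cz n + Cz k).

Definition s1t (a e f g : C) (k n : Z) : C := sgn n * qn a e f g n * psi a n k.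

Definition s1 (a e f g : C) (k : Z) : C := m3 a e f g * csum (s1t a e f g k).

(** The coefficients of the second Saalschuetz series, whose dependence on k is
    that of a single [phi]. *)
Definition sm (a e f g : C) (m : nat) : C :=
  rising (1 + a - f - g) m * rising (1 + a - e - g) m * rising (1 + a - e - f) m * / INR (fact m).

Definition s2t (a e f g : C) (k : Z) (m : nat) : C :=
  sm a e f g m * phi a (vv a e f g - 1 - INR m) k.

Definition s2 (a e f g : C) (k : Z) : C := - (sg e * sg f * sg g) * csum (s2t a e f g k).

Lemma rG_fact m : rG (1 + INR m) = / INR (fact m).
Proof.
assert (E := rGamma_rising 1 m). rewrite rGamma_1 in E.
assert (R : rising 1 m = INR (fact m)).
{ clear E. induction m as [|m IH]; [simpl; easy|].
  rewrite rising_S, IH, fact_simpl, mult_INR, S_INR, RtoC_mult, RtoC_plus. ring. }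
rewrite R in E. assert (H := INR_fact_C m).
replace (rG (1 + INR m)) with (INR (fact m) * rG (1 + INR m) * / INR (fact m)) by (field; easy).
rewrite <- E. ring.
Qed.

Lemma rG_reflect_rising x m : rising x m * rG (1 - x) = sgn (Z.of_nat m) * rG (1 - x - INR m).
Proof.
rewrite rGamma_falling, falling_rising. replace (1 - (1 - x)) with x by ring.
replace (sgn (Z.of_nat m) * (sgn (Z.of_nat m) * rising x m * rG (1 - x)))
  with (sgn (Z.of_nat m) * sgn (Z.of_nat m) * (rising x m * rG (1 - x))) by ring.
rewrite sgn_sq. ring.
Qed.

Definition zle (k n : Z) : option nat := if (k <=? n)%Z then Some (Z.to_nat (n - k)) else None.

Lemma zle_h k (i : nat) : zle k (k + Z.of_nat i) = Some i.
Proof. unfold zle. destruct (Z.leb_spec k (k + Z.of_nat i)); [f_equal|]; lia. Qed.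

Lemma zle_p k n i : zle k n = Some i -> (k + Z.of_nat i)%Z = n.
Proof. unfold zle. destruct (Z.leb_spec k n); [|easy]. intros E; injection E; lia. Qed.

Lemma zle_None k n : zle k n = None -> (n < k)%Z.
Proof. unfold zle. now destruct (Z.leb_spec k n). Qed.

Lemma psi_zero a n k : (n < k)%Z -> psi a n k = 0.
Proof.
intros H. unfold psi. rewrite <- Cz_1, <- Cz_plus, <- Cz_minus, rG_Zneg by lia. ring.
Qed.

Lemma s1t_bal_term a e f g k (m : nat) :
  s1t a e f g k (k + Z.of_nat m)
  = sgn k * (rG (1 - e - Cz k) * rG (1 - f - Cz k) * rG (1 - g - Cz k))
    * bal_term (e + Cz k) (f + Cz k) (g + Cz k) (1 + a + Cz k + Cz k) (vv a e f g + Cz k) m.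
Proof.
unfold s1t, qn, psi, bal_term. rewrite sgn_plus, !Cz_plus, Cz_nat.
replace (1 + (Cz k + INR m) - Cz k) with (1 + INR m) by ring. rewrite rG_fact.
replace (1 + a + (Cz k + INR m) + Cz k) with (1 + a + Cz k + Cz k + INR m) by ring.
replace (vv a e f g + (Cz k + INR m)) with (vv a e f g + Cz k + INR m) by ring.
assert (A : forall x, rising (x + Cz k) m * rG (1 - x - Cz k) = sgn (Z.of_nat m) * rG (1 - x - (Cz k + INR m))).
{ intros x. replace (1 - x - Cz k) with (1 - (x + Cz k)) by ring. rewrite rG_reflect_rising.
  f_equal. f_equal. ring. }
transitivity (sgn k * ((rising (e + Cz k) m * rG (1 - e - Cz k)) * (rising (f + Cz k) m * rG (1 - f - Cz k))
  * (rising (g + Cz k) m * rG (1 - g - Cz k))) * / INR (fact m) * rG (1 + a + Cz k + Cz k + INR m)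
  * rG (vv a e f g + Cz k + INR m)); [|ring].
rewrite !A.
transitivity (sgn k * sgn (Z.of_nat m) * (sgn (Z.of_nat m) * sgn (Z.of_nat m)) * (rG (1 - e - (Cz k + INR m)) * rG (1 - f - (Cz k + INR m))
  * rG (1 - g - (Cz k + INR m))) * / INR (fact m) * rG (1 + a + Cz k + Cz k + INR m)
  * rG (vv a e f g + Cz k + INR m)); [|ring].
rewrite sgn_sq. ring.
Qed.

Lemma vv_balance a e f g k :
  1 + a + Cz k + Cz k + (vv a e f g + Cz k) = e + Cz k + (f + Cz k) + (g + Cz k) + 1.
Proof. unfold vv; ring. Qed.

Lemma s1t_summable a e f g k : summable (s1t a e f g k).
Proof.
apply (summable_reindex (fun m => (k + Z.of_nat m)%Z) (zle k) (zle_h k) (zle_p k)).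
- intros n Hn. apply zle_None in Hn. unfold s1t. rewrite psi_zero by easy. ring.
- eapply summable_ext; [intros m; symmetry; apply s1t_bal_term|].
  apply summable_scal, summable_bal_term, vv_balance.
Qed.

(** The two terms of the nonterminating Saalschuetz theorem, multiplied by
    1/Gamma(1-e-k) etc. so that no parameter has to be excluded. *)
Lemma phi3_expand a e f g k :
  sg (vv a e f g) * phi3 a e f g k = s1 a e f g k + s2 a e f g k.
Proof.
set (v := vv a e f g).
assert (S := saal_zero (e + Cz k) (f + Cz k) (g + Cz k) (1 + a + Cz k + Cz k) (v + Cz k) (vv_balance a e f g k)).
set (R3 := rG (1 - e - Cz k) * rG (1 - f - Cz k) * rG (1 - g - Cz k)).
assert (E1 : csum (s1t a e f g k) = sgn k * R3 *
  bal (e + Cz k) (f + Cz k) (g + Cz k) (1 + a + Cz k + Cz k) (v + Cz k)).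
{ rewrite (csum_reindex (fun m => (k + Z.of_nat m)%Z) (zle k) (zle_h k) (zle_p k)).
  - unfold bal. rewrite <- csum_scal by (apply summable_bal_term, vv_balance).
    apply csum_ext; intros m. apply s1t_bal_term.
  - intros n Hn. apply zle_None in Hn. unfold s1t. rewrite psi_zero by easy. ring.
  - apply s1t_summable. }
assert (E2 : csum (s2t a e f g k) = bal (1 + (e + Cz k) - (v + Cz k)) (1 + (f + Cz k) - (v + Cz k)) (1 + (g + Cz k) - (v + Cz k))
  (1 + a + Cz k + Cz k + 1 - (v + Cz k)) (2 - (v + Cz k))).
{ apply csum_ext; intros m. unfold s2t, sm, bal_term, phi. fold v.
  replace (1 + (e + Cz k) - (v + Cz k)) with (1 + a - f - g) by (unfold v, vv; ring).
  replace (1 + (f + Cz k) - (v + Cz k)) with (1 + a - e - g) by (unfold v, vv; ring).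
  replace (1 + (g + Cz k) - (v + Cz k)) with (1 + a - e - f) by (unfold v, vv; ring).
  replace (1 + a + Cz k + Cz k + 1 - (v + Cz k) + INR m) with (1 + a - (v - 1 - INR m) + Cz k) by ring.
  replace (2 - (v + Cz k) + INR m) with (1 - (v - 1 - INR m) - Cz k) by (rewrite RtoC_2; ring). ring. }
unfold s1, s2. rewrite E1, E2. unfold saal in S. clear E1 E2.
set (B1 := bal (e + Cz k) (f + Cz k) (g + Cz k) (1 + a + Cz k + Cz k) (v + Cz k)) in *.
set (B2 := bal (1 + (e + Cz k) - (v + Cz k)) _ _ _ _) in *. clearbody B1 B2.
replace (1 + (e + Cz k) - (v + Cz k)) with (1 + a - f - g) in S by (unfold v, vv; ring).
replace (1 + (f + Cz k) - (v + Cz k)) with (1 + a - e - g) in S by (unfold v, vv; ring).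
replace (1 + (g + Cz k) - (v + Cz k)) with (1 + a - e - f) in S by (unfold v, vv; ring).
replace (1 + a + Cz k + Cz k - (e + Cz k)) with (1 + a - e + Cz k) in S by ring.
replace (1 + a + Cz k + Cz k - (f + Cz k)) with (1 + a - f + Cz k) in S by ring.
replace (1 + a + Cz k + Cz k - (g + Cz k)) with (1 + a - g + Cz k) in S by ring.
rewrite sg_Z in S.
assert (G : forall x, rG (x + Cz k) * rG (1 - x - Cz k) = sgn k * sg x).
{ intros x. rewrite <- sg_Z. unfold sg. f_equal. f_equal. ring. }
assert (Ge := G e). assert (Gf := G f). assert (Gg := G g). clear G.
assert (Q := sgn_sq k).
unfold phi3, phi, m3. fold R3.
apply Cminus_eq.
transitivity (- sgn k * R3 * 0 - B2 * sgn k * ((sgn k * sg e) * (sgn k * sg f) * (sgn k * sg g)) + sg e * sg f * sg g * B2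
  + sg v * R3 * (rG (1 + a - e + Cz k) * rG (1 + a - f + Cz k) * rG (1 + a - g + Cz k)) * (1 - sgn k * sgn k)).
- rewrite <- S, <- Ge, <- Gf, <- Gg. unfold R3. ring.
- rewrite Q. transitivity (B2 * (sg e * sg f * sg g) * (1 - (sgn k * sgn k) * (sgn k * sgn k))); [ring|].
  rewrite Q. ring.
Qed.

(** ** Bounds for the two parts *)

(** The exponent of decay of [phi3]. *)
Definition th3 (a e f g : C) : R := (3 + 3 * Re a - 2 * (Re e + Re f + Re g))%R.

Lemma zO_phi3 a e f g : zO (phi3 a e f g) (- th3 a e f g).
Proof.
unfold phi3. eapply zO_eq; [intros; reflexivity| |zO_tac]. unfold th3. ring.
Qed.

Lemma s2t_bound a e f g d : (0 < d <= 1)%R -> exists K, (0 < K)%R /\ forall k,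
  rbnd (fun m => Cmod (s2t a e f g k m)) (K * (pz k (- th3 a e f g) + pz k (- 2 + 2 * d))).
Proof.
intros Hd. set (v := vv a e f g).
destruct (asy_balcoef (1 + a - f - g) (1 + a - e - g) (1 + a - e - f)) as [K0 [HK0 Hs]].
assert (Hs' : forall m, (Cmod (sm a e f g m) <= K0 * pw m (th3 a e f g - 3) * (INR (fact m) * INR (fact m)))%R).
{ intros m. replace (th3 a e f g - 3)%R with (Re (1 + a - f - g) + Re (1 + a - e - g) + Re (1 + a - e - f) - 3)%R; [apply Hs|].
  unfold th3. autorewrite with re. ring. }
destruct (row_bound (sm a e f g) (2 - v) (2 + a - v) K0 (th3 a e f g) d HK0 Hs') as [K1 [HK1 H1]]; [|easy|].
{ unfold th3, v, vv. autorewrite with re. ring. }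
destruct (row_bound (sm a e f g) (2 + a - v) (2 - v) K0 (th3 a e f g) d HK0 Hs') as [K2 [HK2 H2]]; [|easy|].
{ unfold th3, v, vv. autorewrite with re. ring. }
exists (K1 + K2)%R; split; [lra|]. intros k.
assert (P : (0 < pz k (- th3 a e f g) + pz k (- 2 + 2 * d))%R).
{ unfold pz. generalize (pw_pos (Z.abs_nat k) (- th3 a e f g)) (pw_pos (Z.abs_nat k) (- 2 + 2 * d)); lra. }
set (p := (pz k (- th3 a e f g) + pz k (- 2 + 2 * d))%R) in *.
assert (P1 : (0 < K1 * p)%R) by (apply Rmult_lt_0_compat; lra).
assert (P2 : (0 < K2 * p)%R) by (apply Rmult_lt_0_compat; lra).
destruct (Z.le_ge_cases 0 k).
- apply rbnd_weaken with (K1 * p)%R; [lra|]. unfold p, pz. eapply rbnd_le; [|exact (H1 (Z.abs_nat k))].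
  intros m. right. f_equal. unfold s2t, row, phi. fold v.
  replace (RtoC (INR (Z.abs_nat k))) with (Cz k) by (rewrite <- Cz_nat; f_equal; lia).
  rewrite <- Cmult_assoc. f_equal. f_equal; f_equal; rewrite RtoC_2; ring.
- apply rbnd_weaken with (K2 * p)%R; [lra|]. unfold p, pz. eapply rbnd_le; [|exact (H2 (Z.abs_nat k))].
  intros m. right. f_equal. unfold s2t, row, phi. fold v.
  replace (RtoC (INR (Z.abs_nat k))) with (- Cz k) by (rewrite <- Cz_nat, <- Cz_opp; f_equal; lia).
  rewrite <- Cmult_assoc. f_equal. rewrite Cmult_comm. f_equal; f_equal; rewrite RtoC_2; ring.
Qed.

Lemma s2t_summable a e f g k : summable (s2t a e f g k).
Proof.
destruct (s2t_bound a e f g 1 ltac:(lra)) as [K [_ H]]. eexists; apply H.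
Qed.

Lemma s2_bound a e f g d : (0 < d <= 1)%R -> exists K, (0 < K)%R /\ forall k,
  (Cmod (s2 a e f g k) <= K * (pz k (- th3 a e f g) + pz k (- 2 + 2 * d)))%R.
Proof.
intros Hd. destruct (s2t_bound a e f g d Hd) as [K [HK H]].
exists ((Cmod (sg e * sg f * sg g) + 1) * K)%R.
assert (A := Cmod_ge_0 (sg e * sg f * sg g)).
split; [apply Rmult_lt_0_compat; lra|]. intros k. unfold s2.
rewrite Cmod_mult, Cmod_opp, Rmult_assoc. specialize (H k).
assert (B := csum_bound _ _ H). assert (D := rbnd_ge0 _ _ H).
apply Rmult_le_compat; [lra|apply Cmod_ge_0|lra|easy].
Qed.

Lemma s1t_bound a e f g d : (0 < d <= 1)%R -> exists K, (0 < K)%R /\ forall k, (0 <= k)%Z ->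
  rbnd (fun n => Cmod (s1t a e f g k n)) (K * pz k (- 2 + 2 * d)).
Proof.
intros Hd. set (v := vv a e f g).
assert (Hq : asy (fun n => rG (v + INR n) * (rG (1 - e - INR n) * rG (1 - f - INR n) * rG (1 - g - INR n))) (Re a - 2) 2).
{ eapply asy_eq; [intros; reflexivity| | |asy_tac]; [|lia]. unfold v, vv. autorewrite with re. ring. }
destruct Hq as [Kq [HKq Hq]].
destruct (rG_bound_p (1 + a)) as [Ka [HKa Ha]].
set (c := Rpower 2 (Rabs (1 - Re (1 + a)))). assert (Hc : (0 < c)%R) by apply exp_pos.
destruct (rsummable_pw (- 1 - d) ltac:(lra)) as [M HM]. assert (HM0 := rbnd_ge0 _ _ HM).
set (A := (Kq * Ka * c * 2)%R). assert (HA : (0 < A)%R) by (unfold A; repeat apply Rmult_lt_0_compat; lra).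
exists (A * M + 1)%R; split; [nra|]. intros k Hk.
assert (Pk := pw_pos (Z.abs_nat k) (-2 + 2 * d)).
apply rbnd_weaken with (A * pz k (- 2 + 2 * d) * M)%R; [unfold pz; nra|].
apply (rbnd_reindex (fun m => (0 + Z.of_nat m)%Z) (zle 0) (zle_h 0) (zle_p 0)).
{ intros n Hn. apply zle_None in Hn. unfold s1t. rewrite psi_zero by lia. rewrite Cmult_0_r. apply Cmod_0. }
apply rbnd_le with (fun n => A * pz k (- 2 + 2 * d) * pw n (- 1 - d))%R.
2:{ apply rbnd_scal; [unfold pz; nra|easy]. }
intros n. rewrite Z.add_0_l.
destruct (Nat.le_gt_cases (Z.abs_nat k) n) as [L|L].
2:{ unfold s1t. rewrite psi_zero by lia. rewrite Cmult_0_r, Cmod_0.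
    repeat apply Rmult_le_pos; try lra; apply pw_ge0. }
set (j := Z.abs_nat k) in *. unfold s1t. rewrite !Cmod_mult, Cmod_sgn, Rmult_1_l.
specialize (Hq n). specialize (Ha (n + j)%nat).
assert (Ek : Cz k = INR j) by (rewrite <- Cz_nat; f_equal; unfold j; lia).
assert (E1 : psi a (Z.of_nat n) k = / INR (fact (n - j)) * rG (1 + a + INR (n + j))).
{ unfold psi. rewrite Ek, Cz_nat.
  replace (1 + INR n - INR j) with (1 + INR (n - j)) by (rewrite minus_INR, RtoC_minus by easy; ring).
  rewrite rG_fact. f_equal. f_equal. rewrite plus_INR, RtoC_plus; ring. }
rewrite E1. unfold qn. fold v. rewrite Cz_nat.
rewrite (Cmod_mult (/ INR (fact (n - j)))), Cmod_inv, Cmod_R, Rabs_pos_eq by (apply INR_fact_C || apply Rlt_le, INR_fact_pos).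
assert (D := pw_double n j (1 - Re (1 + a)) L). fold c in D.
assert (B := bq_le n j d L ltac:(lra)).
assert (f1 := INR_fact_pos n). assert (f2 := INR_fact_pos (n - j)). assert (f3 := INR_fact_pos (n + j)).
assert (p1 := pw_pos n (Re a - 2)). assert (p2 := pw_pos n (1 - Re (1 + a))).
apply Rle_trans with ((Kq * pw n (Re a - 2) * (INR (fact n) * INR (fact n))) * (/ INR (fact (n - j)) * (Ka * (c * pw n (1 - Re (1 + a))) / INR (fact (n + j)))))%R.
{ apply Rmult_le_compat; [apply Cmod_ge_0| | |].
  - apply Rmult_le_pos; [apply Rlt_le, Rinv_0_lt_compat; easy|apply Cmod_ge_0].
  - apply Rle_trans with (1 := Hq). right. simpl. ring.
  - apply Rmult_le_compat_l; [apply Rlt_le, Rinv_0_lt_compat; easy|].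
    apply Rle_trans with (1 := Ha). unfold Rdiv. apply Rmult_le_compat_r; [apply Rlt_le, Rinv_0_lt_compat; easy|].
    apply Rmult_le_compat_l; lra. }
replace ((Kq * pw n (Re a - 2) * (INR (fact n) * INR (fact n))) * (/ INR (fact (n - j)) * (Ka * (c * pw n (1 - Re (1 + a))) / INR (fact (n + j)))))%R
  with (Kq * Ka * c * (pw n (Re a - 2) * pw n (1 - Re (1 + a))) * bq n j)%R by (unfold bq; field; lra).
rewrite pw_plus. replace (Re a - 2 + (1 - Re (1 + a)))%R with (-2)%R by (autorewrite with re; ring).
apply Rle_trans with (Kq * Ka * c * pw n (-2) * (2 * pw n (1 - d) * pw j (-2 + 2 * d)))%R.
{ apply Rmult_le_compat_l; [|easy]. repeat apply Rmult_le_pos; try lra; apply pw_ge0. }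
right. unfold A, pz. fold j. replace (-1 - d)%R with (-2 + (1 - d))%R by ring.
rewrite <- (pw_plus n (-2)). ring.
Qed.

(** For negative k the terms of the first series do not decay uniformly; its
    value does, because the other two terms of the expansion do. *)
Lemma s1_bound_all a e f g d : (0 < d <= 1)%R -> exists K, (0 < K)%R /\ forall k,
  (Cmod (s1 a e f g k) <= K * (pz k (- th3 a e f g) + pz k (- 2 + 2 * d)))%R.
Proof.
intros Hd. destruct (s2_bound a e f g d Hd) as [K [HK H]].
destruct (zO_phi3 a e f g) as [L [HL H']].
exists (Cmod (sg (vv a e f g)) * L + K)%R.
assert (A := Cmod_ge_0 (sg (vv a e f g))).
split; [nra|]. intros k. specialize (H k). specialize (H' k).
replace (s1 a e f g k) with (sg (vv a e f g) * phi3 a e f g k + - s2 a e f g k) by (rewrite phi3_expand; ring).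
eapply Rle_trans; [apply Cmod_triangle|]. rewrite Cmod_opp, Cmod_mult.
unfold pz in *. assert (P := pw_pos (Z.abs_nat k) (-2 + 2 * d)).
set (p := pw (Z.abs_nat k) (- th3 a e f g)) in *.
assert (Cmod (sg (vv a e f g)) * Cmod (phi3 a e f g k) <= Cmod (sg (vv a e f g)) * (L * p))%R by (now apply Rmult_le_compat_l).
assert (0 <= Cmod (sg (vv a e f g)) * L * pw (Z.abs_nat k) (-2 + 2 * d))%R by (repeat apply Rmult_le_pos; lra).
lra.
Qed.

(** * Integrating the expansions against each other *)

Definition ww (a b c d e f g : C) : C := 1 + 1 + a + a + a - b - c - d - e - f - g.

Definition uu (a b c d : C) : C := 1 + a + a - b - c - d.

(** The denominators of the third series. *)
Definition del (a x e f g : C) : C := 1 + 1 + a + a - x - (e + f + g).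

Definition Wt (a b c d e f g : C) (m : nat) : C :=
  sm a e f g m * (/ rG (ww a b c d e f g + INR m)
  * (rG (del a b e f g + INR m) * rG (del a c e f g + INR m) * rG (del a d e f g + INR m))).

Definition WW (a b c d e f g : C) : C := csum (Wt a b c d e f g).

Lemma ww_th a b c d e f g :
  Re (ww a b c d e f g) = ((th3 a b c d + th3 a e f g) / 2 - 1)%R.
Proof. unfold ww, th3. autorewrite with re. field. Qed.

Lemma lam5_shift a b c d e f g (m : nat) : (0 < Re (ww a b c d e f g))%R ->
  cv5 a b c d (vv a e f g - 1 - INR m).
Proof.
unfold cv5, ww, vv. autorewrite with re. assert (H := pos_INR m). lra.
Qed.

Lemma y5_shift a b c d e f g (m : nat) :
  y5 a b c d (vv a e f g - 1 - INR m) = m3 a b c d * (/ rG (ww a b c d e f g + INR m)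
  * (rG (del a b e f g + INR m) * rG (del a c e f g + INR m) * rG (del a d e f g + INR m))).
Proof.
unfold y5, m3, ww, del, vv.
replace (1 + a + a - b - c - d - (e + f + g - a - 1 - INR m)) with (1 + 1 + a + a + a - b - c - d - e - f - g + INR m) by ring.
replace (1 + a - b - (e + f + g - a - 1 - INR m)) with (1 + 1 + a + a - b - (e + f + g) + INR m) by ring.
replace (1 + a - c - (e + f + g - a - 1 - INR m)) with (1 + 1 + a + a - c - (e + f + g) + INR m) by ring.
replace (1 + a - d - (e + f + g - a - 1 - INR m)) with (1 + 1 + a + a - d - (e + f + g) + INR m) by ring.
ring.
Qed.

Lemma zO_bound2 f x p q : zO f x -> exists K, (0 < K)%R /\ forall k : Z, forall h M,
  (h <= M * (pz k p + pz k q))%R -> (0 <= h)%R -> 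
  (Cmod (f k) * h <= K * M * (pz k (x + p) + pz k (x + q)))%R.
Proof.
intros [K [HK H]]. exists K; split; [easy|]. intros k h M Hh H0. specialize (H k).
unfold pz in *. rewrite <- (pw_plus _ x p), <- (pw_plus _ x q).
set (X := pw (Z.abs_nat k) x) in *.
replace (K * M * (X * pw (Z.abs_nat k) p + X * pw (Z.abs_nat k) q))%R
  with ((K * X) * (M * (pw (Z.abs_nat k) p + pw (Z.abs_nat k) q)))%R by ring.
apply Rmult_le_compat; auto using Cmod_ge_0.
Qed.

Lemma rsummable_pz2 K x y : (0 <= K)%R -> (x < -1)%R -> (y < -1)%R ->
  rsummable (fun k => K * (pz k x + pz k y))%R.
Proof.
intros HK Hx Hy. apply rsummable_scal; [easy|]. 
apply rsummable_plus; now apply rsummable_pz.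
Qed.

Lemma rG_shift_inv z n : rG z <> 0 -> / rG (z + INR n) = rising z n * / rG z.
Proof.
intros H. assert (E := rGamma_rising z n).
assert (H1 : rG (z + INR n) <> 0) by (intros X; rewrite X, Cmult_0_r in E; easy).
assert (H2 : rising z n <> 0) by (intros X; rewrite X, Cmult_0_l in E; easy).
rewrite E. field. easy.
Qed.

Lemma asy_inv_rG z : rG z <> 0 -> asy (fun n => / rG (z + INR n)) (Re z - 1) 1.
Proof.
intros H. eapply (asy_use (fun n => rising z n * / rG z)); [asy_tac| |ring|lia].
intros n. now rewrite rG_shift_inv.
Qed.

Lemma asy_Wt a b c d e f g : rG (ww a b c d e f g) <> 0 -> asy (Wt a b c d e f g) (- 2) 0.
Proof.
intros H. unfold Wt, sm. eapply asy_eq; [intros; reflexivity| | |asy_tac; apply asy_inv_rG, H]; [|lia].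
unfold ww, del. autorewrite with re. ring.
Qed.

Lemma Wt_summable a b c d e f g : rG (ww a b c d e f g) <> 0 -> summable (Wt a b c d e f g).
Proof. intros H; apply asy_summable with (1 := asy_Wt _ _ _ _ _ _ _ H); lra. Qed.

(** The row bounds of the expansion make the double sum absolutely convergent
    as soon as [F] decays a little. *)
Lemma pair_s2_swap F x a e f g d : (0 < d <= 1)%R -> zO F x ->
  (x - th3 a e f g < -1)%R -> (x - 2 + 2 * d < -1)%R ->
  csum (fun k => F k * s2 a e f g k)
  = - (sg e * sg f * sg g) * csum (fun m => sm a e f g m * csum (fun k => F k * phi a (vv a e f g - 1 - INR m) k)).
Proof.
intros Hd HF H1 H2.
destruct (s2t_bound a e f g d Hd) as [K [HK HB]].
destruct (zO_bound2 F x (- th3 a e f g) (- 2 + 2 * d) HF) as [L [HL HL']].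
set (v := vv a e f g).
assert (R : forall k, rbnd (fun m => Cmod (F k * s2t a e f g k m)) (L * K * (pz k (x + - th3 a e f g) + pz k (x + (- 2 + 2 * d))))).
{ intros k. eapply rbnd_weaken; [apply (HL' k (K * (pz k (- th3 a e f g) + pz k (- 2 + 2 * d)))%R K)|].
  - lra.
  - apply rbnd_ge0 with (1 := HB k).
  - eapply rbnd_le; [|apply rbnd_scal; [apply Cmod_ge_0|apply (HB k)]]. intros m. rewrite Cmod_mult. lra. }
assert (S : rsummable (fun k => L * K * (pz k (x + - th3 a e f g) + pz k (x + (- 2 + 2 * d))))%R).
{ apply rsummable_pz2; [nra|lra|lra]. }
transitivity (csum (fun k => - (sg e * sg f * sg g) * csum (fun m => F k * s2t a e f g k m))).
{ apply csum_ext; intros k. rewrite csum_scal by apply s2t_summable. unfold s2. ring. }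
rewrite csum_scal by (apply summable_csum_rows with (1 := R); easy).
f_equal. rewrite (csum_swap _ _ R S). apply csum_ext; intros m.
destruct (zO_phi a (v - 1 - INR m)) as [K' [HK' HP]].
rewrite <- csum_scal.
- apply csum_ext; intros k. unfold s2t. fold v. ring.
- apply zO_summable with (x + (2 * Re (v - 1 - INR m) - Re a - 1))%R.
  + apply (zO_mult F); [easy|apply zO_phi].
  + unfold v, vv. unfold th3 in H1. autorewrite with re. generalize (pos_INR m). lra.
Qed.

Lemma zO_vwphi3 a b c d : zO (fun k => vw a k * phi3 a b c d k) (1 - th3 a b c d).
Proof.
eapply zO_eq; [intros; reflexivity| |apply (zO_mult (vw a) (phi3 a b c d)); [apply zO_vw|apply zO_phi3]]. ring.
Qed.

(** Each term of the second series is a single [phi], so that the sum over k is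
    Dougall's. *)
Lemma pair_phi3_s2 a b c d e f g : (0 < Re (ww a b c d e f g))%R -> (0 < th3 a b c d)%R ->
  csum (fun k => vw a k * phi3 a b c d k * s2 a e f g k)
  = - (sg e * sg f * sg g) * sg a * m3 a b c d * WW a b c d e f g.
Proof.
intros Hw Ht. rewrite ww_th in Hw.
set (t := Rmin 1 (th3 a b c d / 4)). 
assert (Ht' : (0 < t <= 1)%R /\ (t <= th3 a b c d / 4)%R).
{ unfold t, Rmin. destruct (Rle_dec 1 (th3 a b c d / 4)); lra. }
rewrite (pair_s2_swap _ _ a e f g t (proj1 Ht') (zO_vwphi3 a b c d)) by lra.
rewrite <- ww_th in Hw.
assert (E : forall m : nat, csum (fun k => vw a k * phi3 a b c d k * phi a (vv a e f g - 1 - INR m) k)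
  = sg a * y5 a b c d (vv a e f g - 1 - INR m)).
{ intros m. assert (Z := err5_zero a b c d _ (lam5_shift a b c d e f g m Hw)). unfold err5 in Z.
  apply Cminus_eq in Z. rewrite <- Z. apply csum_ext; intros k. unfold lam5t, phi3. ring. }
assert (E2 : csum (fun m => sm a e f g m * csum (fun k => vw a k * phi3 a b c d k * phi a (vv a e f g - 1 - INR m) k))
 = csum (fun m => sg a * m3 a b c d * Wt a b c d e f g m)).
{ apply csum_ext; intros m. rewrite E, y5_shift. unfold Wt. ring. }
rewrite E2. rewrite csum_scal.
- unfold WW. ring.
- now apply Wt_summable, rGamma_Re_pos.
Qed.

Lemma csum_Zopp f : summable f -> csum f = csum (fun k => f (- k)%Z).
Proof. intros H. apply (csum_bij Z.opp Z.opp); [intros; lia|intros; lia|easy]. Qed.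

Lemma phi3_reflect a b c d k : phi3 (- a) (b - a) (c - a) (d - a) k = phi3 a b c d (- k).
Proof. unfold phi3. rewrite <- (Z.opp_involutive k) at 1 2 3. now rewrite !phi_reflect. Qed.

Lemma vw_opp a k : vw (- a) k = - vw a (- k).
Proof. unfold vw. rewrite Cz_opp. ring. Qed.

Lemma ww_reflect a b c d e f g :
  ww (- a) (e - a) (f - a) (g - a) (b - a) (c - a) (d - a) = ww a b c d e f g.
Proof. unfold ww. ring. Qed.

Lemma th3_reflect a b c d : th3 (- a) (b - a) (c - a) (d - a) = th3 a b c d.
Proof. unfold th3. autorewrite with re. ring. Qed.

(** The mirror image of [pair_phi3_s2] under k -> -k, a -> -a, x -> x - a. *)
Lemma pair_s2_phi3 a b c d e f g : (0 < Re (ww a b c d e f g))%R -> (0 < th3 a e f g)%R ->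
  summable (fun k => vw a k * s2 (- a) (b - a) (c - a) (d - a) (- k) * phi3 a e f g k) ->
  csum (fun k => vw a k * s2 (- a) (b - a) (c - a) (d - a) (- k) * phi3 a e f g k)
  = - (sg (b - a) * sg (c - a) * sg (d - a)) * sg a * m3 (- a) (e - a) (f - a) (g - a)
    * WW (- a) (e - a) (f - a) (g - a) (b - a) (c - a) (d - a).
Proof.
intros Hw Ht Hs. rewrite csum_Zopp by easy.
assert (E := pair_phi3_s2 (- a) (e - a) (f - a) (g - a) (b - a) (c - a) (d - a)).
rewrite ww_reflect, th3_reflect in E. specialize (E Hw Ht). rewrite sg_opp in E.
assert (X : forall k, vw a (- k) * s2 (- a) (b - a) (c - a) (d - a) (- - k) * phi3 a e f g (- k)
  = - (vw (- a) k * phi3 (- a) (e - a) (f - a) (g - a) k * s2 (- a) (b - a) (c - a) (d - a) k)).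
{ intros k. rewrite Z.opp_involutive, phi3_reflect, vw_opp. ring. }
apply (summable_bij Z.opp Z.opp) in Hs; [|intros; lia|intros; lia].
rewrite (csum_ext _ _ X). apply (summable_ext _ _ X), summable_opp in Hs.
rewrite csum_opp, E; [ring|].
revert Hs. apply summable_ext. intros k; ring.
Qed.

(** After both interchanges only sums with two factors [phi] remain, and these
    vanish. *)
Lemma pair_s2_s2 a b c d e f g : (0 < Re (ww a b c d e f g))%R ->
  (0 < th3 a b c d)%R -> (0 < th3 a e f g)%R ->
  csum (fun k => vw a k * s2 (- a) (b - a) (c - a) (d - a) (- k) * s2 a e f g k) = 0.
Proof.
intros Hw Hp Hq.
set (thP := th3 a b c d) in *. set (thQ := th3 a e f g) in *.
(* The bounds for the parts of the expansions lose an exponent t, which has to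
   stay below what the decay of P and Q leaves. *)
set (t := Rmin (1/4) (Rmin (thP / 4) (thQ / 4))).
assert (Ht : (0 < t <= 1 / 4)%R /\ (t <= thP / 4)%R /\ (t <= thQ / 4)%R).
{ unfold t, Rmin. repeat destruct (Rle_dec _ _); lra. }
assert (Hw' : (thP + thQ > 2)%R). { rewrite ww_th in Hw. fold thP thQ in Hw. lra. }
destruct (s2_bound (- a) (b - a) (c - a) (d - a) t ltac:(lra)) as [K [HK HB]].
rewrite th3_reflect in HB. fold thP in HB.
assert (ZR : zO (fun k => vw a k * s2 (- a) (b - a) (c - a) (d - a) (- k)) (1 - Rmin thP (2 - 2 * t))).
{ apply (zO_mult (vw a) (fun k => s2 (- a) (b - a) (c - a) (d - a) (- k))); [apply zO_vw|].
  exists (K * 2)%R; split; [lra|]. intros k. specialize (HB (- k)%Z).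
  eapply Rle_trans; [apply HB|]. rewrite Rmult_assoc. apply Rmult_le_compat_l; [lra|].
  unfold pz. replace (Z.abs_nat (- k)) with (Z.abs_nat k) by lia.
  assert (pw (Z.abs_nat k) (- thP) <= pw (Z.abs_nat k) (- Rmin thP (2 - 2 * t)))%R
    by (apply pw_le; generalize (Rmin_l thP (2 - 2 * t)); lra).
  assert (pw (Z.abs_nat k) (- 2 + 2 * t) <= pw (Z.abs_nat k) (- Rmin thP (2 - 2 * t)))%R
    by (apply pw_le; generalize (Rmin_r thP (2 - 2 * t)); lra).
  lra. }
assert (Hm : (1 - Rmin thP (2 - 2 * t) - thQ < -1 /\ 1 - Rmin thP (2 - 2 * t) - 2 + 2 * t < -1)%R).
{ unfold Rmin. destruct (Rle_dec _ _); lra. }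
assert (P0 := pair_s2_swap _ _ a e f g t ltac:(lra) ZR). fold thQ in P0.
rewrite P0 by lra. clear P0.
transitivity (- (sg e * sg f * sg g) * csum (fun _ : nat => RtoC 0)).
2:{ rewrite csum_zero by easy. ring. }
f_equal. apply csum_ext; intros m.
assert (E : csum (fun k => vw a k * s2 (- a) (b - a) (c - a) (d - a) (- k) * phi a (vv a e f g - 1 - INR m) k) = 0);
  [|rewrite E; ring].
set (x := vv a e f g - 1 - INR m).
assert (Hx : (2 * Re x - Re a - 1 <= - thQ)%R).
{ unfold x, thQ, th3, vv. autorewrite with re. generalize (pos_INR m). lra. }
assert (ZF : zO (fun k => vw (- a) k * phi (- a) (x - a) k) (1 - thQ)).
{ apply zO_weaken with (1 + (2 * Re (x - a) - Re (- a) - 1))%R; [autorewrite with re; lra|].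
  apply (zO_mult (vw (- a)) (phi (- a) (x - a))); [apply zO_vw|apply zO_phi]. }
assert (H1 : (1 - thQ - thP < -1)%R) by lra.
assert (H2 : (1 - thQ - 2 + 2 * t < -1)%R) by lra.
assert (SS : summable (fun k => vw a k * s2 (- a) (b - a) (c - a) (d - a) (- k) * phi a x k)).
{ apply zO_summable with ((1 - Rmin thP (2 - 2 * t)) + (2 * Re x - Re a - 1))%R; [|lra].
  apply (zO_mult (fun k => vw a k * s2 (- a) (b - a) (c - a) (d - a) (- k)) (phi a x)); [easy|apply zO_phi]. }
rewrite csum_Zopp by easy.
assert (P := pair_s2_swap _ _ (- a) (b - a) (c - a) (d - a) t ltac:(lra) ZF).
rewrite th3_reflect in P. fold thP in P. specialize (P ltac:(lra) ltac:(lra)).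
assert (X : forall k, vw a (- k) * s2 (- a) (b - a) (c - a) (d - a) (- - k) * phi a x (- k)
  = -(1) * (vw (- a) k * phi (- a) (x - a) k * s2 (- a) (b - a) (c - a) (d - a) k)).
{ intros k. rewrite Z.opp_involutive, vw_opp. rewrite <- (phi_reflect a x), Z.opp_involutive. ring. }
rewrite (csum_ext _ _ X). rewrite csum_scal, P.
- transitivity (-(1) * (- (sg (b - a) * sg (c - a) * sg (d - a)) * csum (fun _ : nat => RtoC 0))).
  2:{ rewrite csum_zero by easy. ring. }
  f_equal. f_equal. apply csum_ext; intros n. rewrite <- (Cmult_0_r (sm (- a) (b - a) (c - a) (d - a) n)). f_equal.
  transitivity (csum (fun k => vw (- a) k * (phi (- a) (x - a) k * phi (- a) (vv (- a) (b - a) (c - a) (d - a) - 1 - INR n) k))).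
  { apply csum_ext; intros k. ring. }
  apply vw2_zero. unfold x, vv. unfold ww in Hw. autorewrite with re in *.
  generalize (pos_INR n) (pos_INR m). lra.
- apply (summable_bij Z.opp Z.opp) in SS; [|intros; lia|intros; lia].
  apply (summable_ext _ _ X) in SS. apply (summable_scal (-(1))) in SS.
  revert SS. apply summable_ext. intros k; ring.
Qed.

(** The two factors of an antidifference in k of the weighted product of two
    kernels, see [edge_step]. *)
Definition edge1 (a : C) (k n : Z) : C := rG (1 + Cz n - Cz k) * rG (a + Cz n + Cz k).
Definition edge2 (a : C) (k nu : Z) : C := rG (Cz k + Cz nu) * rG (1 - a + Cz nu - Cz k).

Lemma edge_step a n nu k :
  (Cz n + Cz nu) * (vw a k * psi a n k * psi (- a) nu (- k))
  = edge1 a k n * edge2 a k nu - edge1 a (k + 1) n * edge2 a (k + 1) nu.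
Proof.
unfold edge1, edge2, psi, vw. rewrite !Cz_plus, Cz_opp, Cz_1.
rewrite (rGamma_rec (a + Cz n + Cz k)), (rGamma_rec (Cz k + Cz nu)).
replace (1 + Cz n - (Cz k + 1)) with (Cz n - Cz k) by ring.
replace (1 - a + Cz nu - (Cz k + 1)) with (- a + Cz nu - Cz k) by ring.
rewrite (rGamma_rec (Cz n - Cz k)), (rGamma_rec (- a + Cz nu - Cz k)).
replace (a + Cz n + Cz k + 1) with (1 + a + Cz n + Cz k) by ring.
replace (a + Cz n + (Cz k + 1)) with (1 + a + Cz n + Cz k) by ring.
replace (Cz k + Cz nu + 1) with (1 + Cz nu + Cz k) by ring.
replace (Cz k + 1 + Cz nu) with (1 + Cz nu + Cz k) by ring.
replace (Cz n - Cz k + 1) with (1 + Cz n - Cz k) by ring.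
replace (- a + Cz nu - Cz k + 1) with (1 - a + Cz nu - Cz k) by ring.
replace (1 + Cz nu - - Cz k) with (1 + Cz nu + Cz k) by ring.
replace (1 + - a + Cz nu + - Cz k) with (1 - a + Cz nu - Cz k) by ring.
ring.
Qed.

Lemma edge1_zero a k n : (n < k)%Z -> edge1 a k n = 0.
Proof. intros H. unfold edge1. rewrite <- Cz_1, <- Cz_plus, <- Cz_minus, rG_Zneg by lia. ring. Qed.

Lemma edge2_zero a k n : (n <= - k)%Z -> edge2 a k n = 0.
Proof. intros H. unfold edge2. rewrite <- Cz_plus, rG_Zneg by lia. ring. Qed.

Lemma Cz_neq_0 n : n <> 0%Z -> Cz n <> 0.
Proof. intros H E. apply (f_equal Re) in E. simpl in E. now apply eq_IZR_R0 in E. Qed.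

Lemma csum_seq_telescope (F G : nat -> C) N : (forall i, F i = G i - G (S i)) ->
  fsum F (seq 0 N) = G 0%nat - G N.
Proof.
intros H. induction N as [|N IH]; [simpl; ring|]. rewrite fsum_seq_S, IH, H. ring.
Qed.

Lemma psi_diag a n : vw a n * psi a n n * psi (- a) (- n) (- n) = sg a.
Proof.
unfold psi, vw. rewrite !Cz_opp. 
replace (1 + Cz n - Cz n) with (RtoC 1) by ring.
replace (1 + - Cz n - - Cz n) with (RtoC 1) by ring.
replace (1 + a + Cz n + Cz n) with (a + Cz n + Cz n + 1) by ring.
replace (1 + - a + - Cz n + - Cz n) with (1 - (a + Cz n + Cz n)) by ring.
rewrite rGamma_1.
transitivity (sg (a + Cz n + Cz n)).
- unfold sg. rewrite (rGamma_rec (a + Cz n + Cz n)). ring.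
- rewrite !sg_Z. transitivity (sgn n * sgn n * sg a); [ring|]. rewrite sgn_sq. ring.
Qed.

Definition cond (b : bool) (x : C) : C := if b then x else 0.

(** The kernels are biorthogonal with respect to the weight a + 2k, up to a
    boundary term. On the diagonal the boundary term is 0, in accordance with
    / 0 = 0. *)
Lemma diag_sum a k0 n nu :
  fsum (fun i => vw a (k0 + Z.of_nat i) * psi a n (k0 + Z.of_nat i) * psi (- a) nu (- (k0 + Z.of_nat i)))
    (seq 0 (Z.to_nat (n - k0 + 1)))
  = cond (andb (k0 <=? n)%Z (nu =? - n)%Z) (sg a) + edge1 a k0 n * edge2 a k0 nu * / (Cz n + Cz nu).
Proof.
destruct (Z.leb_spec k0 n) as [L|L].
2:{ replace (Z.to_nat (n - k0 + 1)) with 0%nat by lia. rewrite edge1_zero by easy. simpl. ring. }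
destruct (Z.eqb_spec nu (- n)) as [->|E]; simpl.
- rewrite edge2_zero by lia. replace (Z.to_nat (n - k0 + 1)) with (S (Z.to_nat (n - k0))) by lia.
  rewrite fsum_seq_S. replace (k0 + Z.of_nat (Z.to_nat (n - k0)))%Z with n by lia.
  rewrite psi_diag.
  assert (Z0 : forall m, (m <= Z.to_nat (n - k0))%nat -> fsum (fun i => vw a (k0 + Z.of_nat i) * psi a n (k0 + Z.of_nat i) * psi (- a) (- n) (- (k0 + Z.of_nat i)))
    (seq 0 m) = 0).
  { induction m as [|m IH]; intros Hm; [easy|]. rewrite fsum_seq_S, IH by lia. rewrite (psi_zero (- a)) by lia. ring. }
  rewrite Z0 by lia. ring.
- assert (Hn : Cz n + Cz nu <> 0) by (rewrite <- Cz_plus; apply Cz_neq_0; lia).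
  set (F := fun i => _).
  assert (T : (Cz n + Cz nu) * fsum F (seq 0 (Z.to_nat (n - k0 + 1))) = edge1 a k0 n * edge2 a k0 nu).
  { rewrite <- fsum_scal.
    rewrite (csum_seq_telescope _ (fun i => edge1 a (k0 + Z.of_nat i) n * edge2 a (k0 + Z.of_nat i) nu)).
    - rewrite (edge1_zero _ (k0 + Z.of_nat (Z.to_nat (n - k0 + 1)))) by lia. rewrite Z.add_0_r. ring.
    - intros i. unfold F. rewrite edge_step. now replace (k0 + Z.of_nat i + 1)%Z with (k0 + Z.of_nat (S i))%Z by lia. }
  rewrite <- T. field. easy.
Qed.

(** The contribution of the boundary terms. *)
Definition cross (a e f g p q r : C) (k0 n nu : Z) : C :=
  (sgn n * qn a e f g n * edge1 a k0 n) * (sgn nu * qn (- a) p q r nu * edge2 a k0 nu) * / (Cz n + Cz nu).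

Lemma fsum_csum {I J : Type} (F : I -> J -> C) l : (forall i, summable (F i)) ->
  summable (fun j => fsum (fun i => F i j) l) /\ fsum (fun i => csum (F i)) l = csum (fun j => fsum (fun i => F i j) l).
Proof.
intros H. induction l as [|i l [IH1 IH2]]; simpl.
- split; [|now rewrite csum_zero]. apply (csum_finite (fun _ : J => RtoC 0) []); [constructor|easy].
- split; [now apply summable_plus|]. rewrite csum_plus, IH2 by easy. easy.
Qed.

Lemma csum_single {I : Type} (f : I -> C) i : (forall j, j <> i -> f j = 0) -> summable f /\ csum f = f i.
Proof.
intros H. destruct (csum_finite f [i]) as [S E].
- constructor; [easy|constructor].
- intros j Hj. apply H. intros ->. apply Hj. now left.
- split; [easy|]. rewrite E. simpl. ring.
Qed.

Definition t1t (a e f g p q r : C) (n : Z) : C := qn a e f g n * qn (- a) p q r (- n).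

Lemma zO_t1t a e f g p q r : zO (t1t a e f g p q r) (- 2).
Proof.
apply zO_halves; unfold t1t, qn.
- eapply (asy_use (fun n => rG (vv a e f g + INR n) * (rG (1 - e - INR n) * rG (1 - f - INR n) * rG (1 - g - INR n))
   * (rG (vv (- a) p q r - INR n) * (rG (1 - p + INR n) * rG (1 - q + INR n) * rG (1 - r + INR n))))); [asy_tac| | |lia].
  + intros n. rewrite Cz_mnat, Cz_nat. assert (D : forall x y : C, x - - y = x + y) by (intros; ring). now rewrite !D.
  + unfold vv. autorewrite with re. ring.
- eapply (asy_use (fun n => rG (vv a e f g - INR n) * (rG (1 - e + INR n) * rG (1 - f + INR n) * rG (1 - g + INR n))
   * (rG (vv (- a) p q r + INR n) * (rG (1 - p - INR n) * rG (1 - q - INR n) * rG (1 - r - INR n))))); [asy_tac| | |lia].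
  + intros n. rewrite Z.opp_involutive, Cz_mnat, Cz_nat. assert (D : forall x y : C, x - - y = x + y) by (intros; ring). now rewrite !D.
  + unfold vv. autorewrite with re. ring.
Qed.

Lemma t1t_summable a e f g p q r : summable (t1t a e f g p q r).
Proof. apply zO_summable with (1 := zO_t1t _ _ _ _ _ _ _). lra. Qed.

Lemma cond_summable {I : Type} (b : I -> bool) (f : I -> C) : summable f -> summable (fun i => cond (b i) (f i)).
Proof.
intros H. apply summable_le with (fun i => Cmod (f i)); [|easy]. intros i. unfold cond.
destruct (b i); [lra|]. rewrite Cmod_0. apply Cmod_ge_0.
Qed.

(** For k >= 0 the series s1(k) may be integrated term by term, and each of its
    terms meets finitely many k only. So the other factor can be expanded in
    finitely many places, and the biorthogonality applies. *)
Lemma half_sum a e f g p q r k0 : (0 <= k0)%Z -> (0 < th3 (- a) p q r)%R ->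
  csum (fun i => vw a (k0 + Z.of_nat i) * s1 a e f g (k0 + Z.of_nat i) * s1 (- a) p q r (- (k0 + Z.of_nat i)))
  = m3 a e f g * m3 (- a) p q r *
    (sg a * csum (fun n => cond (k0 <=? n)%Z (t1t a e f g p q r n))
     + csum (fun n => csum (cross a e f g p q r k0 n))).
Proof.
intros Hk Ht. set (th := th3 (- a) p q r) in *.
(* With this d the double sum over k and n converges absolutely. *)
set (d := Rmin (1 / 4) (th / 4)).
assert (Hd : (0 < d <= 1 / 4)%R /\ (d <= th / 4)%R). { unfold d, Rmin. destruct (Rle_dec _ _); lra. }
destruct (s1_bound_all (- a) p q r d ltac:(lra)) as [K1 [HK1 B1]]. fold th in B1.
destruct (s1t_bound a e f g d ltac:(lra)) as [K2 [HK2 B2]].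
destruct (zO_vw a) as [K3 [HK3 B3]].
set (K := fun i : nat => (k0 + Z.of_nat i)%Z).
set (u := fun (i : nat) (n : Z) => vw a (K i) * s1 (- a) p q r (- K i) * s1t a e f g (K i) n).
set (b := fun k => (K3 * K1 * K2 * (pz k (1 - th + (- 2 + 2 * d)) + pz k (1 + (- 2 + 2 * d) + (- 2 + 2 * d))))%R).
assert (HR : forall i, rbnd (fun n => Cmod (u i n)) (b (K i))).
{ intros i. specialize (B1 (- K i)%Z). specialize (B2 (K i) ltac:(unfold K; lia)). specialize (B3 (K i)).
  assert (P1 := Cmod_ge_0 (vw a (K i))). assert (P2 := Cmod_ge_0 (s1 (- a) p q r (- K i))).
  assert (P := rbnd_scal (Cmod (vw a (K i)) * Cmod (s1 (- a) p q r (- K i))) _ _ (Rmult_le_pos _ _ P1 P2) B2).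
  unfold b, pz in *. replace (Z.abs_nat (- K i)) with (Z.abs_nat (K i)) in B1 by lia.
  set (x := Z.abs_nat (K i)) in *.
  assert (Q := pw_pos x (- 2 + 2 * d)).
  eapply rbnd_weaken; [|eapply rbnd_le; [|exact P]].
  - rewrite <- (pw_plus x (1 - th)), <- (pw_plus x (1 + (- 2 + 2 * d))), <- (pw_plus x 1 (- 2 + 2 * d)).
    replace (1 - th)%R with (1 + - th)%R by ring. rewrite <- (pw_plus x 1 (- th)).
    apply Rle_trans with ((K3 * pw x 1) * (K1 * (pw x (- th) + pw x (- 2 + 2 * d))) * (K2 * pw x (- 2 + 2 * d)))%R; [|right; ring].
    apply Rmult_le_compat_r; [nra|]. apply Rmult_le_compat; easy.
  - intros n. unfold u. rewrite !Cmod_mult. lra. }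
assert (HS : rsummable (fun i => b (K i))).
{ assert (S : rsummable b) by (apply rsummable_pz2; [|lra|lra]; apply Rlt_le; repeat apply Rmult_lt_0_compat; lra).
  destruct S as [M HM]. exists M.
  exact (rbnd_restrict K (zle k0) (zle_h k0) b M HM). }
transitivity (m3 a e f g * csum (fun i => csum (u i))).
{ rewrite <- csum_scal by (now apply summable_csum_rows with (1 := HR)).
  apply csum_ext; intros i. unfold u. fold (K i).
  rewrite csum_scal by apply s1t_summable. unfold s1 at 1. ring. }
rewrite <- Cmult_assoc. f_equal.
assert (HT := summable_swap u _ HR HS).
assert (SW := csum_swap u _ HR HS).
change (csum (fun i => csum (u i)) = csum (fun n => csum (fun i => u i n))) in SW. rewrite SW. clear SW.
assert (E : forall n, summable (cross a e f g p q r k0 n) /\ csum (fun i => u i n) = m3 (- a) p q r * (cond (k0 <=? n)%Z (sg a * t1t a e f g p q r n)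
   + csum (cross a e f g p q r k0 n))).
{ intros n.
  assert (U0 : forall i, ~ In i (seq 0 (Z.to_nat (n - k0 + 1))) -> u i n = 0).
  { intros i Hi. rewrite in_seq in Hi. unfold u, s1t. rewrite psi_zero by (unfold K; lia). ring. }
  destruct (csum_finite (fun i => u i n) _ (seq_NoDup _ _) U0) as [_ ->].
  set (V := fun (i : nat) (nu : Z) => (sgn n * qn a e f g n) * (sgn nu * qn (- a) p q r nu)
     * (vw a (K i) * psi a n (K i) * psi (- a) nu (- K i))).
  assert (VE : forall i nu, V i nu = vw a (K i) * s1t a e f g (K i) n * s1t (- a) p q r (- K i) nu).
  { intros i nu. unfold V, s1t. ring. }
  assert (VS : forall i, summable (V i)).
  { intros i. eapply summable_ext; [intros nu; symmetry; apply VE|]. apply summable_scal, s1t_summable. }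
  destruct (fsum_csum V (seq 0 (Z.to_nat (n - k0 + 1))) VS) as [F1 F2].
  assert (D : forall nu, fsum (fun i => V i nu) (seq 0 (Z.to_nat (n - k0 + 1)))
     = cond (andb (k0 <=? n)%Z (nu =? - n)%Z) (sg a * t1t a e f g p q r n) + cross a e f g p q r k0 n nu).
  { intros nu. unfold V. rewrite fsum_scal. unfold K. rewrite diag_sum. unfold cross, cond, t1t.
    destruct (Z.leb_spec k0 n); simpl; [|ring].
    destruct (Z.eqb_spec nu (- n)); [subst; rewrite sgn_opp|ring].
    transitivity (sg a * (qn a e f g n * qn (- a) p q r (- n)) * (sgn n * sgn n) + sgn n * qn a e f g n * edge1 a k0 n * (sgn n * qn (- a) p q r (- n) * edge2 a k0 (- n)) *
 / (Cz n + Cz (- n))); [ring|]. rewrite sgn_sq. ring. }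
  destruct (csum_single (fun nu => cond (andb (k0 <=? n)%Z (nu =? - n)%Z) (sg a * t1t a e f g p q r n)) (- n)%Z) as [G1 G2].
  { intros nu Hnu. destruct (Z.eqb_spec nu (- n)); [easy|]. now rewrite Bool.andb_false_r. }
  rewrite Z.eqb_refl, Bool.andb_true_r in G2.
  apply (summable_ext _ _ D) in F1.
  assert (CS : summable (cross a e f g p q r k0 n)).
  { assert (F3 := summable_minus _ _ F1 G1). revert F3. apply summable_ext. intros nu. ring. }
  split; [easy|].
  rewrite <- G2, <- csum_plus by easy. rewrite <- (csum_ext _ _ D), <- F2, <- fsum_scal.
  apply fsum_ext; intros i _. rewrite (csum_ext _ _ (VE i)), csum_scal by apply s1t_summable.
  unfold u, s1 at 1. ring. }
assert (E1 : forall n, csum (fun i => u i n) = m3 (- a) p q r * (cond (k0 <=? n)%Z (sg a * t1t a e f g p q r n)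
   + csum (cross a e f g p q r k0 n))) by (intros; apply E).
rewrite (csum_ext _ _ E1). apply (summable_ext _ _ E1) in HT.
destruct (classic (m3 (- a) p q r = 0)) as [Z|Z].
{ rewrite Z. rewrite csum_zero by (intros; ring). ring. }
assert (DS : summable (fun n => cond (k0 <=? n)%Z (sg a * t1t a e f g p q r n)))
  by apply cond_summable, summable_scal, t1t_summable.
assert (HT' : summable (fun n => cond (k0 <=? n)%Z (sg a * t1t a e f g p q r n)
   + csum (cross a e f g p q r k0 n))).
{ apply (summable_scal (/ m3 (- a) p q r)) in HT. revert HT. apply summable_ext. intros n. field. easy. }
assert (CS : summable (fun n => csum (cross a e f g p q r k0 n))).
{ assert (F3 := summable_minus _ _ HT' DS). revert F3. apply summable_ext. intros n. ring. }
rewrite csum_scal by easy. f_equal. rewrite csum_plus by easy. f_equal.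
rewrite <- csum_scal by apply cond_summable, t1t_summable.
apply csum_ext; intros n. unfold cond. destruct (k0 <=? n)%Z; ring.
Qed.

Lemma Copp_opp (x : C) : - - x = x. Proof. ring. Qed.

Lemma csum_Z_halves f : summable f ->
  csum f = csum (fun i : nat => f (Z.of_nat i)) + csum (fun i : nat => f (- (1 + Z.of_nat i))%Z).
Proof.
intros H.
assert (S1 := cond_summable (fun k => 0 <=? k)%Z f H).
assert (S2 := cond_summable (fun k => k <? 0)%Z f H).
assert (E : forall k, f k = cond (0 <=? k)%Z (f k) + cond (k <? 0)%Z (f k)).
{ intros k. unfold cond. destruct (Z.leb_spec 0 k), (Z.ltb_spec k 0); try lia; ring. }
rewrite (csum_ext _ _ E), csum_plus by easy. f_equal.
- rewrite (csum_reindex (fun m => (0 + Z.of_nat m)%Z) (zle 0) (zle_h 0) (zle_p 0)) by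
    (easy || (intros j Hj; apply zle_None in Hj; unfold cond; destruct (Z.leb_spec 0 j); [lia|easy])).
  apply csum_ext; intros i. unfold cond. destruct (Z.leb_spec 0 (0 + Z.of_nat i)); [easy|lia].
- rewrite csum_Zopp by easy. apply (summable_bij Z.opp Z.opp) in S2; [|intros; lia|intros; lia].
  rewrite (csum_reindex (fun m => (1 + Z.of_nat m)%Z) (zle 1) (zle_h 1) (zle_p 1)) by
    (easy || (intros j Hj; apply zle_None in Hj; unfold cond; destruct (Z.ltb_spec (- j) 0); [lia|easy])).
  apply csum_ext; intros i. unfold cond. destruct (Z.ltb_spec (- (1 + Z.of_nat i)) 0); [easy|lia].
Qed.

(** The half sum over k < 0 is a reflected half sum over k >= 1. *)
Lemma cross_reflect a e f g p q r n nu :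
  cross a e f g p q r 0 n nu = cross (- a) p q r e f g 1 nu n.
Proof.
unfold cross, edge1, edge2. rewrite !Copp_opp, Cz_0, Cz_1.
replace (1 + Cz n - 0) with (1 + Cz n) by ring.
replace (a + Cz n + 0) with (1 - - a + Cz n - 1) by ring.
replace (0 + Cz nu) with (1 + Cz nu - 1) by ring.
replace (1 - a + Cz nu - 0) with (- a + Cz nu + 1) by ring.
replace (Cz nu + Cz n) with (Cz n + Cz nu) by ring. ring.
Qed.

Lemma zO_one_sided (f : Z -> C) x : (forall k, (k < 0)%Z -> f k = 0) -> asy (fun n => f (Z.of_nat n)) x 0 -> zO f x.
Proof.
intros H0 H. destruct (asy_bound _ _ H) as [K [HK HK']]. exists K; split; [easy|]. intros k.
destruct (Z_lt_le_dec k 0) as [L|L].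
- rewrite H0, Cmod_0 by easy. apply Rmult_le_pos; [lra|apply pw_ge0].
- specialize (HK' (Z.abs_nat k)). replace (Z.of_nat (Z.abs_nat k)) with k in HK' by lia. easy.
Qed.

Lemma zO_qn_edge1 a e f g : zO (fun n => qn a e f g n * edge1 a 0 n) (- 1).
Proof.
apply zO_one_sided.
- intros k Hk. rewrite edge1_zero by easy. ring.
- unfold qn, edge1. 
  eapply (asy_use (fun n => rG (vv a e f g + INR n) * (rG (1 - e - INR n) * rG (1 - f - INR n) * rG (1 - g - INR n))
    * (rG (1 + INR n) * rG (a + INR n)))); [asy_tac| | |lia].
  + intros n. rewrite Cz_nat, Cz_0. 
    replace (1 + INR n - 0) with (1 + INR n) by ring. now replace (a + INR n + 0) with (a + INR n) by ring.
  + unfold vv. autorewrite with re. ring.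
Qed.

Lemma zO_qn_edge2 a e f g : zO (fun n => qn (- a) e f g n * edge2 a 0 n) (- 1).
Proof.
apply zO_one_sided.
- intros k Hk. rewrite edge2_zero by lia. ring.
- unfold qn, edge2. 
  eapply (asy_use (fun n => rG (vv (- a) e f g + INR n) * (rG (1 - e - INR n) * rG (1 - f - INR n) * rG (1 - g - INR n))
    * (rG (0 + INR n) * rG (1 - a + INR n)))); [asy_tac| | |lia].
  + intros n. rewrite Cz_nat, Cz_0. now replace (1 - a + INR n - 0) with (1 - a + INR n) by ring.
  + unfold vv. autorewrite with re. ring.
Qed.

(** 1/(n+nu) is split evenly between the two indices. *)
Lemma inv_add_bound n nu : (0 <= n)%Z -> (1 <= nu)%Z ->
  (Cmod (/ (Cz n + Cz nu)) <= 2 * pz n (- (1 / 2)) * pz nu (- (1 / 2)))%R.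
Proof.
intros Hn Hnu. rewrite <- Cz_plus. unfold Cz.
assert (P : (1 <= IZR (n + nu))%R) by (apply IZR_le; lia).
rewrite Cmod_inv, Cmod_R, Rabs_pos_eq by (try (intros X; apply RtoC_inj in X); lra).
unfold pz.
assert (s1 := pw_opp (Z.abs_nat n) (1 / 2)). assert (t1 := pw_opp (Z.abs_nat nu) (1 / 2)).
assert (s2 := pw_plus (Z.abs_nat n) (1 / 2) (1 / 2)). assert (t2 := pw_plus (Z.abs_nat nu) (1 / 2) (1 / 2)).
replace (1 / 2 + 1 / 2)%R with 1%R in * by field. rewrite pw_1 in s2, t2.
rewrite INR_IZR_INZ in s2, t2. replace (Z.of_nat (Z.abs_nat n)) with n in s2 by lia. replace (Z.of_nat (Z.abs_nat nu)) with nu in t2 by lia.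
assert (p1 := pw_pos (Z.abs_nat n) (1 / 2)). assert (p2 := pw_pos (Z.abs_nat nu) (1 / 2)).
assert (p3 := pw_pos (Z.abs_nat n) (- (1 / 2))). assert (p4 := pw_pos (Z.abs_nat nu) (- (1 / 2))).
set (s := pw (Z.abs_nat n) (1 / 2)) in *. set (t := pw (Z.abs_nat nu) (1 / 2)) in *.
set (s' := pw (Z.abs_nat n) (- (1 / 2))) in *. set (t' := pw (Z.abs_nat nu) (- (1 / 2))) in *.
set (N := IZR (n + nu)) in *.
assert (A1 : (s * s <= N)%R). { rewrite s2. unfold N. rewrite <- plus_IZR. apply IZR_le. lia. }
assert (A2 : (t * t <= 2 * N)%R). { rewrite t2. unfold N. rewrite <- plus_IZR, <- mult_IZR. apply IZR_le. lia. }
assert (A3 : (s * t <= 2 * N)%R).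
{ apply Rsqr_incr_0_var; [|lra]. unfold Rsqr. replace (s * t * (s * t))%R with ((s * s) * (t * t))%R by ring.
  apply Rle_trans with (N * (2 * N))%R; [apply Rmult_le_compat; nra|nra]. }
apply (Rmult_le_reg_l N); [lra|]. rewrite Rinv_r by lra.
apply Rle_trans with ((s * t) * (s' * t'))%R.
- replace (s * t * (s' * t'))%R with ((s * s') * (t * t'))%R by ring. rewrite s1, t1. lra.
- replace (N * (2 * s' * t'))%R with (2 * N * (s' * t'))%R by ring. apply Rmult_le_compat_r; [nra|easy].
Qed.

(** The boundary terms of the two half sums are the same absolutely convergent
    double series, summed in the two possible orders. *)
Lemma cross_swap a e f g p q r :
  csum (fun n => csum (cross a e f g p q r 0 n)) = csum (fun nu => csum (cross (- a) p q r e f g 1 nu)).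
Proof.
destruct (zO_qn_edge1 a e f g) as [K1 [HK1 H1]]. destruct (zO_qn_edge2 a p q r) as [K2 [HK2 H2]].
destruct (rsummable_pz (- 1 + - (1 / 2))) as [M HM]; [lra|]. 
assert (HM0 : (0 <= M)%R) by exact (rbnd_ge0 _ _ HM).
assert (B : forall n nu, (Cmod (cross a e f g p q r 0 n nu) <= K1 * K2 * 2 * pz n (- 1 + - (1 / 2)) * pz nu (- 1 + - (1 / 2)))%R).
{ intros n nu.
  assert (P1 := pw_pos (Z.abs_nat n) (- 1 + - (1 / 2))). assert (P2 := pw_pos (Z.abs_nat nu) (- 1 + - (1 / 2))).
  assert (Z0 : (0 <= K1 * K2 * 2 * pz n (- 1 + - (1 / 2)) * pz nu (- 1 + - (1 / 2)))%R).
  { unfold pz. repeat apply Rmult_le_pos; try lra; apply pw_ge0. }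
  destruct (Z_lt_le_dec n 0) as [L|L].
  { unfold cross. rewrite edge1_zero by easy. rewrite Cmult_0_r, !Cmult_0_l, Cmod_0. easy. }
  destruct (Z_lt_le_dec nu 1) as [L'|L'].
  { unfold cross. rewrite edge2_zero by lia. rewrite !Cmult_0_r, !Cmult_0_l, Cmod_0. easy. }
  assert (H3 := inv_add_bound n nu L L'). specialize (H1 n). specialize (H2 nu).
  unfold cross. rewrite !Cmod_mult, !Cmod_sgn, !Rmult_1_l, <- !Cmod_mult.
  unfold pz in *. rewrite <- (pw_plus (Z.abs_nat n)), <- (pw_plus (Z.abs_nat nu)).
  rewrite !Cmod_mult. rewrite Cmod_mult in H1, H2.
  apply Rle_trans with ((K1 * pw (Z.abs_nat n) (- 1)) * (K2 * pw (Z.abs_nat nu) (- 1)) * (2 * pw (Z.abs_nat n) (- (1 / 2)) * pw (Z.abs_nat nu) (- (1 / 2))))%R; [|right; ring].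
  apply Rmult_le_compat; [|apply Cmod_ge_0| |easy].
  - repeat apply Rmult_le_pos; apply Cmod_ge_0.
  - apply Rmult_le_compat; try easy; repeat apply Rmult_le_pos; apply Cmod_ge_0. }
assert (R : forall n, rbnd (fun nu => Cmod (cross a e f g p q r 0 n nu)) (K1 * K2 * 2 * M * pz n (- 1 + - (1 / 2)))).
{ intros n. eapply rbnd_le; [intros nu; apply B|].
  replace (K1 * K2 * 2 * M * pz n (- 1 + - (1 / 2)))%R with (K1 * K2 * 2 * pz n (- 1 + - (1 / 2)) * M)%R by ring.
  apply rbnd_scal; [|easy]. unfold pz. repeat apply Rmult_le_pos; try lra; apply pw_ge0. }
assert (SW := csum_swap _ _ R).
change (rsummable (fun n => K1 * K2 * 2 * M * pz n (- 1 + - (1 / 2)))%R ->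
  csum (fun n => csum (cross a e f g p q r 0 n)) = csum (fun nu => csum (fun n => cross a e f g p q r 0 n nu))) in SW.
rewrite SW.
- apply csum_ext; intros nu. apply csum_ext; intros n. apply cross_reflect.
- apply rsummable_scal; [|eexists; exact HM]. repeat apply Rmult_le_pos; lra.
Qed.

(** The diagonal terms of the two half sums make up the whole bilateral series,
    and the boundary terms cancel. *)
Lemma pair_s1_s1 a e f g p q r : (0 < th3 (- a) p q r)%R -> (0 < th3 a e f g)%R ->
  summable (fun k => vw a k * s1 a e f g k * s1 (- a) p q r (- k)) ->
  csum (fun k => vw a k * s1 a e f g k * s1 (- a) p q r (- k))
  = sg a * (m3 a e f g * m3 (- a) p q r) * csum (t1t a e f g p q r).
Proof.
intros Hp Hq S. rewrite csum_Z_halves by easy.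
assert (H1 := half_sum a e f g p q r 0 ltac:(lia) Hp).
assert (H2 := half_sum (- a) p q r e f g 1 ltac:(lia)). rewrite Copp_opp in H2. specialize (H2 Hq).
rewrite sg_opp, <- cross_swap in H2.
set (X := csum (fun n => csum (cross a e f g p q r 0 n))) in *.
assert (E2 : csum (fun n => cond (1 <=? n)%Z (t1t (- a) p q r e f g n)) = csum (fun n => cond (n <=? -1)%Z (t1t a e f g p q r n))).
{ rewrite csum_Zopp by (apply cond_summable, t1t_summable). apply csum_ext; intros n.
  unfold t1t. rewrite Copp_opp, Z.opp_involutive. 
  replace (1 <=? - n)%Z with (n <=? - 1)%Z by (destruct (Z.leb_spec n (-1)), (Z.leb_spec 1 (- n)); lia || easy).
  f_equal. ring. }
rewrite E2 in H2. clear E2.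
assert (E : csum (t1t a e f g p q r) = csum (fun n => cond (0 <=? n)%Z (t1t a e f g p q r n)) + csum (fun n => cond (n <=? -1)%Z (t1t a e f g p q r n))).
{ rewrite <- csum_plus by (apply cond_summable, t1t_summable). apply csum_ext; intros n. unfold cond.
  destruct (Z.leb_spec 0 n), (Z.leb_spec n (-1)); try lia; ring. }
rewrite E. 
set (X1 := csum (fun n => cond (0 <=? n)%Z (t1t a e f g p q r n))) in *. set (X2 := csum (fun n => cond (n <=? -1)%Z (t1t a e f g p q r n))) in *.
transitivity (m3 a e f g * m3 (- a) p q r * (sg a * X1 + X) - m3 (- a) p q r * m3 a e f g * (- sg a * X2 + X)); [|ring].
rewrite <- H1, <- H2. clear H1 H2 E X X1 X2.
unfold Cminus. f_equal.
rewrite <- csum_opp.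
- apply csum_ext; intros i. rewrite Z.opp_involutive, vw_opp. ring.
- assert (S' := summable_restrict (fun i : nat => (- (1 + Z.of_nat i))%Z) (fun k => zle 1 (- k)) ltac:(intros; cbv beta; rewrite Z.opp_involutive; apply zle_h) _ S).
  apply summable_opp in S'. revert S'. apply summable_ext. intros i. rewrite Z.opp_involutive, vw_opp. ring.
Qed.

(** ** The transformation in the region where all expansions may be integrated *)

Definition Lam (a b c d e f g : C) : C := csum (fun k => vw a k * (phi3 a b c d k * phi3 a e f g k)).

(** [T1], [T2] and [T3] are the three terms of the theorem multiplied by
    sg u sg v, by 1/Gamma(1+a-x) for x = b, c, d and by 1/Gamma(1-x) for
    x = e, f, g, which leaves no singularity where Re w > 0. *)
Definition T1 (a b c d e f g : C) : C :=
  m3 a e f g * m3 a b c d * csum (t1t a e f g (b - a) (c - a) (d - a)).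

Definition T3 (a b c d e f g : C) : C :=
  - sg (uu a b c d) * (sg e * sg f * sg g) * m3 a b c d * WW a b c d e f g.

Definition T2 (a b c d e f g : C) : C := T3 (- a) (e - a) (f - a) (g - a) (b - a) (c - a) (d - a).

Definition defect (a b c d e f g : C) : C :=
  sg (uu a b c d) * sg (vv a e f g) * Lam a b c d e f g
  - sg a * (T1 a b c d e f g + T2 a b c d e f g + T3 a b c d e f g).

Lemma m3_reflect a b c d : m3 (- a) (b - a) (c - a) (d - a) = m3 a b c d.
Proof. unfold m3. f_equal; [f_equal|]; f_equal; ring. Qed.

Lemma vv_reflect a b c d : sg (vv (- a) (b - a) (c - a) (d - a)) = sg (uu a b c d).
Proof. rewrite <- sg_compl. f_equal. unfold vv, uu. ring. Qed.

Lemma uu_reflect a e f g : sg (uu (- a) (e - a) (f - a) (g - a)) = sg (vv a e f g).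
Proof. rewrite <- sg_compl. f_equal. unfold vv, uu. ring. Qed.

Lemma zO_refl f x : zO f x -> zO (fun k => f (- k)%Z) x.
Proof.
intros [K [HK G]]. exists K; split; [easy|]. intros k. eapply Rle_trans; [apply G|].
unfold pz. replace (Z.abs_nat (- k)) with (Z.abs_nat k) by lia. lra.
Qed.

Lemma zO_two f x y m : (x <= m)%R -> (y <= m)%R ->
  (exists K, (0 < K)%R /\ forall k, (Cmod (f k) <= K * (pz k x + pz k y))%R) -> zO f m.
Proof.
intros Hx Hy [K [HK H]]. exists (K * 2)%R; split; [lra|]. intros k.
eapply Rle_trans; [apply H|]. rewrite Rmult_assoc. apply Rmult_le_compat_l; [lra|].
unfold pz. generalize (pw_le (Z.abs_nat k) _ _ Hx) (pw_le (Z.abs_nat k) _ _ Hy). lra.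
Qed.

(** With sg v Q = S1 + S2 and, by reflection, sg u P = R1 + R2,
    sg u sg v P Q = sg u P S2 + sg v R2 Q - R2 S2 + R1 S1,
    and the four sums over k are T3, T2, 0 and T1, up to the factor [sg a]. *)
Theorem defect_zero_base a b c d e f g : (0 < Re (ww a b c d e f g))%R ->
  (0 < th3 a b c d)%R -> (0 < th3 a e f g)%R -> defect a b c d e f g = 0.
Proof.
intros Hw Hp Hq.
assert (Hpq := Hw). rewrite ww_th in Hpq.
set (thP := th3 a b c d) in *. set (thQ := th3 a e f g) in *.
(* The bounds for the parts of the expansions lose an exponent t, which has to
   stay below what the decay of P and Q leaves. *)
set (t := Rmin (1/4) (Rmin (thP / 4) (thQ / 4))).
assert (Ht : (0 < t <= 1 / 4)%R /\ (t <= thP / 4)%R /\ (t <= thQ / 4)%R).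
{ unfold t, Rmin. repeat destruct (Rle_dec _ _); lra. }
set (x := (- Rmin thP (2 - 2 * t))%R). set (y := (- Rmin thQ (2 - 2 * t))%R).
assert (Hx : (- thP <= x /\ - 2 + 2 * t <= x)%R).
{ unfold x. generalize (Rmin_l thP (2 - 2 * t)) (Rmin_r thP (2 - 2 * t)). lra. }
assert (Hy : (- thQ <= y /\ - 2 + 2 * t <= y)%R).
{ unfold y. generalize (Rmin_l thQ (2 - 2 * t)) (Rmin_r thQ (2 - 2 * t)). lra. }
assert (Hxy : (1 + x + y < -1)%R).
{ unfold x, y, Rmin. repeat destruct (Rle_dec _ _); lra. }
assert (Z1 := fun f => zO_two f _ _ x (proj1 Hx) (proj2 Hx)).
assert (Z2 := fun f => zO_two f _ _ y (proj1 Hy) (proj2 Hy)).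
assert (ZP : zO (phi3 a b c d) x) by (apply zO_weaken with (2 := zO_phi3 _ _ _ _); apply Hx).
assert (ZQ : zO (phi3 a e f g) y) by (apply zO_weaken with (2 := zO_phi3 _ _ _ _); apply Hy).
set (p := b - a). set (q := c - a). set (r := d - a).
assert (Tp : th3 (- a) p q r = thP) by apply th3_reflect.
assert (ZR1 := s1_bound_all (- a) p q r t ltac:(lra)). rewrite Tp in ZR1. apply Z1 in ZR1.
assert (ZR2 := s2_bound (- a) p q r t ltac:(lra)). rewrite Tp in ZR2. apply Z1 in ZR2.
assert (ZS1 := Z2 _ (s1_bound_all a e f g t ltac:(lra))).
assert (ZS2 := Z2 _ (s2_bound a e f g t ltac:(lra))).
apply zO_refl in ZR1, ZR2. clear Z1 Z2.
assert (SS : forall F G, zO F x -> zO G y -> summable (fun k => vw a k * F k * G k)).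
{ intros F G HF HG. apply zO_summable with (1 + x + y)%R; [|easy].
  apply (zO_mult (fun k => vw a k * F k) G); [|easy]. apply (zO_mult (vw a) F); [apply zO_vw|easy]. }
assert (E : forall k, sg (uu a b c d) * sg (vv a e f g) * (vw a k * (phi3 a b c d k * phi3 a e f g k))
  = sg (uu a b c d) * (vw a k * phi3 a b c d k * s2 a e f g k)
    + sg (vv a e f g) * (vw a k * s2 (- a) p q r (- k) * phi3 a e f g k)
    - (vw a k * s2 (- a) p q r (- k) * s2 a e f g k) + vw a k * s1 (- a) p q r (- k) * s1 a e f g k).
{ intros k. assert (X1 := phi3_expand a e f g k). assert (X2 := phi3_expand (- a) p q r (- k)).
  unfold p, q, r in X2. rewrite phi3_reflect, vv_reflect, Z.opp_involutive in X2. fold p q r in X2.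
  set (P := phi3 a b c d k) in *. set (Q := phi3 a e f g k) in *.
  replace (sg (uu a b c d) * sg (vv a e f g) * (vw a k * (P * Q))) with (vw a k * (sg (uu a b c d) * P) * (sg (vv a e f g) * Q)) by ring.
  replace (sg (uu a b c d) * (vw a k * P * s2 a e f g k)) with (vw a k * (sg (uu a b c d) * P) * s2 a e f g k) by ring.
  replace (sg (vv a e f g) * (vw a k * s2 (- a) p q r (- k) * Q)) with (vw a k * s2 (- a) p q r (- k) * (sg (vv a e f g) * Q)) by ring.
  rewrite X1, X2. ring. }
assert (A1 := SS _ _ ZP ZS2). assert (A2 := SS _ _ ZR2 ZQ). assert (A3 := SS _ _ ZR2 ZS2). assert (A4 := SS _ _ ZR1 ZS1).
assert (A0 : summable (fun k => vw a k * (phi3 a b c d k * phi3 a e f g k))).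
{ generalize (SS _ _ ZP ZQ). apply summable_ext; intros; ring. }
unfold defect, Lam. rewrite <- csum_scal by easy. rewrite (csum_ext _ _ E).
cbv beta in A1, A2, A3, A4.
rewrite csum_plus, csum_minus, csum_plus, !csum_scal by
  (repeat first [easy | apply summable_minus | apply summable_plus | apply summable_scal]).
unfold p, q, r in *.
rewrite pair_phi3_s2, pair_s2_phi3, pair_s2_s2 by easy.
assert (B : csum (fun k => vw a k * s1 (- a) (b - a) (c - a) (d - a) (- k) * s1 a e f g k)
  = sg a * (m3 a e f g * m3 (- a) (b - a) (c - a) (d - a)) * csum (t1t a e f g (b - a) (c - a) (d - a))).
{ rewrite <- pair_s1_s1.
  - apply csum_ext; intros; ring.
  - now rewrite Tp.
  - easy.
  - revert A4. apply summable_ext; intros; ring. }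
rewrite B, !m3_reflect. unfold T1, T2, T3. rewrite uu_reflect, m3_reflect. ring.
Qed.

(** * Contiguous relations *)

Lemma csum_lin3 {I : Type} c1 c2 c3 (f1 f2 f3 : I -> C) : summable f1 -> summable f2 -> summable f3 ->
  summable (fun i => c1 * f1 i + c2 * f2 i + c3 * f3 i)
  /\ csum (fun i => c1 * f1 i + c2 * f2 i + c3 * f3 i) = c1 * csum f1 + c2 * csum f2 + c3 * csum f3.
Proof.
intros H1 H2 H3. apply (summable_scal c1) in H1 as H1'. apply (summable_scal c2) in H2 as H2'. apply (summable_scal c3) in H3 as H3'.
assert (H4 := summable_plus _ _ H1' H2'). split; [now apply summable_plus|].
rewrite csum_plus, csum_plus, !csum_scal by easy. easy.
Qed.

Definition wt (al be ga w d1 d2 d3 : C) (m : nat) : C :=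
  rising al m * rising be m * rising ga m * / INR (fact m)
  * (/ rG (w + INR m) * (rG (d1 + INR m) * rG (d2 + INR m) * rG (d3 + INR m))).

Lemma wt_summable al be ga w d1 d2 d3 : rG w <> 0 -> d1 + d2 + d3 = al + be + ga + w + 1 ->
  summable (wt al be ga w d1 d2 d3).
Proof.
intros H B. apply asy_summable with (-2)%R; [|lra]. unfold wt.
eapply asy_eq; [intros; reflexivity| | |asy_tac; apply asy_inv_rG, H]; [|lia].
apply (f_equal Re) in B. autorewrite with re in B. lra.
Qed.

Lemma inv_rG_S x : rG (x + 1) <> 0 -> x <> 0 -> / rG (x + 1) = x * / rG x.
Proof. intros H H'. rewrite (rGamma_rec x). field. auto. Qed.

(** The partial sums are in closed form; their limit is the right-hand side. *)
Lemma wt_contig A B g w D1 D2 D3 : (0 < Re w)%R -> D1 + D2 + D3 = A + B + g + w + 1 ->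
  (w - D2) * (w - D3) * csum (wt (A + 1) (B + 1) g w D1 (D2 + 1) (D3 + 1))
  - csum (wt A B g w D1 D2 D3)
  + (A + B + 1 - D1) * (D1 - g) * csum (wt (A + 1) (B + 1) g (w + 1) (D1 + 1) (D2 + 1) (D3 + 1))
  = - (rG (A + 1) * rG (B + 1) * rG g).
Proof.
intros Hw H.
assert (HwS : forall x, (0 <= x)%R -> rG (w + x) <> 0).
{ intros x Hx. apply rGamma_Re_pos. autorewrite with re. lra. }
assert (H0 : rG w <> 0) by now apply rGamma_Re_pos.
assert (H1 : rG (w + 1) <> 0) by (apply HwS; lra).
assert (S1 : summable (wt (A + 1) (B + 1) g w D1 (D2 + 1) (D3 + 1))).
{ apply wt_summable; [easy|]. apply (lincomb1 1 _ _ _ _ H). ring. }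
assert (S2 : summable (wt A B g w D1 D2 D3)) by now apply wt_summable.
assert (S3 : summable (wt (A + 1) (B + 1) g (w + 1) (D1 + 1) (D2 + 1) (D3 + 1))).
{ apply wt_summable; [easy|]. apply (lincomb1 1 _ _ _ _ H). ring. }
assert (Hw' : w = D1 + D2 + D3 - A - B - g - 1).
{ apply (lincomb1 (-(1)) _ _ _ _ H). ring. }
destruct (csum_lin3 ((w - D2) * (w - D3)) (-(1)) ((A + B + 1 - D1) * (D1 - g)) _ _ _ S1 S2 S3) as [L1 L2].
match goal with |- ?l = _ => match type of L2 with _ = ?r => replace l with r by ring end end. rewrite <- L2.
apply csum_partial with (fun n => - (rising (A + 1) n * rising (B + 1) n * rising g (S n) * / INR (fact n)
   * (A + B + 1 + INR n) * / rG (w + INR n + 1) * rG (D1 + INR n + 1) * rG (D2 + INR n + 1) * rG (D3 + INR n + 1))).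
- exact L1.
- unfold wt. rewrite !rising_S, !rising_0. simpl INR. simpl fact. rewrite !Cplus_0_r.
  rewrite inv_rG_S by (easy || now apply Re_neq_0).
  rgS D1. rgS D2. rgS D3. 
  generalize (rG (D1 + 1)) (rG (D2 + 1)) (rG (D3 + 1)) (/ rG w); intros. rewrite Hw'. field; try exact C1_nz.
- intros n. unfold wt.
  assert (HN := pos_INR n).
  rewrite !fact_simpl, !mult_INR, !RtoC_mult, !RtoC_S.
  rewrite (rising_S_l A), (rising_S_l B), !(rising_S _ (S n)), (rising_S (A + 1)), (rising_S (B + 1)), !RtoC_S.
  replace (w + (INR n + 1)) with (w + INR n + 1) by ring.
  replace (w + 1 + (INR n + 1)) with (w + INR n + 1 + 1) by ring.
  rewrite (inv_rG_S (w + INR n + 1)).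
  2:{ replace (w + INR n + 1 + 1) with (w + (INR n + 2)%R) by (rewrite RtoC_plus, RtoC_2; ring). apply HwS; lra. }
  2:{ apply Re_neq_0. autorewrite with re. simpl. lra. }
  replace (D1 + 1 + (INR n + 1)) with (D1 + INR n + 1 + 1) by ring.
  replace (D2 + 1 + (INR n + 1)) with (D2 + INR n + 1 + 1) by ring.
  replace (D3 + 1 + (INR n + 1)) with (D3 + INR n + 1 + 1) by ring.
  replace (D1 + (INR n + 1)) with (D1 + INR n + 1) by ring.
  replace (D2 + (INR n + 1)) with (D2 + INR n + 1) by ring.
  replace (D3 + (INR n + 1)) with (D3 + INR n + 1) by ring.
  rgS (D1 + INR n + 1). rgS (D2 + INR n + 1). rgS (D3 + INR n + 1).
  generalize (rG (D1 + INR n + 1 + 1)) (rG (D2 + INR n + 1 + 1)) (rG (D3 + INR n + 1 + 1)) (/ rG (w + INR n + 1))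
    (rising (A + 1) n) (rising (B + 1) n) (rising g (S n)).
  intros. rewrite Hw'. field. split; [apply INR_fact_C|]. rewrite <- RtoC_plus. apply INR1_C.
- apply clim_opp. apply clim_ext with (fun n => rnrm (A + 1) n * rnrm (B + 1) n * rnrm g n * / nrm (w + 1) n * nrm (D1 + 1) n * nrm (D2 + 1) n * nrm (D3 + 1) n
     * ((A + B + 1 + INR n) / (INR n + 1)%R) * ((g + INR n) / (INR n + 1)%R)).
  + intros n. rewrite !rising_S, !rnrm_rising.
    replace (w + INR n + 1) with (w + 1 + INR n) by ring.
    replace (D1 + INR n + 1) with (D1 + 1 + INR n) by ring.
    replace (D2 + INR n + 1) with (D2 + 1 + INR n) by ring.
    replace (D3 + INR n + 1) with (D3 + 1 + INR n) by ring. 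
    assert (HN := HwS (1 + INR n)%R ltac:(generalize (pos_INR n); lra)). rewrite RtoC_plus, Cplus_assoc in HN.
    assert (Hn : nrm (w + 1) n <> 0).
    { intros X. apply HN. rewrite nrm_rG, X. unfold Cdiv. ring. }
    rewrite !nrm_rG.
    assert (E : cpw n (A + 1 - 1) * cpw n (B + 1 - 1) * cpw n (g - 1) * cpw n (1 - (D1 + 1)) * cpw n (1 - (D2 + 1)) * cpw n (1 - (D3 + 1))
       * ((INR n + 1)%R * (INR n + 1)%R) = cpw n (1 - (w + 1))).
    { rewrite <- cpw_1, <- !cpw_plus. f_equal. rewrite Hw'. ring. }
    set (c := cpw n (1 - (w + 1))) in *. assert (Hc : c <> 0) by apply cpw_neq_0.
    assert (E' : cpw n (A + 1 - 1) * cpw n (B + 1 - 1) * cpw n (g - 1) * cpw n (1 - (D1 + 1)) * cpw n (1 - (D2 + 1)) * cpw n (1 - (D3 + 1))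
       * ((INR n + 1)%R * (INR n + 1)%R) * / c = 1) by (rewrite E; field; easy).
    clear E. cpw_collect E'. repeat split; auto using INR_fact_C, INR1_C.
  + apply clim_val with (rG (A + 1) * rG (B + 1) * rG g * / 1 * 1 * 1 * 1 * 1 * 1); [field; exact C1_nz|].
    clim_tac. apply clim_inv; [exact C1_nz|apply nrm_lim].
Qed.

Lemma nrmm_lim (z : C) : clim (fun n => rG z * rnrm (1 - z) n) (sg z).
Proof. unfold sg. apply clim_scal, rnrm_lim. Qed.

Lemma rG_minus_asym z n : rG (z - INR n) = sgn (Z.of_nat n) * (rG z * rnrm (1 - z) n) * INR (fact n) * cpw n (- z).
Proof.
rewrite rGamma_falling, falling_rising, rnrm_rising. replace (1 - z - 1) with (- z) by ring. ring.
Qed.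

(** The powers of n cancel, and each of the first four factors leaves its [sg]. *)
Lemma rG8_lim z1 z2 z3 z4 y1 y2 y3 y4 : z1 + z2 + z3 + z4 + (y1 + y2 + y3 + y4) = 1 + 1 + 1 + 1 ->
  clim (fun n => rG (z1 - INR n) * rG (z2 - INR n) * rG (z3 - INR n) * rG (z4 - INR n)
   * (rG (y1 + INR n) * rG (y2 + INR n) * rG (y3 + INR n) * rG (y4 + INR n))) (sg z1 * sg z2 * sg z3 * sg z4).
Proof.
intros H.
apply clim_ext with (fun n => (rG z1 * rnrm (1 - z1) n) * (rG z2 * rnrm (1 - z2) n) * (rG z3 * rnrm (1 - z3) n) * (rG z4 * rnrm (1 - z4) n)
  * nrm y1 n * nrm y2 n * nrm y3 n * nrm y4 n).
- intros n. rewrite !rG_minus_asym, !nrm_rG.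
  assert (E : cpw n (- z1) * cpw n (- z2) * cpw n (- z3) * cpw n (- z4) * cpw n (1 - y1) * cpw n (1 - y2) * cpw n (1 - y3) * cpw n (1 - y4) = 1).
  { rewrite <- !cpw_plus. apply cpw_one. apply (lincomb1 (-(1)) _ _ _ _ H). ring. }
  assert (Q : sgn (Z.of_nat n) * sgn (Z.of_nat n) * (sgn (Z.of_nat n) * sgn (Z.of_nat n)) = 1) by (rewrite sgn_sq; ring).
  match goal with |- ?l = _ => transitivity (l * (sgn (Z.of_nat n) * sgn (Z.of_nat n) * (sgn (Z.of_nat n) * sgn (Z.of_nat n)))
    * (cpw n (- z1) * cpw n (- z2) * cpw n (- z3) * cpw n (- z4) * cpw n (1 - y1) * cpw n (1 - y2) * cpw n (1 - y3) * cpw n (1 - y4))) end.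
  { rewrite E, Q. ring. }
  field. apply INR_fact_C.
- apply clim_val with (sg z1 * sg z2 * sg z3 * sg z4 * 1 * 1 * 1 * 1); [ring|].
  repeat lazymatch goal with
  | |- clim (fun n => rG ?z * rnrm _ n) _ => apply nrmm_lim
  | |- clim (fun n => @?f n * @?g n) _ => apply (clim_mult f g)
  | |- clim (fun n => nrm ?z n) _ => apply nrm_lim end.
Qed.

(** The antidifference for the bilateral series in [T1]. *)
Definition t1_cert (a b c d e f g : C) (n : Z) : C :=
  rG (1 + 1 - uu a b c d - Cz n) * rG (1 - e - Cz n) * rG (1 - f - Cz n) * rG (1 - g - Cz n)
  * (rG (vv a e f g + Cz n) * rG (a - b + Cz n) * rG (a - c + Cz n) * rG (a - d + Cz n)).

(** The two terms on the right are the values of the antidifference at the two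
    infinities. *)
Lemma t1_contig a b c d e f g :
  (a - b - c) * (a - b - d) * csum (t1t a e f g (b + 1 - a) (c - a) (d - a))
  - (a - e - f) * (a - e - g) * csum (t1t a (e + 1) f g (b - a) (c - a) (d - a))
  - (b - e) * (a - b - e) * csum (t1t a e f g (b - a) (c - a) (d - a))
  = sg (uu a b c d) * (sg e * sg f * sg g) - sg (vv a e f g) * (sg (b - a) * sg (c - a) * sg (d - a)).
Proof.
destruct (csum_lin3 ((a - b - c) * (a - b - d)) (- ((a - e - f) * (a - e - g))) (- ((b - e) * (a - b - e))) _ _ _
  (t1t_summable a e f g (b + 1 - a) (c - a) (d - a)) (t1t_summable a (e + 1) f g (b - a) (c - a) (d - a))
  (t1t_summable a e f g (b - a) (c - a) (d - a))) as [L1 L2].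
match goal with |- ?l = _ => match type of L2 with _ = ?r => replace l with r by ring end end. rewrite <- L2.
rewrite (csum_telescope _ (fun k => - t1_cert a b c d e f g k) (sg (uu a b c d) * (sg e * sg f * sg g)) (sg (vv a e f g) * (sg (b - a) * sg (c - a) * sg (d - a)))).
- easy.
- exact L1.
- intros n. unfold t1t, qn, t1_cert, uu, vv. rewrite !Cz_opp, !Cz_plus, Cz_1.
  set (X := Cz n).
  replace (1 - (b + 1 - a) - - X) with (a - b + X) by ring.
  replace (1 - (b - a) - - X) with (1 + a - b + X) by ring.
  replace (1 - (c - a) - - X) with (1 + a - c + X) by ring.
  replace (1 - (d - a) - - X) with (1 + a - d + X) by ring.
  replace (b + 1 - a + (c - a) + (d - a) - - a + - X) with (1 + 1 - (1 + a + a - b - c - d) - X) by ring.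
  replace (b - a + (c - a) + (d - a) - - a + - X) with (- (a + a - b - c - d) - X) by ring.
  replace (e + 1 + f + g - a + X) with (e + f + g - a + X + 1) by ring.
  replace (1 - (e + 1) - X) with (- e - X) by ring.
  replace (1 + 1 - (1 + a + a - b - c - d) - (X + 1)) with (- (a + a - b - c - d) - X) by ring.
  replace (1 - e - (X + 1)) with (- e - X) by ring.
  replace (1 - f - (X + 1)) with (- f - X) by ring.
  replace (1 - g - (X + 1)) with (- g - X) by ring.
  replace (e + f + g - a + (X + 1)) with (e + f + g - a + X + 1) by ring.
  replace (a - b + (X + 1)) with (1 + a - b + X) by ring.
  replace (a - c + (X + 1)) with (1 + a - c + X) by ring.
  replace (a - d + (X + 1)) with (1 + a - d + X) by ring.
  rgS (e + f + g - a + X). rgS (a - b + X). rgS (a - c + X). rgS (a - d + X).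
  rgS (- e - X). rgS (- f - X). rgS (- g - X). rgS (- (a + a - b - c - d) - X).
  replace (- (a + a - b - c - d) - X + 1) with (1 + 1 - (1 + a + a - b - c - d) - X) by ring.
  replace (a - b + X + 1) with (1 + a - b + X) by ring.
  replace (a - c + X + 1) with (1 + a - c + X) by ring.
  replace (a - d + X + 1) with (1 + a - d + X) by ring.
  replace (- e - X + 1) with (1 - e - X) by ring.
  replace (- f - X + 1) with (1 - f - X) by ring.
  replace (- g - X + 1) with (1 - g - X) by ring.
  ring.
- apply clim_val with (- (sg (1 + 1 - uu a b c d) * sg (1 - e) * sg (1 - f) * sg (1 - g))).
  { rewrite !sg_compl. replace (1 + 1 - uu a b c d) with (1 - uu a b c d + 1) by ring. rewrite sg_S, sg_compl. ring. }
  apply clim_opp.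
  eapply clim_ext; [|apply (rG8_lim _ _ _ _ (vv a e f g) (a - b) (a - c) (a - d))].
  + intros n. unfold t1_cert. now rewrite Cz_nat.
  + unfold uu, vv. ring.
- apply clim_val with (- (sg (vv a e f g) * sg (a - b) * sg (a - c) * sg (a - d))).
  { replace (a - b) with (- (b - a)) by ring. replace (a - c) with (- (c - a)) by ring. replace (a - d) with (- (d - a)) by ring.
    rewrite !sg_opp. ring. }
  apply clim_opp.
  eapply clim_ext; [|apply (rG8_lim _ _ _ _ (1 + 1 - uu a b c d) (1 - e) (1 - f) (1 - g))].
  + intros n. unfold t1_cert. rewrite Cz_mnat.
    assert (D : forall x y : C, x - - y = x + y) by (intros; ring). rewrite !D. unfold Cminus. ring.
  + unfold uu, vv. ring.
Qed.

Lemma WW_wt a b c d e f g : WW a b c d e f g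
  = csum (wt (1 + a - e - g) (1 + a - e - f) (1 + a - f - g) (ww a b c d e f g)
      (del a b e f g) (del a c e f g) (del a d e f g)).
Proof. apply csum_ext; intros m. unfold Wt, sm, wt. ring. Qed.

Lemma WW_contig a b c d e f g : (0 < Re (ww a (b + 1) c d e f g))%R ->
  (a - b - c) * (a - b - d) * WW a (b + 1) c d e f g - WW a b c d (e + 1) f g
  + (b - e) * (a - b - e) * WW a b c d e f g = - m3 a e f g.
Proof.
intros Hw.
assert (E := wt_contig (a - e - g) (a - e - f) (1 + a - f - g) (ww a (b + 1) c d e f g)
  (del a (b + 1) e f g) (del a c (e + 1) f g) (del a d (e + 1) f g) Hw).
replace (a - e - g + 1) with (1 + a - e - g) in E by ring.
replace (a - e - f + 1) with (1 + a - e - f) in E by ring.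
replace (del a c (e + 1) f g + 1) with (del a c e f g) in E by (unfold del; ring).
replace (del a d (e + 1) f g + 1) with (del a d e f g) in E by (unfold del; ring).
replace (del a (b + 1) e f g + 1) with (del a b e f g) in E by (unfold del; ring).
replace (ww a (b + 1) c d e f g + 1) with (ww a b c d e f g) in E by (unfold ww; ring).
rewrite <- (WW_wt a b c d e f g) in E.
rewrite <- (WW_wt a (b + 1) c d e f g) in E.
rewrite (WW_wt a b c d (e + 1) f g).
replace (1 + a - (e + 1) - g) with (a - e - g) by ring.
replace (1 + a - (e + 1) - f) with (a - e - f) by ring.
replace (ww a b c d (e + 1) f g) with (ww a (b + 1) c d e f g) by (unfold ww; ring).
replace (del a b (e + 1) f g) with (del a (b + 1) e f g) by (unfold del; ring).
assert (C1 : (ww a (b + 1) c d e f g - del a c (e + 1) f g) * (ww a (b + 1) c d e f g - del a d (e + 1) f g)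
  = (a - b - c) * (a - b - d)) by (unfold ww, del; ring).
assert (C2 : (a - e - g + (a - e - f) + 1 - del a (b + 1) e f g) * (del a (b + 1) e f g - (1 + a - f - g))
  = (b - e) * (a - b - e)) by (unfold del; ring).
rewrite C1, C2 in E. unfold m3.
apply (lincomb1 1 _ _ _ _ (E ltac:(unfold ww, del; ring))). ring.
Qed.

Lemma m3_S a b c d : m3 a (b + 1) c d = (a - b - c) * (a - b - d) * m3 a b c d.
Proof.
unfold m3. replace (1 + a - (b + 1) - d) with (a - b - d) by ring. replace (1 + a - (b + 1) - c) with (a - b - c) by ring.
rewrite (rGamma_rec (a - b - d)), (rGamma_rec (a - b - c)).
replace (a - b - d + 1) with (1 + a - b - d) by ring. replace (a - b - c + 1) with (1 + a - b - c) by ring. ring.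
Qed.

Lemma T3_contig a b c d e f g : (0 < Re (ww a (b + 1) c d e f g))%R ->
  T3 a (b + 1) c d e f g - T3 a b c d (e + 1) f g - (b - e) * (a - b - e) * T3 a b c d e f g
  = - (sg (uu a b c d) * (sg e * sg f * sg g)) * (m3 a b c d * m3 a e f g).
Proof.
intros Hw. assert (E := WW_contig a b c d e f g Hw). unfold T3. rewrite m3_S, sg_S.
replace (uu a (b + 1) c d) with (uu a b c d - 1) by (unfold uu; ring). rewrite sg_pred.
apply (lincomb1 (sg (uu a b c d) * (sg e * sg f * sg g) * m3 a b c d) _ _ _ _ E). ring.
Qed.

Lemma T2_contig a b c d e f g : (0 < Re (ww a (b + 1) c d e f g))%R ->
  T2 a (b + 1) c d e f g - T2 a b c d (e + 1) f g - (b - e) * (a - b - e) * T2 a b c d e f g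
  = sg (vv a e f g) * (sg (b - a) * sg (c - a) * sg (d - a)) * (m3 a b c d * m3 a e f g).
Proof.
intros Hw. unfold T2.
replace (b + 1 - a) with (b - a + 1) by ring. replace (e + 1 - a) with (e - a + 1) by ring.
assert (E := T3_contig (- a) (e - a) (f - a) (g - a) (b - a) (c - a) (d - a)).
rewrite uu_reflect, !m3_reflect in E.
assert (Ew : ww (- a) (e - a + 1) (f - a) (g - a) (b - a) (c - a) (d - a) = ww a (b + 1) c d e f g) by (unfold ww; ring).
rewrite Ew in E. apply (lincomb1 (-(1)) _ _ _ _ (E Hw)). ring.
Qed.

Lemma Lam_summable a b c d e f g : (0 < Re (ww a b c d e f g))%R ->
  summable (fun k => vw a k * (phi3 a b c d k * phi3 a e f g k)).
Proof.
intros Hw. rewrite ww_th in Hw.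
apply zO_summable with (1 + (- th3 a b c d + - th3 a e f g))%R; [|lra].
apply (zO_mult (vw a) (fun k => phi3 a b c d k * phi3 a e f g k)); [apply zO_vw|].
apply zO_mult; apply zO_phi3.
Qed.

Lemma Lam_contig a b c d e f g : (0 < Re (ww a (b + 1) c d e f g))%R ->
  Lam a (b + 1) c d e f g - Lam a b c d (e + 1) f g = - ((b - e) * (a - b - e)) * Lam a b c d e f g.
Proof.
intros Hw. 
assert (H1 := Lam_summable _ _ _ _ _ _ _ Hw).
assert (H2 : summable (fun k => vw a k * (phi3 a b c d k * phi3 a (e + 1) f g k))).
{ apply Lam_summable. revert Hw. unfold ww. autorewrite with re. lra. }
assert (H3 : summable (fun k => vw a k * (phi3 a b c d k * phi3 a e f g k))).
{ apply Lam_summable. revert Hw. unfold ww. autorewrite with re. lra. }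
unfold Lam. rewrite <- csum_scal, <- csum_minus by easy. apply csum_ext; intros k.
unfold phi3. rewrite !phi_S. ring.
Qed.

(** The right-hand sides in the relations for [T1], [T2] and [T3] are the same two
    products with opposite signs. *)
Lemma defect_contig a b c d e f g : (0 < Re (ww a (b + 1) c d e f g))%R ->
  defect a (b + 1) c d e f g - defect a b c d (e + 1) f g = (b - e) * (a - b - e) * defect a b c d e f g.
Proof.
intros Hw.
assert (E0 := Lam_contig _ _ _ _ _ _ _ Hw). assert (E2 := T2_contig _ _ _ _ _ _ _ Hw). assert (E3 := T3_contig _ _ _ _ _ _ _ Hw).
assert (E1 := t1_contig a b c d e f g).
unfold defect, T1. rewrite !m3_S.
replace (uu a (b + 1) c d) with (uu a b c d - 1) by (unfold uu; ring). rewrite sg_pred.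
replace (vv a (e + 1) f g) with (vv a e f g + 1) by (unfold vv; ring). rewrite sg_S.
set (U := sg (uu a b c d)) in *. set (V := sg (vv a e f g)) in *.
set (P1 := m3 a b c d) in *. set (P2 := m3 a e f g) in *.
match type of E0 with ?l0 = ?r0 => match type of E1 with ?l1 = ?r1 => match type of E2 with ?l2 = ?r2 => match type of E3 with ?l3 = ?r3 =>
assert (Q : - U * V * (l0 - r0) - sg a * (P1 * P2 * (l1 - r1) + (l2 - r2) + (l3 - r3)) = 0) by (rewrite E0, E1, E2, E3; ring)
end end end end.
apply (lincomb1 1 _ _ _ _ Q). ring.
Qed.

(** The contiguous relation trades b against e. It keeps w or raises it, and
    improves the decay of one triple at the expense of the other, which has some
    to spare because the two exponents add up to 2 Re w + 2. *)
Lemma defect_zero_P (a c d f g : C) M : forall b e, (0 < Re (ww a b c d e f g))%R -> (0 < th3 a b c d)%R ->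
  (- (2 * INR M) < th3 a e f g)%R -> defect a b c d e f g = 0.
Proof.
induction M as [|M IH]; intros b' e Hw Hp Hq.
- apply defect_zero_base; [easy|easy|simpl in Hq; lra].
- destruct (Rlt_le_dec 0 (th3 a e f g)) as [L|L]; [now apply defect_zero_base|].
  assert (Hw' := Hw). rewrite ww_th in Hw'.
  assert (T1 : th3 a (b' + 1) c d = (th3 a b' c d - 2)%R) by (unfold th3; autorewrite with re; ring).
  assert (T2 : th3 a (e - 1) f g = (th3 a e f g + 2)%R) by (unfold th3; autorewrite with re; ring).
  rewrite S_INR in Hq.
  assert (E := defect_contig a b' c d (e - 1) f g). replace (e - 1 + 1) with e in E by ring.
  replace (ww a (b' + 1) c d (e - 1) f g) with (ww a b' c d e f g) in E by (unfold ww; ring).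
  specialize (E Hw).
  rewrite (IH b' (e - 1)) in E; [|revert Hw; unfold ww; autorewrite with re; lra|easy|rewrite T2; lra].
  rewrite (IH (b' + 1) (e - 1)) in E; [|revert Hw; unfold ww; autorewrite with re; lra|rewrite T1; lra|rewrite T2; lra].
  apply (lincomb1 (-(1)) _ _ _ _ E). ring.
Qed.

(** The opposite move improves the decay of the first triple, and [defect_zero_P]
    can start from any decay of the second. *)
Lemma defect_zero_Q (a c d f g : C) M : forall b e, (0 < Re (ww a b c d e f g))%R ->
  (- (2 * INR M) < th3 a b c d)%R -> defect a b c d e f g = 0.
Proof.
induction M as [|M IH]; intros b' e Hw Hp.
- destruct (nfloor_ex (Rabs (th3 a e f g))) as [N HN]; [apply Rabs_pos|].
  apply defect_zero_P with (M := S N); [easy|simpl in Hp; lra|].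
  rewrite S_INR. generalize (Rle_abs (- th3 a e f g)). rewrite Rabs_Ropp. 
  assert (A := pos_INR N). lra.
- assert (T1 : th3 a (b' - 1) c d = (th3 a b' c d + 2)%R) by (unfold th3; autorewrite with re; ring).
  rewrite S_INR in Hp.
  assert (E := defect_contig a (b' - 1) c d e f g). replace (b' - 1 + 1) with b' in E by ring.
  specialize (E Hw).
  rewrite (IH (b' - 1) e) in E; [|revert Hw; unfold ww; autorewrite with re; lra|rewrite T1; lra].
  rewrite (IH (b' - 1) (e + 1)) in E; [|revert Hw; unfold ww; autorewrite with re; lra|rewrite T1; lra].
  apply (lincomb1 1 _ _ _ _ E). ring.
Qed.

Theorem defect_zero a b c d e f g : (0 < Re (ww a b c d e f g))%R -> defect a b c d e f g = 0.
Proof.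
intros Hw. destruct (nfloor_ex (Rabs (th3 a b c d))) as [N HN]; [apply Rabs_pos|].
apply defect_zero_Q with (M := S N); [easy|].
rewrite S_INR. generalize (Rle_abs (- th3 a b c d)). rewrite Rabs_Ropp.
assert (A := pos_INR N). lra.
Qed.

(** * Hypergeometric series *)

Lemma clim_filterlim u l : clim u l -> filterlim u eventually (locally l).
Proof.
intros H P [eps He].
destruct (proj1 (clim_eps u l) H (mkposreal _ (cond_pos eps)) (cond_pos eps)) as [N HN].
exists N; intros n Hn. apply He. specialize (HN n Hn). simpl in HN.
split.
- apply Rle_lt_trans with (2 := HN). exact (Rabs_Re_le (u n - l)).
- apply Rle_lt_trans with (2 := HN). exact (Rabs_Im_le (u n - l)).
Qed.

Lemma csum_is_series (f : nat -> C) : summable f -> @is_series C_AbsRing C_NormedModule f (csum f).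
Proof.
intros H. apply (clim_filterlim (sum_n f)).
assert (E : forall n, sum_n f n = fsum f (seq 0 (S n))).
{ induction n as [|n IH].
  - rewrite sum_O. simpl. ring.
  - rewrite sum_Sn, IH, (fsum_seq_S f (S n)). easy. }
apply clim_ext with (fun n => fsum f (seq 0 (n + 1))).
- intros n. now rewrite E, Nat.add_1_r.
- apply (clim_shift (fun n => fsum f (seq 0 n))). now apply csum_nat_clim.
Qed.

Lemma CSeries_csum f : summable f -> ex_Cseries f /\ CSeries f = csum f.
Proof.
intros H. assert (S := csum_is_series f H). split; [now exists (csum f)|now apply CSeries_correct].
Qed.

Lemma hyperH_csum A B z f : summable f -> (forall k, hyperH_term A B z k = f k) ->
  hyperH_cvg A B z /\ hyperH A B z = csum f.
Proof.
intros H E. replace f with (hyperH_term A B z) in * by (now apply functional_extensionality). clear E f.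
set (f := hyperH_term A B z) in *.
assert (S1 : summable (fun n => f (Z.of_nat n))).
{ apply (summable_restrict Z.of_nat (zle 0)); [|easy]. intros i; apply (zle_h 0). }
assert (S2 : summable (fun n => f (- Z.of_nat (S n))%Z)).
{ apply (summable_restrict (fun n => (- Z.of_nat (S n))%Z) (fun k => zle 1 (- k))); [|easy].
  intros i. rewrite Z.opp_involutive. replace (Z.of_nat (S i)) with (1 + Z.of_nat i)%Z by lia. apply zle_h. }
destruct (CSeries_csum _ S1) as [C1 D1]. destruct (CSeries_csum _ S2) as [C2 D2].
split; [now split|]. unfold hyperH. fold f. rewrite D1, D2, csum_Z_halves by easy.
f_equal. apply csum_ext; intros n. f_equal. lia.
Qed.

Lemma zpoch_pos x (n : nat) : zpoch x (Z.of_nat n) = rising x n.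
Proof.
destruct n as [|n]; [easy|]. simpl Z.of_nat. unfold zpoch. now rewrite SuccNat2Pos.id_succ.
Qed.

Lemma zpoch_neg x (n : nat) : zpoch x (- Z.of_nat n) = / falling x n.
Proof.
destruct n as [|n]; [simpl; unfold falling; simpl; field; exact C1_nz|].
simpl Z.of_nat. unfold zpoch, Z.opp. now rewrite SuccNat2Pos.id_succ.
Qed.

Lemma Z_nat_cases (P : Z -> Prop) : (forall n : nat, P (Z.of_nat n)) -> (forall n : nat, P (- Z.of_nat n)%Z) -> forall k, P k.
Proof.
intros H1 H2 k. destruct (Z.le_ge_cases 0 k).
- replace k with (Z.of_nat (Z.to_nat k)) by lia. apply H1.
- replace k with (- Z.of_nat (Z.to_nat (- k)))%Z by lia. apply H2.
Qed.

Lemma rG_minus_zpoch x k : (forall n, falling x n <> 0) ->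
  rG (1 - x - Cz k) = sgn k * zpoch x k * rG (1 - x).
Proof.
intros H. revert k. apply Z_nat_cases; intros n.
- rewrite zpoch_pos, Cz_nat. rewrite rGamma_falling, falling_rising. replace (1 - (1 - x)) with x by ring. ring.
- rewrite zpoch_neg, Cz_mnat, sgn_opp. rewrite (rGamma_rising (1 - x) n).
  assert (E := falling_rising x n). 
  assert (Q := sgn_sq (Z.of_nat n)).
  replace (1 - x - - INR n) with (1 - x + INR n) by ring.
  assert (E2 : rising (1 - x) n = sgn (Z.of_nat n) * falling x n).
  { rewrite E. transitivity (sgn (Z.of_nat n) * sgn (Z.of_nat n) * rising (1 - x) n); [rewrite Q; ring|ring]. }
  rewrite E2. transitivity (sgn (Z.of_nat n) * sgn (Z.of_nat n) * rG (1 - x + INR n)); [rewrite Q; ring|].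
  field. apply H.
Qed.

Lemma Cinv_0 : / RtoC 0 = 0.
Proof. unfold Cinv; simpl; apply injective_projections; simpl; unfold Rdiv; ring. Qed.

(** At 0 this is the convention / 0 = 0. *)
Lemma Cinv_inv_total (x : C) : / / x = x.
Proof.
destruct (classic (x = 0)) as [->|H]; [now rewrite !Cinv_0|]. field; easy.
Qed.

Lemma Cinv_mult_total (x y : C) : / (x * y) = / x * / y.
Proof.
destruct (classic (x = 0)) as [->|Hx]; [rewrite Cmult_0_l, Cinv_0; ring|].
destruct (classic (y = 0)) as [->|Hy]; [rewrite Cmult_0_r, Cinv_0; ring|].
field; easy.
Qed.

(** For k < 0 the value 0 of (y)_k stands for a pole, and both sides vanish. *)
Lemma rG_plus_zpoch y k : (forall n, rising y n <> 0) -> rG (y + Cz k) = / zpoch y k * rG y.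
Proof.
intros H. revert k. apply Z_nat_cases; intros n.
- rewrite zpoch_pos, Cz_nat, (rGamma_rising y n). field. apply H.
- rewrite zpoch_neg, Cz_mnat, Cinv_inv_total, <- rGamma_falling. easy.
Qed.

Lemma zpoch_quot x k : (forall n, rising x n <> 0) -> (forall n, falling (x + 1) n <> 0) ->
  zpoch (x + 1) k * / zpoch x k = (x + Cz k) / x.
Proof.
intros H H'.
assert (Hx : x <> 0). { assert (A := H 1%nat). rewrite rising_S, rising_0 in A. intros E. apply A. rewrite E. simpl. ring. }
revert k. apply Z_nat_cases; intros n.
- rewrite !zpoch_pos, Cz_nat. assert (A := rising_S_l x n). rewrite rising_S in A.
  transitivity (x * rising (x + 1) n / (x * rising x n)); [field; auto|]. rewrite <- A. field; auto.
- rewrite !zpoch_neg, Cz_mnat, Cinv_inv_total.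
  assert (A : falling (x + 1) n * (x - INR n) = x * falling x n).
  { rewrite !falling_rising. replace (1 - (x + 1)) with (- x) by ring.
    assert (A := rising_S_l (- x) n). rewrite rising_S in A. replace (- x + 1) with (1 - x) in A by ring.
    apply (lincomb1 (- sgn (Z.of_nat n)) _ _ _ _ A). ring. }
  transitivity (x * falling x n / (x * falling (x + 1) n)); [field; auto|]. rewrite <- A. field; auto.
Qed.

Lemma rG_of_rising y : (forall n, rising y n <> 0) -> rG y <> 0.
Proof.
intros H. apply rGamma_neq_0. intros [n ->]. apply (H (S n)). rewrite rising_S. ring.
Qed.

Lemma rG_of_falling x : (forall n, falling x n <> 0) -> rG (1 - x) <> 0.
Proof.
intros H. apply rGamma_neq_0. intros [n E]. apply (H (S n)). rewrite falling_S, RtoC_S.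
replace (RtoC (INR n)) with (- (- INR n)) by ring. rewrite <- E. ring.
Qed.

Lemma Cpow_1 n : (RtoC 1) ^ n = 1.
Proof. induction n as [|n IH]; simpl; [easy|]. rewrite IH. ring. Qed.

Lemma Cpowz_1 k : Cpowz 1 k = 1.
Proof. destruct k; simpl; rewrite ?Cpow_1; try easy. field; try exact C1_nz. Qed.

Lemma hyperF_wt al be ga w d1 d2 d3 : rG w <> 0 -> d1 + d2 + d3 = al + be + ga + w + 1 ->
  (forall n, rising d1 n <> 0) -> (forall n, rising d2 n <> 0) -> (forall n, rising d3 n <> 0) ->
  hyperF_cvg [al; be; ga; w] [d1; d2; d3] 1 /\
  csum (wt al be ga w d1 d2 d3) = / rG w * rG d1 * rG d2 * rG d3 * hyperF [al; be; ga; w] [d1; d2; d3] 1.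
Proof.
intros Hw Hb H1 H2 H3.
assert (G1 := rG_of_rising _ H1). assert (G2 := rG_of_rising _ H2). assert (G3 := rG_of_rising _ H3).
assert (S := wt_summable _ _ _ _ _ _ _ Hw Hb).
assert (E : forall n, hyperF_term [al; be; ga; w] [d1; d2; d3] 1 n = rG w * / rG d1 * / rG d2 * / rG d3 * wt al be ga w d1 d2 d3 n).
{ intros n. unfold hyperF_term, wt. rewrite Cpow_1. simpl map. unfold Cprod, fold_right.
  rewrite rG_shift_inv by easy. rewrite (rGamma_rising d1 n), (rGamma_rising d2 n), (rGamma_rising d3 n).
  assert (N1 : rG (d1 + INR n) <> 0) by (intros X; apply G1; rewrite (rGamma_rising d1 n), X; ring).
  assert (N2 : rG (d2 + INR n) <> 0) by (intros X; apply G2; rewrite (rGamma_rising d2 n), X; ring).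
  assert (N3 : rG (d3 + INR n) <> 0) by (intros X; apply G3; rewrite (rGamma_rising d3 n), X; ring).
  field. repeat split; auto using INR_fact_C. }
assert (S' : summable (hyperF_term [al; be; ga; w] [d1; d2; d3] 1)).
{ apply (summable_scal (rG w * / rG d1 * / rG d2 * / rG d3)) in S. revert S. apply summable_ext. intros; now rewrite E. }
destruct (CSeries_csum _ S') as [C1 D1]. split; [easy|].
unfold hyperF. rewrite D1, (csum_ext _ _ E), csum_scal by easy. field. auto.
Qed.

Lemma hyperH4 a b c d e f g : (forall n, falling e n <> 0) -> (forall n, falling f n <> 0) -> (forall n, falling g n <> 0) ->
  (forall n, falling (uu a b c d) n <> 0) ->
  (forall n, rising (1 + a - b) n <> 0) -> (forall n, rising (1 + a - c) n <> 0) -> (forall n, rising (1 + a - d) n <> 0) ->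
  (forall n, rising (vv a e f g) n <> 0) ->
  hyperH_cvg [e; f; g; uu a b c d] [1 + a - b; 1 + a - c; 1 + a - d; vv a e f g] 1 /\
  csum (t1t a e f g (b - a) (c - a) (d - a)) = 
   rG (1 - e) * rG (1 - f) * rG (1 - g) * rG (1 - uu a b c d) * rG (1 + a - b) * rG (1 + a - c) * rG (1 + a - d) * rG (vv a e f g)
   * hyperH [e; f; g; uu a b c d] [1 + a - b; 1 + a - c; 1 + a - d; vv a e f g] 1.
Proof.
intros He Hf Hg Hu Hb Hc Hd Hv.
set (K := rG (1 - e) * rG (1 - f) * rG (1 - g) * rG (1 - uu a b c d) * rG (1 + a - b) * rG (1 + a - c) * rG (1 + a - d) * rG (vv a e f g)).
assert (HK : K <> 0).
{ unfold K. repeat apply Cmult_neq_0; auto using rG_of_rising, rG_of_falling. }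
assert (S := t1t_summable a e f g (b - a) (c - a) (d - a)).
destruct (hyperH_csum [e; f; g; uu a b c d] [1 + a - b; 1 + a - c; 1 + a - d; vv a e f g] 1
  (fun k => / K * t1t a e f g (b - a) (c - a) (d - a) k)) as [C1 D1].
- now apply summable_scal.
- intros k. unfold hyperH_term. rewrite Cpowz_1. simpl map. unfold Cprod, fold_right.
  assert (Q : sgn k * sgn k * (sgn k * sgn k) = 1) by (rewrite sgn_sq; ring).
  assert (E : t1t a e f g (b - a) (c - a) (d - a) k = K * (sgn k * sgn k * (sgn k * sgn k))
    * (zpoch e k * zpoch f k * zpoch g k * zpoch (uu a b c d) k * / zpoch (1 + a - b) k * / zpoch (1 + a - c) k * / zpoch (1 + a - d) k * / zpoch (vv a e f g) k)).
  { unfold t1t, qn. rewrite Cz_opp.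
    replace (1 - (b - a) - - Cz k) with (1 + a - b + Cz k) by ring.
    replace (1 - (c - a) - - Cz k) with (1 + a - c + Cz k) by ring.
    replace (1 - (d - a) - - Cz k) with (1 + a - d + Cz k) by ring.
    replace (vv (- a) (b - a) (c - a) (d - a) + - Cz k) with (1 - uu a b c d - Cz k) by (unfold vv, uu; ring).
    rewrite !rG_minus_zpoch, !rG_plus_zpoch by easy. unfold K. ring. }
  rewrite E, Q. 
  assert (M : forall x y z t : C, / (x * (y * (z * (t * 1)))) = / x * / y * / z * / t).
  { intros. rewrite !Cinv_mult_total. assert (I1 : / RtoC 1 = 1) by (field; try exact C1_nz). rewrite I1. ring. }
  unfold Cdiv. rewrite M. assert (KK : K * / K = 1) by (field; easy). match goal with |- ?l = _ => transitivity (K * / K * l) end; [rewrite KK; ring|ring].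
- split; [easy|]. rewrite D1, csum_scal by easy. field. easy.
Qed.

Lemma phi_zpoch a b k : (forall n, falling b n <> 0) -> (forall n, rising (1 + a - b) n <> 0) ->
  phi a b k = sgn k * (zpoch b k * / zpoch (1 + a - b) k) * (rG (1 - b) * rG (1 + a - b)).
Proof. intros H1 H2. unfold phi. rewrite rG_minus_zpoch, rG_plus_zpoch by easy. ring. Qed.

Lemma hyperH7 a b c d e f g : (0 < Re (ww a b c d e f g))%R ->
  (forall n, falling (1 + a / 2) n <> 0) -> (forall n, rising (a / 2) n <> 0) ->
  (forall n, falling b n <> 0) -> (forall n, falling c n <> 0) -> (forall n, falling d n <> 0) ->
  (forall n, falling e n <> 0) -> (forall n, falling f n <> 0) -> (forall n, falling g n <> 0) ->
  (forall n, rising (1 + a - b) n <> 0) -> (forall n, rising (1 + a - c) n <> 0) -> (forall n, rising (1 + a - d) n <> 0) ->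
  (forall n, rising (1 + a - e) n <> 0) -> (forall n, rising (1 + a - f) n <> 0) -> (forall n, rising (1 + a - g) n <> 0) ->
  a <> 0 ->
  let A7 := [1 + a / 2; b; c; d; e; f; g] in
  let B7 := [a / 2; 1 + a - b; 1 + a - c; 1 + a - d; 1 + a - e; 1 + a - f; 1 + a - g] in
  hyperH_cvg A7 B7 1 /\
  Lam a b c d e f g = a * (rG (1 - b) * rG (1 - c) * rG (1 - d) * rG (1 + a - e) * rG (1 + a - f) * rG (1 + a - g))
   * (rG (1 + a - b) * rG (1 + a - c) * rG (1 + a - d) * rG (1 - e) * rG (1 - f) * rG (1 - g)) * hyperH A7 B7 1.
Proof.
intros Hw Ha1 Ha2 F1 F2 F3 F4 F5 F6 R1 R2 R3 R4 R5 R6 Ha A7 B7.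
set (K := a * (rG (1 - b) * rG (1 - c) * rG (1 - d) * rG (1 + a - e) * rG (1 + a - f) * rG (1 + a - g))
   * (rG (1 + a - b) * rG (1 + a - c) * rG (1 + a - d) * rG (1 - e) * rG (1 - f) * rG (1 - g))).
assert (HK : K <> 0).
{ unfold K. repeat apply Cmult_neq_0; auto using rG_of_rising, rG_of_falling. }
assert (KK : K * / K = 1) by (field; easy).
assert (S := Lam_summable _ _ _ _ _ _ _ Hw).
destruct (hyperH_csum A7 B7 1 (fun k => / K * (vw a k * (phi3 a b c d k * phi3 a e f g k)))) as [C1 D1].
- now apply summable_scal.
- intros k. unfold hyperH_term, A7, B7. rewrite Cpowz_1. simpl map. unfold Cprod, fold_right.
  assert (Q : sgn k * sgn k * (sgn k * sgn k) * (sgn k * sgn k) = 1) by (rewrite sgn_sq; ring).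
  unfold phi3. rewrite !phi_zpoch by easy.
  unfold Cdiv. rewrite !Cinv_mult_total. assert (I1 : / RtoC 1 = 1) by (field; try exact C1_nz). rewrite I1.
  fold (a / 2).
  assert (Z := zpoch_quot (a / 2) k Ha2). replace (a / 2 + 1) with (1 + a / 2) in Z by ring. specialize (Z Ha1).
  assert (V : vw a k = a * (zpoch (1 + a / 2) k * / zpoch (a / 2) k)).
  { rewrite Z. unfold vw. rewrite RtoC_2. field; repeat split; try easy; rewrite <- RtoC_2; intros X; apply RtoC_inj in X; lra. }
  rewrite V.
  match goal with |- ?l = _ => transitivity (K * / K * (sgn k * sgn k * (sgn k * sgn k) * (sgn k * sgn k)) * l) end; [rewrite KK, Q; ring|].
  unfold K at 1. ring.
- split; [easy|]. rewrite D1. unfold Lam. rewrite csum_scal by easy.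
  match goal with |- ?l = _ => transitivity (K * / K * l) end; [rewrite KK; ring|ring].
Qed.

Lemma wd_den a b x : hyperH_well_defined a b -> In x b -> forall n, rising x n <> 0.
Proof. intros H Hx n. destruct (H n) as [F _]. rewrite Forall_forall in F. now apply F. Qed.

Lemma wd_num a b x : hyperH_well_defined a b -> In x a -> forall n, falling x n <> 0.
Proof. intros H Hx n. destruct (H n) as [_ F]. rewrite Forall_forall in F. now apply F. Qed.

Lemma wdF_den b x : hyperF_well_defined b -> In x b -> forall n, rising x n <> 0.
Proof. intros H Hx n. specialize (H n). rewrite Forall_forall in H. now apply H. Qed.

Lemma sg_rG a : sg a = a * (rG (1 + a) * rG (1 - a)).
Proof. unfold sg. rewrite (rGamma_rec a). replace (a + 1) with (1 + a) by ring. ring. Qed.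

Lemma RtoC_3 : RtoC 3 = 1 + 1 + 1.
Proof. rewrite <- !RtoC_plus. f_equal. ring. Qed.

Lemma RtoC_m1 : RtoC (-1) = - (1).
Proof. rewrite <- RtoC_opp. f_equal. Qed.

(** Division of [defect_zero] by the factors that are nonzero by well-definedness. *)
Theorem bilateral_7H7_transformation (a b c d e f g : C) : a <> 0 -> 
  (0 < Re (ww a b c d e f g))%R ->
  let w := ww a b c d e f g in
  let u := uu a b c d in
  let v := vv a e f g in
  let A7 := [1 + a / 2; b; c; d; e; f; g] in
  let B7 := [a / 2; 1 + a - b; 1 + a - c; 1 + a - d;
             1 + a - e; 1 + a - f; 1 + a - g] in
  let A1 := [e; f; g; u] in
  let B1 := [1 + a - b; 1 + a - c; 1 + a - d; v] in
  let A2 := [1 + a - b - c; 1 + a - b - d; 1 + a - c - d; w] in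
  let B2 := [1 + u - e; 1 + u - f; 1 + u - g] in
  let A3 := [1 + a - e - f; 1 + a - e - g; 1 + a - f - g; w] in
  let B3 := [del a b e f g; del a c e f g; del a d e f g] in
  let N0 := [1 - b; 1 - c; 1 - d; 1 + a - e; 1 + a - f; 1 + a - g] in
  let D0 := [1 + a; 1 - a] in
  let N1 := [u; 1 - v] in
  let D1 := [1 + a - b - c; 1 + a - b - d; 1 + a - c - d;
             1 + a - e - f; 1 + a - e - g; 1 + a - f - g] in
  let N2 := [1 - e; 1 - f; 1 - g; - u; 1 + u; w] in
  let D2 := [b - a; c - a; d - a; 1 + a - e - f; 1 + a - e - g; 1 + a - f - g;
             1 + u - e; 1 + u - f; 1 + u - g] in
  let N3 := [1 + a - b; 1 + a - c; 1 + a - d; v - 1; 1 + 1 - v; w] in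
  let D3 := [e; f; g; 1 + a - b - c; 1 + a - b - d; 1 + a - c - d;
             del a b e f g; del a c e f g; del a d e f g] in
  ~ Gamma_pole u -> ~ Gamma_pole (1 - v) ->
  hyperH_well_defined A7 B7 ->
  hyperH_well_defined A1 B1 ->
  hyperF_well_defined B2 ->
  hyperF_well_defined B3 ->
  (hyperH_cvg A7 B7 1 /\ hyperH_cvg A1 B1 1
   /\ hyperF_cvg A2 B2 1 /\ hyperF_cvg A3 B3 1)
  /\ hyperH A7 B7 1
     = Gamma_quot N0 D0
       * (Gamma_quot N1 D1 * hyperH A1 B1 1
          + Gamma_quot N2 D2 * hyperF A2 B2 1
          + Gamma_quot N3 D3 * hyperF A3 B3 1).
Proof.
intros Ha Hw w u v A7 B7 A1 B1 A2 B2 A3 B3 N0 D0 N1 D1 N2 D2 N3 D3 Hu Hv H7 H1 H2 H3.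
assert (R7 := fun x => wd_den _ _ x H7). assert (F7 := fun x => wd_num _ _ x H7).
assert (R1 := fun x => wd_den _ _ x H1). assert (F1 := fun x => wd_num _ _ x H1).
assert (R2 := fun x => wdF_den _ x H2). assert (R3 := fun x => wdF_den _ x H3).
unfold A7, B7, A1, B1, B2, B3 in R7, F7, R1, F1, R2, R3. simpl In in R7, F7, R1, F1, R2, R3.
clear H7 H1 H2 H3.
apply rGamma_neq_0 in Hu, Hv.
assert (Hw0 : rG w <> 0) by now apply rGamma_Re_pos.
destruct (hyperH7 a b c d e f g Hw) as [C7 E7]; [apply F7 || apply R7 || idtac; tauto..|].
destruct (hyperH4 a b c d e f g) as [C4 E4]; [(apply F1 || apply R1); tauto..|].
fold u v in C4, E4. fold A1 B1 in C4, E4. fold A7 B7 in C7, E7.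
destruct (hyperF_wt (1 + a - e - f) (1 + a - e - g) (1 + a - f - g) w (del a b e f g) (del a c e f g) (del a d e f g)) as [C3 E3];
  [easy|unfold w, ww, del; ring|apply R3; tauto..|].
destruct (hyperF_wt (1 + a - b - c) (1 + a - b - d) (1 + a - c - d) w (1 + u - e) (1 + u - f) (1 + u - g)) as [C2 E2];
  [easy|unfold w, u, ww, uu; ring|apply R2; tauto..|].
fold A2 B2 in C2, E2. fold A3 B3 in C3, E3.
split; [now split|].
assert (Z := defect_zero a b c d e f g Hw). apply Cminus_eq in Z.
assert (W3 : WW a b c d e f g = / rG w * rG (del a b e f g) * rG (del a c e f g) * rG (del a d e f g) * hyperF A3 B3 1).
{ rewrite <- E3. apply csum_ext; intros m. unfold Wt, sm, wt, w. ring. }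
assert (W2 : WW (- a) (e - a) (f - a) (g - a) (b - a) (c - a) (d - a) = / rG w * rG (1 + u - e) * rG (1 + u - f) * rG (1 + u - g) * hyperF A2 B2 1).
{ rewrite <- E2. apply csum_ext; intros m. unfold Wt, sm, wt, w. rewrite ww_reflect.
  replace (1 + - a - (c - a) - (d - a)) with (1 + a - c - d) by ring.
  replace (1 + - a - (b - a) - (d - a)) with (1 + a - b - d) by ring.
  replace (1 + - a - (b - a) - (c - a)) with (1 + a - b - c) by ring.
  replace (del (- a) (e - a) (b - a) (c - a) (d - a)) with (1 + u - e) by (unfold del, u, uu; ring).
  replace (del (- a) (f - a) (b - a) (c - a) (d - a)) with (1 + u - f) by (unfold del, u, uu; ring).
  replace (del (- a) (g - a) (b - a) (c - a) (d - a)) with (1 + u - g) by (unfold del, u, uu; ring). ring. }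
unfold T1, T2, T3 in Z. rewrite uu_reflect, m3_reflect, W2, W3, E4, E7 in Z. fold u v in Z.
clear E2 E3 E4 E7 W2 W3 C7 C4 C2 C3.
assert (Xu : rG (1 - u) <> 0) by (apply rG_of_falling, F1; tauto).
assert (Xv : rG v <> 0) by (apply rG_of_rising, R1; tauto).
assert (X1 : rG (1 - b) <> 0) by (apply rG_of_falling, F7; tauto).
assert (X2 : rG (1 - c) <> 0) by (apply rG_of_falling, F7; tauto).
assert (X3 : rG (1 - d) <> 0) by (apply rG_of_falling, F7; tauto).
assert (X4 : rG (1 - e) <> 0) by (apply rG_of_falling, F7; tauto).
assert (X5 : rG (1 - f) <> 0) by (apply rG_of_falling, F7; tauto).
assert (X6 : rG (1 - g) <> 0) by (apply rG_of_falling, F7; tauto).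
assert (Y1 : rG (1 + a - b) <> 0) by (apply rG_of_rising, R7; tauto).
assert (Y2 : rG (1 + a - c) <> 0) by (apply rG_of_rising, R7; tauto).
assert (Y3 : rG (1 + a - d) <> 0) by (apply rG_of_rising, R7; tauto).
assert (Y4 : rG (1 + a - e) <> 0) by (apply rG_of_rising, R7; tauto).
assert (Y5 : rG (1 + a - f) <> 0) by (apply rG_of_rising, R7; tauto).
assert (Y6 : rG (1 + a - g) <> 0) by (apply rG_of_rising, R7; tauto).
set (S7 := hyperH A7 B7 1) in *. set (S4 := hyperH A1 B1 1) in *.
set (S2 := hyperF A2 B2 1) in *. set (S3 := hyperF A3 B3 1) in *.
clearbody S7 S4 S2 S3.
(* The Gamma factors of the second and the third term that the sums do not
   produce, in pairs. *)
assert (Zu : rG (- u) * rG (1 + u) = - sg u).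
{ rewrite <- sg_opp. unfold sg. f_equal. f_equal. ring. }
assert (Zv : rG (v - 1) * rG (1 + 1 - v) = - sg v).
{ rewrite <- sg_pred. unfold sg. f_equal. f_equal. ring. }
assert (P : forall x, sg (x - a) = rG (x - a) * rG (1 + a - x)).
{ intros x. unfold sg. f_equal. f_equal. ring. }
rewrite !P, (sg_rG a) in Z.
change (sg e) with (rG e * rG (1 - e)) in Z. change (sg f) with (rG f * rG (1 - f)) in Z.
change (sg g) with (rG g * rG (1 - g)) in Z.
assert (SU : sg u <> 0) by (unfold sg; now apply Cmult_neq_0).
assert (SV : sg v <> 0) by (unfold sg; now apply Cmult_neq_0).
set (C1 := rG (1 + a - b) * rG (1 + a - c) * rG (1 + a - d) * rG (1 - e) * rG (1 - f) * rG (1 - g)) in *.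
assert (HC1 : C1 <> 0) by (unfold C1; repeat apply Cmult_neq_0; easy).
set (C0 := rG (1 - b) * rG (1 - c) * rG (1 - d) * rG (1 + a - e) * rG (1 + a - f) * rG (1 + a - g)) in *.
assert (HC0 : C0 <> 0) by (unfold C0; repeat apply Cmult_neq_0; easy).
set (UV := sg u * sg v) in *.
assert (HUV : UV <> 0) by now apply Cmult_neq_0.
assert (G0 : Gamma_quot N0 D0 = rG (1 + a) * rG (1 - a) * / C0).
{ unfold Gamma_quot, N0, D0, Gamma. simpl map. unfold Cprod, fold_right, C0. field. repeat split; easy. }
assert (G1 : Gamma_quot N1 D1 * S4 * (UV * C1) = m3 a e f g * m3 a b c d *
      (rG (1 - e) * rG (1 - f) * rG (1 - g) * rG (1 - u) *
       rG (1 + a - b) * rG (1 + a - c) * rG (1 + a - d) * rG v * S4)).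
{ unfold Gamma_quot, N1, D1, Gamma, m3. simpl map. unfold Cprod, fold_right, C1, UV, sg. field. split; easy. }
assert (Hmu : rG (- u) <> 0). { intros X. rewrite X, Cmult_0_l in Zu. apply SU. replace (sg u) with (- - sg u) by ring. rewrite <- Zu. ring. }
assert (Hpu : rG (1 + u) <> 0). { intros X. rewrite X, Cmult_0_r in Zu. apply SU. replace (sg u) with (- - sg u) by ring. rewrite <- Zu. ring. }
assert (Hmv : rG (v - 1) <> 0). { intros X. rewrite X, Cmult_0_l in Zv. apply SV. replace (sg v) with (- - sg v) by ring. rewrite <- Zv. ring. }
assert (Hpv : rG (1 + 1 - v) <> 0). { intros X. rewrite X, Cmult_0_r in Zv. apply SV. replace (sg v) with (- - sg v) by ring. rewrite <- Zv. ring. }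
assert (G2 : Gamma_quot N2 D2 * S2 * (UV * C1) = - sg v * (rG (b - a) * rG (1 + a - b) * (rG (c - a) * rG (1 + a - c)) * (rG (d - a) * rG (1 + a - d)))
   * m3 a e f g * (/ rG w * rG (1 + u - e) * rG (1 + u - f) * rG (1 + u - g) * S2)).
{ unfold Gamma_quot, N2, D2, Gamma, m3. simpl map. unfold Cprod, fold_right, C1, UV. 
  replace (sg u) with (- (rG (- u) * rG (1 + u))) by (rewrite Zu; ring). field. repeat split; easy. }
assert (G3 : Gamma_quot N3 D3 * S3 * (UV * C1) = - sg u * (rG e * rG (1 - e) * (rG f * rG (1 - f)) * (rG g * rG (1 - g))) * m3 a b c d
  * (/ rG w * rG (del a b e f g) * rG (del a c e f g) * rG (del a d e f g) * S3)).
{ unfold Gamma_quot, N3, D3, Gamma, m3. simpl map. unfold Cprod, fold_right, C1, UV. 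
  replace (sg v) with (- (rG (v - 1) * rG (1 + 1 - v))) by (rewrite Zv; ring). field. repeat split; easy. }
rewrite <- G1, <- G2, <- G3 in Z. rewrite G0.
set (q1 := Gamma_quot N1 D1) in *. set (q2 := Gamma_quot N2 D2) in *. set (q3 := Gamma_quot N3 D3) in *.
clearbody q1 q2 q3 C1 C0 UV.
assert (HQ : a * UV * C1 * C0 <> 0) by (repeat apply Cmult_neq_0; easy).
assert (Z' : (a * UV * C1 * C0) * S7 = (a * UV * C1 * C0) * (rG (1 + a) * rG (1 - a) * / C0 * (q1 * S4 + q2 * S2 + q3 * S3))).
{ transitivity (UV * (a * C0 * C1 * S7)); [ring|]. rewrite Z. field. easy. }
match goal with |- ?l = ?r => transitivity (/ (a * UV * C1 * C0) * ((a * UV * C1 * C0) * l)); [field; repeat split; easy|] end.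
rewrite Z'. field. repeat split; easy.
Qed.

Ltac params := unfold uu, vv, ww, del; rewrite ?RtoC_2, ?RtoC_3, ?RtoC_m1;
  repeat (apply (f_equal2 cons); [ring|]); reflexivity.

Theorem theorem3p5 (a b c d e f g : C)
  (ha : a <> 0) (hb : b <> 0) (hc : c <> 0) (hd : d <> 0)
  (he : e <> 0) (hf : f <> 0) (hg : g <> 0)
  (hRe : (0 < Re (2 + 3 * a - b - c - d - e - f - g)%C)%R) :
  let w := 2 + 3 * a - b - c - d - e - f - g in
  (* parameters of 7H7, 4H4 and the two 4F3 *)
  let A7 := [1 + a / 2; b; c; d; e; f; g] in
  let B7 := [a / 2; 1 + a - b; 1 + a - c; 1 + a - d;
             1 + a - e; 1 + a - f; 1 + a - g] in
  let A1 := [e; f; g; 1 + 2 * a - b - c - d] in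
  let B1 := [1 + a - b; 1 + a - c; 1 + a - d; - a + e + f + g] in
  let A2 := [1 + a - b - c; 1 + a - b - d; 1 + a - c - d; w] in
  let B2 := [2 + 2 * a - b - c - d - e; 2 + 2 * a - b - c - d - f;
             2 + 2 * a - b - c - d - g] in
  let A3 := [1 + a - e - f; 1 + a - e - g; 1 + a - f - g; w] in
  let B3 := [2 + 2 * a - b - e - f - g; 2 + 2 * a - c - e - f - g;
             2 + 2 * a - d - e - f - g] in
  (* arguments of the Gamma factors *)
  let N0 := [1 - b; 1 - c; 1 - d; 1 + a - e; 1 + a - f; 1 + a - g] in
  let D0 := [1 + a; 1 - a] in
  let N1 := [1 + 2 * a - b - c - d; 1 + a - e - f - g] in
  let D1 := [1 + a - b - c; 1 + a - b - d; 1 + a - c - d;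
             1 + a - e - f; 1 + a - e - g; 1 + a - f - g] in
  let N2 := [1 - e; 1 - f; 1 - g; -1 - 2 * a + b + c + d;
             2 + 2 * a - b - c - d; w] in
  let D2 := [b - a; c - a; d - a; 1 + a - e - f; 1 + a - e - g; 1 + a - f - g;
             2 + 2 * a - b - c - d - e; 2 + 2 * a - b - c - d - f;
             2 + 2 * a - b - c - d - g] in
  let N3 := [1 + a - b; 1 + a - c; 1 + a - d; -1 - a + e + f + g;
             2 + a - e - f - g; w] in
  let D3 := [e; f; g; 1 + a - b - c; 1 + a - b - d; 1 + a - c - d;
             2 + 2 * a - b - e - f - g; 2 + 2 * a - c - e - f - g;
             2 + 2 * a - d - e - f - g] in
  List.Forall (fun x => ~ Gamma_pole x) (N0 ++ N1 ++ N2 ++ N3) ->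
  hyperH_well_defined A7 B7 ->
  hyperH_well_defined A1 B1 ->
  hyperF_well_defined B2 ->
  hyperF_well_defined B3 ->
  (hyperH_cvg A7 B7 1 /\ hyperH_cvg A1 B1 1
   /\ hyperF_cvg A2 B2 1 /\ hyperF_cvg A3 B3 1)
  /\ hyperH A7 B7 1
     = Gamma_quot N0 D0
       * (Gamma_quot N1 D1 * hyperH A1 B1 1
          + Gamma_quot N2 D2 * hyperF A2 B2 1
          + Gamma_quot N3 D3 * hyperF A3 B3 1).
Proof.
intros w A7 B7 A1 B1 A2 B2 A3 B3 N0 D0 N1 D1 N2 D2 N3 D3 Hall.
assert (Hw : w = ww a b c d e f g) by (unfold w, ww; rewrite RtoC_2, RtoC_3; ring).
change (0 < Re w)%R in hRe. rewrite Hw in hRe. clearbody w. subst w.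
assert (Hu : ~ Gamma_pole (uu a b c d)).
{ rewrite Forall_forall in Hall. apply Hall. rewrite !in_app_iff. right; left. left. unfold uu. rewrite RtoC_2. ring. }
assert (Hv : ~ Gamma_pole (1 - vv a e f g)).
{ rewrite Forall_forall in Hall. apply Hall. rewrite !in_app_iff. right; left. right; left. unfold vv. ring. }
clear Hall.
assert (E1 : A1 = [e; f; g; uu a b c d]) by (unfold A1; params).
assert (E2 : B1 = [1 + a - b; 1 + a - c; 1 + a - d; vv a e f g]) by (unfold B1; params).
assert (E3 : B2 = [1 + uu a b c d - e; 1 + uu a b c d - f; 1 + uu a b c d - g]) by (unfold B2; params).
assert (E4 : B3 = [del a b e f g; del a c e f g; del a d e f g]) by (unfold B3; params).
assert (E5 : N1 = [uu a b c d; 1 - vv a e f g]) by (unfold N1; params).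
assert (E6 : N2 = [1 - e; 1 - f; 1 - g; - uu a b c d; 1 + uu a b c d; ww a b c d e f g]) by (unfold N2; params).
assert (E7 : D2 = [b - a; c - a; d - a; 1 + a - e - f; 1 + a - e - g; 1 + a - f - g;
  1 + uu a b c d - e; 1 + uu a b c d - f; 1 + uu a b c d - g]) by (unfold D2; params).
assert (E8 : N3 = [1 + a - b; 1 + a - c; 1 + a - d; vv a e f g - 1; 1 + 1 - vv a e f g; ww a b c d e f g]) by (unfold N3; params).
assert (E9 : D3 = [e; f; g; 1 + a - b - c; 1 + a - b - d; 1 + a - c - d;
  del a b e f g; del a c e f g; del a d e f g]) by (unfold D3; params).
clearbody A1 B1 B2 B3 N1 N2 D2 N3 D3. subst.
now apply bilateral_7H7_transformation.
Qed.
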